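(* Let $b\ge2$ and $0\le a_1<a_2\le b-1$ be integers. \begin{enumerate} \item If $b=2$, then $p(0,2,n)-p(1,2,n)=Q_n(-1)$ for all $n\ge0$. \item If $b=3$, then as $n\to\infty$, $$\frac{p(a_1,3,n)-p(a_2,3,n)}{A_{a_1,a_2}\,n^{-\frac23}\exp\left(\frac{2\pi}{3}\sqrt{\frac n6}\right)}=\cos\left(\alpha_{a_1,a_2}-\frac{4\pi n}{3}\right)+o(1),$$ where $A_{a_1,a_2}\ge0$ and $\alpha_{a_1,a_2}\in[0,2\pi)$ are defined by $$A_{a_1,a_2}e^{i\alpha_{a_1,a_2}}=(\zeta_3^{-a_1}-\zeta_3^{-a_2})(1-\zeta_3^2)^{\frac16}(1-\zeta_3)^{\frac12}\frac{\Gamma\left(\frac13\right)}{3(6\pi)^{\frac23}}.$$ \item If $b=4$ and $a_1,a_2$ have opposite parity, then as $n\to\infty$, $$p(a_1,4,n)-p(a_2,4,n)\sim\frac{(-1)^{a_1}-(-1)^{a_2}}{4}Q_n(-1).$$ \item If $b\ge5$, or if $b=4$ and $a_1,a_2$ have the same parity, then as $n\to\infty$, $$\frac{p(a_1,b,n)-p(a_2,b,n)}{B_{a_1,a_2,b}\,n^{-\frac34}\exp(2\lambda_1\sqrt n)}=\cos\left(\beta_{a_1,a_2,b}+2\lambda_2\sqrt n\right)+o(1),$$ where $\lambda_1,\lambda_2\in\mathbb R$ are given by $\lambda_1+i\lambda_2=\sqrt{\mathrm{Li}_2(\zeta_b)}$, and $B_{a_1,a_2,b}\ge0$ and $\beta_{a_1,a_2,b}\in[0,2\pi)$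 are defined by $$B_{a_1,a_2,b}e^{i\beta_{a_1,a_2,b}}=\frac{\zeta_b^{-a_1}-\zeta_b^{-a_2}}{b}\sqrt{\frac{(1-\zeta_b)(\lambda_1+i\lambda_2)}{\pi}}.$$ \end{enumerate}
   Context: $p(a,b,n)$ denotes the number of partitions of $n$ whose number of parts is congruent to $a$ modulo $b$. $\zeta_b:=e^{2\pi i/b}$. For complex $\zeta$, the numbers $Q_n(\zeta)$ are defined by $\sum_{n\ge0}Q_n(\zeta)q^n=\prod_{m\ge1}(1-\zeta q^m)^{-1}$. $\mathrm{Li}_2(z):=\sum_{n\ge1}z^n/n^2$ for $|z|\le1$. Principal branches of square roots, complex powers and logarithms are used throughout. *)

(* Defs.v *)
From Stdlib Require Import Reals Lra.
From Coquelicot Require Import Coquelicot.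
From mathcomp Require Import ssreflect ssrfun ssrbool eqtype ssrnat seq path div.
From mathcomp Require Import fintype tuple finset zify.

Set Implicit Arguments.
Unset Strict Implicit.
Unset Printing Implicit Defensive.

Definition is_partition (n : nat) (s : seq nat) : bool :=
  [&& sorted geq s, 0%N \notin s & sumn s == n].

(* A partition of n has at most n parts, each at most n, so bounding the length
   and the entries only serves to make the ambient type finite; see
   is_partition_bseq. *)
Definition p (a b n : nat) : nat :=
  #|[set s : {bseq n of 'I_n.+1} |
      is_partition n (map val s) && (size s == a %[mod b])]|.

Lemma is_partition_bseq (n : nat) (s : seq nat) :
  is_partition n s -> exists t : {bseq n of 'I_n.+1}, map val t = s.
Proof.
case/and3P=> _ s0 /eqP sn.
have szs : (size s <= n)%N.
  rewrite -sn {sn}; elim: s s0 => //= x s IH; rewrite inE negb_or.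
  by case/andP=> x0 /IH; lia.
have les : {in s, forall x, (x < n.+1)%N}.
  rewrite -sn {sn szs s0}; elim: s => //= y s IH x; rewrite inE => /orP[/eqP->|/IH]; lia.
have es : map val (map (@inord n) s) = s.
  by rewrite -map_comp -[RHS]map_id; apply/eq_in_map => x /les /inordK.
have szt : (size (map (@inord n) s) <= n)%N by rewrite size_map.
by exists (Bseq szt).
Qed.

Open Scope R_scope.
Local Open Scope C_scope.

(* Formal power series over C are represented by their coefficient sequences. *)
Definition fps_one (n : nat) : C := if n == 0%N then RtoC 1 else RtoC 0.

Definition fps_mul (f g : nat -> C) (n : nat) : C :=
  sum_n (fun k => f k * g (n - k)%N) n.

(* The series 1 - z q^m. *)
Definition fps_factor (z : C) (m n : nat) : C :=
  if n == 0%N then RtoC 1 else if n == m then - z else RtoC 0.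

(* The series (1 - z q^m)^{-1}; see fps_factor_geom. *)
Definition fps_geom (z : C) (m n : nat) : C :=
  if (m %| n)%N then Cpow z (n %/ m) else RtoC 0.

Fixpoint fps_prod (z : C) (N : nat) : nat -> C :=
  if N is N'.+1 then fps_mul (fps_prod z N') (fps_geom z N'.+1) else fps_one.

(* The factors with m > n do not contribute to the coefficient of q^n in the
   infinite product; see fps_prod_stable. *)
Definition Q (n : nat) (z : C) : C := fps_prod z n n.

Lemma sum_n_C_single (f : nat -> C) (n j : nat) :
  (j <= n)%N -> (forall k, (k <= n)%N -> k != j -> f k = 0) -> sum_n f n = f j.
Proof.
elim: n => [|n IH] jn f0; first by rewrite sum_O; have -> : j = 0%N by lia.
rewrite sum_Sn; have [ej|jn1] := eqVneq j n.+1.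
  rewrite ej in f0 *.
  rewrite (sum_n_ext_loc _ (fun=> zero)); last by move=> k kn; apply: f0; lia.
  by rewrite /sum_n sum_n_m_const_zero plus_zero_l.
rewrite IH; [|lia|by move=> k kn kj; apply: f0 kj; lia].
by rewrite (f0 n.+1) ?plus_zero_r //; lia.
Qed.

Lemma fps_factor_geom (z : C) (m : nat) : (0 < m)%N ->
  forall n, fps_mul (fps_factor z m) (fps_geom z m) n = fps_one n.
Proof.
move=> m0 n; rewrite /fps_mul /fps_one.
have [->|n0] := eqVneq n 0%N.
  by rewrite sum_O /fps_factor /fps_geom subn0 dvdn0 div0n eqxx Cmult_1_l.
have [nm|mn] := ltnP n m.
  rewrite (@sum_n_C_single _ n 0%N) //.
    rewrite /fps_geom subn0 gtnNdvd ?Cmult_0_r //; lia.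
  move=> k kn k0; rewrite /fps_factor (negPf k0).
  have -> : (k == m) = false by lia.
  exact: Cmult_0_l.
transitivity (fps_factor z m 0 * fps_geom z m n
              + fps_factor z m m * fps_geom z m (n - m)).
  pose g k := if k == 0%N then fps_factor z m 0 * fps_geom z m n else RtoC 0.
  pose h k := if k == m then fps_factor z m m * fps_geom z m (n - m) else RtoC 0.
  rewrite (sum_n_ext_loc _ (fun k => plus (g k) (h k))).
    rewrite sum_n_plus (@sum_n_C_single g n 0%N) //; last by move=> k _ /negPf; rewrite /g => ->.
    rewrite (@sum_n_C_single h n m) //; last by move=> k _ /negPf; rewrite /h => ->.
    by rewrite /g /h !eqxx.
  move=> k kn; rewrite /g /h; change (@plus C_AbelianMonoid) with Cplus.
  have [->|k0] := eqVneq k 0%N.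
    have -> : (0%N == m) = false by lia.
    by rewrite subn0 Cplus_0_r.
  have [->|km] := eqVneq k m; first by rewrite Cplus_0_l.
  by rewrite /fps_factor (negPf k0) (negPf km) Cmult_0_l Cplus_0_l.
rewrite /fps_factor /fps_geom !eqxx.
have -> : (m == 0%N) = false by lia.
rewrite dvdn_subl ?dvdnn //; case: ifP => dmn; last by ring.
have -> : (n %/ m)%N = ((n - m) %/ m).+1.
  by rewrite -{1}(subnK mn) divnDr ?divnn ?m0 ?addn1.
by rewrite /=; ring.
Qed.

Lemma fps_prod_stable (z : C) (N n : nat) : (n <= N)%N -> fps_prod z N n = Q n z.
Proof.
elim: N => [|N IH] nN; first by have -> : n = 0%N by lia.
have [->//|nN1] := eqVneq n N.+1.
rewrite -IH; last by lia.
rewrite /= {1}/fps_mul (@sum_n_C_single _ n n) //.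
  by rewrite subnn /fps_geom dvdn0 div0n Cmult_1_r.
move=> k kn kn1; rewrite /fps_geom gtnNdvd ?Cmult_0_r //; lia.
Qed.

Definition Cexp (z : C) : C := (exp (Re z) * cos (Im z), exp (Re z) * sin (Im z))%R.

(* The argument in (-PI, PI]; its value at 0 is irrelevant. *)
Definition Carg (z : C) : R :=
  if Rle_dec 0 (Im z) then acos (Re z / Cmod z) else (- acos (Re z / Cmod z))%R.

Definition Clog (z : C) : C := (ln (Cmod z), Carg z).

Definition Cpower (z w : C) : C :=
  if Ceq_dec z 0 then (if Ceq_dec w 0 then RtoC 1 else RtoC 0)
  else Cexp (w * Clog z).

Definition Csqrt (z : C) : C := Cpower z (/ 2).

Definition zeta (b : nat) : C := Cexp (2 * PI * Ci / INR b).

Definition CSeries (u : nat -> C) : C :=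
  (Series (fun n => Re (u n)), Series (fun n => Im (u n))).

Definition Li2 (z : C) : C :=
  CSeries (fun n => Cpow z n.+1 / Cpow (INR n.+1) 2).

Definition Gamma (x : R) : R :=
  RInt_gen (fun t => Rpower t (x - 1) * exp (- t))%R (at_right 0) (Rbar_locally p_infty).

(* Main.v *)
(** Sieving by roots of unity, [b p(a,b,n)] is the sum over [j] of [zeta_b^(-ja) Q_n(zeta_b^j)], so that
    everything is about [Q_n(z)] for [|z| = 1], the coefficient of [q^n] in
    [exp (sum_k z^k/k q^k/(1-q^k))].  At [q = xi e^(-w)] with [w -> 0] this exponent has polar part
    [Li2(z^k) / (k^2 w)] if [xi] has order [k], and none if [xi] is not a root of unity.  Hence [xi]
    contributes [e^(2 sqrt(g n))] with [g = (Re c + |c|) / 2], [c = Li2(z^k) / k^2], and the precise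
    contribution of the dominant [xi] comes from a saddle point at [w = sqrt(c/n)].

    The dominant [j] and [xi] are found by comparing these [g]: on the circle, [Re Li2(e^(it))] is the
    polynomial [pi^2/6 - pi t/2 + t^2/4] and [Im Li2(e^(it))] has derivative [- ln (2 sin (t/2))].
    The maximum is at [z = zeta_b^(+-1)], [xi = 1] in part (4), at [z = xi = -1] in part (3), and at
    [z = zeta_3], [xi = zeta_3^2] (and conjugates) in part (2), where [xi = zeta_3] has the same [g] but
    a smaller power of [n].

    For the constants, the exponent is a sum of series [sum_j y^j/j e^(-jxs)/(1-e^(-js))] with [y] a
    root of unity.  After its polar part is removed, such a series tends to [- (1/2 - x) ln (1 - y)] if
    [y <> 1], by Abel summation; for [y = 1] its exponential satisfies the functional equation of
    [Gamma] up to elementary factors and is log-convex in [x], so that it is given by [Gamma(x)], as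
    in the theorem of Bohr and Mollerup. *)

Require Import Defs.
From Stdlib Require Import Reals Lra ClassicalEpsilon.
From Coquelicot Require Import Coquelicot.
From mathcomp Require Import ssreflect ssrfun ssrbool eqtype ssrnat seq path div.
From mathcomp Require Import fintype tuple finset zify.

Set Implicit Arguments.
Unset Strict Implicit.
Unset Printing Implicit Defensive.
Local Arguments INR : simpl never.

(** * Complex exponential *)

(** Away from the few points that carry the main term, an error o(1/Re w) in the exponent is enough.
    After multiplication by [Re w] the series for the exponent is dominated by the Basel series,
    whatever the direction in which [w] tends to 0. So its limit can be taken termwise, point by
    point on the circle, and compactness bounds all remaining arcs at once; no estimate uniform in
    the order of [xi] is needed. The price is a list of strict inequalities between values of
    [growth]. These reduce to polynomial and numerical inequalities because a level set of [growth]
    is a parabola. Precise expansions are needed only in a cone around the positive axis. There Abel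
    summation and real functional equations replace the modular transformation of the eta function;
    its constant (1/2) ln (2 pi) comes from a duplication formula with a bounded error. At the
    saddle no Taylor expansion is made: with n = s^4 and w = (Lam + i t/s)/s^2 the exponent equals 2
    Lam s^2 - t^2 / (Lam + i t/s) exactly, apart from the lower-order factor. *)

Ltac unplusC := repeat match goal with
  | |- context [@plus ?G ?x ?y] => change (@plus G x y) with (Cplus x y)
  | |- context [@minus ?G ?x ?y] => change (@minus G x y) with (Cminus x y)
  | |- context [@opp ?G ?x] => change (@opp G x) with (Copp x)
  end.

(** Sums formed in the algebraic hierarchy are only convertible to sums in [C]; the operations and
    the type of the equation are made syntactically those of [C] before [ring] is called. *)
Ltac ringC := unplusC; lazymatch goal with |- ?a = ?b => change (@eq C a b) end; ring.

Lemma Rabs_sqr (x : R) : Rabs x * Rabs x = x * x.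
Proof. by rewrite -Rabs_mult Rabs_pos_eq //; nra. Qed.

Lemma exp_le (x y : R) : x <= y -> exp x <= exp y.
Proof. by case=> [h|->]; [left; exact: exp_increasing|right]. Qed.

Lemma C_ext (z w : C) : Re z = Re w -> Im z = Im w -> z = w.
Proof. by case: z w => [a b] [c d] /= -> ->. Qed.

Lemma Re_plus (z w : C) : Re (z + w)%C = Re z + Re w. Proof. by []. Qed.
Lemma Im_plus (z w : C) : Im (z + w)%C = Im z + Im w. Proof. by []. Qed.
Lemma Re_opp (z : C) : Re (- z)%C = - Re z. Proof. by []. Qed.
Lemma Im_opp (z : C) : Im (- z)%C = - Im z. Proof. by []. Qed.
Lemma Re_minus (z w : C) : Re (z - w)%C = Re z - Re w. Proof. by []. Qed.
Lemma Im_minus (z w : C) : Im (z - w)%C = Im z - Im w. Proof. by []. Qed.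
Lemma Re_mult (z w : C) : Re (z * w)%C = Re z * Re w - Im z * Im w. Proof. by []. Qed.
Lemma Im_mult (z w : C) : Im (z * w)%C = Re z * Im w + Im z * Re w. Proof. by []. Qed.
Definition ReImE := (Re_plus, Im_plus, Re_minus, Im_minus, Re_opp, Im_opp, Re_mult, Im_mult).

Lemma Cmod_minus_sym (z w : C) : Cmod (z - w)%C = Cmod (w - z)%C.
Proof. by rewrite -Cmod_opp; congr Cmod; ring. Qed.

Lemma Cmod_minus_le (z w : C) : Cmod (z - w)%C <= Cmod z + Cmod w.
Proof. by rewrite -(Cmod_opp w); exact: Cmod_triangle. Qed.

Lemma Cmod_triangle_inv (z w : C) : Cmod z - Cmod w <= Cmod (z - w)%C.
Proof.
have := Cmod_triangle (z - w)%C w.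
have -> : (z - w + w = z)%C by ring.
lra.
Qed.

Lemma Cmod_sqr (z : C) : Cmod z * Cmod z = Re z * Re z + Im z * Im z.
Proof. have := Cmod2_alt z; rewrite /= !Rmult_1_r; lra. Qed.

Lemma im_le_Cmod (z : C) : Rabs (Im z) <= Cmod z.
Proof. apply: Rle_trans (Rmax_Cmod z); exact: Rmax_r. Qed.

Lemma Cmod_le_ReIm (z : C) : Cmod z <= Rabs (Re z) + Rabs (Im z).
Proof.
have h1 := Rabs_pos (Re z); have h2 := Rabs_pos (Im z).
apply: Rsqr_incr_0_var; last lra.
rewrite /Rsqr Cmod_sqr.
rewrite -[Re z * _]Rabs_sqr -[Im z * _]Rabs_sqr; nra.
Qed.

Lemma Cmod_pos (x : R) : 0 <= x -> Cmod (RtoC x) = x.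
Proof. by move=> x0; rewrite Cmod_R Rabs_pos_eq. Qed.

Lemma Cmod_sqr_le (z : C) (M : R) :
  0 <= M -> Re z * Re z + Im z * Im z <= M * M -> Cmod z <= M.
Proof. by move=> M0; rewrite -Cmod_sqr => h; apply: Rsqr_incr_0_var. Qed.

Lemma RtoC_neq0 (x : R) : x <> 0 -> RtoC x <> 0%C.
Proof. by move=> x0 e; apply: x0; case: e. Qed.

Lemma RtoC_invE (x : R) : RtoC (/ x) = (/ RtoC x)%C.
Proof.
case: (Req_dec x 0) => [->|h]; last exact: RtoC_inv.
by apply: C_ext; rewrite /= ?Rinv_0 /Rdiv; ring.
Qed.

Lemma Cmult_neq0 (z w : C) : z <> 0%C -> w <> 0%C -> (z * w)%C <> 0%C.
Proof. exact: Cmult_neq_0. Qed.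

Lemma Cinv_neq0 (z : C) : z <> 0%C -> (/ z)%C <> 0%C.
Proof.
move=> z0 e; have : Cmod (z * / z)%C = 0 by rewrite e Cmult_0_r Cmod_0.
by rewrite Cinv_r // Cmod_1; lra.
Qed.

Lemma Cmod_neq0 (z : C) : 0 < Cmod z -> z <> 0%C.
Proof. by move/Cmod_gt_0. Qed.

Lemma Re_pos_neq0 (z : C) : 0 < Re z -> z <> 0%C.
Proof. by move=> h e; move: h; rewrite e /=; lra. Qed.

Lemma Re_le_Cmod (z : C) : Re z <= Cmod z.
Proof. have := re_le_Cmod z; have := Rle_abs (Re z); lra. Qed.

Lemma Cexp_plus (z w : C) : Cexp (z + w)%C = (Cexp z * Cexp w)%C.
Proof.
case: z w => [a b] [c d].
by apply: C_ext; rewrite /= exp_plus ?cos_plus ?sin_plus; ring.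
Qed.

Lemma Cexp_0 : Cexp 0 = 1%C.
Proof. by apply: C_ext; rewrite /= exp_0 ?cos_0 ?sin_0; ring. Qed.

Lemma Cexp_real (x : R) : Cexp (RtoC x) = RtoC (exp x).
Proof. by apply: C_ext; rewrite /= ?cos_0 ?sin_0; ring. Qed.

Lemma Cmod_Cexp (z : C) : Cmod (Cexp z) = exp (Re z).
Proof.
have e0 := exp_pos (Re z).
apply: Rsqr_inj; [exact: Cmod_ge_0|lra|].
rewrite /Rsqr Cmod_sqr /=.
have := sin2_cos2 (Im z); rewrite /Rsqr; nra.
Qed.

Lemma Cexp_neq0 (z : C) : Cexp z <> 0%C.
Proof. by apply: Cmod_neq0; rewrite Cmod_Cexp; exact: exp_pos. Qed.

Lemma Cexp_opp (z : C) : Cexp (- z)%C = (/ Cexp z)%C.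
Proof.
have e : (Cexp (- z) * Cexp z = 1)%C.
  by rewrite -Cexp_plus -Cexp_0; congr Cexp; ring.
rewrite -[LHS]Cmult_1_r -(Cinv_r (Cexp z)); last exact: Cexp_neq0.
by rewrite Cmult_assoc e Cmult_1_l.
Qed.

Lemma Cexp_minus (z w : C) : Cexp (z - w)%C = (Cexp z / Cexp w)%C.
Proof. by rewrite /Cdiv -Cexp_opp -Cexp_plus. Qed.

Lemma Cexp_pow (z : C) (n : nat) : Cpow (Cexp z) n = Cexp (RtoC (INR n) * z)%C.
Proof.
elim: n => [|n IH]; first by rewrite /= -Cexp_0; congr Cexp; change (INR 0) with 0; ring.
rewrite S_INR RtoC_plus /= IH -Cexp_plus; congr Cexp; ring.
Qed.

Lemma Cexp_2PI : Cexp (RtoC (2 * PI) * Ci)%C = 1%C.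
Proof.
apply: C_ext; rewrite /= !(Rmult_0_r, Rmult_1_r, Rmult_0_l, Rmult_1_l) ?Rplus_0_r ?Rplus_0_l
  ?Rminus_0_r exp_0 ?cos_2PI ?sin_2PI; ring.
Qed.

Lemma exp_minus_1_le (x : R) : Rabs (exp x - 1) <= Rabs x * exp (Rmax x 0).
Proof.
have h (y : R) : 1 + y <= exp y by exact: exp_ineq1_le.
case: (Rle_dec 0 x) => x0.
  rewrite Rmax_left // !Rabs_pos_eq //; last by have := h x; lra.
  have := h (- x); rewrite exp_Ropp => hx; have e0 := exp_pos x.
  have : exp x * (1 - x) <= exp x * / exp x by apply: Rmult_le_compat_l; lra.
  rewrite Rinv_r; lra.
rewrite Rmax_right; last lra.
rewrite exp_0 Rmult_1_r.
have : exp x <= 1 by rewrite -exp_0; apply: exp_le; lra.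
have := h x => h1 h2.
rewrite (Rabs_left1 x); last lra.
rewrite Rabs_left1; lra.
Qed.

Lemma Rabs_sin_le (y : R) : Rabs (sin y) <= Rabs y.
Proof.
wlog h : y / 0 <= y.
  move=> W; case: (Rle_dec 0 y) => h; first exact: W.
  by have := W (- y); rewrite sin_neg !Rabs_Ropp; apply; lra.
rewrite (Rabs_pos_eq _ h); case: (Rle_dec y PI) => hp.
  rewrite Rabs_pos_eq; last exact: sin_ge_0.
  case: h => [h|<-]; first by left; exact: sin_lt_x.
  rewrite sin_0; lra.
have := PI2_1; have := SIN_bound y; split_Rabs; lra.
Qed.

Lemma one_minus_cos_le (y : R) : 1 - cos y <= y * y / 2.
Proof.
have e : y = 2 * (y / 2) by field.
rewrite {1}e cos_2a_sin.
have := Rabs_sin_le (y / 2); have := Rabs_pos (sin (y / 2)) => h0 h1.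
have := Rmult_le_compat _ _ _ _ h0 h0 h1 h1; rewrite !Rabs_sqr; lra.
Qed.

(** With z = x + iy, |e^z - 1|^2 = (e^x - 1)^2 + 2 e^x (1 - cos y) separates the two coordinates,
    and each part is at most the square of its coordinate times m^2. *)
Lemma Cexp_minus_1_le (z : C) : Cmod (Cexp z - 1)%C <= Cmod z * exp (Rmax (Re z) 0).
Proof.
set m := exp _; have m0 : 0 < m by exact: exp_pos.
have hx := exp_minus_1_le (Re z); rewrite -/m in hx.
have hc := one_minus_cos_le (Im z).
have c0 : 0 <= 1 - cos (Im z) by have := COS_bound (Im z); lra.
have e0 := exp_pos (Re z).
have em : exp (Re z) <= m * m.
  have h1 : exp (Re z) <= m by apply: exp_le; exact: Rmax_l.
  have : 1 <= m by rewrite -exp_0; apply: exp_le; exact: Rmax_r.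
  nra.
apply: Cmod_sqr_le; first by apply: Rmult_le_pos; [exact: Cmod_ge_0|lra].
have -> : Cmod z * m * (Cmod z * m) = (Re z * Re z + Im z * Im z) * (m * m).
  by rewrite -Cmod_sqr; ring.
have -> : Re (Cexp z - 1)%C * Re (Cexp z - 1)%C + Im (Cexp z - 1)%C * Im (Cexp z - 1)%C
   = (exp (Re z) - 1) * (exp (Re z) - 1) + 2 * exp (Re z) * (1 - cos (Im z)).
  rewrite !ReImE /=; have := sin2_cos2 (Im z); rewrite /Rsqr.
  move=> e; set E := exp _; set c := cos _ in e *; set s := sin _ in e *.
  have -> : (E * c + - (1)) * (E * c + - (1)) + (E * s + - 0) * (E * s + - 0)
    = E * E * (s * s + c * c) - 2 * E * c + 1 by ring.
  rewrite e; ring.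
have h1 : (exp (Re z) - 1) * (exp (Re z) - 1) <= Re z * Re z * (m * m).
  have -> : Re z * Re z * (m * m) = (Rabs (Re z) * m) * (Rabs (Re z) * m).
    by rewrite -Rabs_sqr; ring.
  rewrite -[X in X <= _]Rabs_sqr; apply: Rmult_le_compat; try exact: Rabs_pos; lra.
have h2 : 2 * exp (Re z) * (1 - cos (Im z)) <= Im z * Im z * (m * m).
  apply: Rle_trans (_ : 2 * (m * m) * (Im z * Im z / 2) <= _); last lra.
  apply: Rmult_le_compat; lra.
lra.
Qed.

Lemma Cexp_lipschitz (z w : C) (M : R) :
  Re z <= M -> Re w <= M -> Cmod (Cexp z - Cexp w)%C <= Cmod (z - w)%C * exp M.
Proof.
move=> zM wM.
have -> : (Cexp z - Cexp w = Cexp w * (Cexp (z - w) - 1))%C.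
  by rewrite Cexp_minus; field; exact: Cexp_neq0.
rewrite Cmod_mult Cmod_Cexp.
have -> : exp M = exp (Re w) * exp (M - Re w) by rewrite -exp_plus; congr exp; ring.
have h : Cmod (Cexp (z - w) - 1)%C <= Cmod (z - w)%C * exp (M - Re w).
  apply: Rle_trans (Cexp_minus_1_le _) _.
  apply: Rmult_le_compat_l; first exact: Cmod_ge_0.
  apply: exp_le; apply: Rmax_lub; rewrite ?ReImE; lra.
have e0 := exp_pos (Re w).
apply: Rle_trans (_ : exp (Re w) * (Cmod (z - w)%C * exp (M - Re w)) <= _).
  by apply: Rmult_le_compat_l; lra.
lra.
Qed.

(** * Continuity and derivatives of complex-valued functions of a real variable *)

Notation contC f x := (continuous (T := R_UniformSpace) (U := C_R_NormedModule) f x).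

Lemma continuousC (f : R -> C) (x : R) :
  continuous (fun t => Re (f t)) x -> continuous (fun t => Im (f t)) x ->
  contC f x.
Proof.
move=> h1 h2 P [e hP].
have := h1 _ (locally_ball (Re (f x)) e); have := h2 _ (locally_ball (Im (f x)) e).
rewrite /filtermap => q2 q1; apply: filter_imp (filter_and _ _ q1 q2) => t [b1 b2].
by apply: hP; split.
Qed.

Lemma continuous_Re (f : R -> C) (x : R) :
  contC f x -> continuous (fun t => Re (f t)) x.
Proof.
move=> h P [e hP]; have := h (fun z => P (Re z)).
apply; exists e => z [b1 _]; exact: hP.
Qed.

Lemma continuous_Im (f : R -> C) (x : R) :
  contC f x -> continuous (fun t => Im (f t)) x.
Proof.
move=> h P [e hP]; have := h (fun z => P (Im z)).
apply; exists e => z [_ b1]; exact: hP.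
Qed.

Lemma contC_const (c : C) (x : R) : contC (fun _ => c) x.
Proof. exact: continuous_const. Qed.

Lemma contC_plus (f g : R -> C) (x : R) :
  contC f x -> contC g x -> contC (fun t => f t + g t)%C x.
Proof. exact: (@continuous_plus _ _ C_R_NormedModule). Qed.

Lemma contC_opp (f : R -> C) (x : R) : contC f x -> contC (fun t => - f t)%C x.
Proof. exact: (@continuous_opp _ _ C_R_NormedModule). Qed.

Lemma contC_minus (f g : R -> C) (x : R) :
  contC f x -> contC g x -> contC (fun t => f t - g t)%C x.
Proof. exact: (@continuous_minus _ _ C_R_NormedModule). Qed.

Lemma contC_mult (f g : R -> C) (x : R) :
  contC f x -> contC g x -> contC (fun t => f t * g t)%C x.
Proof.
move=> hf hg.
have f1 := continuous_Re hf; have f2 := continuous_Im hf.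
have g1 := continuous_Re hg; have g2 := continuous_Im hg.
apply: continuousC.
  apply: (continuous_minus (V := R_NormedModule) (fun t => Re (f t) * Re (g t))
            (fun t => Im (f t) * Im (g t))); exact: continuous_mult.
apply: (continuous_plus (V := R_NormedModule) (fun t => Re (f t) * Im (g t))
            (fun t => Im (f t) * Re (g t))); exact: continuous_mult.
Qed.

Lemma contC_RtoC (f : R -> R) (x : R) : continuous f x -> contC (fun t => RtoC (f t)) x.
Proof. move=> h; apply: continuousC => //; exact: continuous_const. Qed.

Lemma contC_inv (f : R -> C) (x : R) :
  contC f x -> f x <> 0%C -> contC (fun t => / f t)%C x.
Proof.
move=> hf f0.
have f1 := continuous_Re hf; have f2 := continuous_Im hf.
have c : continuous (fun t => / (Re (f t) ^ 2 + Im (f t) ^ 2)) x.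
  apply: continuous_comp (continuous_Rinv _ _).
    apply: (continuous_plus (V := R_NormedModule) (fun t => Re (f t) ^ 2) (fun t => Im (f t) ^ 2)).
      by rewrite /=; do ![exact: f1|exact: continuous_const|apply: continuous_mult].
    by rewrite /=; do ![exact: f2|exact: continuous_const|apply: continuous_mult].
  rewrite -Cmod2_alt => e; apply: f0; apply: Cmod_eq_0; nra.
apply: continuousC; first exact: continuous_mult.
apply: continuous_mult c; exact: (continuous_opp (V := R_NormedModule)).
Qed.

Lemma contC_Cexp (f : R -> C) (x : R) : contC f x -> contC (fun t => Cexp (f t)) x.
Proof.
move=> hf; have f1 := continuous_Re hf; have f2 := continuous_Im hf.
have e : continuous (fun t => exp (Re (f t))) x.
  exact: continuous_comp f1 (continuous_exp _).
by apply: continuousC; apply: continuous_mult => //;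
  apply: continuous_comp f2 _; [exact: continuous_cos|exact: continuous_sin].
Qed.

Lemma contC_comp (f : R -> C) (g : R -> R) (x : R) :
  continuous g x -> contC f (g x) -> contC (fun t => f (g t)) x.
Proof. exact: continuous_comp. Qed.

Lemma ex_RIntC (f : R -> C) (a b : R) :
  (forall t, contC f t) -> ex_RInt (V := C_R_NormedModule) f a b.
Proof. by move=> h; apply: (ex_RInt_continuous (V := C_R_CompleteNormedModule)) => t _. Qed.

Lemma is_deriveC (f : R -> C) (x : R) (l : C) :
  is_derive (fun t => Re (f t)) x (Re l) -> is_derive (fun t => Im (f t)) x (Im l) ->
  is_derive (V := C_R_NormedModule) f x l.
Proof.
move=> [_ h1] [_ h2]; split.
  exact: (@is_linear_scal_l _ C_R_NormedModule).
move=> y hy e.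
have := h1 y hy (pos_div_2 e); have := h2 y hy (pos_div_2 e).
move=> q2 q1; apply: filter_imp (filter_and _ _ q1 q2) => t [b1 b2].
set w := minus _ _; change (norm (K := R_AbsRing) w) with (norm (K := R_AbsRing) (V := C_R_NormedModule) w).
rewrite [X in X <= _](_ : _ = Cmod w); last by rewrite Cmod_norm.
apply: Rle_trans (Cmod_le_ReIm w) _.
move: b1 b2; rewrite /norm /= /abs /= /w => b1 b2.
have h := Rplus_le_compat _ _ _ _ b1 b2.
apply: Rle_trans h _; right; field.
Qed.

(** * Series of complex numbers *)

Lemma lim_seq_le_R (u v : nat -> R) (a b : R) :
  is_lim_seq u a -> is_lim_seq v b -> (forall n, u n <= v n) -> a <= b.
Proof. by move=> hu hv h; exact: (is_lim_seq_le u v a b h hu hv). Qed.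

Notation is_cser u l := (is_series (K := R_AbsRing) (V := C_R_NormedModule) u l).

Lemma is_series_lim (u : nat -> R) (l : R) : is_lim_seq (sum_n u) l -> is_series u l.
Proof. by []. Qed.

Lemma Re_sum_n (u : nat -> C) (n : nat) :
  Re (sum_n (G := C_R_NormedModule) u n) = sum_n (fun k => Re (u k)) n.
Proof. by elim: n => [|n IH]; rewrite ?sum_O // !sum_Sn -IH. Qed.

Lemma Im_sum_n (u : nat -> C) (n : nat) :
  Im (sum_n (G := C_R_NormedModule) u n) = sum_n (fun k => Im (u k)) n.
Proof. by elim: n => [|n IH]; rewrite ?sum_O // !sum_Sn -IH. Qed.

Lemma is_cser_pair (u : nat -> C) (l : C) :
  is_series (fun n => Re (u n)) (Re l) -> is_series (fun n => Im (u n)) (Im l) -> is_cser u l.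
Proof.
move=> h1 h2 P [e hP].
have := h1 _ (locally_ball (Re l) e); have := h2 _ (locally_ball (Im l) e).
rewrite /filtermap => q2 q1; apply: filter_imp (filter_and _ _ q1 q2) => t [b1 b2].
by apply: hP; move: b1 b2; rewrite -Re_sum_n -Im_sum_n.
Qed.

Lemma is_cser_Re (u : nat -> C) (l : C) : is_cser u l -> is_series (fun n => Re (u n)) (Re l).
Proof.
move=> h P [e hP]; have := h (fun z => P (Re z)); rewrite /filtermap => h'.
have {h'} : eventually (fun n => P (Re (sum_n (G := C_R_NormedModule) u n))).
  by apply: h'; exists e => z [b1 _]; exact: hP.
by apply: filter_imp => n; rewrite Re_sum_n.
Qed.

Lemma is_cser_Im (u : nat -> C) (l : C) : is_cser u l -> is_series (fun n => Im (u n)) (Im l).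
Proof.
move=> h P [e hP]; have := h (fun z => P (Im z)); rewrite /filtermap => h'.
have {h'} : eventually (fun n => P (Im (sum_n (G := C_R_NormedModule) u n))).
  by apply: h'; exists e => z [_ b1]; exact: hP.
by apply: filter_imp => n; rewrite Im_sum_n.
Qed.

Lemma CSeries_unique (u : nat -> C) (l : C) : is_cser u l -> CSeries u = l.
Proof.
move=> h; apply: C_ext; rewrite /CSeries /=.
  exact: is_series_unique (is_cser_Re h).
exact: is_series_unique (is_cser_Im h).
Qed.

Lemma is_cser_le (u : nat -> C) (b : nat -> R) :
  (forall n, Cmod (u n) <= b n) -> ex_series b -> is_cser u (CSeries u).
Proof.
move=> h eb; have [l hl] : ex_series (V := C_R_NormedModule) u.
  apply: (ex_series_le (V := C_R_CompleteNormedModule)) eb => n.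
  by rewrite [X in X <= _](_ : _ = Cmod (u n)) // Cmod_norm.
by rewrite (CSeries_unique hl).
Qed.

Lemma is_cser_ext (u v : nat -> C) (l : C) : (forall n, u n = v n) -> is_cser u l -> is_cser v l.
Proof. exact: is_series_ext. Qed.

Lemma CSeries_ext (u v : nat -> C) : (forall n, u n = v n) -> CSeries u = CSeries v.
Proof. by move=> h; rewrite /CSeries; congr pair; apply: Series_ext => n; rewrite h. Qed.

Lemma is_cser_plus (u v : nat -> C) (k l : C) :
  is_cser u k -> is_cser v l -> is_cser (fun n => u n + v n)%C (k + l)%C.
Proof. exact: (@is_series_plus _ C_R_NormedModule). Qed.

Lemma is_cser_minus (u v : nat -> C) (k l : C) :
  is_cser u k -> is_cser v l -> is_cser (fun n => u n - v n)%C (k - l)%C.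
Proof. exact: (@is_series_minus _ C_R_NormedModule). Qed.

Lemma is_cser_Cmult (c : C) (u : nat -> C) (l : C) :
  is_cser u l -> is_cser (fun n => c * u n)%C (c * l)%C.
Proof.
move=> h; have h1 := is_cser_Re h; have h2 := is_cser_Im h.
apply: is_cser_pair; rewrite !ReImE.
  apply: (@is_series_ext _ R_NormedModule (fun n => minus (Re c * Re (u n)) (Im c * Im (u n)))) => //.
  apply: (@is_series_minus _ R_NormedModule); exact: (@is_series_scal R_AbsRing R_NormedModule).
apply: (@is_series_ext _ R_NormedModule (fun n => plus (Re c * Im (u n)) (Im c * Re (u n)))) => //.
apply: (@is_series_plus _ R_NormedModule); exact: (@is_series_scal R_AbsRing R_NormedModule).
Qed.

Lemma Cmod_sum_n_le (u : nat -> C) (n : nat) :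
  Cmod (sum_n (G := C_R_NormedModule) u n) <= sum_n (fun k => Cmod (u k)) n.
Proof.
elim: n => [|n IH]; rewrite ?sum_O ?sum_Sn; first by right.
apply: Rle_trans (Cmod_triangle _ _) _; exact: Rplus_le_compat_r.
Qed.

Lemma is_cser_lim (u : nat -> C) (l : C) : is_cser u l ->
  is_lim_seq (fun n => Cmod (sum_n (G := C_R_NormedModule) u n - l)%C) 0.
Proof.
move=> h; have := is_cser_Re h; have := is_cser_Im h.
move=> /(is_lim_seq_minus' _ _ _ _)/(_ (is_lim_seq_const (Im l))) h2.
move=> /(is_lim_seq_minus' _ _ _ _)/(_ (is_lim_seq_const (Re l))) h1.
rewrite Rminus_diag_eq // in h1; rewrite Rminus_diag_eq // in h2.
have e1 := is_lim_seq_abs _ _ h1; have e2 := is_lim_seq_abs _ _ h2.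
have := is_lim_seq_plus' _ _ _ _ e1 e2; rewrite /= Rabs_R0 Rplus_0_r => e3.
apply: is_lim_seq_le_le (is_lim_seq_const 0) e3 => n; split; first exact: Cmod_ge_0.
by apply: Rle_trans (Cmod_le_ReIm _) _; rewrite -Re_sum_n -Im_sum_n; right.
Qed.

Lemma Cmod_cser_le (u : nat -> C) (b : nat -> R) (l : C) (M : R) :
  is_cser u l -> (forall n, Cmod (u n) <= b n) -> is_series b M -> Cmod l <= M.
Proof.
move=> hu hb hM.
have h1 := is_cser_lim hu.
have h2 := is_lim_seq_plus' _ _ _ _ hM h1; rewrite Rplus_0_r in h2.
refine (lim_seq_le_R (is_lim_seq_const (Cmod l)) h2 _) => n.
have h3 := Cmod_sum_n_le u n.
have h4 : sum_n (fun k => Cmod (u k)) n <= sum_n b n by exact: sum_n_m_le.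
apply: Rle_trans (Rplus_le_compat_r _ _ _ (Rle_trans _ _ _ h3 h4)).
rewrite Cmod_minus_sym; have := Cmod_triangle_inv l (sum_n (G := C_R_NormedModule) u n); lra.
Qed.

Lemma Cmod_CSeries_le (u : nat -> C) (b : nat -> R) :
  (forall n, Cmod (u n) <= b n) -> ex_series b -> Cmod (CSeries u) <= Series b.
Proof.
move=> h eb; apply: Cmod_cser_le (is_cser_le h eb) h _; exact: Series_correct.
Qed.

(** Comparison with a telescoping series whose limit need not be known: nonnegativity of [b] alone
    bounds the partial sums by [b 0]. *)
Lemma series_telescope (a b : nat -> R) :
  (forall n, 0 <= a n <= b n - b n.+1) -> (forall n, 0 <= b n) ->
  ex_series a /\ Series a <= b 0%N.
Proof.
move=> ha hb.
have hs n : sum_n a n <= b 0%N - b n.+1.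
  elim: n => [|n IH]; rewrite ?sum_O ?sum_Sn /plus /=; first by have := ha 0%N; lra.
  have := ha n.+1; lra.
have [l hl] : ex_series a.
  have inc n : sum_n a n <= sum_n a n.+1.
    by rewrite sum_Sn /plus /=; have := ha n.+1; lra.
  have bd n : sum_n a n <= b 0%N.
    by apply: Rle_trans (hs n) _; have := hb n.+1; lra.
  have [l hl] := ex_finite_lim_seq_incr _ _ inc bd.
  by exists l.
split; first by exists l.
rewrite (is_series_unique _ _ hl).
refine (lim_seq_le_R hl (is_lim_seq_const (b 0%N)) _) => n.
apply: Rle_trans (hs n) _; have := hb n.+1; lra.
Qed.

(** The terms of the Basel series, which serve as the majorant of every dilogarithm-type series
    below. *)
Definition isq (n : nat) : R := / (INR n.+1 * INR n.+1).

Lemma INR_S_pos (n : nat) : 0 < INR n.+1.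
Proof. by apply: lt_0_INR; lia. Qed.

Lemma isq_pos (n : nat) : 0 < isq n.
Proof. by apply: Rinv_0_lt_compat; apply: Rmult_lt_0_compat; exact: INR_S_pos. Qed.

(** The shift by 1/2 comes from 1/y^2 <= 1/(y - 1/2) - 1/(y + 1/2); it makes the tail bound sharp
    enough for the numerical estimates with few terms. *)
Lemma isq_tail (N : nat) :
  ex_series (fun n => isq (N + n)%N) /\ Series (fun n => isq (N + n)%N) <= / (INR N + / 2).
Proof.
pose b n := / (INR (N + n)%N + / 2).
have -> : / (INR N + / 2) = b 0%N by rewrite /b addn0.
have i0 n : 0 < INR (N + n)%N + / 2 by have := pos_INR (N + n)%N; lra.
apply: series_telescope => n; last by left; apply: Rinv_0_lt_compat.
split; first by left; exact: isq_pos.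
have := i0 n; rewrite /b /isq addnS !S_INR; set y := INR _ => y0.
have -> : / (y + / 2) - / (y + 1 + / 2) = / ((y + / 2) * (y + 1 + / 2)) by field; lra.
apply: Rinv_le_contravar; nra.
Qed.

Lemma ex_series_isq : ex_series isq.
Proof. by have [h _] := isq_tail 0. Qed.

Lemma Cmod_sum_n_small (u : nat -> C) (N : nat) (e : R) :
  (forall n, (n <= N)%N -> Cmod (u n) <= e) ->
  Cmod (sum_n (G := C_R_NormedModule) u N) <= INR N.+1 * e.
Proof.
elim: N => [|N IH] h; first by rewrite sum_O Rmult_1_l; exact: h.
rewrite sum_Sn S_INR; apply: Rle_trans (Cmod_triangle _ _) _.
have := h N.+1 (leqnn _); have := IH (fun n hn => h n (leqW hn)); lra.
Qed.

(** Dominated convergence for series. A general filter is taken since the lemma is applied both to w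
    -> 0 in the half-plane and to t -> 0 from the right. *)
Lemma tannery (T : Type) (F : (T -> Prop) -> Prop) (FF : Filter F)
    (a : T -> nat -> C) (M : nat -> R) :
  ex_series M -> F (fun t => forall n, Cmod (a t n) <= M n) ->
  (forall n e, 0 < e -> F (fun t => Cmod (a t n) <= e)) ->
  forall e, 0 < e -> F (fun t => Cmod (CSeries (a t)) <= e).
Proof.
move=> exM hM ha e e0.
have [N hN] : exists N, Series (fun n => M (N.+1 + n)%N) < e / 2.
  have /is_lim_seq_spec : is_lim_seq (sum_n M) (Series M) by exact: Series_correct.
  move=> /(_ (mkposreal (e / 2) ltac:(lra))) /= [N h]; exists N.
  have := h N (le_n N).
  rewrite (Series_incr_n M N.+1) //; last by lia.
  have -> : sum_n (G := R_NormedModule) M N = sum_f_R0 M (Nat.pred N.+1) by rewrite sum_n_Reals.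
  rewrite [_ - _](_ : _ = - Series (fun k => M (N.+1 + k)%N)); last first.
    set A := Series (fun k => M (N.+1 + k)%N); set B := sum_f_R0 _ _.
    by change (B - (B + A) = - A); ring.
  by rewrite Rabs_Ropp; apply: Rle_lt_trans; exact: Rle_abs.
(* Only the terms up to [N] need the hypothesis of pointwise convergence; these finitely many
   conditions are intersected by induction. *)
have hF : F (fun t => forall n, (n <= N)%N -> Cmod (a t n) <= e / 2 / INR N.+1).
  have : 0 < e / 2 / INR N.+1 by apply: Rdiv_lt_0_compat; [lra|exact: INR_S_pos].
  move: (e / 2 / INR N.+1) => d d0; elim: (N) => [|m IH].
    by apply: filter_imp (ha 0%N d d0) => t h n; rewrite leqn0 => /eqP ->.
  apply: filter_imp (filter_and _ _ IH (ha m.+1 d d0)) => t [h1 h2] n.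
  by rewrite leq_eqVlt => /orP[/eqP->//|hn]; apply: h1.
apply: filter_imp (filter_and _ _ hM hF) => t [h1 h2].
have h3 := is_cser_le h1 exM.
have h4 : is_cser (fun n => a t (N.+1 + n)%N)
    (CSeries (a t) - sum_n (G := C_R_NormedModule) (a t) N)%C.
  apply: (@is_series_incr_n _ C_R_NormedModule (a t) N.+1 _ (Nat.lt_0_succ N)).
  set S := sum_n _ _; set l := plus _ _.
  have -> // : l = CSeries (a t).
  by change ((CSeries (a t) - S + S)%C = CSeries (a t)); ring.
have h5 : ex_series (fun n => M (N.+1 + n)%N) by rewrite -ex_series_incr_n.
have h6 := Cmod_cser_le h4 (fun n => h1 _) (Series_correct _ h5).
have h7 := Cmod_sum_n_small h2.
have e1 : INR N.+1 * (e / 2 / INR N.+1) = e / 2 by field; have := INR_S_pos N; lra.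
rewrite e1 in h7.
have := Cmod_triangle_inv (CSeries (a t)) (sum_n (G := C_R_NormedModule) (a t) N).
lra.
Qed.

(* The branch of -log (1 - y) on the half-plane [Re y < 1]. *)
Definition log1m (y : C) : C := (- ln (Cmod (1 - y)%C), atan (Im y / (1 - Re y))).

Lemma Cexp_log1m (y : C) : Re y < 1 -> Cexp (log1m y) = (/ (1 - y))%C.
Proof.
move=> y1; have d0 : 0 < 1 - Re y by lra.
have m0 : 0 < Cmod (1 - y)%C.
  by apply/Cmod_gt_0; apply: Re_pos_neq0; rewrite ReImE /=; lra.
set m := Cmod _ in m0 *.
have mm : m * m = (1 - Re y) * (1 - Re y) + Im y * Im y.
  by rewrite /m Cmod_sqr !ReImE /=; ring.
have es : sqrt (1 + (Im y / (1 - Re y))²) = m / (1 - Re y).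
  apply: sqrt_lem_1; rewrite /Rsqr; first by nra.
    by apply: Rmult_le_pos; [lra|left; exact: Rinv_0_lt_compat].
  have -> : m / (1 - Re y) * (m / (1 - Re y)) = m * m / ((1 - Re y) * (1 - Re y)) by field; lra.
  rewrite mm; field; lra.
rewrite /Cexp /= -/m cos_atan sin_atan es exp_Ropp exp_ln //.
rewrite /Cinv /=; have e2 : (1 + - Re y) * ((1 + - Re y) * 1) + (0 + - Im y) * ((0 + - Im y) * 1) = m * m.
  rewrite mm; ring.
apply: C_ext; rewrite /= -/(Re y) -/(Im y) e2; field; lra.
Qed.

Lemma Cpow_RtoC_mult (t : R) (y : C) (n : nat) : Cpow (RtoC t * y)%C n = (RtoC (t ^ n) * Cpow y n)%C.
Proof. by rewrite Cpow_mult_l RtoC_pow. Qed.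

Lemma Cgeom_sum (u : C) (N : nat) : (1 - u)%C <> 0%C ->
  sum_n (G := C_R_NormedModule) (fun k => Cpow u k) N = ((1 - Cpow u N.+1) / (1 - u))%C.
Proof.
move=> u1; elim: N => [|N IH]; first by rewrite sum_O /=; field.
rewrite sum_Sn IH; change (@plus C_R_NormedModule) with Cplus; rewrite /=; field; exact: u1.
Qed.

Section LogSeries.

Variable y : C.
Hypothesis y1 : Cmod y < 1.

(** This is [log1m (t y)] with the modulus written out, a form in which both coordinates can be
    differentiated in [t]; [S N] is the N-th partial sum of the series at [t y]. *)
Let H (t : R) : C := (- (/ 2 * ln ((1 - t * Re y) * (1 - t * Re y) + t * Im y * (t * Im y))),
                      atan (t * Im y / (1 - t * Re y))).
Let S (N : nat) (t : R) : C :=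
  sum_n (G := C_R_NormedModule) (fun k => RtoC (t ^ k.+1) * (Cpow y k.+1 / RtoC (INR k.+1)))%C N.

Let small (t : R) : Rabs t <= 1 -> Cmod (RtoC t * y)%C < 1.
Proof.
move=> t1; rewrite Cmod_mult Cmod_R.
have := Cmod_ge_0 y; have := Rabs_pos t; nra.
Qed.

Let pos (t : R) : Rabs t <= 1 -> 0 < 1 - t * Re y.
Proof.
move=> /small h; have := re_le_Cmod (RtoC t * y)%C; rewrite ReImE /=.
have := Rle_abs (t * Re y - 0 * Im y); lra.
Qed.

Let dH (t : R) : Rabs t <= 1 ->
  is_derive (fun t => Re (H t)) t (Re (y / (1 - RtoC t * y))%C) /\
  is_derive (fun t => Im (H t)) t (Im (y / (1 - RtoC t * y))%C).
Proof.
move=> t1; have p0 := pos t1.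
have e2 : (1 + - (t * Re y - 0 * Im y)) * ((1 + - (t * Re y - 0 * Im y)) * 1) +
   (0 + - (t * Im y + 0 * Re y)) * ((0 + - (t * Im y + 0 * Re y)) * 1) =
   (1 - t * Re y) * (1 - t * Re y) + t * Im y * (t * Im y) by ring.
have n0 : 0 < (1 - t * Re y) * (1 - t * Re y) + t * Im y * (t * Im y) by nra.
split; rewrite /H /Re /Im /=; auto_derive; rewrite -/(Re y) -/(Im y).
- by repeat split; lra.
- by rewrite e2; field; lra.
- by repeat split; lra.
- by rewrite e2; field; repeat split; try lra; nra.
Qed.

Let dS (N : nat) (t : R) :
  is_derive (fun t => Re (S N t)) t (Re (y * sum_n (G := C_R_NormedModule) (fun k => Cpow (RtoC t * y) k) N)%C) /\
  is_derive (fun t => Im (S N t)) t (Im (y * sum_n (G := C_R_NormedModule) (fun k => Cpow (RtoC t * y) k) N)%C).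
Proof.
have term (k : nat) (c : R) : is_derive (fun t => t ^ k.+1 * c) t (INR k.+1 * t ^ k * c).
  by auto_derive => //; simpl; ring.
have tq (k : nat) : (RtoC (INR k.+1 * t ^ k) * (Cpow y k.+1 / RtoC (INR k.+1)))%C
    = (y * Cpow (RtoC t * y) k)%C.
  rewrite Cpow_RtoC_mult RtoC_mult; change (Cpow y k.+1) with (y * Cpow y k)%C; field; apply: RtoC_neq0; have := INR_S_pos k; lra.
elim: N => [|N [IH1 IH2]]; rewrite /S.
  split; rewrite sum_O -tq.
    apply: (is_derive_ext (fun t => t ^ 1 * Re (Cpow y 1 / RtoC (INR 1))%C)) => [u|].
      by rewrite sum_O ReImE /=; ring.
    apply: eq_ind (term 0%N _) _ _; rewrite ReImE /=; ring.
  apply: (is_derive_ext (fun t => t ^ 1 * Im (Cpow y 1 / RtoC (INR 1))%C)) => [u|].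
    by rewrite sum_O ReImE /=; ring.
  apply: eq_ind (term 0%N _) _ _; rewrite ReImE /=; ring.
rewrite sum_Sn; change (@plus C_R_NormedModule) with Cplus; rewrite Cmult_plus_distr_l -tq.
split.
  apply: (is_derive_ext (fun t => plus (Re (S N t)) (t ^ N.+2 * Re (Cpow y N.+2 / RtoC (INR N.+2))%C))) => [u|].
    rewrite sum_Sn; change (@plus C_R_NormedModule) with Cplus; rewrite /S !ReImE /plus /=; ring.
  rewrite Re_plus; apply: (@is_derive_plus _ R_NormedModule) IH1 _.
  apply: eq_ind (term _ _) _ _; rewrite [RHS]ReImE /=; ring.
apply: (is_derive_ext (fun t => plus (Im (S N t)) (t ^ N.+2 * Im (Cpow y N.+2 / RtoC (INR N.+2))%C))) => [u|].
  rewrite sum_Sn; change (@plus C_R_NormedModule) with Cplus; rewrite /S !ReImE /plus /=; ring.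
rewrite Im_plus; apply: (@is_derive_plus _ R_NormedModule) IH2 _.
apply: eq_ind (term _ _) _ _; rewrite [RHS]ReImE /=; ring.
Qed.

Let rem (N : nat) (t : R) : Rabs t <= 1 ->
  Cmod (y / (1 - RtoC t * y) - y * sum_n (G := C_R_NormedModule) (fun k => Cpow (RtoC t * y) k) N)%C
  <= Cmod y ^ N / (1 - Cmod y).
Proof.
move=> t1; have p0 := pos t1; have s1 := small t1.
have n0 : (1 - RtoC t * y)%C <> 0%C by apply: Re_pos_neq0; rewrite !ReImE /=; lra.
rewrite Cgeom_sum //.
have -> : (y / (1 - RtoC t * y) - y * ((1 - Cpow (RtoC t * y) N.+1) / (1 - RtoC t * y)))%C
   = (Cpow (RtoC t * y) N.+1 * (y / (1 - RtoC t * y)))%C by field.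
have c0 := Cmod_ge_0 y.
have le1 : Cmod (RtoC t * y)%C <= Cmod y.
  by rewrite Cmod_mult Cmod_R; have := Rabs_pos t; nra.
have c1 := Cmod_ge_0 (RtoC t * y)%C.
rewrite Cmod_mult Cmod_div // Cmod_pow.
apply: Rmult_le_compat.
- exact: pow_le.
- by apply: Rmult_le_pos => //; left; apply: Rinv_0_lt_compat; apply/Cmod_gt_0.
- rewrite /=; have := pow_incr _ _ N (conj c1 le1); have := pow_le _ N c1; nra.
have := Cmod_triangle_inv 1 (RtoC t * y)%C; rewrite Cmod_1 => h.
rewrite -[X in _ <= X]Rmult_1_l; apply: Rmult_le_compat => //; try lra.
  by left; apply: Rinv_0_lt_compat; apply/Cmod_gt_0.
by apply: Rinv_le_contravar; lra.
Qed.

(** Along the segment t -> t y the logarithm and the partial sum both start from 0, and their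
    derivatives differ by [y] times the remainder of a geometric series, at most |y|^N / (1 -
    |y|). *)
Lemma is_cser_log1m : is_cser (fun k => Cpow y k.+1 / RtoC (INR k.+1))%C (log1m y).
Proof.
have c0 := Cmod_ge_0 y.
have lim0 : is_lim_seq (fun N => Cmod y ^ N / (1 - Cmod y)) 0.
  have := is_lim_seq_scal_r _ (/ (1 - Cmod y)) _ (is_lim_seq_geom (Cmod y) _).
  by rewrite /= Rmult_0_l; apply; rewrite Rabs_pos_eq.
have H0 : H 0 = 0%C.
  by rewrite /H !Rmult_0_l Rminus_0_r Rmult_1_r Rplus_0_r ln_1 /Rdiv Rmult_0_l atan_0 Rmult_0_r Ropp_0.
have H1 : H 1 = log1m y.
  rewrite /H /log1m !Rmult_1_l; congr pair; congr Ropp.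
  have -> : (1 - Re y) * (1 - Re y) + Im y * Im y = Cmod (1 - y)%C * Cmod (1 - y)%C.
    by rewrite Cmod_sqr !ReImE /=; ring.
  have m0 : 0 < Cmod (1 - y)%C.
    apply/Cmod_gt_0; apply: Re_pos_neq0; rewrite ReImE /=.
    by have := pos (t := 1); rewrite Rabs_R1 Rmult_1_l; lra.
  rewrite ln_mult //; lra.
have S0 N : S N 0 = 0%C.
  elim: N => [|N IH]; rewrite /S ?sum_O ?sum_Sn.
    by apply: C_ext; rewrite ReImE /=; ring.
  rewrite -/(S N 0) IH; change (@plus C_R_NormedModule) with Cplus.
  by apply: C_ext; rewrite !ReImE /=; ring.
have S1 N : S N 1 = sum_n (G := C_R_NormedModule) (fun k => Cpow y k.+1 / RtoC (INR k.+1))%C N.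
  by apply: sum_n_ext => k; rewrite pow1 Cmult_1_l.
have key N : Rabs (Re (H 1 - S N 1)%C) <= Cmod y ^ N / (1 - Cmod y) /\
             Rabs (Im (H 1 - S N 1)%C) <= Cmod y ^ N / (1 - Cmod y).
  have e1 : Rabs (1 - 0) = 1 by rewrite Rminus_0_r Rabs_R1.
  split.
  rewrite (_ : Re (H 1 - S N 1)%C = (Re (H 1) - Re (S N 1)) - (Re (H 0) - Re (S N 0))); last first.
    by rewrite H0 S0 ReImE /=; ring.
  rewrite -[X in _ <= X]Rmult_1_r -[X in _ * X]e1.
  apply: (@bounded_variation (fun t => Re (H t) - Re (S N t))
      (fun t => Re (y / (1 - RtoC t * y) - y * sum_n (G := C_R_NormedModule) (fun k => Cpow (RtoC t * y) k) N)%C)).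
  move=> t; rewrite Rminus_0_r Rminus_0_r Rabs_R1 => t1; split.
    by rewrite Re_minus; apply: (@is_derive_minus _ R_NormedModule); [case: (dH t1)|case: (dS N t)].
  exact: Rle_trans (re_le_Cmod _) (rem N t1).
  rewrite (_ : Im (H 1 - S N 1)%C = (Im (H 1) - Im (S N 1)) - (Im (H 0) - Im (S N 0))); last first.
    by rewrite H0 S0 ReImE /=; ring.
  rewrite -[X in _ <= X]Rmult_1_r -[X in _ * X]e1.
  apply: (@bounded_variation (fun t => Im (H t) - Im (S N t))
      (fun t => Im (y / (1 - RtoC t * y) - y * sum_n (G := C_R_NormedModule) (fun k => Cpow (RtoC t * y) k) N)%C)).
  move=> t; rewrite Rminus_0_r Rminus_0_r Rabs_R1 => t1; split.
    by rewrite Im_minus; apply: (@is_derive_minus _ R_NormedModule); [case: (dH t1)|case: (dS N t)].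
  exact: Rle_trans (im_le_Cmod _) (rem N t1).
rewrite -H1; apply: is_cser_pair; apply: is_series_lim.
  apply: (is_lim_seq_ext (fun N => Re (H 1) - Re (H 1 - S N 1)%C)) => [N|].
    by rewrite S1 ReImE Re_sum_n; ring.
  have h : is_lim_seq (fun N => Re (H 1 - S N 1)%C) 0.
    apply/is_lim_seq_abs_0; apply: is_lim_seq_le_le (is_lim_seq_const 0) lim0 => N.
    by split; [exact: Rabs_pos|case: (key N)].
  by have := is_lim_seq_minus' _ _ _ _ (is_lim_seq_const (Re (H 1))) h; rewrite Rminus_0_r.
apply: (is_lim_seq_ext (fun N => Im (H 1) - Im (H 1 - S N 1)%C)) => [N|].
    by rewrite S1 ReImE Im_sum_n; ring.
  have h : is_lim_seq (fun N => Im (H 1 - S N 1)%C) 0.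
    apply/is_lim_seq_abs_0; apply: is_lim_seq_le_le (is_lim_seq_const 0) lim0 => N.
    by split; [exact: Rabs_pos|case: (key N)].
  by have := is_lim_seq_minus' _ _ _ _ (is_lim_seq_const (Im (H 1))) h; rewrite Rminus_0_r.
Qed.

End LogSeries.

(** * Cauchy's formula for Q_n *)

Lemma sum_n_trailing_zero (h : nat -> C) (N n : nat) : (N <= n)%N ->
  (forall k, (N < k)%N -> h k = 0%C) -> sum_n (G := C_AbelianMonoid) h n = sum_n h N.
Proof.
move=> Nn h0; rewrite -(subnKC Nn); elim: (n - N)%N => [|j IH]; first by rewrite addn0.
by rewrite addnS sum_Sn IH h0 ?plus_zero_r //; lia.
Qed.

Lemma fps_geomE (z : C) (m j : nat) : (0 < m)%N ->
  fps_geom z m j = ((if j == 0%N then 1 else 0) + (if (m <= j)%N then z * fps_geom z m (j - m) else 0))%C.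
Proof.
move=> m0; rewrite /fps_geom; have [->|j0] := eqVneq j 0%N.
  by rewrite dvdn0 div0n leqNgt m0 Cplus_0_r.
rewrite Cplus_0_l; have [mj|jm] := leqP m j; last by rewrite gtnNdvd // lt0n.
rewrite dvdn_subl ?dvdnn //; case: ifP => d; last by rewrite Cmult_0_r.
have -> : (j %/ m)%N = ((j - m) %/ m).+1.
  by rewrite -{1}(subnK mj) divnDr ?divnn ?m0 ?addn1.
by [].
Qed.

(** Coefficient form of F_(N+1) = F_N + z q^(N+1) F_(N+1). The contour integrals and the partitions
    with bounded parts satisfy the same recursion, which is how both are identified with
    [fps_prod]. *)
Lemma fps_prod_rec (z : C) (N n : nat) :
  fps_prod z N.+1 n = (fps_prod z N n +
    (if (N < n)%N then z * fps_prod z N.+1 (n - N.+1)%N else 0))%C.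
Proof.
rewrite {1}/fps_prod -/fps_prod {1}/fps_mul; set f := fps_prod z N.
rewrite (sum_n_ext_loc _ (fun k => plus ((if k == n then f n else 0) : C)
  ((if (N < n)%N && (k <= n - N.+1)%N then z * (f k * fps_geom z N.+1 (n - N.+1 - k)%N) else 0)%C : C))).
  rewrite sum_n_plus; congr Cplus.
    by rewrite (@sum_n_C_single _ n n) ?eqxx // => k _ /negPf ->.
  case: (boolP (N < n)%N) => Nn /=; last first.
    by rewrite (@sum_n_C_single _ n 0%N).
  rewrite (@sum_n_trailing_zero _ (n - N.+1)%N); [|lia|]; last first.
    by move=> k hk; have -> : (k <= n - N.+1)%N = false by lia.
  rewrite (sum_n_ext_loc _ (fun k => mult (K := C_Ring) z (f k * fps_geom z N.+1 (n - N.+1 - k)%N)%C)).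
    exact: (@sum_n_mult_l C_Ring).
  by move=> k hk; have -> : (k <= n - N.+1)%N = true by lia.
move=> k hk; change (@plus C_AbelianMonoid) with Cplus; rewrite fps_geomE //.
have -> : (n - k == 0)%N = (k == n) by apply/idP/idP; lia.
have -> : (N < n - k)%N = (N < n)%N && (k <= n - N.+1)%N by apply/idP/idP; lia.
have -> : (n - k - N.+1)%N = (n - N.+1 - k)%N by lia.
by case: eqP => [->|_]; case: ifP => _; ringC.
Qed.

Notation RIntC f a b := (RInt (V := C_R_CompleteNormedModule) f a b).
Notation is_RIntC f a b l := (is_RInt (V := C_R_NormedModule) f a b l).

Lemma RIntC_correct (f : R -> C) (a b : R) : (forall t, contC f t) -> is_RIntC f a b (RIntC f a b).
Proof. by move=> h; apply: (@RInt_correct C_R_CompleteNormedModule); exact: ex_RIntC. Qed.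

Lemma is_RIntC_ext (f g : R -> C) (a b : R) (l : C) :
  (forall t, f t = g t) -> is_RIntC f a b l -> is_RIntC g a b l.
Proof. by move=> h; apply: is_RInt_ext => t _. Qed.

Lemma is_RIntC_Cmult (f : R -> C) (a b : R) (c l : C) :
  is_RIntC f a b l -> is_RIntC (fun t => c * f t)%C a b (c * l)%C.
Proof.
move=> h.
have h1 := is_RInt_fct_extend_fst (U := R_NormedModule) (V := R_NormedModule) _ _ _ _ h.
have h2 := is_RInt_fct_extend_snd (U := R_NormedModule) (V := R_NormedModule) _ _ _ _ h.
apply: (is_RInt_fct_extend_pair (U := R_NormedModule) (V := R_NormedModule)).
  apply: (@is_RInt_minus R_NormedModule); exact: (@is_RInt_scal R_NormedModule).
apply: (@is_RInt_plus R_NormedModule); exact: (@is_RInt_scal R_NormedModule).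
Qed.

Lemma RIntC_unique (f : R -> C) (a b : R) (l : C) : is_RIntC f a b l -> RIntC f a b = l.
Proof. exact: (@is_RInt_unique C_R_CompleteNormedModule). Qed.

Lemma Cmod_RIntC_le (f : R -> C) (a b M : R) (l : C) : a <= b ->
  (forall t, a <= t <= b -> Cmod (f t) <= M) -> is_RIntC f a b l -> Cmod l <= (b - a) * M.
Proof.
move=> ab h hl.
have e w : norm (K := R_AbsRing) (V := C_R_NormedModule) w = Cmod w by rewrite Cmod_norm.
rewrite -e; apply: norm_RInt_le_const ab _ hl => t ht; rewrite e; exact: h.
Qed.

Lemma contC_vert (x t : R) : contC (fun v => ((x, v) : C)) t.
Proof. by apply: continuousC => /=; [exact: continuous_const|exact: continuous_id]. Qed.

Lemma contC_pow (f : R -> C) (n : nat) (t : R) : contC f t -> contC (fun v => Cpow (f v) n) t.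
Proof.
move=> h; elim: n => [|n IH]; first exact: contC_const.
exact: contC_mult.
Qed.

Lemma sin_Z_PI (k : Z) : sin (IZR k * PI) = 0.
Proof. by apply: sin_eq_0_1; exists k. Qed.

(** Orthogonality of characters on the segment Re w = x. The exponent ranges over the integers
    because the recursion for the Fourier coefficients leads to negative indices. *)
Lemma RInt_char (x : R) (k : Z) :
  is_RIntC (fun v => Cexp (RtoC (IZR k) * ((x, v) : C))%C) (- PI) PI
    (if Z.eqb k 0 then RtoC (2 * PI) else 0%C).
Proof.
case: (Z.eqb_spec k 0) => [->|k0].
  apply: (is_RIntC_ext (f := fun _ => 1%C)).
    by move=> v; rewrite -Cexp_0; congr Cexp; apply: C_ext; rewrite ReImE /=; ring.
  have := @is_RInt_const C_R_NormedModule (- PI) PI (RtoC 1).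
  have -> // : scal (V := C_R_NormedModule) (PI - - PI) (RtoC 1) = RtoC (2 * PI).
  by apply: C_ext; rewrite /= /scal /= /mult /=; ring.
have kR : IZR k <> 0 by move/eq_IZR.
have <- : (RtoC (exp (IZR k * x)) * 0 = 0)%C by rewrite Cmult_0_r.
apply: (is_RIntC_ext (f := fun v => RtoC (exp (IZR k * x)) * ((cos (IZR k * v), sin (IZR k * v)) : C))%C).
  move=> v; apply: C_ext; rewrite !ReImE /=.
    by rewrite !Rmult_0_l !Rminus_0_r !Rplus_0_r.
  by rewrite !Rmult_0_l !Rminus_0_r !Rplus_0_r.
apply: is_RIntC_Cmult.
apply: (is_RInt_fct_extend_pair (U := R_NormedModule) (V := R_NormedModule)) => /=.
  have := @is_RInt_derive R_CompleteNormedModule (fun v => sin (IZR k * v) / IZR k)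
    (fun v => cos (IZR k * v)) (- PI) PI.
  have -> : minus (sin (IZR k * PI) / IZR k) (sin (IZR k * - PI) / IZR k) = 0.
    by rewrite Ropp_mult_distr_r_reverse sin_neg sin_Z_PI /minus /plus /opp /=; field.
  apply=> v _; first by auto_derive => //; field.
  apply: continuous_comp (continuous_cos _).
  by apply: continuous_mult; [exact: continuous_const|exact: continuous_id].
have := @is_RInt_derive R_CompleteNormedModule (fun v => - cos (IZR k * v) / IZR k)
    (fun v => sin (IZR k * v)) (- PI) PI.
have -> : minus (- cos (IZR k * PI) / IZR k) (- cos (IZR k * - PI) / IZR k) = 0.
  by rewrite Ropp_mult_distr_r_reverse cos_neg /minus /plus /opp /=; field.
apply=> v _; first by auto_derive => //; field.
apply: continuous_comp (continuous_sin _).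
by apply: continuous_mult; [exact: continuous_const|exact: continuous_id].
Qed.

Fixpoint euler_prod (z xi : C) (N : nat) (w : C) : C :=
  if N is N'.+1 then (euler_prod z xi N' w / (1 - z * Cpow (xi * Cexp (- w)) N))%C else 1%C.

Lemma euler_prodS (z xi : C) (N : nat) (w : C) :
  euler_prod z xi N.+1 w = (euler_prod z xi N w / (1 - z * Cpow (xi * Cexp (- w)) N.+1))%C.
Proof. by []. Qed.

Section CoefficientIntegral.

Variables (z xi : C) (x : R).
Hypotheses (z1 : Cmod z <= 1) (xi1 : Cmod xi = 1) (x0 : 0 < x).

Let q (v : R) : C := (xi * Cexp (- ((x, v) : C)))%C.

Let qmod (v : R) : Cmod (q v) = exp (- x).
Proof. by rewrite /q Cmod_mult xi1 Cmod_Cexp Rmult_1_l. Qed.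

Let r1 : 0 < exp (- x) < 1.
Proof. by split; [exact: exp_pos|rewrite -exp_0; apply: exp_increasing; lra]. Qed.

Let den (v : R) (m : nat) : 1 - exp (- x) <= Cmod (1 - z * Cpow (q v) m.+1)%C.
Proof.
have := Cmod_triangle_inv 1 (z * Cpow (q v) m.+1)%C.
rewrite Cmod_1 Cmod_mult Cmod_pow qmod /=.
have h : exp (- x) ^ m <= 1.
  by rewrite -(pow1 m); apply: pow_incr; case: r1; lra.
have h2 : 0 <= exp (- x) ^ m by apply: pow_le; case: r1; lra.
have := Cmod_ge_0 z; case: r1 => a b c.
have : Cmod z * (exp (- x) * exp (- x) ^ m) <= 1 * (exp (- x) * 1).
  apply: Rmult_le_compat => //; first by apply: Rmult_le_pos; lra.
  apply: Rmult_le_compat; lra.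
lra.
Qed.

Let den0 (v : R) (m : nat) : (1 - z * Cpow (q v) m.+1)%C <> 0%C.
Proof. by apply: Cmod_neq0; have := den v m; case: r1; lra. Qed.

Let contq (t : R) : contC q t.
Proof.
apply: contC_mult; first exact: contC_const.
apply: contC_Cexp; apply: contC_opp; exact: contC_vert.
Qed.

Let contP (N : nat) (t : R) : contC (fun v => euler_prod z xi N ((x, v) : C)) t.
Proof.
elim: N => [|N IH]; first exact: contC_const.
apply: contC_mult => //; apply: contC_inv; last exact: den0.
apply: contC_minus; first exact: contC_const.
apply: contC_mult; first exact: contC_const.
exact: contC_pow.
Qed.

Let boundP (N : nat) (v : R) : Cmod (euler_prod z xi N ((x, v) : C)) <= (/ (1 - exp (- x))) ^ N.
Proof.
elim: N => [|N IH]; first by rewrite Cmod_1 /=; lra.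
rewrite euler_prodS Cmod_div; last exact: den0.
rewrite -tech_pow_Rmult Rmult_comm; have := den v N; case: r1 => a b c.
apply: Rmult_le_compat => //; try exact: Cmod_ge_0.
  by left; apply: Rinv_0_lt_compat; apply: Rlt_le_trans c; lra.
by apply: Rinv_le_contravar => //; lra.
Qed.

Let ig (N : nat) (k : Z) (v : R) : C :=
  (euler_prod z xi N ((x, v) : C) * Cexp (RtoC (IZR k) * ((x, v) : C)))%C.

Let contig (N : nat) (k : Z) (t : R) : contC (ig N k) t.
Proof.
apply: contC_mult => //; apply: contC_Cexp; apply: contC_mult; first exact: contC_const.
exact: contC_vert.
Qed.

Let I (N : nat) (k : Z) : C := RIntC (ig N k) (- PI) PI.

Let bound (N : nat) (k : Z) :
  Cmod (I N k) <= 2 * PI * (/ (1 - exp (- x))) ^ N * exp (IZR k * x).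
Proof.
have := Cmod_RIntC_le (M := (/ (1 - exp (- x))) ^ N * exp (IZR k * x)) _ _
  (RIntC_correct (a := - PI) (b := PI) (@contig N k)).
rewrite /I => h; apply: Rle_trans (h _ _) _; last by right; ring.
  by have := PI_RGT_0; lra.
move=> t _; rewrite /ig Cmod_mult Cmod_Cexp ReImE /= Rmult_0_l Rminus_0_r.
apply: Rmult_le_compat_r; [left; exact: exp_pos|exact: boundP].
Qed.

Let rec (N : nat) (k : Z) :
  I N.+1 k = (I N k + z * Cpow xi N.+1 * I N.+1 (k - Z.of_nat N.+1))%C.
Proof.
apply: RIntC_unique.
apply: (is_RIntC_ext (f := fun v => plus (ig N k v)
  (z * Cpow xi N.+1 * ig N.+1 (k - Z.of_nat N.+1) v)%C)).
  move=> v; change (@plus C_R_NormedModule) with Cplus.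
  have -> : ig N k v = (ig N.+1 k v * (1 - z * Cpow (q v) N.+1))%C.
    rewrite /ig euler_prodS -/(q v); have := @den0 v N.
    by set d := (1 - _)%C => d0; field.
  rewrite /ig; set P := euler_prod _ _ _ _.
  have -> : Cexp (RtoC (IZR (k - Z.of_nat N.+1)) * ((x, v) : C))%C =
    (Cexp (RtoC (IZR k) * ((x, v) : C)) * Cpow (Cexp (- ((x, v) : C))) N.+1)%C.
    rewrite Cexp_pow -Cexp_plus; congr Cexp.
    by rewrite minus_IZR RtoC_minus -INR_IZR_INZ; ring.
  rewrite /q Cpow_mult_l; ringC.
apply: (@is_RInt_plus C_R_NormedModule); first exact: RIntC_correct.
apply: is_RIntC_Cmult; exact: RIntC_correct.
Qed.

(** Negative coefficients vanish without expanding the product: once those of level N are 0, [rec]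
    bounds |I (N+1) k| by |I (N+1) (k - N - 1)|, and every repetition improves the trivial bound by
    at least a factor e^(-x). *)
Let neg (N : nat) (k : Z) : (k < 0)%Z -> I N k = 0%C.
Proof.
elim: N k => [|N IH] k k0.
  have := @RInt_char x k; have -> : Z.eqb k 0 = false by apply/Z.eqb_neq; lia.
  move=> h; apply: RIntC_unique; apply: is_RIntC_ext h => v.
  by rewrite /ig Cmult_1_l.
set B := 2 * PI * (/ (1 - exp (- x))) ^ N.+1.
have B0 : 0 <= B.
  apply: Rmult_le_pos; first by have := PI_RGT_0; lra.
  by apply: pow_le; left; apply: Rinv_0_lt_compat; case: r1; lra.
have h (j : nat) : forall k, (k < 0)%Z -> Cmod (I N.+1 k) <= B * exp ((IZR k - INR j) * x).
  elim: j => [|j IHj] l l0; first by rewrite Rminus_0_r; exact: bound.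
  rewrite rec IH // Cplus_0_l Cmod_mult (Cmod_mult z) Cmod_pow xi1 pow1 Rmult_1_r.
  apply: Rle_trans (_ : 1 * Cmod (I N.+1 (l - Z.of_nat N.+1)) <= _).
    by apply: Rmult_le_compat_r; [exact: Cmod_ge_0|exact: z1].
  rewrite Rmult_1_l; apply: Rle_trans (IHj _ _) _; first by lia.
  apply: Rmult_le_compat_l => //; apply: exp_le; apply: Rmult_le_compat_r; first by lra.
  rewrite minus_IZR -INR_IZR_INZ !S_INR; have := pos_INR N; lra.
have lim : is_lim_seq (fun j => B * exp (IZR k * x) * (exp (- x)) ^ j) 0.
  have := is_lim_seq_scal_l _ (B * exp (IZR k * x)) _ (is_lim_seq_geom (exp (- x)) _).
  by rewrite /= Rmult_0_r; apply; rewrite Rabs_pos_eq; case: r1; lra.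
have c0 : Cmod (I N.+1 k) <= 0.
  refine (lim_seq_le_R (is_lim_seq_const _) lim _) => j.
  apply: Rle_trans (h j k k0) _; right; rewrite Rmult_assoc; congr Rmult.
  have -> : exp (- x) ^ j = exp (- (INR j * x)).
    elim: j => [|j IHj]; first by rewrite /= -exp_0; congr exp; change (INR 0) with 0; ring.
    by rewrite /= IHj -exp_plus S_INR; congr exp; ring.
  by rewrite -exp_plus; congr exp; ring.
by apply: Cmod_eq_0; have := Cmod_ge_0 (I N.+1 k); lra.
Qed.

Let main (N n : nat) : I N (Z.of_nat n) = (RtoC (2 * PI) * (Cpow xi n * fps_prod z N n))%C.
Proof.
elim: N n => [|N IH] n.
  have := @RInt_char x (Z.of_nat n); rewrite /= /fps_one => h; apply: RIntC_unique.
  apply: (is_RIntC_ext (f := fun v => Cexp (RtoC (IZR (Z.of_nat n)) * ((x, v) : C))%C)).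
    by move=> v; rewrite /ig Cmult_1_l.
  move: h; case: eqP => [->|n0] /=; first by rewrite !Cmult_1_r.
  have -> : Z.eqb (Z.of_nat n) 0 = false by apply/Z.eqb_neq; lia.
  by rewrite !Cmult_0_r.
elim/ltn_ind: n => n IHn; rewrite rec IH fps_prod_rec.
have [Nn|nN] := ltnP N n; last by rewrite neg; [ring|lia].
have -> : (Z.of_nat n - Z.of_nat N.+1)%Z = Z.of_nat (n - N.+1) by lia.
rewrite IHn; last by lia.
have -> : Cpow xi n = (Cpow xi N.+1 * Cpow xi (n - N.+1)%N)%C.
  by rewrite -Cpow_add_r; congr Cpow; lia.
ring.
Qed.

Lemma coef_euler_prod (N n : nat) : (n <= N)%N ->
  is_RIntC (fun v => euler_prod z xi N ((x, v) : C) * Cexp (RtoC (INR n) * ((x, v) : C)))%C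
    (- PI) PI (RtoC (2 * PI) * (Cpow xi n * Q n z))%C.
Proof.
move=> nN; have := RIntC_correct (a := - PI) (b := PI) (@contig N (Z.of_nat n)).
rewrite -/(I _ _) main fps_prod_stable //.
by apply: is_RIntC_ext => v; rewrite /ig -INR_IZR_INZ.
Qed.

End CoefficientIntegral.

(* [elog z q] is the logarithm of [prod_m (1 - z q^m)^(-1)], as the Lambert series obtained by
   expanding each factor. *)
Definition elog_term (z q : C) (k : nat) : C :=
  (Cpow z k.+1 / RtoC (INR k.+1) * (Cpow q k.+1 / (1 - Cpow q k.+1)))%C.

Definition elog (z q : C) : C := CSeries (elog_term z q).

Lemma Cpow_mul (q : C) (a b : nat) : Cpow q (a * b) = Cpow (Cpow q a) b.
Proof. exact: Cpow_mult_r. Qed.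

Lemma one_minus_pow (q : C) (k : nat) : Cmod q < 1 -> 1 - Cmod q <= Cmod (1 - Cpow q k.+1)%C.
Proof.
move=> q1; have q0 := Cmod_ge_0 q.
have := Cmod_triangle_inv 1 (Cpow q k.+1); rewrite Cmod_1 Cmod_pow /=.
have h : Cmod q ^ k <= 1 by rewrite -(pow1 k); apply: pow_incr; lra.
have : Cmod q * Cmod q ^ k <= Cmod q * 1 by apply: Rmult_le_compat_l.
lra.
Qed.

Lemma one_minus_pow_neq0 (q : C) (k : nat) : Cmod q < 1 -> (1 - Cpow q k.+1)%C <> 0%C.
Proof. by move=> q1; apply: Cmod_neq0; have := one_minus_pow k q1; lra. Qed.

Lemma Cmod_coef_le (z : C) (k : nat) : Cmod z <= 1 ->
  Cmod (Cpow z k.+1 / RtoC (INR k.+1))%C <= / INR k.+1.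
Proof.
move=> z1; have z0 := Cmod_ge_0 z; have k0 := INR_S_pos k.
rewrite Cmod_div; last by apply: RtoC_neq0; lra.
rewrite Cmod_pow Cmod_pos; last by lra.
rewrite -[X in _ <= X]Rmult_1_l; apply: Rmult_le_compat_r; first by left; apply: Rinv_0_lt_compat.
by rewrite -(pow1 k.+1); apply: pow_incr.
Qed.

Lemma Cmod_mult_pow_lt1 (z q : C) (k : nat) : Cmod z <= 1 -> Cmod q < 1 ->
  Cmod (z * Cpow q k.+1)%C < 1.
Proof.
move=> z1 q1; have q0 := Cmod_ge_0 q; have z0 := Cmod_ge_0 z.
rewrite Cmod_mult Cmod_pow -tech_pow_Rmult.
have h : Cmod q ^ k <= 1 by rewrite -(pow1 k); apply: pow_incr; lra.
have h0 : 0 <= Cmod q ^ k by exact: pow_le.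
have h1 : 0 <= Cmod q * Cmod q ^ k by exact: Rmult_le_pos.
have : Cmod q * Cmod q ^ k <= Cmod q * 1 by exact: Rmult_le_compat_l.
have : Cmod z * (Cmod q * Cmod q ^ k) <= 1 * (Cmod q * Cmod q ^ k) by exact: Rmult_le_compat_r.
lra.
Qed.

Lemma INR_S_ge1 (k : nat) : 1 <= INR k.+1.
Proof. by rewrite S_INR; have := pos_INR k; lra. Qed.

Lemma inv_INR_S_le1 (k : nat) : / INR k.+1 <= 1.
Proof. by rewrite -[X in _ <= X]Rinv_1; apply: Rinv_le_contravar; [lra|exact: INR_S_ge1]. Qed.

Section EulerProductLimit.

Variables (z : C).
Hypothesis (z1 : Cmod z <= 1).

(** The logarithm of the finite product: the factor 1 - q^((k+1) N) cuts q^(k+1) / (1 - q^(k+1))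
    down to its first N terms as a geometric series. *)
Let elogN (q : C) (N : nat) : C :=
  CSeries (fun k => elog_term z q k * (1 - Cpow q (k.+1 * N)))%C.

Lemma elog_term_le (q : C) (k : nat) : Cmod q < 1 ->
  Cmod (elog_term z q k) <= Cmod q ^ k.+1 * / (1 - Cmod q).
Proof.
move=> q1; have q0 := Cmod_ge_0 q; rewrite /elog_term Cmod_mult.
have d0 := @one_minus_pow_neq0 _ k q1; rewrite (Cmod_div (Cpow q k.+1)) // Cmod_pow.
rewrite -[X in _ <= X]Rmult_1_l; apply: Rmult_le_compat; try exact: Cmod_ge_0.
- by apply: Rmult_le_pos; [exact: pow_le|left; apply: Rinv_0_lt_compat; apply/Cmod_gt_0].
- by apply: Rle_trans (Cmod_coef_le k z1) (inv_INR_S_le1 k).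
apply: Rmult_le_compat_l; first exact: pow_le.
by apply: Rinv_le_contravar; [lra|exact: one_minus_pow].
Qed.

Let geomS (r : R) : 0 <= r < 1 -> is_series (fun k => r ^ k.+1 * / (1 - r)) (r * / (1 - r) * / (1 - r)).
Proof.
move=> hr; have := is_series_scal_l (r * / (1 - r)) _ _ (is_series_geom r _).
have e : scal (r * / (1 - r)) (/ (1 - r)) = r * / (1 - r) * / (1 - r) by [].
rewrite e => h; apply: is_series_ext (h _); last by rewrite Rabs_pos_eq; lra.
by move=> n; rewrite /scal /= /mult /=; ring.
Qed.

Lemma is_cser_elog (q : C) : Cmod q < 1 -> is_cser (elog_term z q) (elog z q).
Proof.
move=> q1; apply: is_cser_le (fun n => elog_term_le n q1) _.
by eexists; apply: geomS; split=> //; exact: Cmod_ge_0.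
Qed.

Let M (r : R) : R := 2 * (r * / (1 - r) * / (1 - r)).

Let one_minus_le2 (q : C) (n : nat) : Cmod q < 1 -> Cmod (1 - Cpow q n)%C <= 2.
Proof.
move=> q1; apply: Rle_trans (Cmod_minus_le _ _) _; rewrite Cmod_1 Cmod_pow.
have : Cmod q ^ n <= 1; last by lra.
by rewrite -(pow1 n); apply: pow_incr; split; [exact: Cmod_ge_0|lra].
Qed.

Let termN_le (q : C) (N k : nat) : Cmod q < 1 ->
  Cmod (elog_term z q k * (1 - Cpow q (k.+1 * N)))%C <= 2 * (Cmod q ^ k.+1 * / (1 - Cmod q)).
Proof.
move=> q1; rewrite Cmod_mult Rmult_comm; apply: Rmult_le_compat; try exact: Cmod_ge_0.
  exact: one_minus_le2.
exact: elog_term_le.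
Qed.

Let geomM (r : R) : 0 <= r < 1 -> is_series (fun k => 2 * (r ^ k.+1 * / (1 - r))) (M r).
Proof. by move=> hr; apply: (is_series_scal_l 2); exact: geomS. Qed.

Let is_cser_elogN (q : C) (N : nat) : Cmod q < 1 ->
  is_cser (fun k => elog_term z q k * (1 - Cpow q (k.+1 * N)))%C (elogN q N).
Proof.
move=> q1; apply: is_cser_le (fun k => termN_le N k q1) _.
by eexists; apply: geomM; split=> //; exact: Cmod_ge_0.
Qed.

Let elogN_bound (q : C) (N : nat) : Cmod q < 1 -> Cmod (elogN q N) <= M (Cmod q).
Proof.
move=> q1; exact: (Cmod_cser_le (@is_cser_elogN _ N q1) (fun k => termN_le N k q1)
  (geomM (conj (Cmod_ge_0 q) q1))).
Qed.

Let elog_bound (q : C) : Cmod q < 1 -> Cmod (elog z q) <= M (Cmod q).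
Proof.
move=> q1; have q0 := Cmod_ge_0 q.
apply: Rle_trans (Cmod_cser_le (is_cser_elog q1) (fun k => elog_term_le k q1) (geomS (conj q0 q1))) _.
rewrite /M; have : 0 <= Cmod q * / (1 - Cmod q) * / (1 - Cmod q); last by lra.
have i0 : 0 < / (1 - Cmod q) by apply: Rinv_0_lt_compat; lra.
by apply: Rmult_le_pos; [apply: Rmult_le_pos|]; lra.
Qed.

Let elogN_diff (q : C) (N : nat) : Cmod q < 1 ->
  Cmod (elogN q N - elog z q)%C <= Cmod q ^ N * M (Cmod q).
Proof.
move=> q1; have q0 := Cmod_ge_0 q.
have h := is_cser_minus (@is_cser_elogN _ N q1) (is_cser_elog q1).
apply: (Cmod_cser_le h _ (is_series_scal_l (Cmod q ^ N) _ _ (geomM (conj q0 q1)))) => k.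
have -> : (elog_term z q k * (1 - Cpow q (k.+1 * N)) - elog_term z q k)%C =
  (- (elog_term z q k * Cpow q (k.+1 * N)))%C by ring.
rewrite Cmod_opp Cmod_mult Cmod_pow /scal /= /mult /= Rmult_comm.
have t := elog_term_le k q1; have t0 := Cmod_ge_0 (elog_term z q k).
apply: Rmult_le_compat => //; first exact: pow_le.
  rewrite mulSn pow_add -[X in _ <= X]Rmult_1_r; apply: Rmult_le_compat_l; first exact: pow_le.
  by rewrite -(pow1 (k * N)); apply: pow_incr; lra.
by move: t; rewrite -tech_pow_Rmult; lra.
Qed.

Let elogN_S (q : C) (N : nat) : Cmod q < 1 ->
  elogN q N.+1 = (elogN q N + log1m (z * Cpow q N.+1))%C.
Proof.
move=> q1; have q0 := Cmod_ge_0 q.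
have y1 := Cmod_mult_pow_lt1 N z1 q1.
apply: CSeries_unique.
apply: is_cser_ext (is_cser_plus (@is_cser_elogN _ N q1) (is_cser_log1m y1)) => k.
have d0 := @one_minus_pow_neq0 _ k q1.
have k0 : RtoC (INR k.+1) <> 0%C by apply: RtoC_neq0; have := INR_S_pos k; lra.
rewrite Cpow_mult_l -(Cpow_mult_r q N.+1 k.+1).
have -> : (N.+1 * k.+1)%coq_nat = (k.+1 + k.+1 * N)%N.
  by change ((N.+1 * k.+1)%N = (k.+1 + k.+1 * N)%N); rewrite mulnC mulnS.
have -> : (k.+1 * N.+1)%N = (k.+1 + k.+1 * N)%N by rewrite mulnS.
rewrite !Cpow_add_r /elog_term.
move: d0; set a := Cpow q k.+1; set c := Cpow z k.+1; set e := Cpow q (k.+1 * N) => d0.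
by unplusC; field.
Qed.

Lemma euler_prod_elogN (xi : C) (w : C) (N : nat) :
  Cmod (xi * Cexp (- w))%C < 1 -> euler_prod z xi N w = Cexp (elogN (xi * Cexp (- w))%C N).
Proof.
move=> q1; elim: N => [|N IH].
  rewrite /= -Cexp_0; congr Cexp; symmetry; apply: CSeries_unique.
  apply: (is_cser_ext (u := fun k => RtoC 0 * elog_term z (xi * Cexp (- w)) k)%C).
    by move=> k; rewrite muln0 /=; ring.
  have -> : RtoC 0 = (RtoC 0 * elog z (xi * Cexp (- w)))%C by ring.
  have := @is_cser_Cmult (RtoC 0) _ _ (is_cser_elog q1).
  by rewrite Cmult_0_l.
rewrite euler_prodS IH elogN_S // Cexp_plus Cexp_log1m //.
apply: Rle_lt_trans (Re_le_Cmod _) _.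
exact: Cmod_mult_pow_lt1.
Qed.

(** The bound involves [q] only through its modulus, so it is uniform on the circle, and the limit N
    -> infinity may be taken under the integral. *)
Lemma euler_prod_diff (xi : C) (w : C) (N : nat) : Cmod (xi * Cexp (- w))%C < 1 ->
  Cmod (euler_prod z xi N w - Cexp (elog z (xi * Cexp (- w))))%C
   <= Cmod (xi * Cexp (- w)) ^ N * (M (Cmod (xi * Cexp (- w))) * exp (M (Cmod (xi * Cexp (- w))))).
Proof.
move=> q1; rewrite euler_prod_elogN //.
apply: Rle_trans (Cexp_lipschitz (M := M (Cmod (xi * Cexp (- w)))) _ _) _.
- exact: Rle_trans (Re_le_Cmod _) (elogN_bound N q1).
- exact: Rle_trans (Re_le_Cmod _) (elog_bound q1).
rewrite -Rmult_assoc; apply: Rmult_le_compat_r; first by left; exact: exp_pos.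
exact: elogN_diff.
Qed.

(* Cauchy's formula on the circle of radius [exp (- x)], with the base point rotated to [xi]. *)
Lemma coef_integral (xi : C) (x : R) (n : nat) : Cmod xi = 1 -> 0 < x ->
  is_RIntC (fun v => Cexp (elog z (xi * Cexp (- ((x, v) : C)))) * Cexp (RtoC (INR n) * ((x, v) : C)))%C
    (- PI) PI (RtoC (2 * PI) * (Cpow xi n * Q n z))%C.
Proof.
move=> xi1 x0.
have qm v : Cmod (xi * Cexp (- ((x, v) : C)))%C = exp (- x).
  by rewrite Cmod_mult xi1 Cmod_Cexp Rmult_1_l.
have r1 : 0 < exp (- x) < 1 by split; [exact: exp_pos|rewrite -exp_0; apply: exp_increasing; lra].
set l := (_ * _)%C.
pose f (N : nat) v := (euler_prod z xi (n + N) ((x, v) : C) * Cexp (RtoC (INR n) * ((x, v) : C)))%C.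
pose g v := (Cexp (elog z (xi * Cexp (- ((x, v) : C)))) * Cexp (RtoC (INR n) * ((x, v) : C)))%C.
have fl N : is_RIntC (f N) (- PI) PI l.
  by apply: coef_euler_prod => //; lia.
have fg : filterlim f eventually (locally (T := fct_UniformSpace R C_R_NormedModule) g).
  move=> P [e he].
  pose B := M (exp (- x)) * exp (M (exp (- x))) * exp (INR n * x).
  have lim : is_lim_seq (fun N => B * exp (- x) ^ N) 0.
    have := is_lim_seq_scal_l _ B _ (is_lim_seq_geom (exp (- x)) _).
    by rewrite /= Rmult_0_r; apply; rewrite Rabs_pos_eq; lra.
  have /is_lim_seq_spec/(_ e) [N0 hN0] := lim; exists N0 => N hN; apply: he => v.
  apply: C_NormedModule_mixin_compat1.
  have -> : minus (f N v) (g v) = ((euler_prod z xi (n + N) ((x, v) : C) -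
     Cexp (elog z (xi * Cexp (- ((x, v) : C))))) * Cexp (RtoC (INR n) * ((x, v) : C)))%C.
    by rewrite /f /g; ringC.
  rewrite Cmod_mult Cmod_Cexp ReImE /= Rmult_0_l Rminus_0_r.
  have q1 : Cmod (xi * Cexp (- ((x, v) : C)))%C < 1 by rewrite qm; lra.
  have := euler_prod_diff (n + N) q1; rewrite qm => hd.
  have := hN0 N hN; rewrite Rminus_0_r => h3.
  apply: Rle_lt_trans (Rmult_le_compat_r (exp (INR n * x)) _ _ _ hd) _; first by left; exact: exp_pos.
  apply: Rle_lt_trans h3; apply: Rle_trans _ (Rle_abs _).
  rewrite /B pow_add.
  have hn : exp (- x) ^ n <= 1 by rewrite -(pow1 n); apply: pow_incr; lra.
  have M0 : 0 <= M (exp (- x)).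
    rewrite /M; have i0 : 0 < / (1 - exp (- x)) by apply: Rinv_0_lt_compat; lra.
    by apply: Rmult_le_pos; [lra|apply: Rmult_le_pos; [apply: Rmult_le_pos|]; lra].
  have e1 := exp_pos (M (exp (- x))); have e2 := exp_pos (INR n * x).
  have p1 : 0 <= exp (- x) ^ N by apply: pow_le; lra.
  have B0 : 0 <= M (exp (- x)) * exp (M (exp (- x))) * exp (INR n * x).
    by apply: Rmult_le_pos; [apply: Rmult_le_pos|]; lra.
  have : exp (- x) ^ n * (exp (- x) ^ N * (M (exp (- x)) * exp (M (exp (- x))) * exp (INR n * x)))
     <= 1 * (exp (- x) ^ N * (M (exp (- x)) * exp (M (exp (- x))) * exp (INR n * x))).
    by apply: Rmult_le_compat_r => //; apply: Rmult_le_pos.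
  lra.
have [If [h1 h2]] := @filterlim_RInt nat C_R_CompleteNormedModule f (- PI) PI eventually _ g (fun _ => l) fl fg.
have <- // : If = l.
apply: (filterlim_locally_unique (V := C_R_NormedModule) (F := eventually) (fun _ => l)) h1 _.
exact: filterlim_const.
Qed.

End EulerProductLimit.

(** * The kernel exp (- x s) / (1 - exp (- s)) *)

(** The kernel without its simple pole at 0; the value at the removable singularity would be 1/2 -
    x. *)
Definition psi (x : R) (s : C) : C := (Cexp (- (RtoC x * s)) / (1 - Cexp (- s)) - / s)%C.

Section PsiNearZero.

(** [phi1 s] is (e^s - 1)/s and [phi2 s] is (e^s - 1 - s)/s^2. As integrals they make sense at s = 0
    and inherit Lipschitz bounds from the exponential. *)
Let phi1 (s : C) : C := RIntC (fun t => Cexp (RtoC t * s)) 0 1.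
Let phi2 (s : C) : C := RIntC (fun t => RtoC (1 - t) * Cexp (RtoC t * s))%C 0 1.

Let cont1 (s : C) (t : R) : contC (fun t => Cexp (RtoC t * s)) t.
Proof.
apply: contC_Cexp; apply: contC_mult; last exact: contC_const.
apply: contC_RtoC; exact: continuous_id.
Qed.

Let cont2 (s : C) (t : R) : contC (fun t => RtoC (1 - t) * Cexp (RtoC t * s))%C t.
Proof.
apply: contC_mult; last exact: cont1.
apply: contC_RtoC; apply: (continuous_minus (V := R_NormedModule)); [exact: continuous_const|exact: continuous_id].
Qed.

Let phi1E (s : C) : (s * phi1 s = Cexp s - 1)%C.
Proof.
have h1 : is_RIntC (fun t => s * Cexp (RtoC t * s))%C 0 1 (s * phi1 s)%C.
  apply: is_RIntC_Cmult; apply: RIntC_correct; exact: cont1.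
have h2 := @is_RInt_derive C_R_CompleteNormedModule (fun t => Cexp (RtoC t * s))
  (fun t => s * Cexp (RtoC t * s))%C 0 1.
rewrite -(RIntC_unique h1); apply: RIntC_unique.
have -> : (Cexp s - 1)%C = minus (Cexp (RtoC 1 * s)) (Cexp (RtoC 0 * s)).
  by rewrite Cmult_1_l Cmult_0_l Cexp_0.
apply: h2 => t _; last by apply: contC_mult; [exact: contC_const|exact: cont1].
by apply: is_deriveC; rewrite /Re /Im /=; auto_derive => //; rewrite /Rminus; ring.
Qed.

Let phi2E (s : C) : (s * phi2 s = phi1 s - 1)%C.
Proof.
have h1 : is_RIntC (fun t => plus (- Cexp (RtoC t * s))%C (s * (RtoC (1 - t) * Cexp (RtoC t * s)))%C) 0 1
    (plus (- phi1 s)%C (s * phi2 s)%C).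
  apply: (@is_RInt_plus C_R_NormedModule).
    apply: (@is_RInt_opp C_R_NormedModule); apply: RIntC_correct; exact: cont1.
  apply: is_RIntC_Cmult; apply: RIntC_correct; exact: cont2.
have h2 := @is_RInt_derive C_R_CompleteNormedModule (fun t => RtoC (1 - t) * Cexp (RtoC t * s))%C
  (fun t => plus (- Cexp (RtoC t * s))%C (s * (RtoC (1 - t) * Cexp (RtoC t * s)))%C) 0 1.
have e : plus (- phi1 s)%C (s * phi2 s)%C = minus (RtoC (1 - 1) * Cexp (RtoC 1 * s))%C (RtoC (1 - 0) * Cexp (RtoC 0 * s))%C.
  rewrite -(RIntC_unique h1); apply: RIntC_unique; apply: h2 => t _.
    by unplusC; apply: is_deriveC; rewrite /Re /Im /=; auto_derive => //; rewrite /Rminus; ring.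
  apply: contC_plus; first by apply: contC_opp; exact: cont1.
  by apply: contC_mult; [exact: contC_const|exact: cont2].
move: e; unplusC; rewrite Cmult_1_l Cmult_0_l Cexp_0 Rminus_diag_eq // Rminus_0_r => e.
have -> : (s * phi2 s)%C = (- phi1 s + s * phi2 s + phi1 s)%C by ring.
rewrite e; ring.
Qed.

Let exp14 (z : C) (t : R) : 0 <= t <= 1 -> Cmod z <= / 4 -> Re (RtoC t * z)%C <= / 4.
Proof.
move=> ht hz; rewrite ReImE /= Rmult_0_l Rminus_0_r.
have := Re_le_Cmod z; have := Cmod_ge_0 z; nra.
Qed.

Let e3 : exp (/ 4) <= 3.
Proof. by apply: Rle_trans exp_le_3; apply: exp_le; lra. Qed.

Let lipt (a b : C) (t : R) : 0 <= t <= 1 -> Cmod a <= / 4 -> Cmod b <= / 4 ->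
  Cmod (Cexp (RtoC t * a) - Cexp (RtoC t * b))%C <= 3 * Cmod (a - b)%C.
Proof.
move=> ht ha hb; apply: Rle_trans (Cexp_lipschitz (exp14 ht ha) (exp14 ht hb)) _.
have -> : (RtoC t * a - RtoC t * b = RtoC t * (a - b))%C by ring.
rewrite Cmod_mult Cmod_pos; last by lra.
have c0 := Cmod_ge_0 (a - b)%C; have e0 := exp_pos (/ 4); have e3' := e3.
apply: Rle_trans (_ : 1 * Cmod (a - b)%C * 3 <= _); last by lra.
apply: Rmult_le_compat; try lra; first by apply: Rmult_le_pos; lra.
by apply: Rmult_le_compat_r; lra.
Qed.

Let bndt (a : C) (t : R) : 0 <= t <= 1 -> Cmod a <= / 4 -> Cmod (Cexp (RtoC t * a)) <= 3.
Proof.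
by move=> ht ha; rewrite Cmod_Cexp; apply: Rle_trans e3; apply: exp_le; exact: exp14.
Qed.

Let RInt01 (f : R -> C) (M : R) : (forall t, contC f t) ->
  (forall t, 0 <= t <= 1 -> Cmod (f t) <= M) -> Cmod (RIntC f 0 1) <= M.
Proof.
move=> cf h; have := Cmod_RIntC_le Rle_0_1 h (RIntC_correct cf).
by rewrite Rminus_0_r Rmult_1_l.
Qed.

Let RInt01_minus (f g : R -> C) : (forall t, contC f t) -> (forall t, contC g t) ->
  (RIntC f 0 1 - RIntC g 0 1)%C = RIntC (fun t => f t - g t)%C 0 1.
Proof.
move=> cf cg; symmetry; apply: RIntC_unique.
by apply: (@is_RInt_minus C_R_NormedModule); apply: RIntC_correct.
Qed.

Let phi1_lip (a b : C) : Cmod a <= / 4 -> Cmod b <= / 4 ->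
  Cmod (phi1 a - phi1 b)%C <= 3 * Cmod (a - b)%C.
Proof.
move=> ha hb; rewrite RInt01_minus; try exact: cont1.
apply: RInt01; first by move=> t; apply: contC_minus; exact: cont1.
by move=> t ht; exact: lipt.
Qed.

Let phi2_lip (a b : C) : Cmod a <= / 4 -> Cmod b <= / 4 ->
  Cmod (phi2 a - phi2 b)%C <= 3 * Cmod (a - b)%C.
Proof.
move=> ha hb; rewrite RInt01_minus; try exact: cont2.
apply: RInt01; first by move=> t; apply: contC_minus; exact: cont2.
move=> t ht.
have -> : (RtoC (1 - t) * Cexp (RtoC t * a) - RtoC (1 - t) * Cexp (RtoC t * b) =
  RtoC (1 - t) * (Cexp (RtoC t * a) - Cexp (RtoC t * b)))%C by ring.
rewrite Cmod_mult Cmod_pos; last by lra.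
have := lipt ht ha hb; have := Cmod_ge_0 (Cexp (RtoC t * a) - Cexp (RtoC t * b))%C.
move=> h0 h1; rewrite -[X in _ <= X]Rmult_1_l; apply: Rmult_le_compat; lra.
Qed.

Let phi1_le (a : C) : Cmod a <= / 4 -> Cmod (phi1 a) <= 3.
Proof. by move=> ha; apply: RInt01; [exact: cont1|move=> t ht; exact: bndt]. Qed.

Let phi2_le (a : C) : Cmod a <= / 4 -> Cmod (phi2 a) <= 3.
Proof.
move=> ha; apply: RInt01; [exact: cont2|move=> t ht].
rewrite Cmod_mult Cmod_pos; last by lra.
have := bndt ht ha; have := Cmod_ge_0 (Cexp (RtoC t * a)); nra.
Qed.

Let phi1_0 : phi1 0 = 1%C.
Proof.
have := phi2E 0; rewrite Cmult_0_l => e.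
have -> : (phi1 0 = phi1 0 - 1 + 1)%C by ring.
by rewrite -e Cplus_0_l.
Qed.

(** The radius 1/4 is dictated here: with Lipschitz constant 3 and [phi1 0] = 1, the modulus stays
    above 1 - 3/4. *)
Let phi1_ge (a : C) : Cmod a <= / 4 -> / 4 <= Cmod (phi1 a).
Proof.
move=> ha; have h0 : Cmod 0 <= / 4 by rewrite Cmod_0; lra.
have := phi1_lip h0 ha; rewrite phi1_0.
have -> : (0 - a = - a)%C by ring.
have := Cmod_triangle_inv 1 (phi1 a); rewrite Cmod_1 Cmod_opp; lra.
Qed.

Let phi2_0 : phi2 0 = RtoC (/ 2).
Proof.
apply: RIntC_unique.
apply: (is_RIntC_ext (f := fun t => RtoC (1 - t))).
  by move=> t; rewrite Cmult_0_r Cexp_0 Cmult_1_r.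
apply: (is_RInt_fct_extend_pair (U := R_NormedModule) (V := R_NormedModule)) => /=.
  have := @is_RInt_derive R_CompleteNormedModule (fun t => t - t * t / 2) (fun t => 1 - t) 0 1.
  have -> : minus (1 - 1 * 1 / 2) (0 - 0 * 0 / 2) = / 2 by rewrite /minus /plus /opp /=; field.
  apply=> t _; first by auto_derive => //; field.
  by apply: (continuous_minus (V := R_NormedModule)); [exact: continuous_const|exact: continuous_id].
have := @is_RInt_const R_NormedModule 0 1 0.
by rewrite /scal /= /mult /= Rmult_0_r.
Qed.

Variable x : R.
Hypothesis x01 : 0 <= x <= 1.

(** The numerator in psi x s = N s / phi1 s, obtained by dividing numerator and denominator of the
    combined fraction by s^2. *)
Let N (s : C) : C := (RtoC (1 - x) * phi1 (RtoC (1 - x) * s) - phi2 s)%C.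

Let scale (a : C) : Cmod a <= / 4 -> Cmod (RtoC (1 - x) * a)%C <= / 4.
Proof.
rewrite Cmod_mult Cmod_pos; last by lra.
have := Cmod_ge_0 a; nra.
Qed.

Let N_le (a : C) : Cmod a <= / 4 -> Cmod (N a) <= 6.
Proof.
move=> ha; apply: Rle_trans (Cmod_minus_le _ _) _.
rewrite Cmod_mult Cmod_pos; last by lra.
have := phi1_le (scale ha); have := phi2_le ha; have := Cmod_ge_0 (phi1 (RtoC (1 - x) * a)).
nra.
Qed.

Let N_lip (a b : C) : Cmod a <= / 4 -> Cmod b <= / 4 -> Cmod (N a - N b)%C <= 6 * Cmod (a - b)%C.
Proof.
move=> ha hb.
have -> : (N a - N b = RtoC (1 - x) * (phi1 (RtoC (1 - x) * a) - phi1 (RtoC (1 - x) * b)) -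
  (phi2 a - phi2 b))%C by rewrite /N; ring.
apply: Rle_trans (Cmod_minus_le _ _) _; have h2 := phi2_lip ha hb.
have h1 := phi1_lip (scale ha) (scale hb).
have e : (RtoC (1 - x) * a - RtoC (1 - x) * b = RtoC (1 - x) * (a - b))%C by ring.
rewrite e Cmod_mult Cmod_pos in h1; last by lra.
rewrite Cmod_mult Cmod_pos; last by lra.
have c0 := Cmod_ge_0 (a - b)%C.
have : (1 - x) * Cmod (phi1 (RtoC (1 - x) * a) - phi1 (RtoC (1 - x) * b))%C <=
  1 * (3 * (1 * Cmod (a - b)%C)); last by lra.
apply: Rmult_le_compat; try exact: Cmod_ge_0; try lra.
apply: Rle_trans h1 _; apply: Rmult_le_compat_l; first by lra.
by apply: Rmult_le_compat_r; lra.
Qed.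

Let psiE (s : C) : s <> 0%C -> Cmod s <= / 4 -> psi x s = (N s / phi1 s)%C.
Proof.
move=> s0 hs; have p0 : phi1 s <> 0%C by apply: Cmod_neq0; have := phi1_ge hs; lra.
have e1 := phi1E s; have e2 := phi2E s; have e4 := phi1E (RtoC (1 - x) * s)%C.
have d : (1 - Cexp (- s) = Cexp (- s) * (s * phi1 s))%C.
  by rewrite e1 Cexp_opp; field; exact: Cexp_neq0.
have n : Cexp (- (RtoC x * s)) = (Cexp (- s) * (1 + RtoC (1 - x) * s * phi1 (RtoC (1 - x) * s)))%C.
  have -> : (1 + RtoC (1 - x) * s * phi1 (RtoC (1 - x) * s) = Cexp (RtoC (1 - x) * s))%C.
    rewrite e4; ring.
  by rewrite -Cexp_plus; congr Cexp; rewrite RtoC_minus; ring.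
have q : (phi2 s = (phi1 s - 1) / s)%C by rewrite -e2; field.
rewrite /psi d n /N q; field; split=> //; split=> //; exact: Cexp_neq0.
Qed.

(** The constant is 6 * 4 + 6 * 3 * 4 * 4, from |N a - N b| <= 6 |a - b|, |N| <= 6, |phi1 a - phi1
    b| <= 3 |a - b| and |1/phi1| <= 4. *)
Let NP_lip (a b : C) : Cmod a <= / 4 -> Cmod b <= / 4 ->
  Cmod (N a / phi1 a - N b / phi1 b)%C <= 312 * Cmod (a - b)%C.
Proof.
move=> ha hb; have pa := phi1_ge ha; have pb := phi1_ge hb.
have pa0 : phi1 a <> 0%C by apply: Cmod_neq0; lra.
have pb0 : phi1 b <> 0%C by apply: Cmod_neq0; lra.
have -> : (N a / phi1 a - N b / phi1 b = (N a - N b) * / phi1 a +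
   N b * (phi1 b - phi1 a) * (/ phi1 a * / phi1 b))%C by field.
apply: Rle_trans (Cmod_triangle _ _) _.
have ia : Cmod (/ phi1 a) <= 4.
  rewrite Cmod_inv //; have -> : 4 = / / 4 by field.
  by apply: Rinv_le_contravar; lra.
have ib : Cmod (/ phi1 b) <= 4.
  rewrite Cmod_inv //; have -> : 4 = / / 4 by field.
  by apply: Rinv_le_contravar; lra.
have c0 := Cmod_ge_0 (a - b)%C.
have h1 := N_lip ha hb; have h2 := N_le hb; have h3 := phi1_lip hb ha.
rewrite (Cmod_minus_sym b a) in h3.
rewrite !Cmod_mult.
have : Cmod (N a - N b)%C * Cmod (/ phi1 a)%C <= 6 * Cmod (a - b)%C * 4.
  by apply: Rmult_le_compat; try exact: Cmod_ge_0.
have : Cmod (N b) * Cmod (phi1 b - phi1 a)%C * (Cmod (/ phi1 a)%C * Cmod (/ phi1 b)%C) <=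
   6 * (3 * Cmod (a - b)%C) * (4 * 4).
  apply: Rmult_le_compat; try (apply: Rmult_le_pos; exact: Cmod_ge_0).
    by apply: Rmult_le_compat; try exact: Cmod_ge_0.
  by apply: Rmult_le_compat; try exact: Cmod_ge_0.
lra.
Qed.

Lemma psi_near_lip (a b : C) : a <> 0%C -> b <> 0%C -> Cmod a <= / 4 -> Cmod b <= / 4 ->
  Cmod (psi x a - psi x b)%C <= 312 * Cmod (a - b)%C.
Proof. by move=> a0 b0 ha hb; rewrite !psiE //; exact: NP_lip. Qed.

Lemma psi_near_0 (a : C) : a <> 0%C -> Cmod a <= / 4 ->
  Cmod (psi x a - RtoC (/ 2 - x))%C <= 312 * Cmod a.
Proof.
move=> a0 ha; have h0 : Cmod 0 <= / 4 by rewrite Cmod_0; lra.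
have := NP_lip ha h0; rewrite -psiE //.
have -> : (a - 0 = a)%C by ring.
have -> // : (N 0 / phi1 0)%C = RtoC (/ 2 - x).
rewrite /N Cmult_0_r phi1_0 phi2_0.
have -> : / 2 - x = 1 - x - / 2 by field.
by rewrite (RtoC_minus (1 - x)); field.
Qed.

Lemma psi_near_le (a : C) : a <> 0%C -> Cmod a <= / 4 -> Cmod (psi x a) <= 79.
Proof.
move=> a0 ha; have := psi_near_0 a0 ha.
have := Cmod_triangle_inv (psi x a) (RtoC (/ 2 - x)); rewrite Cmod_R.
have : Rabs (/ 2 - x) <= 1 by apply: Rabs_le; lra.
lra.
Qed.

End PsiNearZero.

(** A Stolz angle at 0, in which the modulus and the real part are comparable. *)
Definition cone (U : R) (s : C) : Prop := 0 < Re s /\ Rabs (Im s) <= U * Re s.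

Lemma cone_Cmod (U : R) (s : C) : cone U s -> Cmod s <= (1 + U) * Re s.
Proof.
move=> [h1 h2]; apply: Rle_trans (Cmod_le_ReIm s) _.
rewrite (Rabs_pos_eq (Re s)); lra.
Qed.

Lemma cone_neq0 (U : R) (s : C) : cone U s -> s <> 0%C.
Proof. by move=> [h _]; exact: Re_pos_neq0. Qed.

Lemma cone_scal (U k : R) (s : C) : 0 < k -> cone U s -> cone U (RtoC k * s)%C.
Proof.
move=> k0 [h1 h2]; rewrite /cone !ReImE /= !Rmult_0_l Rminus_0_r Rplus_0_r; split; first by nra.
rewrite Rabs_mult (Rabs_pos_eq k); nra.
Qed.

Lemma exp_decay (x m : R) : 0 < x <= 1 -> 0 <= m -> exp (- (x * m)) <= 4 / (x * x) * / ((1 + m) * (1 + m)).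
Proof.
move=> hx m0; rewrite exp_Ropp.
have h : x / 2 * (1 + m) <= exp (x * m / 2).
  by apply: Rle_trans (exp_ineq1_le _); nra.
have e : exp (x * m) = exp (x * m / 2) * exp (x * m / 2) by rewrite -exp_plus; congr exp; field.
have -> : 4 / (x * x) * / ((1 + m) * (1 + m)) = / (x / 2 * (1 + m) * (x / 2 * (1 + m))).
  by field; split; lra.
have h0 : 0 < x / 2 * (1 + m) by apply: Rmult_lt_0_compat; lra.
apply: Rinv_le_contravar; first exact: Rmult_lt_0_compat.
by rewrite e; apply: Rmult_le_compat; lra.
Qed.

Lemma one_minus_Cexp_ge (rho : R) (s : C) : 0 < rho -> rho <= Re s ->
  1 - exp (- rho) <= Cmod (1 - Cexp (- s))%C.
Proof.
move=> r0 hs; have := Cmod_triangle_inv 1 (Cexp (- s)).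
rewrite Cmod_1 Cmod_Cexp Re_opp.
have : exp (- Re s) <= exp (- rho) by apply: exp_le; lra.
lra.
Qed.

Lemma exp_neg_lt1 (rho : R) : 0 < rho -> exp (- rho) < 1.
Proof. by move=> h; rewrite -exp_0; apply: exp_increasing; lra. Qed.

(** The two parts of [psi] are treated separately: the exponential one decays like e^(-x m), which
    [exp_decay] converts into (1 + m)^(-2), and 1/a - 1/b = (b - a)/(ab). *)
Lemma psi_far_lip (x rho : R) : 0 < x <= 1 -> 0 < rho -> exists D, 0 < D /\
  forall a b m, rho <= m -> m <= Re a -> m <= Re b ->
  Cmod (psi x a - psi x b)%C <= D * Cmod (a - b)%C * / ((1 + m) * (1 + m)).
Proof.
move=> hx r0; have d0 : 0 < 1 - exp (- rho) by have := exp_neg_lt1 r0; lra.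
set d := 1 - exp (- rho) in d0.
pose D1 := 3 * (4 / (x * x)) * / (d * d); pose D2 := (1 + rho) / rho * ((1 + rho) / rho).
have D10 : 0 < D1.
  apply: Rmult_lt_0_compat; last by apply: Rinv_0_lt_compat; nra.
  apply: Rmult_lt_0_compat; first by lra.
  by apply: Rdiv_lt_0_compat; nra.
have D20 : 0 < D2 by apply: Rmult_lt_0_compat; apply: Rdiv_lt_0_compat; lra.
exists (D1 + D2); split; first by lra.
move=> a b m rm ma mb.
have a0 : a <> 0%C by apply: Re_pos_neq0; lra.
have b0 : b <> 0%C by apply: Re_pos_neq0; lra.
have da : d <= Cmod (1 - Cexp (- a))%C by apply: one_minus_Cexp_ge; lra.
have db : d <= Cmod (1 - Cexp (- b))%C by apply: one_minus_Cexp_ge; lra.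
have na : (1 - Cexp (- a))%C <> 0%C by apply: Cmod_neq0; lra.
have nb : (1 - Cexp (- b))%C <> 0%C by apply: Cmod_neq0; lra.
set ea := Cexp (- (RtoC x * a)); set eb := Cexp (- (RtoC x * b)).
have -> : (psi x a - psi x b = ((ea - eb) * (1 - Cexp (- b)) + eb * (Cexp (- a) - Cexp (- b))) *
   (/ (1 - Cexp (- a)) * / (1 - Cexp (- b))) + (a - b) * (/ a * / b))%C.
  by rewrite /psi -/ea -/eb; field.
apply: Rle_trans (Cmod_triangle _ _) _.
have c0 := Cmod_ge_0 (a - b)%C.
have m1 : 0 < (1 + m) * (1 + m) by nra.
have im : 0 < / ((1 + m) * (1 + m)) by exact: Rinv_0_lt_compat.
have -> : (D1 + D2) * Cmod (a - b)%C * / ((1 + m) * (1 + m)) =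
  D1 * Cmod (a - b)%C * / ((1 + m) * (1 + m)) + D2 * Cmod (a - b)%C * / ((1 + m) * (1 + m)) by ring.
apply: Rplus_le_compat.
  have xm : exp (- (x * m)) <= 4 / (x * x) * / ((1 + m) * (1 + m)) by apply: exp_decay; lra.
  have exm := exp_pos (- (x * m)).
  have h1 : Cmod (ea - eb)%C <= Cmod (a - b)%C * exp (- (x * m)).
    apply: Rle_trans (Cexp_lipschitz (M := - (x * m)) _ _) _; try by rewrite !ReImE /=; nra.
    have -> : (- (RtoC x * a) - - (RtoC x * b) = RtoC x * (b - a))%C by ring.
    rewrite Cmod_mult Cmod_pos; last by lra.
    rewrite Cmod_minus_sym; apply: Rmult_le_compat_r; first by lra.
    rewrite -[X in _ <= X]Rmult_1_l; apply: Rmult_le_compat_r; lra.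
  have h2 : Cmod (1 - Cexp (- b))%C <= 2.
    apply: Rle_trans (Cmod_minus_le _ _) _; rewrite Cmod_1 Cmod_Cexp Re_opp.
    by have := @exp_neg_lt1 (Re b); lra.
  have h3 : Cmod eb <= exp (- (x * m)) by rewrite Cmod_Cexp !ReImE /=; apply: exp_le; nra.
  have h4 : Cmod (Cexp (- a) - Cexp (- b))%C <= Cmod (a - b)%C.
    apply: Rle_trans (Cexp_lipschitz (M := 0) _ _) _; try by rewrite !ReImE; lra.
    have -> : (- a - - b = - (a - b))%C by ring.
    by rewrite Cmod_opp exp_0; lra.
  rewrite !Cmod_mult.
  have i1 : Cmod (/ (1 - Cexp (- a)))%C <= / d by rewrite Cmod_inv //; exact: Rinv_le_contravar.
  have i2 : Cmod (/ (1 - Cexp (- b)))%C <= / d by rewrite Cmod_inv //; exact: Rinv_le_contravar.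
  have n1 : Cmod ((ea - eb) * (1 - Cexp (- b)) + eb * (Cexp (- a) - Cexp (- b)))%C <=
     3 * (Cmod (a - b)%C * exp (- (x * m))).
    apply: Rle_trans (Cmod_triangle _ _) _; rewrite !Cmod_mult.
    have : Cmod (ea - eb)%C * Cmod (1 - Cexp (- b))%C <= Cmod (a - b)%C * exp (- (x * m)) * 2.
      by apply: Rmult_le_compat; try exact: Cmod_ge_0.
    have : Cmod eb * Cmod (Cexp (- a) - Cexp (- b))%C <= exp (- (x * m)) * Cmod (a - b)%C.
      by apply: Rmult_le_compat; try exact: Cmod_ge_0.
    lra.
  apply: Rle_trans (_ : 3 * (Cmod (a - b)%C * exp (- (x * m))) * (/ d * / d) <= _).
    apply: Rmult_le_compat => //; try exact: Cmod_ge_0.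
      by apply: Rmult_le_pos; exact: Cmod_ge_0.
    by apply: Rmult_le_compat => //; exact: Cmod_ge_0.
  have -> : D1 * Cmod (a - b)%C * / ((1 + m) * (1 + m)) =
    3 * (Cmod (a - b)%C * (4 / (x * x) * / ((1 + m) * (1 + m)))) * (/ d * / d).
    by rewrite /D1; field; repeat split; lra.
  have id0 : 0 < / d by exact: Rinv_0_lt_compat.
  apply: Rmult_le_compat_r; first by nra.
  apply: Rmult_le_compat_l; first by lra.
  exact: Rmult_le_compat_l.
rewrite !Cmod_mult !Cmod_inv //.
have -> : D2 * Cmod (a - b)%C * / ((1 + m) * (1 + m)) = Cmod (a - b)%C * (D2 * / ((1 + m) * (1 + m))) by ring.
apply: Rmult_le_compat_l => //.
have ra := Re_le_Cmod a; have rb := Re_le_Cmod b.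
have iv (y : R) : m <= y -> / y <= (1 + rho) / rho * / (1 + m).
  move=> my; have -> : (1 + rho) / rho * / (1 + m) = / (rho * (1 + m) / (1 + rho)) by field; lra.
  apply: Rinv_le_contravar.
    by apply: Rdiv_lt_0_compat; [apply: Rmult_lt_0_compat|]; lra.
  apply/(Rmult_le_reg_r (1 + rho)); first by lra.
  rewrite /Rdiv Rmult_assoc Rinv_l; nra.
have ha := iv (Cmod a) (Rle_trans _ _ _ ma ra); have hb := iv (Cmod b) (Rle_trans _ _ _ mb rb).
have p : / Cmod a * / Cmod b <= (1 + rho) / rho * / (1 + m) * ((1 + rho) / rho * / (1 + m)).
  by apply: Rmult_le_compat => //; left; apply: Rinv_0_lt_compat; lra.
apply: Rle_trans p _; right; rewrite /D2; field; lra.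
Qed.

Lemma psi_decay (x U : R) : 0 < x <= 1 -> 0 <= U -> exists D, 0 < D /\
  forall a, cone U a -> Cmod (psi x a) <= D * / (1 + Re a).
Proof.
(* In the cone, |a| > 1/4 forces Re a >= rho, so the estimate near 0 and the estimate with
   denominators bounded below cover everything. The 158 below is twice 79, since 1/(1 + Re a) >= 1/2
   when |a| <= 1/4. *)
move=> hx U0; pose rho := / (4 * (1 + U)).
have r0 : 0 < rho by apply: Rinv_0_lt_compat; lra.
have d0 : 0 < 1 - exp (- rho) by have := exp_neg_lt1 r0; lra.
set d := 1 - exp (- rho) in d0.
pose D2 := 4 / (x * x) * / d + (1 + rho) / rho.
have h1 : 0 < 4 / (x * x) by apply: Rdiv_lt_0_compat; nra.
have h2 : 0 < / d by exact: Rinv_0_lt_compat.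
have h3 : 0 < (1 + rho) / rho by apply: Rdiv_lt_0_compat; lra.
have h4 : 0 < 4 / (x * x) * / d by exact: Rmult_lt_0_compat.
exists (158 + D2); split; first by rewrite /D2; lra.
move=> a ca; have [ra _] := ca; have na := cone_neq0 ca.
have ia : 0 < / (1 + Re a) by apply: Rinv_0_lt_compat; lra.
case: (Rle_dec (Cmod a) (/ 4)) => ha.
  have h5 : Cmod (psi x a) <= 79 by apply: psi_near_le => //; lra.
  have : Re a <= / 4 by apply: Rle_trans (Re_le_Cmod a) ha.
  move=> ra4; apply: Rle_trans h5 _.
  have : / 2 <= / (1 + Re a) by apply: Rinv_le_contravar; lra.
  rewrite /D2; nra.
have ra4 : rho <= Re a.
  have := cone_Cmod ca => h; rewrite /rho; apply: (Rmult_le_reg_l (4 * (1 + U))); first by lra.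
  rewrite Rinv_r; lra.
have da : d <= Cmod (1 - Cexp (- a))%C by exact: one_minus_Cexp_ge.
have nd : (1 - Cexp (- a))%C <> 0%C by apply: Cmod_neq0; lra.
apply: Rle_trans (Cmod_minus_le _ _) _.
rewrite Cmod_div // Cmod_inv // Cmod_Cexp !ReImE /= Rmult_0_l Rminus_0_r.
have e1 : exp (- (x * Re a)) <= 4 / (x * x) * / (1 + Re a).
  apply: Rle_trans (exp_decay hx (Rlt_le _ _ ra)) _.
  apply: Rmult_le_compat_l; first by lra.
  by apply: Rinv_le_contravar; nra.
have e2 : exp (- (x * Re a)) / Cmod (1 - Cexp (- a))%C <= 4 / (x * x) * / (1 + Re a) * / d.
  apply: Rmult_le_compat => //; first by left; exact: exp_pos.
    by left; apply: Rinv_0_lt_compat; lra.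
  exact: Rinv_le_contravar.
have e3 : / Cmod a <= (1 + rho) / rho * / (1 + Re a).
  have -> : (1 + rho) / rho * / (1 + Re a) = / (rho * (1 + Re a) / (1 + rho)) by field; lra.
  apply: Rinv_le_contravar.
    by apply: Rdiv_lt_0_compat; [apply: Rmult_lt_0_compat|]; lra.
  apply: Rle_trans (Re_le_Cmod a); apply/(Rmult_le_reg_r (1 + rho)); first by lra.
  rewrite /Rdiv Rmult_assoc Rinv_l; nra.
rewrite /D2; lra.
Qed.

Lemma psi_at_0 (x U : R) : 0 < x <= 1 -> 0 <= U -> exists D, 0 < D /\
  forall a, cone U a -> Cmod (psi x a - RtoC (/ 2 - x))%C <= D * Cmod a.
Proof.
move=> hx U0; have [D [D0 hD]] := psi_decay hx U0.
exists (312 + 4 * (D + 1)); split; first by lra.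
move=> a ca; have [ra _] := ca; have na := cone_neq0 ca; have c0 := Cmod_ge_0 a.
case: (Rle_dec (Cmod a) (/ 4)) => ha.
  by apply: Rle_trans (psi_near_0 _ na ha) _; [lra|nra].
apply: Rle_trans (Cmod_minus_le _ _) _; rewrite Cmod_R.
have : Rabs (/ 2 - x) <= 1 by apply: Rabs_le; lra.
have : Cmod (psi x a) <= D.
  apply: Rle_trans (hD a ca) _; rewrite -[X in _ <= X]Rmult_1_r.
  apply: Rmult_le_compat_l; first by lra.
  by rewrite -[X in _ <= X]Rinv_1; apply: Rinv_le_contravar; lra.
nra.
Qed.

(** A Lipschitz bound valid up to 0 and decaying quadratically at infinity. This is what makes the
    differences of psi (k s) and psi ((k+1) s) summable over k. *)
Lemma psi_lip (x U : R) : 0 < x <= 1 -> 0 <= U -> exists D, 0 < D /\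
  forall a b m, cone U a -> cone U b -> 0 <= m -> m <= Re a -> m <= Re b -> (m = Re a \/ m = Re b) ->
  Cmod (psi x a - psi x b)%C <= D * Cmod (a - b)%C * / ((1 + m) * (1 + m)).
Proof.
move=> hx U0; have [D [D0 hD]] := psi_decay hx U0.
(* If m < rho, the point with real part m has modulus at most 1/8. Then either the other one lies
   within 1/4 of the origin, or the two are at least 1/8 apart and boundedness of [psi] suffices. *)
pose rho := / (8 * (1 + U)).
have r0 : 0 < rho by apply: Rinv_0_lt_compat; lra.
have r1 : rho <= 1 by rewrite -Rinv_1; apply: Rinv_le_contravar; lra.
have [E [E0 hE]] := psi_far_lip hx r0.
exists (E + 4 * (312 + 16 * D)); split; first by lra.
move=> a b m ca cb m0 ma mb mm.
have c0 := Cmod_ge_0 (a - b)%C.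
have im : 0 < / ((1 + m) * (1 + m)) by apply: Rinv_0_lt_compat; nra.
case: (Rle_dec rho m) => hm.
  apply: Rle_trans (hE a b m hm ma mb) _; apply: Rmult_le_compat_r; first by lra.
  by apply: Rmult_le_compat_r; lra.
have i4 : / 4 <= / ((1 + m) * (1 + m)) by apply: Rinv_le_contravar; nra.
have suff1 : Cmod (psi x a - psi x b)%C <= (312 + 16 * D) * Cmod (a - b)%C.
  have bnd (s : C) : cone U s -> Cmod (psi x s) <= D.
    move=> cs; apply: Rle_trans (hD s cs) _; rewrite -[X in _ <= X]Rmult_1_r.
    apply: Rmult_le_compat_l; first by lra.
    by rewrite -[X in _ <= X]Rinv_1; case: cs => rs _; apply: Rinv_le_contravar; lra.
  have small (s : C) : cone U s -> m = Re s -> Cmod s <= / 8.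
    move=> cs es; apply: Rle_trans (cone_Cmod cs) _; rewrite -es.
    have : (1 + U) * m <= (1 + U) * rho by apply: Rmult_le_compat_l; lra.
    have -> : (1 + U) * rho = / 8 by rewrite /rho; field; lra.
    by [].
  have far : / 8 <= Cmod (a - b)%C -> Cmod (psi x a - psi x b)%C <= (312 + 16 * D) * Cmod (a - b)%C.
    move=> h; apply: Rle_trans (Cmod_minus_le _ _) _.
    have := bnd a ca; have := bnd b cb; nra.
  have near : Cmod a <= / 4 -> Cmod b <= / 4 -> Cmod (psi x a - psi x b)%C <= (312 + 16 * D) * Cmod (a - b)%C.
    move=> ha hb; apply: Rle_trans (psi_near_lip _ (cone_neq0 ca) (cone_neq0 cb) ha hb) _; first by lra.
    by apply: Rmult_le_compat_r; lra.
  case: mm => em.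
    have ha := small a ca em.
    case: (Rle_dec (Cmod b) (/ 4)) => hb; first by apply: near => //; lra.
    by apply: far; have := Cmod_triangle_inv b a; rewrite Cmod_minus_sym; lra.
  have hb := small b cb em.
  case: (Rle_dec (Cmod a) (/ 4)) => ha; first by apply: near => //; lra.
  by apply: far; have := Cmod_triangle_inv a b; lra.
apply: Rle_trans suff1 _.
have h : (312 + 16 * D) * Cmod (a - b)%C <= 4 * (312 + 16 * D) * Cmod (a - b)%C * / ((1 + m) * (1 + m)).
  have : 0 <= (312 + 16 * D) * Cmod (a - b)%C by apply: Rmult_le_pos; lra.
  nra.
apply: Rle_trans h _; apply: Rmult_le_compat_r; first by lra.
by apply: Rmult_le_compat_r; lra.
Qed.

(** * Polar parts at the points of the unit circle *)

(** The approach to 0 is not confined to a cone: on an arc, [w] may have an imaginary part much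
    larger than its real part. *)
Definition near0 (P : C -> Prop) : Prop :=
  exists d : posreal, forall w : C, 0 < Re w < d -> Rabs (Im w) < d -> P w.

Global Instance near0_filter : Filter near0.
Proof.
constructor.
- by exists (mkposreal 1 Rlt_0_1).
- move=> P Q [d1 h1] [d2 h2].
  have m0 : 0 < Rmin d1 d2 by apply: Rmin_glb_lt; exact: cond_pos.
  exists (mkposreal _ m0) => w /= hr hi.
  by have := Rmin_l d1 d2; have := Rmin_r d1 d2; split; [apply: h1|apply: h2]; lra.
- by move=> P Q PQ [d h]; exists d => w hr hi; apply: PQ; exact: h.
Qed.

Lemma near0_Cmod (e : R) : 0 < e -> near0 (fun w => Cmod w < e).
Proof.
move=> e0; exists (mkposreal (e / 2) ltac:(lra)) => w /= hr hi.
apply: Rle_lt_trans (Cmod_le_ReIm w) _; rewrite Rabs_pos_eq; lra.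
Qed.

Lemma near0_Re (P : C -> Prop) : (forall w, 0 < Re w -> P w) -> near0 P.
Proof. by move=> h; exists (mkposreal 1 Rlt_0_1) => w [hr _] _; exact: h. Qed.

Lemma Cmod_Cexp_neg (xi w : C) : Cmod xi = 1 -> Cmod (xi * Cexp (- w))%C = exp (- Re w).
Proof. by move=> h; rewrite Cmod_mult h Cmod_Cexp Rmult_1_l Re_opp. Qed.

(* The terms of [elog z (xi e^(-w))] that are singular at [w = 0]: their polar parts sum up to
   [CSeries (resonant z xi) / w]. *)
Definition resonant (z xi : C) (j : nat) : C :=
  if Ceq_dec (Cpow xi j.+1) 1 then (Cpow z j.+1 / RtoC (INR j.+1 * INR j.+1))%C else 0%C.

Lemma INR_S_neq0 (j : nat) : RtoC (INR j.+1) <> 0%C.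
Proof. by apply: RtoC_neq0; have := INR_S_pos j; lra. Qed.

Lemma Cmod_pow_le1 (z : C) (n : nat) : Cmod z <= 1 -> Cmod (Cpow z n) <= 1.
Proof. by move=> h; rewrite Cmod_pow -(pow1 n); apply: pow_incr; split; [exact: Cmod_ge_0|]. Qed.

Lemma Cmod_isq_le (z : C) (j : nat) : Cmod z <= 1 ->
  Cmod (Cpow z j.+1 / RtoC (INR j.+1 * INR j.+1))%C <= isq j.
Proof.
move=> z1; have j0 := INR_S_pos j; have j2 : 0 < INR j.+1 * INR j.+1 by nra.
rewrite Cmod_div; last by apply: RtoC_neq0; lra.
rewrite Cmod_pos; last by lra.
rewrite /isq -[X in _ <= X]Rmult_1_l; apply: Rmult_le_compat_r; last exact: Cmod_pow_le1.
by left; apply: Rinv_0_lt_compat.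
Qed.

Lemma resonant_le (z xi : C) (j : nat) : Cmod z <= 1 -> Cmod (resonant z xi j) <= isq j.
Proof.
move=> z1; rewrite /resonant; case: Ceq_dec => ?; first exact: Cmod_isq_le.
by rewrite Cmod_0; left; exact: isq_pos.
Qed.

Lemma is_cser_resonant (z xi : C) : Cmod z <= 1 -> is_cser (resonant z xi) (CSeries (resonant z xi)).
Proof. by move=> z1; apply: is_cser_le (fun j => resonant_le xi j z1) ex_series_isq. Qed.

Lemma geom_ratio_le (y : R) : 0 < y -> exp (- y) / (1 - exp (- y)) <= / y.
Proof.
move=> y0; have e1 : exp (- y) < 1 by exact: exp_neg_lt1.
have := exp_ineq1_le y => h; have e0 := exp_pos y.
rewrite exp_Ropp in e1 *.
have -> : / exp y / (1 - / exp y) = / (exp y - 1) by field; lra.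
apply: Rinv_le_contravar; lra.
Qed.

Lemma elog_term_mod_le (z q : C) (j : nat) : Cmod z <= 1 -> Cmod q < 1 ->
  Cmod (elog_term z q j) <= / INR j.+1 * (Cmod q ^ j.+1 / (1 - Cmod q ^ j.+1)).
Proof.
move=> z1 q1; have q0 := Cmod_ge_0 q.
rewrite /elog_term Cmod_mult; apply: Rmult_le_compat; try exact: Cmod_ge_0.
  exact: Cmod_coef_le.
have r1 : Cmod q ^ j.+1 < 1.
  rewrite -tech_pow_Rmult; have : Cmod q ^ j <= 1 by rewrite -(pow1 j); apply: pow_incr; lra.
  have h0 : 0 <= Cmod q ^ j by exact: pow_le.
  nra.
rewrite Cmod_div; last exact: one_minus_pow_neq0.
rewrite Cmod_pow; apply: Rmult_le_compat_l; first exact: pow_le.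
apply: Rinv_le_contravar; first by lra.
by have := Cmod_triangle_inv 1 (Cpow q j.+1); rewrite Cmod_1 Cmod_pow.
Qed.

Lemma exp_pow (y : R) (n : nat) : exp y ^ n = exp (INR n * y).
Proof.
elim: n => [|n IH]; first by change (INR 0) with 0; rewrite Rmult_0_l exp_0.
by rewrite -tech_pow_Rmult IH -exp_plus S_INR; congr exp; ring.
Qed.

(** With r = e^(-(j+1) Re w), the denominator is at least 1 - r and r/(1 - r) <= 1/((j+1) Re w).
    This majorant depends neither on [xi] nor on the direction of [w]. *)
Lemma elog_term_scaled_le (z xi w : C) (j : nat) : Cmod z <= 1 -> Cmod xi = 1 -> 0 < Re w ->
  Re w * Cmod (elog_term z (xi * Cexp (- w)) j) <= isq j.
Proof.
move=> z1 xi1 w0; have j0 := INR_S_pos j.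
have qm := Cmod_Cexp_neg w xi1.
have q1 : Cmod (xi * Cexp (- w))%C < 1 by rewrite qm; exact: exp_neg_lt1.
apply: Rle_trans (Rmult_le_compat_l _ _ _ (Rlt_le _ _ w0) (elog_term_mod_le j z1 q1)) _.
rewrite qm exp_pow Ropp_mult_distr_r_reverse.
have y0 : 0 < INR j.+1 * Re w by exact: Rmult_lt_0_compat.
have := geom_ratio_le y0 => h.
apply: Rle_trans (_ : Re w * (/ INR j.+1 * / (INR j.+1 * Re w)) <= _).
  apply: Rmult_le_compat_l; first by lra.
  apply: Rmult_le_compat_l => //; left; exact: Rinv_0_lt_compat.
by right; rewrite /isq; field; split; lra.
Qed.

Lemma Cpow_qE (xi w : C) (j : nat) :
  Cpow (xi * Cexp (- w)) j = (Cpow xi j * Cexp (- (RtoC (INR j) * w)))%C.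
Proof. by rewrite Cpow_mult_l Cexp_pow; congr Cmult; congr Cexp; ring. Qed.

(** The factor [Re w], rather than [w], is what gives domination in all directions. Termwise, a
    resonant term differs from its polar part by a bounded quantity and a non-resonant term is
    itself bounded, so both die after multiplication by [Re w]. *)
Lemma local_elog (z xi : C) (e : R) : Cmod z <= 1 -> Cmod xi = 1 -> 0 < e ->
  near0 (fun w => Cmod (RtoC (Re w) * elog z (xi * Cexp (- w)) -
                         RtoC (Re w) / w * CSeries (resonant z xi))%C <= e).
Proof.
move=> z1 xi1 e0.
pose a (w : C) j := (RtoC (Re w) * elog_term z (xi * Cexp (- w)) j - RtoC (Re w) / w * resonant z xi j)%C.
have hs (w : C) : 0 < Re w -> CSeries (a w) = (RtoC (Re w) * elog z (xi * Cexp (- w)) -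
                         RtoC (Re w) / w * CSeries (resonant z xi))%C.
  move=> w0; have q1 : Cmod (xi * Cexp (- w))%C < 1 by rewrite Cmod_Cexp_neg //; exact: exp_neg_lt1.
  apply: CSeries_unique; apply: is_cser_minus; apply: is_cser_Cmult; first exact: is_cser_elog.
  exact: is_cser_resonant.
have xw (w : C) : 0 < Re w -> Cmod (RtoC (Re w) / w)%C <= 1.
  move=> w0; have wn : w <> 0%C by exact: Re_pos_neq0.
  have cw : 0 < Cmod w by apply/Cmod_gt_0.
  rewrite Cmod_div // Cmod_pos; last by lra.
  apply: (Rmult_le_reg_r (Cmod w)) => //; rewrite /Rdiv Rmult_assoc Rinv_l; last by lra.
  by have := Re_le_Cmod w; lra.
have hM : near0 (fun w => forall j, Cmod (a w j) <= 2 * isq j).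
  apply: near0_Re => w w0 j; apply: Rle_trans (Cmod_minus_le _ _) _.
  rewrite 2!Cmod_mult (Cmod_pos (Rlt_le _ _ w0)).
  have := elog_term_scaled_le j z1 xi1 w0.
  have : Cmod (RtoC (Re w) / w)%C * Cmod (resonant z xi j) <= 1 * isq j.
    by apply: Rmult_le_compat; try exact: Cmod_ge_0; [exact: xw|exact: resonant_le].
  lra.
have hp j d : 0 < d -> near0 (fun w => Cmod (a w j) <= d).
  move=> d0; have j0 := INR_S_pos j; have jn := @INR_S_neq0 j.
  rewrite /a /resonant; case: Ceq_dec => hxi.
    (* The resonant term differs from its polar part by a value of the bounded function [psi]. *)
    have [k1 hk] : near0 (fun w => Cmod w < / (4 * INR j.+1) /\ Cmod w < d / 79).
      apply: filter_and; apply: near0_Cmod; last by lra.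
      by apply: Rinv_0_lt_compat; lra.
    exists k1 => w hr hi; have [h1 h2] := hk w hr hi; clear hk.
    have wn : w <> 0%C by apply: Re_pos_neq0; lra.
    set s := (RtoC (INR j.+1) * w)%C.
    have sn : s <> 0%C by exact: Cmult_neq0.
    have s4 : Cmod s <= / 4.
      rewrite /s Cmod_mult Cmod_pos; last by lra.
      have : INR j.+1 * Cmod w <= INR j.+1 * / (4 * INR j.+1) by apply: Rmult_le_compat_l; lra.
      have -> : INR j.+1 * / (4 * INR j.+1) = / 4 by field; lra.
      by [].
    have nd : (1 - Cexp (- s))%C <> 0%C.
      apply: Cmod_neq0; have := @one_minus_Cexp_ge (Re s) s.
      have rs : 0 < Re s by rewrite /s ReImE /= Rmult_0_l Rminus_0_r; apply: Rmult_lt_0_compat; lra.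
      by move=> /(_ rs (Rle_refl _)); have := exp_neg_lt1 rs; lra.
    have -> : (RtoC (Re w) * elog_term z (xi * Cexp (- w)) j -
       RtoC (Re w) / w * (Cpow z j.+1 / RtoC (INR j.+1 * INR j.+1)) =
       RtoC (Re w) * (Cpow z j.+1 / RtoC (INR j.+1) * psi 1 s))%C.
      rewrite /elog_term Cpow_qE hxi Cmult_1_l -/s /psi Cmult_1_l RtoC_mult.
      rewrite /s in sn nd *; field; repeat split => //.
    rewrite Cmod_mult Cmod_pos; last by lra.
    have c1 := Cmod_coef_le j z1; have c2 := inv_INR_S_le1 j.
    have p1 := @psi_near_le 1 _ s sn s4.
    have wr := Re_le_Cmod w.
    rewrite Cmod_mult.
    have m1 : Cmod (Cpow z j.+1 / RtoC (INR j.+1))%C * Cmod (psi 1 s) <= 1 * 79.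
      by apply: Rmult_le_compat; try exact: Cmod_ge_0; [lra|apply: p1; lra].
    have : Re w * (Cmod (Cpow z j.+1 / RtoC (INR j.+1))%C * Cmod (psi 1 s)) <= d / 79 * (1 * 79).
      apply: Rmult_le_compat => //; try lra; apply: Rmult_le_pos; exact: Cmod_ge_0.
    lra.
  (* Non-resonant term: for small [w] its denominator stays above c/2. *)
  set c := Cmod (1 - Cpow xi j.+1)%C.
  have c0 : 0 < c.
    apply/Cmod_gt_0 => e1; apply: hxi.
    have -> : (Cpow xi j.+1 = 1 - (1 - Cpow xi j.+1))%C by ring.
    by rewrite e1; ring.
  have [k1 hk] : near0 (fun w => (Cmod w < c / (2 * INR j.+1)) /\ Cmod w < d * c / 2).
    apply: filter_and; apply: near0_Cmod; first by apply: Rdiv_lt_0_compat; lra.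
    by apply: Rdiv_lt_0_compat; nra.
  exists k1 => w hr hi; have [h1 h2] := hk w hr hi; clear hk.
  rewrite Cmult_0_r /Cminus Copp_0 Cplus_0_r Cmod_mult Cmod_pos; last by lra.
  have qm := Cmod_Cexp_neg w xi1.
  have q1 : Cmod (xi * Cexp (- w))%C < 1 by rewrite qm; apply: exp_neg_lt1; lra.
  rewrite /elog_term Cmod_mult (Cmod_div (Cpow (xi * Cexp (- w)) _)); last exact: one_minus_pow_neq0.
  have hd : c / 2 <= Cmod (1 - Cpow (xi * Cexp (- w)) j.+1)%C.
    have -> : (1 - Cpow (xi * Cexp (- w)) j.+1 = (1 - Cpow xi j.+1) -
        Cpow xi j.+1 * (Cexp (- (RtoC (INR j.+1) * w)) - Cexp 0))%C.
      rewrite Cpow_qE Cexp_0; ring.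
    apply: Rle_trans (Cmod_triangle_inv _ _); rewrite -/c.
    rewrite (Cmod_mult (Cpow _ _)) Cmod_pow xi1 pow1 Rmult_1_l.
    have := @Cexp_lipschitz (- (RtoC (INR j.+1) * w))%C 0%C 0.
    have -> : (- (RtoC (INR j.+1) * w) - 0 = - (RtoC (INR j.+1) * w))%C by ring.
    rewrite exp_0 Rmult_1_r Cmod_opp Cmod_mult (Cmod_pos (Rlt_le _ _ j0)) !ReImE /=.
    move=> h; have : Cmod (Cexp (- (RtoC (INR j.+1) * w)) - Cexp 0)%C <= INR j.+1 * Cmod w.
      by apply: h; [nra|lra].
    have : INR j.+1 * Cmod w <= INR j.+1 * (c / (2 * INR j.+1)) by apply: Rmult_le_compat_l; lra.
    have -> : INR j.+1 * (c / (2 * INR j.+1)) = c / 2 by field; lra.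
    lra.
  have c1 := Cmod_coef_le j z1; have c2 := inv_INR_S_le1 j.
  have p1 : Cmod (Cpow (xi * Cexp (- w)) j.+1) <= 1 by apply: Cmod_pow_le1; lra.
  have i1 : / Cmod (1 - Cpow (xi * Cexp (- w)) j.+1)%C <= 2 / c.
    have -> : 2 / c = / (c / 2) by field; lra.
    by apply: Rinv_le_contravar; lra.
  have i0 : 0 < / Cmod (1 - Cpow (xi * Cexp (- w)) j.+1)%C by apply: Rinv_0_lt_compat; lra.
  have wr := Re_le_Cmod w.
  have : Re w * (Cmod (Cpow z j.+1 / RtoC (INR j.+1))%C *
     (Cmod (Cpow (xi * Cexp (- w)) j.+1) / Cmod (1 - Cpow (xi * Cexp (- w)) j.+1)%C))
     <= d * c / 2 * (1 * (1 * (2 / c))).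
    apply: Rmult_le_compat; try lra.
      apply: Rmult_le_pos; first exact: Cmod_ge_0.
      by apply: Rmult_le_pos; [exact: Cmod_ge_0|lra].
    apply: Rmult_le_compat; try lra; try exact: Cmod_ge_0.
      by apply: Rmult_le_pos; [exact: Cmod_ge_0|lra].
    by apply: Rmult_le_compat; try lra; exact: Cmod_ge_0.
  have -> : d * c / 2 * (1 * (1 * (2 / c))) = d by field; lra.
  by [].
have exM : ex_series (fun j => 2 * isq j) by apply: (ex_series_scal_l 2); exact: ex_series_isq.
have [k hk] := tannery near0_filter exM hM hp e0.
by exists k => w hr hi; rewrite -hs; [exact: hk|lra].
Qed.

(* [growth c / x] is the maximum of [Re (c / w)] over the line [Re w = x]. *)
Definition growth (c : C) : R := (Re c + Cmod c) / 2.

Lemma growth_ge0 (c : C) : 0 <= growth c.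
Proof. by rewrite /growth; have := re_le_Cmod c; have := Rle_abs (- Re c); rewrite Rabs_Ropp; lra. Qed.

(* [Re w / w] runs over the circle of radius 1/2 centred at 1/2. *)
Lemma Re_polar_le (c w : C) : 0 < Re w -> Re (RtoC (Re w) / w * c)%C <= growth c.
Proof.
move=> w0; have wn : w <> 0%C by exact: Re_pos_neq0.
have cw : 0 < Cmod w by apply/Cmod_gt_0.
have -> : (RtoC (Re w) / w * c = RtoC (/ 2) * c + (RtoC (Re w) / w - RtoC (/ 2)) * c)%C by ring.
rewrite Re_plus.
have -> : Re (RtoC (/ 2) * c)%C = Re c / 2 by rewrite ReImE /=; field.
have : Re ((RtoC (Re w) / w - RtoC (/ 2)) * c)%C <= Cmod c / 2; last by rewrite /growth; lra.
apply: Rle_trans (Re_le_Cmod _) _; rewrite Cmod_mult.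
have n2 : RtoC 2 <> 0%C by apply: RtoC_neq0; lra.
have -> : (RtoC (Re w) / w - RtoC (/ 2) = (RtoC (2 * Re w) - w) / (RtoC 2 * w))%C.
  have -> : RtoC (/ 2) = (/ RtoC 2)%C by apply: C_ext; rewrite /=; field.
  by rewrite RtoC_mult; field.
rewrite Cmod_div; last exact: Cmult_neq0.
have -> : (RtoC (2 * Re w) - w)%C = Cconj w.
  by apply: C_ext; rewrite /Re /Im /=; ring.
rewrite Cmod_conj Cmod_mult Cmod_pos; last by lra.
right; field; lra.
Qed.

Lemma unit_rot (xi : C) (v : R) : Cmod xi = 1 -> Cmod (xi * Cexp (- ((0, v) : C)))%C = 1.
Proof. by move=> h; rewrite Cmod_Cexp_neg //= Ropp_0 exp_0. Qed.

(** Each point of the arc has a neighbourhood in which the limit of x * elog holds up to [e], and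
    finitely many neighbourhoods cover it. The base point v = 0 may exceed [L], so a cone of slope
    [U] around it is left out. *)
Lemma arc_bound (z xi : C) (al be U L e : R) : Cmod z <= 1 -> Cmod xi = 1 -> 0 < U -> 0 < e ->
  Cmod (CSeries (resonant z xi)) / U <= L ->
  (forall v, al <= v <= be -> v <> 0 ->
     growth (CSeries (resonant z (xi * Cexp (- ((0, v) : C))))) <= L) ->
  exists x0, 0 < x0 /\ forall x v, 0 < x < x0 -> al <= v <= be -> U * x <= Rabs v ->
    Re (elog z (xi * Cexp (- ((x, v) : C)))) <= (L + e) / x.
Proof.
move=> z1 xi1 U0 e0 hL hv.
have loc v1 : exists d : posreal, al <= v1 <= be -> forall x v, 0 < x < d -> Rabs (v - v1) < d ->
    U * x <= Rabs v -> Re (elog z (xi * Cexp (- ((x, v) : C)))) <= (L + e) / x.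
  case: (Rle_dec al v1) => hal; last by exists (mkposreal 1 Rlt_0_1); lra.
  case: (Rle_dec v1 be) => hbe; last by exists (mkposreal 1 Rlt_0_1); lra.
  have [d hd] := local_elog z1 (unit_rot v1 xi1) e0.
  exists d => _ x v hx hvv hUv.
  have := hd (x, v - v1) hx hvv.
  have -> : (xi * Cexp (- ((0, v1) : C)) * Cexp (- ((x, (v - v1)%R) : C)) = xi * Cexp (- ((x, v) : C)))%C.
    rewrite -Cmult_assoc -Cexp_plus; congr Cmult; congr Cexp.
    by apply: C_ext; rewrite /Re /Im /=; ring.
  set G := elog _ _; set S := CSeries _; set w : C := (x, (v - v1)%R).
  change (Re w) with x => h.
  have hre : x * Re G - Re (RtoC x / w * S)%C <= e.
    have -> : x * Re G - Re (RtoC x / w * S)%C = Re (RtoC x * G - RtoC x / w * S)%C.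
      by rewrite Re_minus [Re (RtoC x * G)%C]Re_mult /=; ring.
    exact: Rle_trans (Re_le_Cmod _) h.
  have hS : Re (RtoC x / w * S)%C <= L.
    case: (Req_dec v1 0) => hv1; last first.
      by apply: Rle_trans (@Re_polar_le S w _) _; [rewrite /=; lra|apply: hv].
    have Sx : S = CSeries (resonant z xi).
      rewrite /S hv1; congr (CSeries (resonant _ _)).
      have -> : (- ((0, 0) : C))%C = 0%C by apply: C_ext; rewrite /Re /Im /=; ring.
      by rewrite Cexp_0 Cmult_1_r.
    (* At the base point, outside the cone, |w| >= |v| >= U x, hence |x/w| <= 1/U. *)
    apply: Rle_trans (Re_le_Cmod _) _; apply: Rle_trans hL; rewrite -Sx.
    have wn : w <> 0%C by apply: Re_pos_neq0 => /=; lra.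
    have := im_le_Cmod w; rewrite /= hv1 Rminus_0_r => hw.
    rewrite Cmod_mult Cmod_div // Cmod_pos; last by lra.
    rewrite Rmult_comm; apply: Rmult_le_compat_l; first exact: Cmod_ge_0.
    have cw : 0 < Cmod w by apply/Cmod_gt_0.
    apply: (Rmult_le_reg_l (U * Cmod w)); first exact: Rmult_lt_0_compat.
    have -> : U * Cmod w * (x / Cmod w) = U * x by field; lra.
    have -> : U * Cmod w * / U = Cmod w by field; lra.
    lra.
  apply: (Rmult_le_reg_l x); first by lra.
  have -> : x * ((L + e) / x) = L + e by field; lra.
  lra.
(* The radius has to be a function of the point before compactness can be applied, hence the choice
   operator; the covering point is then recovered by classical logic. *)
pose delta v := proj1_sig (constructive_indefinite_description _ (loc v)).
have hdelta v := proj2_sig (constructive_indefinite_description _ (loc v)).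
have [d hd] := compactness_value_1d al be delta.
exists d; split; first exact: cond_pos.
move=> x v hx hab hU.
have [t [ht [h1 h2]]] := NNPP _ (hd v hab).
by apply: (hdelta t ht) => //; rewrite -/(delta t); lra.
Qed.

(** * Block series with y <> 1 *)

(** The block series without its polar part [Li2 y / s]; see [is_cser_block]. *)
Definition psum (y : C) (x : R) (s : C) : C :=
  CSeries (fun k => Cpow y k.+1 / RtoC (INR k.+1) * psi x (RtoC (INR k.+1) * s))%C.

Definition block_term (y : C) (x : R) (s : C) (k : nat) : C :=
  (Cpow y k.+1 / RtoC (INR k.+1) *
    (Cexp (- (RtoC x * (RtoC (INR k.+1) * s))) / (1 - Cexp (- (RtoC (INR k.+1) * s)))))%C.

Lemma Re_scal (k : R) (s : C) : Re (RtoC k * s)%C = k * Re s.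
Proof. by rewrite ReImE /= Rmult_0_l Rminus_0_r. Qed.

Lemma is_cser_Li2 (z : C) : Cmod z <= 1 ->
  is_cser (fun k => Cpow z k.+1 / RtoC (INR k.+1 * INR k.+1))%C (Li2 z).
Proof.
move=> z1; have h := is_cser_le (fun k => Cmod_isq_le k z1) ex_series_isq.
have -> // : Li2 z = CSeries (fun k => Cpow z k.+1 / RtoC (INR k.+1 * INR k.+1))%C.
apply: CSeries_ext => k; congr Cdiv; rewrite /= RtoC_mult; ring.
Qed.

Lemma psum_term_le (y : C) (x D U : R) (s : C) (k : nat) : Cmod y <= 1 -> 0 < D -> cone U s ->
  (forall a, cone U a -> Cmod (psi x a) <= D * / (1 + Re a)) ->
  Cmod (Cpow y k.+1 / RtoC (INR k.+1) * psi x (RtoC (INR k.+1) * s))%C <= D / Re s * isq k.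
Proof.
move=> y1 D0 cs hD; have k0 := INR_S_pos k; have [r0 _] := cs.
have ck := cone_scal k0 cs.
rewrite Cmod_mult; have h1 := Cmod_coef_le k y1; have := hD _ ck; rewrite Re_scal => h2.
have h3 : D * / (1 + INR k.+1 * Re s) <= D * / (INR k.+1 * Re s).
  apply: Rmult_le_compat_l; first by lra.
  by apply: Rinv_le_contravar; [exact: Rmult_lt_0_compat|lra].
apply: Rle_trans (_ : / INR k.+1 * (D * / (INR k.+1 * Re s)) <= _).
  apply: Rmult_le_compat; try exact: Cmod_ge_0; lra.
by right; rewrite /isq; field; lra.
Qed.

Lemma is_cser_psum (y : C) (x U : R) (s : C) : Cmod y <= 1 -> 0 < x <= 1 -> 0 <= U -> cone U s ->
  is_cser (fun k => Cpow y k.+1 / RtoC (INR k.+1) * psi x (RtoC (INR k.+1) * s))%C (psum y x s).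
Proof.
move=> y1 hx U0 cs; have [D [D0 hD]] := psi_decay hx U0.
apply: is_cser_le (fun k => psum_term_le k y1 D0 cs hD) _.
by apply: (ex_series_scal_l (D / Re s)); exact: ex_series_isq.
Qed.

Lemma is_cser_block (y : C) (x U : R) (s : C) : Cmod y <= 1 -> 0 < x <= 1 -> 0 <= U -> cone U s ->
  is_cser (block_term y x s) (Li2 y / s + psum y x s)%C.
Proof.
move=> y1 hx U0 cs; have s0 := cone_neq0 cs.
have h1 := is_cser_psum y1 hx U0 cs.
have h2 := @is_cser_Cmult (/ s)%C _ _ (is_cser_Li2 y1).
have -> : (Li2 y / s = / s * Li2 y)%C by rewrite /Cdiv Cmult_comm.
apply: is_cser_ext (is_cser_plus h2 h1) => k; unplusC; have k0 := @INR_S_neq0 k.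
have nd : (1 - Cexp (- (RtoC (INR k.+1) * s)))%C <> 0%C.
  have ks : cone U (RtoC (INR k.+1) * s)%C by apply: cone_scal => //; exact: INR_S_pos.
  case: ks => r0 _; apply: Cmod_neq0.
  apply: Rlt_le_trans (one_minus_Cexp_ge r0 (Rle_refl _)).
  by have := exp_neg_lt1 r0; lra.
by rewrite /block_term /psi RtoC_mult; field.
Qed.

Section AbelSummation.

Variable y : C.
Hypotheses (y1 : Cmod y = 1) (yn : y <> 1%C).

Let d0 : 0 < Cmod (1 - y)%C.
Proof.
apply/Cmod_gt_0 => e; apply: yn.
have h : (y = 1 - (1 - y))%C by ring.
by rewrite h e; ring.
Qed.

Let U (k : nat) : C := sum_n (G := C_R_NormedModule) (fun i => Cpow y i.+1) k.

Let U_le (k : nat) : Cmod (U k) <= 2 / Cmod (1 - y)%C.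
Proof.
have n0 : (1 - y)%C <> 0%C by exact: Cmod_neq0.
have -> : U k = (y * ((1 - Cpow y k.+1) / (1 - y)))%C.
  rewrite -Cgeom_sum // /U; elim: k => [|k IH]; first by rewrite !sum_O /=; ring.
  by rewrite !sum_Sn IH; unplusC; rewrite /=; ring.
rewrite Cmod_mult y1 Rmult_1_l Cmod_div //; apply: Rmult_le_compat_r.
  by left; exact: Rinv_0_lt_compat.
by apply: Rle_trans (Cmod_minus_le _ _) _; rewrite Cmod_1 Cmod_pow y1 pow1; lra.
Qed.

(** Summation by parts: as |y| = 1 and y <> 1, the partial sums of the powers of [y] are bounded by
    2 / |1 - y|. *)
Lemma abel_sum (g : nat -> C) (b : nat -> R) : (forall k, Cmod (g k - g k.+1)%C <= b k) ->
  ex_series b -> is_lim_seq (fun k => Cmod (g k)) 0 ->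
  exists l : C, is_cser (fun k => Cpow y k.+1 * g k)%C l /\ Cmod l <= 2 / Cmod (1 - y)%C * Series b.
Proof.
move=> hg exb g0.
have hM k : Cmod (U k * (g k - g k.+1))%C <= 2 / Cmod (1 - y)%C * b k.
  by rewrite Cmod_mult; apply: Rmult_le_compat => //; exact: Cmod_ge_0.
have exM : ex_series (fun k => 2 / Cmod (1 - y)%C * b k) by exact: (ex_series_scal_l _ b).
set l := CSeries (fun k => U k * (g k - g k.+1))%C.
have hl : is_cser (fun k => U k * (g k - g k.+1))%C l by exact: is_cser_le hM exM.
exists l; split; last first.
  rewrite -Series_scal_l; exact: Cmod_CSeries_le hM exM.
have id N : sum_n (G := C_R_NormedModule) (fun k => Cpow y k.+1 * g k)%C N =
   (sum_n (G := C_R_NormedModule) (fun k => U k * (g k - g k.+1))%C N + U N * g N.+1)%C.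
  elim: N => [|N IH]; first by rewrite /U !sum_O; ringC.
  rewrite sum_Sn IH sum_Sn.
  have -> : U N.+1 = (U N + Cpow y N.+2)%C by rewrite /U sum_Sn.
  ringC.
have l1 := is_cser_lim hl.
have l2 : is_lim_seq (fun N => 2 / Cmod (1 - y)%C * Cmod (g N.+1)) 0.
  have := is_lim_seq_scal_l _ (2 / Cmod (1 - y)%C) _ (proj1 (is_lim_seq_incr_1 _ _) g0).
  by rewrite /= Rmult_0_r.
have := is_lim_seq_plus' _ _ _ _ l1 l2; rewrite Rplus_0_r => l3.
have l4 : is_lim_seq (fun N => Cmod (sum_n (G := C_R_NormedModule) (fun k => Cpow y k.+1 * g k)%C N - l)%C) 0.
  apply: is_lim_seq_le_le (is_lim_seq_const 0) l3 => N; split; first exact: Cmod_ge_0.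
  rewrite id; set S := sum_n _ _.
  have -> : (S + U N * g N.+1 - l = (S - l) + U N * g N.+1)%C by ringC.
  apply: Rle_trans (Cmod_triangle _ _) _; apply: Rplus_le_compat_l.
  by rewrite Cmod_mult; apply: Rmult_le_compat_r => //; exact: Cmod_ge_0.
apply: is_cser_pair; apply: is_series_lim.
  apply: (is_lim_seq_ext (fun N => Re (sum_n (G := C_R_NormedModule) (fun k => Cpow y k.+1 * g k)%C N - l)%C + Re l)) => [N|].
    by rewrite Re_minus Re_sum_n; ring.
  have h : is_lim_seq (fun N => Re (sum_n (G := C_R_NormedModule) (fun k => Cpow y k.+1 * g k)%C N - l)%C) 0.
    apply/is_lim_seq_abs_0; apply: is_lim_seq_le_le (is_lim_seq_const 0) l4 => N.
    by split; [exact: Rabs_pos|exact: re_le_Cmod].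
  by have := is_lim_seq_plus' _ _ _ _ h (is_lim_seq_const (Re l)); rewrite Rplus_0_l.
apply: (is_lim_seq_ext (fun N => Im (sum_n (G := C_R_NormedModule) (fun k => Cpow y k.+1 * g k)%C N - l)%C + Im l)) => [N|].
  by rewrite Im_minus Im_sum_n; ring.
have h : is_lim_seq (fun N => Im (sum_n (G := C_R_NormedModule) (fun k => Cpow y k.+1 * g k)%C N - l)%C) 0.
  apply/is_lim_seq_abs_0; apply: is_lim_seq_le_le (is_lim_seq_const 0) l4 => N.
  by split; [exact: Rabs_pos|exact: im_le_Cmod].
by have := is_lim_seq_plus' _ _ _ _ h (is_lim_seq_const (Im l)); rewrite Rplus_0_l.
Qed.

Let sq (k : nat) := sqrt (INR k.+1).

Let sq0 (k : nat) : 0 < sq k.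
Proof. by apply: sqrt_lt_R0; exact: INR_S_pos. Qed.

Let sqq (k : nat) : sq k * sq k = INR k.+1.
Proof. by apply: sqrt_sqrt; left; exact: INR_S_pos. Qed.

Let sq_telescope : ex_series (fun k => / (sq k * INR k.+2)) /\ Series (fun k => / (sq k * INR k.+2)) <= 2.
Proof.
have -> : 2 = 2 * / sq 0 by rewrite /sq /INR sqrt_1; field.
apply: (series_telescope (b := fun k => 2 * / sq k)) => k; last first.
  by apply: Rmult_le_pos; [lra|left; apply: Rinv_0_lt_compat].
have := sq0 k; have := sq0 k.+1; have := sqq k; have := sqq k.+1.
rewrite (S_INR k.+1); set p := sq k; set q := sq k.+1 => e1 e2 q0 p0.
have pq : p <= q by apply: sqrt_le_1_alt; rewrite (S_INR k.+1); lra.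
rewrite -e1; split; first by left; apply: Rinv_0_lt_compat; apply: Rmult_lt_0_compat => //; nra.
have -> : 2 * / p - 2 * / q = 2 * (q * q - p * p) / (p * q * (q + p)) by field; lra.
have -> : q * q - p * p = 1 by lra.
rewrite Rmult_1_r -[X in X <= _]Rmult_1_l.
have -> : 1 * / (p * (q * q)) = 2 * / (p * q * (2 * q)) by field; lra.
apply: Rmult_le_compat_l; first by lra.
apply: Rinv_le_contravar; first by apply: Rmult_lt_0_compat; [nra|lra].
by apply: Rmult_le_compat_l; [nra|lra].
Qed.

(** The two hypotheses interpolate between a bound O(t k) near 0 and a bound O(1) at infinity.
    Dividing by k leaves differences at most 2 A sqrt t / (sqrt k (k + 1)), whose sum is at most 4 A
    sqrt t by telescoping 2 / sqrt k; the boundary factor 2 / |1 - y| gives the 8. *)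
Lemma abel_sqrt (h : nat -> C) (A t : R) : 0 <= A -> 0 <= t ->
  (forall k, Cmod (h k) <= A * (sqrt t * sqrt (INR k.+1))) ->
  (forall k, Cmod (h k - h k.+1)%C <= A * (sqrt t / sqrt (INR k.+1))) ->
  exists l : C, is_cser (fun k => Cpow y k.+1 / RtoC (INR k.+1) * h k)%C l /\
            Cmod l <= 8 / Cmod (1 - y)%C * A * sqrt t.
Proof.
move=> A0 t0 h1 h2; set T := sqrt t in h1 h2 *.
have T0 : 0 <= T by exact: sqrt_pos.
have [ex tl] := sq_telescope.
have [|||l [hl ll]] := @abel_sum (fun k => h k / RtoC (INR k.+1))%C (fun k => 2 * A * T * / (sq k * INR k.+2)).
- move=> k; have k0 := @INR_S_neq0 k; have k1 := @INR_S_neq0 k.+1.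
  have -> : (h k / RtoC (INR k.+1) - h k.+1 / RtoC (INR k.+2) =
     h k * / (RtoC (INR k.+1) * RtoC (INR k.+2)) + (h k - h k.+1) * / RtoC (INR k.+2))%C.
    have e : RtoC (INR k.+2) = (RtoC (INR k.+1) + 1)%C by rewrite S_INR RtoC_plus.
    by rewrite e in k1 *; field.
  apply: Rle_trans (Cmod_triangle _ _) _.
  have p0 := INR_S_pos k; have p1 := INR_S_pos k.+1.
  rewrite 2!Cmod_mult -RtoC_mult !Cmod_inv; try by apply: RtoC_neq0; nra.
  rewrite !Cmod_pos; try nra.
  have i1 : 0 < / (INR k.+1 * INR k.+2) by apply: Rinv_0_lt_compat; nra.
  have i2 : 0 < / INR k.+2 by exact: Rinv_0_lt_compat.
  have q1 := Rmult_le_compat_r _ _ _ (Rlt_le _ _ i1) (h1 k).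
  have q2 := Rmult_le_compat_r _ _ _ (Rlt_le _ _ i2) (h2 k).
  apply: Rle_trans (Rplus_le_compat _ _ _ _ q1 q2) _; right.
  rewrite -/(sq k) -(sqq k); have := sq0 k => s0; field; lra.
- by apply: (ex_series_scal_l (2 * A * T)).
- have lb : is_lim_seq (fun n => A * T * / sq n) 0.
    have -> : Rbar.Finite 0 = Rbar_mult (A * T) 0 by rewrite /= Rmult_0_r.
    apply: is_lim_seq_scal_l.
    have -> : Rbar.Finite 0 = Rbar_inv p_infty by [].
    apply: is_lim_seq_inv => //.
    apply/(is_lim_seq_incr_1 (fun n => sqrt (INR n))).
    exact: filterlim_comp (is_lim_seq_INR) (filterlim_sqrt_p).
  apply: is_lim_seq_le_le (is_lim_seq_const 0) lb => k; split; first exact: Cmod_ge_0.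
  rewrite Cmod_div; last exact: INR_S_neq0.
  have p0 := INR_S_pos k; rewrite Cmod_pos; last by lra.
  apply: Rle_trans (Rmult_le_compat_r _ _ _ _ (h1 k)) _; first by left; exact: Rinv_0_lt_compat.
  by right; rewrite -/(sq k) -(sqq k); have := sq0 k => s0; field; lra.
exists l; split.
  apply: is_cser_ext hl => k; have k0 := @INR_S_neq0 k; field; exact: k0.
apply: Rle_trans ll _; rewrite Series_scal_l.
have -> : 8 / Cmod (1 - y)%C * A * T = 2 / Cmod (1 - y)%C * (2 * A * T * 2) by field; lra.
apply: Rmult_le_compat_l; first by left; apply: Rdiv_lt_0_compat; lra.
apply: Rmult_le_compat_l => //; apply: Rmult_le_pos => //; lra.
Qed.

Lemma ex_cser_dirichlet : exists l : C, is_cser (fun k => Cpow y k.+1 / RtoC (INR k.+1))%C l.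
Proof.
have [|||l [hl _]] := @abel_sum (fun k => / RtoC (INR k.+1))%C isq.
- move=> k; have p0 := INR_S_pos k; have p1 := INR_S_pos k.+1.
  have -> : (/ RtoC (INR k.+1) - / RtoC (INR k.+2))%C = RtoC (/ INR k.+1 - / INR k.+2).
    by rewrite RtoC_minus !RtoC_invE.
  rewrite Cmod_R; rewrite S_INR in p1 *.
  have -> : / INR k.+1 - / (INR k.+1 + 1) = / (INR k.+1 * (INR k.+1 + 1)) by field; lra.
  rewrite Rabs_pos_eq; last by left; apply: Rinv_0_lt_compat; nra.
  by apply: Rinv_le_contravar; nra.
- exact: ex_series_isq.
- apply: (is_lim_seq_ext (fun k => / INR k.+1)).
    move=> k; rewrite -RtoC_invE Cmod_pos //; left; apply: Rinv_0_lt_compat; exact: INR_S_pos.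
  have -> : Rbar.Finite 0 = Rbar_inv p_infty by [].
  apply: is_lim_seq_inv => //.
  by apply/(is_lim_seq_incr_1 INR); exact: is_lim_seq_INR.
by exists l.
Qed.

Let sqrt_tk (k : nat) (t : R) : 0 < t -> t / (1 + INR k.+1 * t) <= sqrt t / sq k.
Proof.
move=> t0; have s0 := sq0 k; have st : 0 < sqrt t by exact: sqrt_lt_R0.
have tt : sqrt t * sqrt t = t by apply: sqrt_sqrt; lra.
have e : sqrt t / sq k = t / (sq k * sqrt t) by rewrite -[X in _ = X / _]tt; field; lra.
rewrite e; apply: Rmult_le_compat_l; first by lra.
apply: Rinv_le_contravar; first exact: Rmult_lt_0_compat.
rewrite -(sqq k) -[X in _ <= 1 + _ * X]tt.
have := Rle_0_sqr (sq k * sqrt t - / 2); rewrite /Rsqr; lra.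
Qed.

Let le_sqrt_tk (k : nat) (t M B D : R) : 0 < t -> 0 <= D -> M <= D * (INR k.+1 * t) -> M <= D ->
  M <= D * (sqrt t * sq k).
Proof.
move=> t0 D0 h1 h2; have s0 := sq0 k; have st : 0 < sqrt t by exact: sqrt_lt_R0.
have tt : sqrt t * sqrt t = t by apply: sqrt_sqrt; lra.
case: (Rle_dec 1 (sqrt t * sq k)) => h; first by nra.
apply: Rle_trans h1 _; apply: Rmult_le_compat_l => //.
rewrite -(sqq k) -[X in _ * X <= _]tt.
have : 0 < sqrt t * sq k by exact: Rmult_lt_0_compat.
nra.
Qed.

(** Convergence on the circle is Dirichlet's test; the value follows by Abel's theorem with a rate,
    [abel_sqrt] being applied to h k = e^(-(k+1) e) - 1, the change of the coefficients between [y]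
    and the radial point e^(-e) y. *)
Lemma is_cser_log1m_circle : is_cser (fun k => Cpow y k.+1 / RtoC (INR k.+1))%C (log1m y) /\
  forall e, 0 < e -> Cmod (log1m (RtoC (exp (- e)) * y) - log1m y)%C <= 8 / Cmod (1 - y)%C * sqrt e.
Proof.
have [l hl] := ex_cser_dirichlet.
have est e : 0 < e -> Cmod (log1m (RtoC (exp (- e)) * y) - l)%C <= 8 / Cmod (1 - y)%C * sqrt e.
  move=> e0.
  have eS (k : nat) : Rabs (exp (- (INR k.+1 * e)) - 1) <= INR k.+1 * e /\ Rabs (exp (- (INR k.+1 * e)) - 1) <= 1.
    have p0 := INR_S_pos k; have pe : 0 < INR k.+1 * e by exact: Rmult_lt_0_compat.
    have h1 := exp_neg_lt1 pe; have h2 := exp_ineq1_le (- (INR k.+1 * e)).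
    by rewrite Rabs_left1; have := exp_pos (- (INR k.+1 * e)); lra.
  have [||||l' [hl' ll]] := @abel_sqrt (fun k => RtoC (exp (- (INR k.+1 * e)) - 1)) 1 e; try lra.
  - move=> k; have [h1 h2] := eS k; rewrite Cmod_R.
    by apply: (@le_sqrt_tk k e _ 0) => //; lra.
  - move=> k; rewrite -RtoC_minus Cmod_R Rmult_1_l.
    have p0 := INR_S_pos k; have pe : 0 < INR k.+1 * e by exact: Rmult_lt_0_compat.
    apply: Rle_trans (sqrt_tk k e0).
    have e1 : exp (- (INR k.+2 * e)) = exp (- (INR k.+1 * e)) * exp (- e).
      by rewrite -exp_plus (S_INR k.+1); congr exp; ring.
    have h1 := exp_neg_lt1 e0; have h2 := exp_ineq1_le (- e); have h3 := exp_pos (- (INR k.+1 * e)).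
    have h4 : exp (- (INR k.+1 * e)) <= / (1 + INR k.+1 * e).
      rewrite exp_Ropp; apply: Rinv_le_contravar; first by lra.
      exact: exp_ineq1_le.
    rewrite e1 Rabs_pos_eq; last by nra.
    have : exp (- (INR k.+1 * e)) * (1 - exp (- e)) <= / (1 + INR k.+1 * e) * e.
      by apply: Rmult_le_compat; lra.
    rewrite /Rdiv; lra.
  rewrite Rmult_1_r in ll.
  have y2 : Cmod (RtoC (exp (- e)) * y)%C < 1.
    rewrite Cmod_mult y1 Cmod_pos; last by left; exact: exp_pos.
    by rewrite Rmult_1_r; exact: exp_neg_lt1.
  have h := is_cser_minus (is_cser_log1m y2) hl.
  have -> // : (log1m (RtoC (exp (- e)) * y) - l)%C = l'.
  rewrite -(CSeries_unique h) -(CSeries_unique hl'); apply: CSeries_ext => k; unplusC.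
  have k0 := @INR_S_neq0 k.
  rewrite Cpow_RtoC_mult exp_pow Ropp_mult_distr_r_reverse RtoC_minus; field; exact: k0.
(* The sum [l] is identified by letting the radial point tend to [y]: there Re y < 1, so [log1m] is
   continuous along the radius. *)
have lim e : 0 < e -> Cmod (log1m y - l)%C <= e.
  move=> e0.
  have ry : Re y < 1.
    have := Re_le_Cmod y; rewrite y1 => -[//|e1]; exfalso; apply: yn; apply: C_ext => //=.
    have := Cmod_sqr y; rewrite y1 e1; nra.
  pose f (t : R) : R := Re (log1m (RtoC (exp (- t)) * y)) .
  pose g (t : R) : R := Im (log1m (RtoC (exp (- t)) * y)).
  have fE t : f t = - ln (sqrt ((1 - exp (- t) * Re y) * (1 - exp (- t) * Re y) + exp (- t) * Im y * (exp (- t) * Im y))).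
    rewrite /f /log1m /=; congr (- ln _); rewrite /Cmod /=; congr sqrt; rewrite -/(Re y) -/(Im y); ring.
  have gE t : g t = atan (exp (- t) * Im y / (1 - exp (- t) * Re y)).
    rewrite /g /log1m /=; congr atan; congr Rdiv; rewrite -/(Re y) -/(Im y); ring.
  have pp : 0 < (1 - Re y) * (1 - Re y) + Im y * Im y by nra.
  have cf : continuous f 0.
    apply: (continuous_ext _ _ _ (fun t => esym (fE t))).
    apply: (ex_derive_continuous (V := R_NormedModule)).
    by auto_derive; rewrite Ropp_0 exp_0 !Rmult_1_l; repeat split; try lra; apply: sqrt_lt_R0; lra.
  have cg : continuous g 0.
    apply: (continuous_ext _ _ _ (fun t => esym (gE t))).
    apply: (ex_derive_continuous (V := R_NormedModule)).
    by auto_derive; rewrite Ropp_0 exp_0 !Rmult_1_l; repeat split; lra.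
  have g0' : log1m y = (f 0, g 0).
    by rewrite /f /g Ropp_0 exp_0 Cmult_1_l; case: (log1m y).
  have [d1 hd1] := cf _ (locally_ball (f 0) (mkposreal (e / 4) ltac:(lra))).
  have [d2 hd2] := cg _ (locally_ball (g 0) (mkposreal (e / 4) ltac:(lra))).
  pose K := 8 / Cmod (1 - y)%C.
  have K0 : 0 < K by apply: Rdiv_lt_0_compat; lra.
  pose t := Rmin (Rmin d1 d2 / 2) (e / (2 * K) * (e / (2 * K))).
  have q0 : 0 < e / (2 * K) by apply: Rdiv_lt_0_compat; lra.
  have t0 : 0 < t.
    apply: Rmin_glb_lt; last exact: Rmult_lt_0_compat.
    have : 0 < Rmin d1 d2 by apply: Rmin_glb_lt; exact: cond_pos.
    lra.
  have td : t <= Rmin d1 d2 / 2 by exact: Rmin_l.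
  have tq : t <= e / (2 * K) * (e / (2 * K)) by exact: Rmin_r.
  have m1 := Rmin_l d1 d2; have m2 := Rmin_r d1 d2.
  have b1 : Rabs (f t - f 0) < e / 4.
    by apply: (hd1 t); rewrite /ball /= /AbsRing_ball /= /abs /minus /plus /opp /= Ropp_0 Rplus_0_r Rabs_pos_eq; lra.
  have b2 : Rabs (g t - g 0) < e / 4.
    by apply: (hd2 t); rewrite /ball /= /AbsRing_ball /= /abs /minus /plus /opp /= Ropp_0 Rplus_0_r Rabs_pos_eq; lra.
  have st : sqrt t <= e / (2 * K).
    by rewrite -(sqrt_square (e / (2 * K))); [exact: sqrt_le_1_alt|lra].
  have h1 := est t t0; rewrite -/K in h1.
  have h2 : K * sqrt t <= e / 2.
    have : K * sqrt t <= K * (e / (2 * K)) by apply: Rmult_le_compat_l; lra.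
    have -> : K * (e / (2 * K)) = e / 2 by field; lra.
    by [].
  have h3 : Cmod (log1m y - log1m (RtoC (exp (- t)) * y))%C <= e / 2.
    apply: Rle_trans (Cmod_le_ReIm _) _; rewrite Re_minus Im_minus.
    rewrite g0' -/(f t) -/(g t); change (Re (f 0, g 0)) with (f 0); change (Im (f 0, g 0)) with (g 0).
    by rewrite (Rabs_minus_sym (f 0)) (Rabs_minus_sym (g 0)); lra.
  have -> : (log1m y - l = (log1m y - log1m (RtoC (exp (- t)) * y)) + (log1m (RtoC (exp (- t)) * y) - l))%C by ring.
  apply: Rle_trans (Cmod_triangle _ _) _; lra.
have <- : l = log1m y; last by split.
have z0 : Cmod (log1m y - l)%C = 0.
  apply: Rle_antisym; last exact: Cmod_ge_0.
  by apply: le_epsilon => e e0; rewrite Rplus_0_l; exact: lim.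
have := Cmod_eq_0 _ z0 => h.
have h' : (l = log1m y - (log1m y - l))%C by ring.
by rewrite h' h; ring.
Qed.

(** [abel_sqrt] is applied to psi (k s) - (1/2 - x): its size comes from [psi_at_0] and [psi_decay],
    its differences from [psi_lip]. The subtracted constant sums up to (1/2 - x) times the
    logarithmic series. *)
Lemma psum_asymp (x W : R) : 0 < x <= 1 -> 0 <= W -> exists A, 0 < A /\
  forall s, cone W s -> Cmod (psum y x s - RtoC (/ 2 - x) * log1m y)%C <= A * sqrt (Cmod s).
Proof.
move=> hx W0.
have [D1 [D10 hD1]] := psi_decay hx W0.
have [D2 [D20 hD2]] := psi_at_0 hx W0.
have [D3 [D30 hD3]] := psi_lip hx W0.
pose A := D1 + 1 + D2 + D3 * (1 + W).
have A0 : 0 < A by rewrite /A; nra.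
exists (8 / Cmod (1 - y)%C * A); split.
  by apply: Rmult_lt_0_compat => //; apply: Rdiv_lt_0_compat; lra.
move=> s cs; have s0 := cone_neq0 cs; have t0 : 0 < Cmod s by apply/Cmod_gt_0.
have cR := cone_Cmod cs; have [r0 _] := cs.
have [||||l [hl ll]] := @abel_sqrt (fun k => psi x (RtoC (INR k.+1) * s) - RtoC (/ 2 - x))%C A (Cmod s); try lra.
- move=> k; have p0 := INR_S_pos k; have ck := cone_scal p0 cs.
  apply: (@le_sqrt_tk k _ _ 0) => //; first by lra.
    apply: Rle_trans (hD2 _ ck) _; rewrite Cmod_mult Cmod_pos; last by lra.
    by apply: Rmult_le_compat_r; rewrite /A; nra.
  apply: Rle_trans (Cmod_minus_le _ _) _; rewrite Cmod_R.
  have : Rabs (/ 2 - x) <= 1 by apply: Rabs_le; lra.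
  have : Cmod (psi x (RtoC (INR k.+1) * s)) <= D1.
    apply: Rle_trans (hD1 _ ck) _; rewrite -[X in _ <= X]Rmult_1_r.
    apply: Rmult_le_compat_l; first by lra.
    by rewrite -[X in _ <= X]Rinv_1; case: ck => rs _; apply: Rinv_le_contravar; lra.
  rewrite /A; nra.
- move=> k; have p0 := INR_S_pos k; have p1 := INR_S_pos k.+1.
  have ck := cone_scal p0 cs; have ck1 := cone_scal p1 cs.
  have -> : (psi x (RtoC (INR k.+1) * s) - RtoC (/ 2 - x) - (psi x (RtoC (INR k.+2) * s) - RtoC (/ 2 - x)) =
    psi x (RtoC (INR k.+1) * s) - psi x (RtoC (INR k.+2) * s))%C by ring.
  have := hD3 _ _ (INR k.+1 * Re s) ck ck1; rewrite !Re_scal => h.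
  have kr : 0 < INR k.+1 * Re s by exact: Rmult_lt_0_compat.
  have h' := h (Rlt_le _ _ kr) (Rle_refl _) _ (or_introl erefl).
  apply: Rle_trans (h' _) _; first by rewrite (S_INR k.+1); nra.
  have -> : (RtoC (INR k.+1) * s - RtoC (INR k.+2) * s = - s)%C by rewrite (S_INR k.+1) RtoC_plus; ring.
  rewrite Cmod_opp.
  have h1 : / ((1 + INR k.+1 * Re s) * (1 + INR k.+1 * Re s)) <= (1 + W) * / (1 + INR k.+1 * Cmod s).
    have -> : (1 + W) * / (1 + INR k.+1 * Cmod s) = / ((1 + INR k.+1 * Cmod s) / (1 + W)).
      by field; split; nra.
    apply: Rinv_le_contravar; first by apply: Rdiv_lt_0_compat; nra.
    apply: (Rmult_le_reg_r (1 + W)); first by lra.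
    rewrite /Rdiv Rmult_assoc Rinv_l; last by lra.
    have : INR k.+1 * Cmod s <= INR k.+1 * ((1 + W) * Re s) by apply: Rmult_le_compat_l; lra.
    nra.
  apply: Rle_trans (_ : D3 * (1 + W) * (sqrt (Cmod s) / sq k) <= _); last first.
    apply: Rmult_le_compat_r; last by rewrite /A; lra.
    by apply: Rmult_le_pos; [exact: sqrt_pos|left; apply: Rinv_0_lt_compat].
  have h2 := sqrt_tk k t0.
  have : D3 * Cmod s * / ((1 + INR k.+1 * Re s) * (1 + INR k.+1 * Re s)) <=
     D3 * Cmod s * ((1 + W) * / (1 + INR k.+1 * Cmod s)).
    by apply: Rmult_le_compat_l => //; nra.
  move=> h3; apply: Rle_trans h3 _.
  have -> : D3 * Cmod s * ((1 + W) * / (1 + INR k.+1 * Cmod s)) =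
    D3 * (1 + W) * (Cmod s / (1 + INR k.+1 * Cmod s)) by rewrite /Rdiv; ring.
  by apply: Rmult_le_compat_l => //; nra.
have [hlog _] := is_cser_log1m_circle.
have hp := is_cser_psum (Req_le _ _ y1) hx W0 cs.
have h := is_cser_minus hp (@is_cser_Cmult (RtoC (/ 2 - x)) _ _ hlog).
have -> // : (psum y x s - RtoC (/ 2 - x) * log1m y)%C = l.
rewrite -(CSeries_unique h) -(CSeries_unique hl); apply: CSeries_ext => k; ringC.
Qed.

End AbelSummation.

(** * The Gamma function *)

(** For a nonnegative integrand the two-sided improper integral is the supremum of the proper ones,
    so one sequence of intervals computes it, and existence comes with boundedness. *)
Lemma improper_int (f : R -> R) (M : R) :
  (forall u, 0 < u -> continuous f u) -> (forall u, 0 < u -> 0 <= f u) ->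
  (forall a b, 0 < a -> a <= b -> RInt f a b <= M) ->
  is_lim_seq (fun n => RInt f (/ INR n.+1) (INR n.+1))
    (RInt_gen f (at_right 0) (Rbar_locally p_infty)).
Proof.
move=> cf pf bf.
have ex a b : 0 < a -> a <= b -> ex_RInt f a b.
  move=> a0 ab; apply: (ex_RInt_continuous (V := R_CompleteNormedModule)) => u.
  by rewrite Rmin_left // => hu; apply: cf; lra.
have pos a b : 0 < a -> a <= b -> 0 <= RInt f a b.
  move=> a0 ab; apply: RInt_ge_0 => //; first exact: ex.
  by move=> u hu; apply: pf; lra.
have mono a b a' b' : 0 < a' -> a' <= a -> a <= b -> b <= b' -> RInt f a b <= RInt f a' b'.
  move=> a0 aa ab bb.
  have e1 : RInt f a' b' = RInt f a' a + RInt f a b + RInt f b b'.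
    rewrite -(RInt_Chasles f a' b b'); try by apply: ex; lra.
    by rewrite -(RInt_Chasles f a' a b); try by apply: ex; lra.
  have := pos a' a a0 aa; have := pos b b' ltac:(lra) bb; lra.
pose E v := exists a b, 0 < a /\ a <= b /\ v = RInt f a b.
have [l [ub lub]] : {l | is_lub E l}.
  apply: completeness; first by exists M => v [a [b [a0 [ab ->]]]]; exact: bf.
  by exists (RInt f 1 1), 1, 1; repeat split; lra.
have near (e : posreal) : exists a0 b0, 0 < a0 /\ a0 <= b0 /\ forall a b, 0 < a -> a <= a0 -> b0 <= b ->
    Rabs (RInt f a b - l) < e.
  (* If no interval came within [e] of the supremum, l - e would already be an upper bound. *)
  apply: NNPP => hn.
  have : l <= l - e; last by have := cond_pos e; lra.
  apply: lub => v [a [b [a0 [ab ->]]]]; apply: Rnot_lt_le => hv; apply: hn.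
  exists a, b; do 2 split=> //; move=> a' b' a'0 aa bb.
  have h1 := mono a b a' b' a'0 aa ab bb.
  have h2 : RInt f a' b' <= l by apply: ub; exists a', b'; repeat split; lra.
  by rewrite Rabs_left1; lra.
have hl : is_RInt_gen f (at_right 0) (Rbar_locally p_infty) l.
  move=> P [e he]; have [a0 [b0 [a00 [ab h]]]] := near e.
  apply: (Filter_prod _ _ _ (fun a => 0 < a <= a0) (fun b => b0 <= b)).
  - exists (mkposreal _ a00) => a /= ha a1; split=> //.
    by move: ha; rewrite /ball /= /AbsRing_ball /= /abs /minus /plus /opp /=; split_Rabs; lra.
  - by exists b0 => b hb; lra.
  move=> a b [a1 a2] hb /=; exists (RInt f a b); split.
    by apply: RInt_correct; apply: ex; lra.
  by apply: he; exact: h.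
rewrite (is_RInt_gen_unique _ _ hl).
apply/is_lim_seq_spec => e; have [a0 [b0 [a00 [ab h]]]] := near e.
have [N hN] : exists N, Rmax b0 (/ a0) < INR N.
  by have [N] := nfloor_ex (Rmax b0 (/ a0)) (Rle_trans _ _ _ (Rle_trans _ _ _ (Rlt_le _ _ a00) ab) (Rmax_l _ _)); exists N.+1; rewrite S_INR; lra.
exists N => n nN; have := Rmax_l b0 (/ a0); have := Rmax_r b0 (/ a0) => m1 m2.
have h1 : INR N <= INR n by apply: le_INR.
have n0 := INR_S_pos n; have h2 := S_INR n.
apply: h; first exact: Rinv_0_lt_compat; last by lra.
rewrite -(Rinv_inv a0); apply: Rinv_le_contravar; last by lra.
exact: Rinv_0_lt_compat.
Qed.

Definition gamma_int (y : R) (u : R) : R := Rpower u (y - 1) * exp (- u).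

Lemma gamma_int_cont (y u : R) : 0 < u -> continuous (gamma_int y) u.
Proof.
by move=> u0; apply: (ex_derive_continuous (V := R_NormedModule)); rewrite /gamma_int /Rpower; auto_derive.
Qed.

Lemma gamma_int_pos (y u : R) : 0 < gamma_int y u.
Proof. by apply: Rmult_lt_0_compat; exact: exp_pos. Qed.

Lemma ex_gamma_int (y a b : R) : 0 < a -> a <= b -> ex_RInt (gamma_int y) a b.
Proof.
move=> a0 ab; apply: (ex_RInt_continuous (V := R_CompleteNormedModule)) => u.
by rewrite Rmin_left // => hu; apply: gamma_int_cont; lra.
Qed.

Lemma Rpower_exp_le (a u : R) : 0 < a -> 0 < u -> Rpower (1 + u) a <= Rpower a a * exp 1 * exp u.
Proof.
move=> a0 u0.
have h : (1 + u) / a <= exp ((1 + u) / a) by have := exp_ineq1_le ((1 + u) / a); lra.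
have q0 : 0 < (1 + u) / a by apply: Rdiv_lt_0_compat; lra.
have -> : Rpower (1 + u) a = Rpower a a * Rpower ((1 + u) / a) a.
  by rewrite Rpower_mult_distr //; congr (Rpower _ _); field; lra.
rewrite Rmult_assoc; apply: Rmult_le_compat_l; first by left; exact: exp_pos.
rewrite -exp_plus /Rpower; apply: exp_le.
have : ln ((1 + u) / a) <= (1 + u) / a by rewrite -[X in _ <= X]ln_exp; apply: Rcomplements.ln_le.
move=> hl; have : a * ln ((1 + u) / a) <= a * ((1 + u) / a) by apply: Rmult_le_compat_l; lra.
have -> : a * ((1 + u) / a) = 1 + u by field; lra.
by [].
Qed.

Definition GI (y : R) (n : nat) : R := RInt (gamma_int y) (/ INR n.+1) (INR n.+1).

Lemma inv_INR_le (n : nat) : 0 < / INR n.+1 /\ / INR n.+1 <= INR n.+1.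
Proof.
have h := INR_S_pos n; split; first exact: Rinv_0_lt_compat.
by apply: Rle_trans (inv_INR_S_le1 n) (INR_S_ge1 n).
Qed.

Lemma GI_lim (y : R) : 0 < y -> is_lim_seq (GI y) (Gamma y).
Proof.
move=> y0; pose K := Rpower (y + 1) (y + 1) * exp 1.
have K0 : 0 < K by apply: Rmult_lt_0_compat; exact: exp_pos.
apply: (improper_int (M := K / y)).
- by move=> u; exact: gamma_int_cont.
- by move=> u _; left; exact: gamma_int_pos.
move=> a b a0 ab.
(* Domination by a multiple of the derivative of [(u / (1 + u)) ^ y]. *)
pose H u := K / y * Rpower (u / (1 + u)) y.
pose dH u := K * (Rpower (u / (1 + u)) (y - 1) * / ((1 + u) * (1 + u))).
have ih : is_RInt dH a b (H b - H a).
  apply: (is_RInt_derive (V := R_CompleteNormedModule)) => u; rewrite Rmin_left // => hu.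
    have q0 : 0 < u / (1 + u) by apply: Rdiv_lt_0_compat; lra.
    rewrite /H /dH /Rpower; auto_derive; first by repeat split; lra.
    have -> : exp ((y - 1) * ln (u / (1 + u))) = exp (y * ln (u / (1 + u))) * / (u / (1 + u)).
      rewrite -[X in _ * / X]exp_ln // -exp_Ropp -exp_plus; congr exp; ring.
    rewrite /Rdiv; field; lra.
  apply: (ex_derive_continuous (V := R_NormedModule)); rewrite /dH /Rpower; auto_derive.
  have q0 : 0 < u / (1 + u) by apply: Rdiv_lt_0_compat; lra.
  by repeat split; try lra; nra.
have le : RInt (gamma_int y) a b <= H b - H a.
  apply: (is_RInt_le (gamma_int y) dH a b) => //.
    by apply: RInt_correct; exact: ex_gamma_int.
  move=> u hu; have u0 : 0 < u by lra.
  have h := @Rpower_exp_le (y + 1) u ltac:(lra) u0.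
  rewrite /gamma_int /dH.
  have -> : Rpower (u / (1 + u)) (y - 1) = Rpower u (y - 1) * / Rpower (1 + u) (y - 1).
    rewrite /Rpower -exp_Ropp -exp_plus; congr exp.
    by rewrite ln_div; [ring|lra|lra].
  have e2 : Rpower (1 + u) (y + 1) = Rpower (1 + u) (y - 1) * ((1 + u) * (1 + u)).
    have -> : y + 1 = (y - 1) + 1 + 1 by ring.
    by rewrite !Rpower_plus Rpower_1; [ring|lra].
  rewrite e2 in h.
  have p0 : 0 < Rpower u (y - 1) by exact: exp_pos.
  have p1 : 0 < Rpower (1 + u) (y - 1) by exact: exp_pos.
  have p2 : 0 < (1 + u) * (1 + u) by nra.
  have p3 : 0 < Rpower (1 + u) (y - 1) * ((1 + u) * (1 + u)) by exact: Rmult_lt_0_compat.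
  have -> : K * (Rpower u (y - 1) * / Rpower (1 + u) (y - 1) * / ((1 + u) * (1 + u))) =
     Rpower u (y - 1) * (K * / (Rpower (1 + u) (y - 1) * ((1 + u) * (1 + u)))) by field; lra.
  apply: Rmult_le_compat_l; first by lra.
  set P := Rpower (1 + u) (y - 1) * ((1 + u) * (1 + u)) in h p3 *.
  rewrite exp_Ropp; have eu := exp_pos u.
  apply: (Rmult_le_reg_r (P * exp u)); first exact: Rmult_lt_0_compat.
  have -> : / exp u * (P * exp u) = P by field; lra.
  have -> : K * / P * (P * exp u) = K * exp u by field; lra.
  exact: h.
apply: Rle_trans le _.
have h1 : H b <= K / y.
  rewrite /H -[X in _ <= X]Rmult_1_r; apply: Rmult_le_compat_l.
    by left; exact: Rdiv_lt_0_compat.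
  have q0 : 0 < b / (1 + b) by apply: Rdiv_lt_0_compat; lra.
  have q1 : b / (1 + b) <= 1.
    by apply: (Rmult_le_reg_r (1 + b)); [lra|rewrite /Rdiv Rmult_assoc Rinv_l; lra].
  rewrite /Rpower -[X in _ <= X]exp_0; apply: exp_le.
  have : ln (b / (1 + b)) <= 0 by rewrite -ln_1; apply: Rcomplements.ln_le.
  nra.
have : 0 < H a.
  by apply: Rmult_lt_0_compat; [exact: Rdiv_lt_0_compat|exact: exp_pos].
lra.
Qed.

Lemma GI_S (y : R) (n : nat) : GI (y + 1) n = y * GI y n -
  (Rpower (INR n.+1) y * exp (- INR n.+1) - Rpower (/ INR n.+1) y * exp (- / INR n.+1)).
Proof.
have [a0 ab] := inv_INR_le n; set a := / INR n.+1 in a0 ab *; set b := INR n.+1 in ab *.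
have h1 : is_RInt (fun u => y * gamma_int y u - gamma_int (y + 1) u) a b
   (Rpower b y * exp (- b) - Rpower a y * exp (- a)).
  apply: (is_RInt_derive (V := R_CompleteNormedModule) (fun u => Rpower u y * exp (- u))) => u; rewrite Rmin_left // => hu.
    rewrite /gamma_int /Rpower; auto_derive; first by lra.
    have -> : y + 1 - 1 = y by ring.
    have -> : exp ((y - 1) * ln u) = exp (y * ln u) * / u.
      by rewrite -[X in _ * / X]exp_ln -?exp_Ropp -?exp_plus; [congr exp; ring|lra].
    by field; lra.
  by apply: (continuous_minus (V := R_NormedModule));
    [apply: (continuous_scal_r (V := R_NormedModule) y)|]; apply: gamma_int_cont; lra.
apply: is_RInt_unique; rewrite -/a -/b.
apply: (is_RInt_ext (fun u => minus (scal y (gamma_int y u)) (y * gamma_int y u - gamma_int (y + 1) u))).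
  by move=> u _; rewrite /minus /plus /opp /scal /= /mult /=; lra.
apply: (is_RInt_minus (V := R_NormedModule)) h1.
apply: (is_RInt_scal (V := R_NormedModule)); apply: RInt_correct; exact: ex_gamma_int.
Qed.

Lemma boundary_lim (y : R) : 0 < y ->
  is_lim_seq (fun n => Rpower (INR n.+1) y * exp (- INR n.+1) - Rpower (/ INR n.+1) y * exp (- / INR n.+1)) 0.
Proof.
move=> y0; pose K := Rpower (y + 1) (y + 1) * exp 1.
have linv : is_lim_seq (fun n => / INR n.+1) 0.
  have -> : Rbar.Finite 0 = Rbar_inv p_infty by [].
  apply: is_lim_seq_inv => //; apply/(is_lim_seq_incr_1 INR); exact: is_lim_seq_INR.
have l1 : is_lim_seq (fun n => Rpower (INR n.+1) y * exp (- INR n.+1)) 0.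
  have lk : is_lim_seq (fun n => K * / INR n.+1) 0.
    by have := is_lim_seq_scal_l _ K _ linv; rewrite /= Rmult_0_r.
  apply: is_lim_seq_le_le (is_lim_seq_const 0) lk => n.
  have n0 := INR_S_pos n; split; first by left; apply: Rmult_lt_0_compat; exact: exp_pos.
  have h := @Rpower_exp_le (y + 1) _ ltac:(lra) n0.
  have h2 : Rpower (INR n.+1) (y + 1) <= Rpower (1 + INR n.+1) (y + 1).
    by apply: Rle_Rpower_l; lra.
  have e : Rpower (INR n.+1) (y + 1) = Rpower (INR n.+1) y * INR n.+1.
    by rewrite Rpower_plus Rpower_1.
  rewrite e in h2; have h3 := Rle_trans _ _ _ h2 h; have eu := exp_pos (INR n.+1).
  rewrite exp_Ropp; apply: (Rmult_le_reg_r (INR n.+1 * exp (INR n.+1))); first exact: Rmult_lt_0_compat.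
  have -> : Rpower (INR n.+1) y * / exp (INR n.+1) * (INR n.+1 * exp (INR n.+1)) = Rpower (INR n.+1) y * INR n.+1.
    by field; lra.
  have -> : K * / INR n.+1 * (INR n.+1 * exp (INR n.+1)) = K * exp (INR n.+1) by field; lra.
  exact: h3.
have l2 : is_lim_seq (fun n => Rpower (/ INR n.+1) y * exp (- / INR n.+1)) 0.
  have lk : is_lim_seq (fun n => Rpower (/ INR n.+1) y) 0.
    apply: (is_lim_seq_ext (fun n => exp (- y * ln (INR n.+1)))).
      by move=> n; rewrite /Rpower ln_Rinv; [congr exp; ring|exact: INR_S_pos].
    have ll : is_lim_seq (fun n => ln (INR n.+1)) p_infty.
      apply: (filterlim_comp _ _ _ (fun n => INR n.+1) ln _ (Rbar_locally p_infty)); last exact: is_lim_ln_p.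
      by apply/(is_lim_seq_incr_1 INR); exact: is_lim_seq_INR.
    have lm : is_lim_seq (fun n => - y * ln (INR n.+1)) m_infty.
      have := is_lim_seq_scal_l _ (- y) _ ll; rewrite /=.
      by case: Rle_dec => h //; exfalso; lra.
    exact: filterlim_comp lm is_lim_exp_m.
  apply: is_lim_seq_le_le (is_lim_seq_const 0) lk => n.
  split; first by left; apply: Rmult_lt_0_compat; exact: exp_pos.
  rewrite -[X in _ <= X]Rmult_1_r; apply: Rmult_le_compat_l; first by left; exact: exp_pos.
  by left; apply: exp_neg_lt1; case: (inv_INR_le n).
by have := is_lim_seq_minus' _ _ _ _ l1 l2; rewrite Rminus_0_r.
Qed.

Lemma Gamma_S (y : R) : 0 < y -> Gamma (y + 1) = y * Gamma y.
Proof.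
move=> y0; have h1 := @GI_lim (y + 1) ltac:(lra).
have h2 : is_lim_seq (GI (y + 1)) (y * Gamma y).
  have := is_lim_seq_minus' _ _ _ _ (is_lim_seq_scal_l _ y _ (GI_lim y0)) (boundary_lim y0).
  rewrite Rminus_0_r; apply: is_lim_seq_ext => n; by rewrite GI_S.
have := is_lim_seq_unique _ _ h1; rewrite (is_lim_seq_unique _ _ h2).
by case.
Qed.

Lemma Gamma_pos (y : R) : 0 < y -> 0 < Gamma y.
Proof.
move=> y0; have h := proj1 (is_lim_seq_incr_1 _ _) (GI_lim y0).
have i1 : INR 1 = 1 by []. 
have i2 : INR 2 = 2 by [].
have g1 : 0 < RInt (gamma_int y) 1 2.
  apply: RInt_gt_0; first by lra.
    by move=> u _; exact: gamma_int_pos.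
  by move=> u hu; apply: gamma_int_cont; lra.
apply: Rlt_le_trans g1 _; refine (lim_seq_le_R (is_lim_seq_const _) h _) => n.
have n0 := pos_INR n; have n2 : 2 <= INR n.+2 by rewrite !S_INR; lra.
have i0 : 0 < / INR n.+2 by apply: Rinv_0_lt_compat; lra.
have i3 : / INR n.+2 <= 1 by exact: inv_INR_S_le1.
have e : GI y n.+1 = RInt (gamma_int y) (/ INR n.+2) 1 + (RInt (gamma_int y) 1 2 + RInt (gamma_int y) 2 (INR n.+2)).
  rewrite (_ : RInt (gamma_int y) 1 2 + _ = RInt (gamma_int y) 1 (INR n.+2)).
    by rewrite /GI -(RInt_Chasles (gamma_int y) (/ INR n.+2) 1) //; apply: ex_gamma_int; lra.
  by apply: RInt_Chasles; apply: ex_gamma_int; lra.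
have p1 : 0 <= RInt (gamma_int y) (/ INR n.+2) 1.
  by apply: RInt_ge_0 => //; [apply: ex_gamma_int; lra|move=> u _; left; exact: gamma_int_pos].
have p2 : 0 <= RInt (gamma_int y) 2 (INR n.+2).
  by apply: RInt_ge_0 => //; [apply: ex_gamma_int; lra|move=> u _; left; exact: gamma_int_pos].
rewrite e; lra.
Qed.

Lemma Gamma_1 : Gamma 1 = 1.
Proof.
have h := GI_lim Rlt_0_1.
have linv : is_lim_seq (fun n => / INR n.+1) 0.
  have -> : Rbar.Finite 0 = Rbar_inv p_infty by [].
  apply: is_lim_seq_inv => //; apply/(is_lim_seq_incr_1 INR); exact: is_lim_seq_INR.
have h2 : is_lim_seq (GI 1) 1.
  have e n : GI 1 n = exp (- / INR n.+1) - exp (- INR n.+1).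
    have [a0 ab] := inv_INR_le n; apply: is_RInt_unique.
    have -> : exp (- / INR n.+1) - exp (- INR n.+1) = - exp (- INR n.+1) - - exp (- / INR n.+1) by ring.
    apply: (is_RInt_derive (V := R_CompleteNormedModule) (fun u => - exp (- u))) => u; rewrite Rmin_left // => hu.
      rewrite /gamma_int /Rpower Rminus_diag_eq // Rmult_0_l exp_0; auto_derive => //; ring.
    by apply: gamma_int_cont; lra.
  apply: (is_lim_seq_ext (fun n => exp (- / INR n.+1) - exp (- INR n.+1))) => [n|]; first by rewrite e.
  have -> : 1 = 1 - 0 by ring.
  apply: is_lim_seq_minus'.
    have lo : is_lim_seq (fun n => - / INR n.+1) (Rbar.Finite (- 0)) by exact: (proj1 (is_lim_seq_opp _ _) linv).
    have := is_lim_seq_continuous exp _ _ _ lo.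
    by rewrite Ropp_0 exp_0; apply; apply: derivable_continuous_pt; exact: derivable_pt_exp.
  have lm : is_lim_seq (fun n => - INR n.+1) m_infty.
    exact: (proj1 (is_lim_seq_opp _ _) (proj1 (is_lim_seq_incr_1 INR p_infty) is_lim_seq_INR)).
  exact: filterlim_comp lm is_lim_exp_m.
have := is_lim_seq_unique _ _ h; rewrite (is_lim_seq_unique _ _ h2).
by case.
Qed.

Lemma exp_mult_convex (t w : R) : 0 <= t <= 1 -> exp (t * w) <= t * exp w + (1 - t).
Proof.
move=> ht; have e0 := exp_pos (t * w).
have h1 : exp (t * w) * (1 + (1 - t) * w) <= exp w.
  have -> : exp w = exp (t * w) * exp ((1 - t) * w) by rewrite -exp_plus; congr exp; ring.
  by apply: Rmult_le_compat_l; [lra|exact: exp_ineq1_le].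
have h2 : exp (t * w) * (1 + - (t * w)) <= 1.
  have e1 : exp (t * w) * exp (- (t * w)) = 1 by rewrite -exp_plus Rplus_opp_r exp_0.
  by rewrite -[X in _ <= X]e1; apply: Rmult_le_compat_l; [lra|exact: exp_ineq1_le].
have : t * (exp (t * w) * (1 + (1 - t) * w)) <= t * exp w by apply: Rmult_le_compat_l; lra.
have : (1 - t) * (exp (t * w) * (1 + - (t * w))) <= (1 - t) * 1 by apply: Rmult_le_compat_l; lra.
nra.
Qed.

(** Log-convexity in the form that the Bohr-Mollerup argument uses. Under the integral, (u/y)^t <= t
    u/y + (1 - t); the normalisation by [y] makes the two resulting integrals both multiples of
    Gamma y, because Gamma (y + 1) = y Gamma y. *)
Lemma Gamma_add_le (y t : R) : 0 < y -> 0 <= t <= 1 -> Gamma (y + t) <= Rpower y t * Gamma y.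
Proof.
move=> y0 ht.
have l1 := @GI_lim (y + t) ltac:(lra).
have l2 : is_lim_seq (fun n => Rpower y t * ((1 - t) * GI y n + t / y * GI (y + 1) n)) (Rpower y t * Gamma y).
  have -> : Gamma y = (1 - t) * Gamma y + t / y * Gamma (y + 1) by rewrite Gamma_S //; field; lra.
  apply: (is_lim_seq_scal_l _ _ (Rbar.Finite _)); apply: is_lim_seq_plus'.
    exact: (is_lim_seq_scal_l _ _ _ (GI_lim y0)).
  by apply: (is_lim_seq_scal_l _ _ (Rbar.Finite _)); apply: GI_lim; lra.
refine (lim_seq_le_R l1 l2 _) => n; have [a0 ab] := inv_INR_le n.
have e1 := ex_gamma_int y a0 ab; have e2 := ex_gamma_int (y + 1) a0 ab.
apply: (is_RInt_le (gamma_int (y + t)) (fun u => Rpower y t * ((1 - t) * gamma_int y u + t / y * gamma_int (y + 1) u)) _ _ _ _ ab).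
- by apply: RInt_correct; exact: ex_gamma_int.
- apply: (is_RInt_scal (V := R_NormedModule)); apply: (is_RInt_plus (V := R_NormedModule));
    by apply: (is_RInt_scal (V := R_NormedModule)); apply: RInt_correct.
move=> u hu; have u0 : 0 < u by lra.
have h := @exp_mult_convex t (ln (u / y)) ht; rewrite exp_ln in h; last exact: Rdiv_lt_0_compat.
rewrite /gamma_int.
have -> : y + 1 - 1 = (y - 1) + 1 by ring.
have -> : y + t - 1 = (y - 1) + t by ring.
rewrite (Rpower_plus (y - 1) t) (Rpower_plus (y - 1) 1) Rpower_1 //.
have -> : Rpower u t = Rpower y t * exp (t * ln (u / y)).
  by rewrite /Rpower -exp_plus ln_div //; congr exp; ring.
have p : 0 < Rpower y t * Rpower u (y - 1) * exp (- u).
  by apply: Rmult_lt_0_compat; [apply: Rmult_lt_0_compat|]; exact: exp_pos.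
have -> : Rpower u (y - 1) * (Rpower y t * exp (t * ln (u / y))) * exp (- u) =
  Rpower y t * Rpower u (y - 1) * exp (- u) * exp (t * ln (u / y)) by ring.
have -> : Rpower y t * ((1 - t) * (Rpower u (y - 1) * exp (- u)) + t / y * (Rpower u (y - 1) * u * exp (- u))) =
  Rpower y t * Rpower u (y - 1) * exp (- u) * (t * (u / y) + (1 - t)) by field; lra.
by apply: Rmult_le_compat_l; lra.
Qed.

(** * Block series with y = 1 *)

Fixpoint shift_sum (lam : R -> R) (y : R) (n : nat) : R :=
  if n is m.+1 then shift_sum lam y m + lam (y + INR m) else 0.

(** Shifting by the recursion down to 1 and [x], convexity from n + 1 to n + 1 + x gives the upper
    bound [BMU] for f x - f 1, and convexity from n + 1 + x to n + 2 the lower bound [BML]. *)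
Definition BMU (lam : R -> R) (x : R) (n : nat) : R :=
  shift_sum lam 1 n + x * lam (INR n.+1) - shift_sum lam x n.+1.

Definition BML (lam : R -> R) (x : R) (n : nat) : R :=
  BMU lam x n + (1 - x) * (lam (INR n.+1) - lam (x + INR n.+1)).

(* The Bohr-Mollerup estimate: a convex solution of [f (y + 1) = f y + lam y] is pinned down by [lam]. *)
Lemma bohr_mollerup (f lam : R -> R) (x : R) (n : nat) :
  (forall y, 0 < y -> f (y + 1) = f y + lam y) ->
  (forall y t, 0 < y -> 0 <= t <= 1 -> f (y + t) <= f y + t * lam y) -> 0 < x < 1 ->
  BML lam x n <= f x - f 1 <= BMU lam x n.
Proof.
move=> hrec hconv hx.
have sh y m : 0 < y -> f (y + INR m) = f y + shift_sum lam y m.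
  move=> y0; elim: m => [|m IH]; first by rewrite /= /INR !Rplus_0_r.
  have m0 := pos_INR m.
  by rewrite S_INR -Rplus_assoc hrec ?IH /=; lra.
have h1 := sh 1 n Rlt_0_1; have h2 := sh x n.+1 ltac:(lra).
have n0 := INR_S_pos n.
have e1 : 1 + INR n = INR n.+1 by rewrite S_INR; ring.
rewrite e1 in h1.
have c1 := hconv (INR n.+1) x n0 ltac:(lra).
have c2 := hconv (x + INR n.+1) (1 - x) ltac:(lra) ltac:(lra).
have e2 : INR n.+1 + x = x + INR n.+1 by ring.
have e3 : x + INR n.+1 + (1 - x) = INR n.+1 + 1 by ring.
rewrite e2 in c1; rewrite e3 hrec // in c2.
rewrite /BML /BMU; split; lra.
Qed.

Definition Aterm (x r : R) (k : nat) : R :=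
  / INR k.+1 * (exp (- (x * (INR k.+1 * r))) / (1 - exp (- (INR k.+1 * r)))).

(** Expanding the denominators shows that this is minus the logarithm of the q-Pochhammer product of
    the factors 1 - e^(-(x+m) r), m >= 0: up to elementary terms, the logarithm of a q-Gamma
    function. *)
Definition A (x r : R) : R := Series (Aterm x r).

Lemma Aden_pos (r : R) (k : nat) : 0 < r -> 0 < 1 - exp (- r) <= 1 - exp (- (INR k.+1 * r)).
Proof.
move=> r0; have := exp_neg_lt1 r0; have := INR_S_ge1 k => h1 h2; split; first by lra.
have : exp (- (INR k.+1 * r)) <= exp (- r); [apply: exp_le; nra|lra].
Qed.

Lemma Aterm_pos (x r : R) (k : nat) : 0 < r -> 0 < Aterm x r k.
Proof.
move=> r0; have [h1 h2] := Aden_pos k r0; have k0 := INR_S_pos k.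
apply: Rmult_lt_0_compat; first exact: Rinv_0_lt_compat.
by apply: Rdiv_lt_0_compat; [exact: exp_pos|lra].
Qed.

Lemma ex_A (x r : R) : 0 < x -> 0 < r -> ex_series (Aterm x r).
Proof.
move=> x0 r0; pose q := exp (- (x * r)).
have q0 : 0 < q by exact: exp_pos.
have q1 : q < 1 by apply: exp_neg_lt1; exact: Rmult_lt_0_compat.
apply: (ex_series_le (V := R_CompleteNormedModule) _ (fun k => (q / (1 - exp (- r))) * q ^ k)).
  move=> k; have [h1 h2] := Aden_pos k r0; have k0 := INR_S_pos k.
  rewrite /norm /= /abs /= Rabs_pos_eq; last by left; exact: Aterm_pos.
  have -> : q / (1 - exp (- r)) * q ^ k = 1 * (exp (- (x * (INR k.+1 * r))) / (1 - exp (- r))).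
    have -> : exp (- (x * (INR k.+1 * r))) = q ^ k.+1 by rewrite /q exp_pow; congr exp; ring.
    by rewrite /= ; field; lra.
  apply: Rmult_le_compat; first by left; exact: Rinv_0_lt_compat.
  - by apply: Rmult_le_pos; [left; exact: exp_pos|left; apply: Rinv_0_lt_compat; lra].
  - exact: inv_INR_S_le1.
  apply: Rmult_le_compat_l; first by left; exact: exp_pos.
  by apply: Rinv_le_contravar.
apply: (ex_series_scal_l (q / (1 - exp (- r)))); apply: ex_series_geom; rewrite Rabs_pos_eq; lra.
Qed.

Lemma log_series (u : R) : 0 < u ->
  is_series (fun k => / INR k.+1 * exp (- (INR k.+1 * u))) (- ln (1 - exp (- u))).
Proof.
move=> u0; have e0 := exp_pos (- u); have e1 := exp_neg_lt1 u0.
have y1 : Cmod (RtoC (exp (- u))) < 1 by rewrite Cmod_pos; lra.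
have := is_cser_Re (is_cser_log1m y1).
have -> : Re (log1m (RtoC (exp (- u)))) = - ln (1 - exp (- u)).
  by rewrite /log1m /= -RtoC_minus Cmod_pos //; lra.
apply: is_series_ext => k; rewrite -RtoC_pow exp_pow -RtoC_div; last by have := INR_S_pos k; lra.
by rewrite /= Ropp_mult_distr_r_reverse /Rdiv Rmult_comm.
Qed.

Lemma A_rec (x r : R) : 0 < x -> 0 < r -> A (x + 1) r = A x r + ln (1 - exp (- (x * r))).
Proof.
move=> x0 r0; have xr : 0 < x * r by exact: Rmult_lt_0_compat.
have h1 := Series_correct _ (ex_A x0 r0).
have h2 := @is_series_minus _ R_NormedModule _ _ _ _ h1 (log_series xr).
have -> : A x r + ln (1 - exp (- (x * r))) = minus (A x r) (- ln (1 - exp (- (x * r)))).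
  by rewrite /minus /plus /opp /=; ring.
apply: is_series_unique; apply: is_series_ext h2 => k.
have [d1 d2] := Aden_pos k r0; have k0 := INR_S_pos k.
rewrite /minus /plus /opp /= /Aterm.
have -> : exp (- ((x + 1) * (INR k.+1 * r))) = exp (- (x * (INR k.+1 * r))) * exp (- (INR k.+1 * r)).
  by rewrite -exp_plus; congr exp; ring.
have -> : INR k.+1 * (x * r) = x * (INR k.+1 * r) by ring.
by field; lra.
Qed.

Lemma A_conv (y t r : R) : 0 < y -> 0 <= t <= 1 -> 0 < r ->
  A (y + t) r <= (1 - t) * A y r + t * A (y + 1) r.
Proof.
move=> y0 ht r0; have y1 : 0 < y + 1 by lra. have yt : 0 < y + t by lra.
have h1 := ex_A y0 r0; have h2 := ex_A y1 r0.
rewrite /A -!Series_scal_l -Series_plus; try by apply: (ex_series_scal_l (V := R_NormedModule)).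
apply: Series_le => [k|]; last first.
  by apply: (ex_series_plus (V := R_NormedModule)); apply: (ex_series_scal_l (V := R_NormedModule)).
split; first by left; exact: Aterm_pos.
have [d1 d2] := Aden_pos k r0; have k0 := INR_S_pos k.
have h := @exp_mult_convex t (- (INR k.+1 * r)) ht.
rewrite /Aterm; set d := 1 - exp (- (INR k.+1 * r)) in d2 *.
have -> : exp (- ((y + t) * (INR k.+1 * r))) = exp (- (y * (INR k.+1 * r))) * exp (t * - (INR k.+1 * r)).
  by rewrite -exp_plus; congr exp; ring.
have -> : exp (- ((y + 1) * (INR k.+1 * r))) = exp (- (y * (INR k.+1 * r))) * exp (- (INR k.+1 * r)).
  by rewrite -exp_plus; congr exp; ring.
set E := exp (- (y * _)); have E0 : 0 < E by exact: exp_pos.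
have -> : (1 - t) * (/ INR k.+1 * (E / d)) + t * (/ INR k.+1 * (E * exp (- (INR k.+1 * r)) / d)) =
  / INR k.+1 * (E * (t * exp (- (INR k.+1 * r)) + (1 - t)) / d) by field; lra.
apply: Rmult_le_compat_l; first by left; exact: Rinv_0_lt_compat.
apply: Rmult_le_compat_r; first by left; apply: Rinv_0_lt_compat; lra.
by apply: Rmult_le_compat_l; lra.
Qed.

(** With e = e^(-k r/2), this is e/(1 - e) = (e + e^2)/(1 - e^2) term by term. It relates A 1 at r/2
    and at r, and so determines the constant that the recursion in [x] leaves open. *)
Lemma A_duplication (r : R) : 0 < r -> A 1 (r / 2) = A (/ 2) r + A 1 r.
Proof.
move=> r0; have h1 := ex_A Rlt_0_1 r0; have h2 := @ex_A (/ 2) r ltac:(lra) r0.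
rewrite /A -Series_plus //; apply: Series_ext => k; rewrite /Aterm.
have k0 := INR_S_pos k.
set e := exp (- (INR k.+1 * (r / 2))).
have e0 : 0 < e by exact: exp_pos.
have e1 : e < 1 by apply: exp_neg_lt1; apply: Rmult_lt_0_compat; lra.
have -> : exp (- (/ 2 * (INR k.+1 * r))) = e by rewrite /e; congr exp; field.
have -> : exp (- (INR k.+1 * r)) = e * e by rewrite /e -exp_plus; congr exp; field.
have -> : exp (- (1 * (INR k.+1 * (r / 2)))) = e by rewrite /e; congr exp; field.
have -> : exp (- (1 * (INR k.+1 * r))) = e * e by rewrite /e -exp_plus; congr exp; field.
by field; repeat split; nra.
Qed.

(** The increment in y of A y r - y ln r; it tends to ln y, the increment of ln Gamma, as r tends to
    0. *)
Definition lamr (r y : R) : R := ln ((1 - exp (- (y * r))) / r).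

Lemma lamr_ln (r y : R) : 0 < r -> 0 < y -> ln y - y * r <= lamr r y <= ln y.
Proof.
move=> r0 y0; have yr : 0 < y * r by exact: Rmult_lt_0_compat.
have h1 := exp_ineq1_le (- (y * r)); have h2 := exp_neg_lt1 yr.
have q0 : 0 < (1 - exp (- (y * r))) / r by apply: Rdiv_lt_0_compat; lra.
have h3 : exp (- (y * r)) <= / (1 + y * r).
  by rewrite exp_Ropp; apply: Rinv_le_contravar; [lra|exact: exp_ineq1_le].
have h4 : y * exp (- (y * r)) <= (1 - exp (- (y * r))) / r.
  apply: (Rmult_le_reg_r r) => //.
  have -> : (1 - exp (- (y * r))) / r * r = 1 - exp (- (y * r)) by field; lra.
  have e : exp (- (y * r)) * (1 + y * r) <= 1.
    by rewrite -[X in _ <= X](Rinv_l (1 + y * r)); [apply: Rmult_le_compat_r; lra|lra].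
  lra.
split.
  have -> : ln y - y * r = ln (y * exp (- (y * r))).
    by rewrite ln_mult ?ln_exp //; try exact: exp_pos; ring.
  by apply: Rcomplements.ln_le => //; apply: Rmult_lt_0_compat => //; exact: exp_pos.
apply: Rcomplements.ln_le => //; apply: (Rmult_le_reg_r r) => //.
rewrite /Rdiv Rmult_assoc Rinv_l; lra.
Qed.

Lemma shift_sum_lamr (r y : R) (n : nat) : 0 < r -> 0 < y ->
  shift_sum ln y n - r * shift_sum id y n <= shift_sum (lamr r) y n <= shift_sum ln y n.
Proof.
move=> r0 y0; elim: n => [|n IH] /=; first by lra.
have h := @lamr_ln r (y + INR n) r0; have := pos_INR n => n0.
have := h ltac:(lra); lra.
Qed.

Lemma BM_lamr (x : R) (n : nat) : 0 < x < 1 -> exists K, 0 < K /\ forall r, 0 < r ->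
  BML ln x n - K * r <= BML (lamr r) x n /\ BMU (lamr r) x n <= BMU ln x n + K * r.
Proof.
move=> hx; have n0 := INR_S_pos n.
have sp y m : 0 < y -> 0 <= shift_sum id y m.
  by move=> y0; elim: m => [|m IH] /=; [lra|have := pos_INR m; lra].
exists (shift_sum id 1 n + shift_sum id x n.+1 + 2 * (INR n.+1 + x)).
split; first by have := sp 1 n Rlt_0_1; have := sp x n.+1 ltac:(lra); lra.
move=> r r0.
have s1 := shift_sum_lamr n r0 Rlt_0_1.
have s2 := @shift_sum_lamr r x n.+1 r0 ltac:(lra).
have l1 := lamr_ln r0 n0; have l2 := @lamr_ln r (x + INR n.+1) r0 ltac:(lra).
have p1 := sp 1 n Rlt_0_1; have p2 := sp x n.+1 ltac:(lra).
have q1 : 0 <= r * shift_sum id 1 n by apply: Rmult_le_pos; lra.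
have q2 : 0 <= r * shift_sum id x n.+1 by apply: Rmult_le_pos; lra.
have q3 : 0 < INR n.+1 * r by exact: Rmult_lt_0_compat.
have q4 : 0 < (x + INR n.+1) * r by apply: Rmult_lt_0_compat; lra.
have q5 : 0 < x * r by apply: Rmult_lt_0_compat; lra.
have m1 : x * (ln (INR n.+1) - INR n.+1 * r) <= x * lamr r (INR n.+1) by apply: Rmult_le_compat_l; lra.
have m2 : x * lamr r (INR n.+1) <= x * ln (INR n.+1) by apply: Rmult_le_compat_l; lra.
have m3 : (1 - x) * (ln (INR n.+1) - INR n.+1 * r) <= (1 - x) * lamr r (INR n.+1) by apply: Rmult_le_compat_l; lra.
have m4 : (1 - x) * lamr r (x + INR n.+1) <= (1 - x) * ln (x + INR n.+1) by apply: Rmult_le_compat_l; lra.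
rewrite /BML /BMU; split; lra.
Qed.

Lemma BM_ln_gap (x : R) (n : nat) : 0 < x < 1 -> BMU ln x n - BML ln x n <= / INR n.+1.
Proof.
move=> hx; have n0 := INR_S_pos n; rewrite /BML.
have h : ln (x + INR n.+1) - ln (INR n.+1) <= / INR n.+1.
  rewrite -ln_div; [|lra|lra].
  have e : (x + INR n.+1) / INR n.+1 = 1 + x / INR n.+1 by field; lra.
  have i0 : 0 < x / INR n.+1 by apply: Rdiv_lt_0_compat; lra.
  rewrite e; apply: Rle_trans (_ : x / INR n.+1 <= _).
    rewrite -[X in _ <= X]ln_exp; apply: Rcomplements.ln_le; first by lra.
    exact: exp_ineq1_le.
  rewrite -[X in _ <= X]Rmult_1_l; apply: Rmult_le_compat_r; last by lra.
  by left; exact: Rinv_0_lt_compat.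
have i0 : 0 < / INR n.+1 by exact: Rinv_0_lt_compat.
nra.
Qed.

Lemma BM_Gamma (x : R) (n : nat) : 0 < x < 1 -> BML ln x n <= ln (Gamma x) <= BMU ln x n.
Proof.
move=> hx; have h := @bohr_mollerup (fun y => ln (Gamma y)) ln x n.
rewrite Gamma_1 ln_1 Rminus_0_r in h; apply: h => //.
  move=> y y0; rewrite Gamma_S // ln_mult //; [lra|exact: Gamma_pos].
move=> y t y0 ht; have g0 := Gamma_pos y0.
have -> : ln (Gamma y) + t * ln y = ln (Rpower y t * Gamma y).
  by rewrite ln_mult //; [rewrite /Rpower ln_exp; ring|exact: exp_pos].
apply: Rcomplements.ln_le; first by apply: Gamma_pos; lra.
exact: Gamma_add_le.
Qed.

(** The order of the limits matters: [N] is fixed first so that the Bohr-Mollerup bounds for ln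
    Gamma are within e/2 of each other; for that [N], the bounds built from [lamr r] differ from
    them by at most K r. *)
Lemma A_Gamma (x e : R) : 0 < x < 1 -> 0 < e -> exists d, 0 < d /\ forall r, 0 < r < d ->
  Rabs (A x r - A 1 r + (1 - x) * ln r - ln (Gamma x)) < e.
Proof.
move=> hx e0.
have [N [hN0 hN]] : exists N : nat, / INR N.+1 < e / 2 /\ True.
  have [N] := nfloor_ex (/ (e / 2)) ltac:(left; apply: Rinv_0_lt_compat; lra).
  move=> hN; exists N; split=> //; rewrite -(Rinv_inv (e / 2)); apply: Rinv_lt_contravar.
    by apply: Rmult_lt_0_compat; [apply: Rinv_0_lt_compat; lra|exact: INR_S_pos].
  by rewrite S_INR; lra.
have [K [K0 hK]] := BM_lamr N hx.
exists (e / 2 / K); split; first by apply: Rdiv_lt_0_compat; lra.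
move=> r hr; have r0 : 0 < r by lra.
have hKr : K * r < e / 2.
  have : K * r < K * (e / 2 / K) by apply: Rmult_lt_compat_l; lra.
  by have -> : K * (e / 2 / K) = e / 2 by field; lra.
have [k1 k2] := hK r r0; have g := BM_Gamma N hx; have gap := BM_ln_gap N hx.
have := @bohr_mollerup (fun y => A y r - y * ln r) (lamr r) x N _ _ hx.
have lr y : 0 < y -> lamr r y = ln (1 - exp (- (y * r))) - ln r.
  move=> y0; rewrite /lamr ln_div //.
  by have := @exp_neg_lt1 (y * r) (Rmult_lt_0_compat _ _ y0 r0); lra.
case.
- by move=> y y0; rewrite A_rec // lr //; ring.
- move=> y t y0 ht; have := A_conv y0 ht r0; rewrite A_rec // lr //.
  move=> h; have -> : A y r - y * ln r + t * (ln (1 - exp (- (y * r))) - ln r) =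
    ((1 - t) * A y r + t * (A y r + ln (1 - exp (- (y * r))))) - (y + t) * ln r by ring.
  lra.
move=> b1 b2.
have -> : A x r - A 1 r + (1 - x) * ln r = A x r - x * ln r - (A 1 r - 1 * ln r) by ring.
by apply: Rabs_def1; lra.
Qed.

(** * The block series with y = 1 near the positive axis *)

Lemma cone_real (U r : R) : 0 <= U -> 0 < r -> cone U (RtoC r).
Proof. by move=> U0 r0; split=> //=; rewrite Rabs_R0; nra. Qed.

Lemma A_psum (x r : R) : 0 < x <= 1 -> 0 < r -> RtoC (A x r) = (Li2 1 / RtoC r + psum 1 x (RtoC r))%C.
Proof.
move=> hx r0; have h11 : Cmod 1 <= 1 by rewrite Cmod_1; lra.
have hb := is_cser_block h11 hx (Rle_refl 0) (cone_real (Rle_refl 0) r0).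
rewrite -(CSeries_unique hb); symmetry; apply: CSeries_unique.
have e k : block_term 1 x (RtoC r) k = RtoC (Aterm x r k).
  have [d1 d2] := Aden_pos k r0; have k0 := INR_S_pos k.
  rewrite /block_term /Aterm Cpow_1_l RtoC_mult RtoC_invE RtoC_div; last by lra.
  rewrite RtoC_minus -!Cexp_real !RtoC_opp !RtoC_mult.
  by rewrite /Cdiv Cmult_1_l.
apply: is_cser_ext (fun k => esym (e k)) _; apply: is_cser_pair => /=.
  by apply: Series_correct; apply: ex_A; lra.
apply: is_series_lim; apply: is_lim_seq_ext (is_lim_seq_const 0) => n.
elim: n => [|n IH]; first by rewrite sum_O.
by rewrite sum_Sn -IH /plus /=; ring.
Qed.

(** A Riemann sum of 1/(1 + u)^2 over the half-line, bounded uniformly in the mesh r. *)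
Lemma telescope_sq (r : R) : 0 < r ->
  ex_series (fun k => r * / ((1 + INR k.+1 * r) * (1 + INR k.+1 * r))) /\
  Series (fun k => r * / ((1 + INR k.+1 * r) * (1 + INR k.+1 * r))) <= 1.
Proof.
move=> r0; have e : 1 = / (1 + INR 0 * r) by rewrite /INR; field.
rewrite [X in _ /\ _ <= X]e.
apply: (series_telescope (b := fun k => / (1 + INR k * r))) => k; last first.
  by left; apply: Rinv_0_lt_compat; have := pos_INR k; nra.
have k0 := pos_INR k; rewrite S_INR; set y := INR k in k0 *.
have p1 : 0 < 1 + y * r by nra.
have p2 : 0 < 1 + (y + 1) * r by nra.
split; first by apply: Rmult_le_pos; [lra|left; apply: Rinv_0_lt_compat; nra].
have -> : / (1 + y * r) - / (1 + (y + 1) * r) = r * / ((1 + y * r) * (1 + (y + 1) * r)) by field; lra.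
apply: Rmult_le_compat_l; first by lra.
by apply: Rinv_le_contravar; nra.
Qed.

Lemma psum1_real_diff (x U : R) : 0 < x <= 1 -> 0 <= U -> exists D, 0 < D /\ forall s, cone U s ->
  Cmod (psum 1 x s - psum 1 x (RtoC (Re s)))%C <= D * (Rabs (Im s) / Re s).
Proof.
move=> hx U0; have [D [D0 hD]] := psi_lip hx U0; exists D; split=> // s cs.
have [r0 _] := cs; have h11 : Cmod 1 <= 1 by rewrite Cmod_1; lra.
have cr := cone_real U0 r0.
have h := is_cser_minus (is_cser_psum h11 hx U0 cs) (is_cser_psum h11 hx U0 cr).
have [ex tl] := telescope_sq r0.
apply: Rle_trans (_ : D * (Rabs (Im s) / Re s) * 1 <= _); last by lra.
apply: Rle_trans (Rmult_le_compat_l _ _ _ _ tl); last first.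
  apply: Rmult_le_pos; first by lra.
  by apply: Rmult_le_pos; [exact: Rabs_pos|left; exact: Rinv_0_lt_compat].
rewrite -Series_scal_l.
have bound k : Cmod (Cpow 1 k.+1 / RtoC (INR k.+1) * psi x (RtoC (INR k.+1) * s) -
   Cpow 1 k.+1 / RtoC (INR k.+1) * psi x (RtoC (INR k.+1) * RtoC (Re s)))%C <=
   D * (Rabs (Im s) / Re s) * (Re s * / ((1 + INR k.+1 * Re s) * (1 + INR k.+1 * Re s))).
  have k0 := INR_S_pos k; have ck := cone_scal k0 cs; have ckr := cone_scal k0 cr.
  have -> : (Cpow 1 k.+1 / RtoC (INR k.+1) * psi x (RtoC (INR k.+1) * s) -
    Cpow 1 k.+1 / RtoC (INR k.+1) * psi x (RtoC (INR k.+1) * RtoC (Re s)) =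
    RtoC (/ INR k.+1) * (psi x (RtoC (INR k.+1) * s) - psi x (RtoC (INR k.+1) * RtoC (Re s))))%C.
    by rewrite Cpow_1_l RtoC_invE /Cdiv; ring.
  rewrite Cmod_mult Cmod_pos; last by left; exact: Rinv_0_lt_compat.
  have kr : 0 < INR k.+1 * Re s by exact: Rmult_lt_0_compat.
  have := hD _ _ (INR k.+1 * Re s) ck ckr; rewrite !Re_scal /= => h1.
  have h2 := h1 (Rlt_le _ _ kr) (Rle_refl _) (Rle_refl _) (or_introl erefl).
  have e1 : Cmod (RtoC (INR k.+1) * s - RtoC (INR k.+1) * RtoC (Re s))%C = INR k.+1 * Rabs (Im s).
    have -> : (RtoC (INR k.+1) * s - RtoC (INR k.+1) * RtoC (Re s) = RtoC (INR k.+1 * Im s) * Ci)%C.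
      by apply: C_ext; rewrite /Re /Im /=; ring.
    by rewrite Cmod_mult Cmod_Ci Cmod_R Rmult_1_r Rabs_mult Rabs_pos_eq; lra.
  rewrite e1 in h2.
  apply: Rle_trans (Rmult_le_compat_l _ _ _ _ h2) _; first by left; exact: Rinv_0_lt_compat.
  right; field; split; [|split]; nra.
apply: (Cmod_cser_le h bound); apply: Series_correct.
by apply: (ex_series_scal_l (D * (Rabs (Im s) / Re s))).
Qed.

Lemma Li2_1_real : Im (Li2 1) = 0.
Proof.
have h11 : Cmod 1 <= 1 by rewrite Cmod_1; lra.
have h := is_series_unique _ _ (is_cser_Im (is_cser_Li2 h11)); rewrite -h.
apply: is_series_unique; apply: is_series_lim; apply: is_lim_seq_ext (is_lim_seq_const 0) => n.
have e k : Im (Cpow 1 k.+1 / RtoC (INR k.+1 * INR k.+1))%C = 0.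
  rewrite Cpow_1_l -RtoC_div //; have := INR_S_pos k; nra.
elim: n => [|n IH]; first by rewrite sum_O e.
by rewrite sum_Sn -IH e /plus /=; ring.
Qed.

Lemma RtoC_Re (z : C) : Im z = 0 -> RtoC (Re z) = z.
Proof. by move=> h; apply: C_ext. Qed.

Definition dlt (r : R) : R := A 1 r - Re (Li2 1) / r - / 2 * ln r.

(** For x = 1 the kernel [psi] has the value -1/2 at 0, which is not summable against 1/k. Adding
    e^(-u)/2 cancels it and leaves O(u/(1 + u)^2); the added series is -(1/2) ln (1 - e^(-r)), that
    is -(1/2) ln r up to a bounded term. *)
Lemma dlt_bounded : exists B, forall r, 0 < r <= 1 -> Rabs (dlt r) <= B.
Proof.
have hx : 0 < 1 <= 1 by lra.
have [D1 [D10 hD1]] := psi_decay hx (Rle_refl 0).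
have [D2 [D20 hD2]] := psi_at_0 hx (Rle_refl 0).
pose K := 4 * (D1 + D2 + 1).
have h11 : Cmod 1 <= 1 by rewrite Cmod_1; lra.
exists (K + 1) => r hr; have r0 : 0 < r by lra.
have cr := cone_real (Rle_refl 0) r0.
have hp := is_cser_psum h11 hx (Rle_refl 0) cr.
have y1 : Cmod (RtoC (exp (- r))) < 1 by rewrite Cmod_pos; [exact: exp_neg_lt1|left; exact: exp_pos].
have hl := @is_cser_Cmult (RtoC (/ 2)) _ _ (is_cser_log1m y1).
have h := is_cser_plus hp hl.
have [ex tl] := telescope_sq r0.
have bound k : Cmod (Cpow 1 k.+1 / RtoC (INR k.+1) * psi 1 (RtoC (INR k.+1) * RtoC r) +
   RtoC (/ 2) * (Cpow (RtoC (exp (- r))) k.+1 / RtoC (INR k.+1)))%C <=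
   K * (r * / ((1 + INR k.+1 * r) * (1 + INR k.+1 * r))).
  have k0 := INR_S_pos k; have ck := cone_scal k0 cr.
  set u := INR k.+1 * r; have u0 : 0 < u by exact: Rmult_lt_0_compat.
  rewrite -RtoC_mult -/u in ck *.
  have -> : (Cpow 1 k.+1 / RtoC (INR k.+1) * psi 1 (RtoC u) +
     RtoC (/ 2) * (Cpow (RtoC (exp (- r))) k.+1 / RtoC (INR k.+1)) =
     RtoC (/ INR k.+1) * (psi 1 (RtoC u) + RtoC (/ 2 * exp (- u))))%C.
    rewrite Cpow_1_l -RtoC_pow exp_pow Ropp_mult_distr_r_reverse -/u RtoC_mult !RtoC_invE /Cdiv; ring.
  rewrite Cmod_mult Cmod_pos; last by left; exact: Rinv_0_lt_compat.
  have hk : Cmod (psi 1 (RtoC u) + RtoC (/ 2 * exp (- u)))%C <= K * (u * / ((1 + u) * (1 + u))).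
    have e1 := exp_neg_lt1 u0; have e2 := exp_ineq1_le (- u); have e3 := exp_pos (- u).
    have i1 : 0 < / ((1 + u) * (1 + u)) by apply: Rinv_0_lt_compat; nra.
    case: (Rle_dec u 1) => hu.
      have -> : (psi 1 (RtoC u) + RtoC (/ 2 * exp (- u)) =
        (psi 1 (RtoC u) - RtoC (/ 2 - 1)) + RtoC (- (/ 2 * (1 - exp (- u)))))%C.
        have e4 : RtoC (/ 2 * exp (- u)) = (RtoC (- (/ 2 * (1 - exp (- u)))) - RtoC (/ 2 - 1))%C.
          by rewrite -RtoC_minus; congr RtoC; field.
        by rewrite e4; ring.
      apply: Rle_trans (Cmod_triangle _ _) _; rewrite Cmod_R Rabs_Ropp Rabs_pos_eq; last by lra.
      have := hD2 _ ck; rewrite Cmod_pos; last by lra.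
      move=> h1; have i2 : / 4 <= / ((1 + u) * (1 + u)) by apply: Rinv_le_contravar; nra.
      have : K * (u * / 4) <= K * (u * / ((1 + u) * (1 + u))).
        by apply: Rmult_le_compat_l; [rewrite /K; lra|apply: Rmult_le_compat_l; lra].
      have : (D1 + D2 + 1) * u = K * (u * / 4) by rewrite /K; field.
      have : 0 < D1 * u by exact: Rmult_lt_0_compat.
      lra.
    apply: Rle_trans (Cmod_triangle _ _) _; rewrite Cmod_pos; last by lra.
    have h1 := hD1 _ ck; rewrite /= in h1.
    have h2 : exp (- u) <= / (1 + u).
      by rewrite exp_Ropp; apply: Rinv_le_contravar; [lra|exact: exp_ineq1_le].
    have h3 : / (1 + u) <= 2 * (u * / ((1 + u) * (1 + u))).
      have -> : 2 * (u * / ((1 + u) * (1 + u))) = / (1 + u) * (2 * u / (1 + u)) by field; lra.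
      rewrite -[X in X <= _]Rmult_1_r; apply: Rmult_le_compat_l; first by left; apply: Rinv_0_lt_compat; lra.
      by apply: (Rmult_le_reg_r (1 + u)); [lra|rewrite /Rdiv Rmult_assoc Rinv_l; lra].
    have p : 0 <= u * / ((1 + u) * (1 + u)) by apply: Rmult_le_pos; lra.
    have : (D1 + 1) * / (1 + u) <= (D1 + 1) * (2 * (u * / ((1 + u) * (1 + u)))) by apply: Rmult_le_compat_l; lra.
    have : 0 <= D2 * (u * / ((1 + u) * (1 + u))) by apply: Rmult_le_pos; lra.
    have : 0 <= D1 * (u * / ((1 + u) * (1 + u))) by apply: Rmult_le_pos; lra.
    rewrite /K; lra.
  apply: Rle_trans (Rmult_le_compat_l _ _ _ _ hk) _; first by left; exact: Rinv_0_lt_compat.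
  by right; rewrite /u; field; split; nra.
have exK := ex_series_scal_l K _ ex.
have := Cmod_cser_le h bound (Series_correct _ exK); rewrite Series_scal_l => hc.
have K0 : 0 < K by rewrite /K; lra.
have {}hc : Cmod (psum 1 1 (RtoC r) + RtoC (/ 2) * log1m (RtoC (exp (- r))))%C <= K.
  by apply: Rle_trans hc _; rewrite -[X in _ <= X]Rmult_1_r; apply: Rmult_le_compat_l; lra.
have := Rle_trans _ _ _ (re_le_Cmod _) hc.
have -> : psum 1 1 (RtoC r) = RtoC (A 1 r - Re (Li2 1) / r).
  rewrite RtoC_minus A_psum // RtoC_div; last by lra.
  by rewrite (RtoC_Re Li2_1_real); ring.
have l1 := @lamr_ln r 1 r0 Rlt_0_1; rewrite ln_1 /lamr Rmult_1_l in l1.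
have e1 := exp_neg_lt1 r0.
rewrite ln_div in l1; try lra.
set X := A 1 r - _.
have -> : Re (RtoC X + RtoC (/ 2) * log1m (RtoC (exp (- r))))%C = X - / 2 * ln (1 - exp (- r)).
  by rewrite !ReImE /= -RtoC_minus Cmod_pos; [ring|lra].
rewrite /dlt -/X; split_Rabs; lra.
Qed.

(** By duplication, dlt r + c is half of its value at r/2, up to an error below e/4. Iterating n
    times, boundedness gives (B + |c|) / 2^n + e/2. The constant is (1/2) ln (2 pi), as in the
    transformation of the eta function. *)
Lemma dlt_lim (e : R) : 0 < e -> exists d, 0 < d /\ forall r, 0 < r < d ->
  Rabs (dlt r + (ln (Gamma (/ 2)) + / 2 * ln 2)) < e.
Proof.
move=> e0; have [B hB] := dlt_bounded.
set c := ln (Gamma (/ 2)) + / 2 * ln 2.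
have [d [d0 hd]] := @A_Gamma (/ 2) (e / 2) ltac:(lra) ltac:(lra).
have m0 : 0 < Rmin d 1 by apply: Rmin_glb_lt; lra.
exists (Rmin d 1); split=> // r hr.
have m1 := Rmin_l d 1; have m2 := Rmin_r d 1.
have fe s : 0 < s -> dlt s + c = / 2 * (dlt (s / 2) + c) -
    / 2 * (A (/ 2) s - A 1 s + (1 - / 2) * ln s - ln (Gamma (/ 2))).
  move=> s0; rewrite /dlt A_duplication // /c ln_div //; [field; lra|lra].
have iter n : forall s, 0 < s < Rmin d 1 -> Rabs (dlt s + c) <= (B + Rabs c) * (/ 2) ^ n + e / 2.
  elim: n => [|n IH] s hs.
    rewrite /= Rmult_1_r; apply: Rle_trans (Rabs_triang _ _) _.
    by have := hB s ltac:(lra); lra.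
  rewrite fe; last by lra.
  have h1 := IH (s / 2) ltac:(lra); have h2 := hd s ltac:(lra).
  apply: Rle_trans (Rabs_triang _ _) _; rewrite Rabs_Ropp !Rabs_mult (Rabs_pos_eq (/ 2)) /=; lra.
have lim : is_lim_seq (fun n => (B + Rabs c) * (/ 2) ^ n + e / 2) (e / 2).
  have g : is_lim_seq (fun n => (/ 2) ^ n) 0 by apply: is_lim_seq_geom; rewrite Rabs_pos_eq; lra.
  have := is_lim_seq_plus' _ _ _ _ (is_lim_seq_scal_l _ (B + Rabs c) _ g) (is_lim_seq_const (e / 2)).
  by rewrite Rmult_0_r Rplus_0_l.
have : Rabs (dlt r + c) <= e / 2; last by lra.
by refine (lim_seq_le_R (is_lim_seq_const _) lim _) => n; apply: iter; lra.
Qed.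

Lemma psum1_lim (x e : R) : 0 < x < 1 -> 0 < e -> exists d, 0 < d /\ forall r, 0 < r < d ->
  Cmod (psum 1 x (RtoC r) - RtoC ((x - / 2) * ln r + (ln (Gamma x) - (ln (Gamma (/ 2)) + / 2 * ln 2))))%C < e.
Proof.
move=> hx e0.
have [d1 [d10 h1]] := @A_Gamma x (e / 2) hx ltac:(lra).
have [d2 [d20 h2]] := @dlt_lim (e / 2) ltac:(lra).
exists (Rmin d1 d2); split; first by apply: Rmin_glb_lt.
move=> r hr; have m1 := Rmin_l d1 d2; have m2 := Rmin_r d1 d2.
have q1 := h1 r ltac:(lra); have q2 := h2 r ltac:(lra).
have -> : psum 1 x (RtoC r) = RtoC (A x r - Re (Li2 1) / r).
  rewrite RtoC_minus A_psum ?RtoC_div ?(RtoC_Re Li2_1_real); [ring|lra|lra|lra].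
rewrite -RtoC_minus Cmod_R.
set c := _ + / 2 * ln 2 in q2 *.
have -> : A x r - Re (Li2 1) / r - ((x - / 2) * ln r + (ln (Gamma x) - c)) =
  (A x r - A 1 r + (1 - x) * ln r - ln (Gamma x)) + (dlt r + c) by rewrite /dlt; field; lra.
by apply: Rle_lt_trans (Rabs_triang _ _) _; lra.
Qed.

(** * Complex Gaussian integrals *)

Lemma Re_mult_RtoC (z : C) (x : R) : Re (z * RtoC x)%C = Re z * x.
Proof. by rewrite Re_mult /= Rmult_0_r Rminus_0_r. Qed.

Lemma RInt_Cexp (s : C) : is_RIntC (fun t => s * Cexp (RtoC t * s))%C 0 1 (Cexp s - 1)%C.
Proof.
have h := @is_RInt_derive C_R_CompleteNormedModule (fun t => Cexp (RtoC t * s))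
  (fun t => s * Cexp (RtoC t * s))%C 0 1.
have -> : (Cexp s - 1)%C = minus (Cexp (RtoC 1 * s)) (Cexp (RtoC 0 * s)).
  by rewrite Cmult_1_l Cmult_0_l Cexp_0.
apply: h => t _; last first.
  apply: contC_mult; first exact: contC_const.
  apply: contC_Cexp; apply: contC_mult; last exact: contC_const.
  apply: contC_RtoC; exact: continuous_id.
by apply: is_deriveC; rewrite /Re /Im /=; auto_derive => //; rewrite /Rminus; ring.
Qed.

Lemma Cexp_second_order (z : C) : Cmod (Cexp z - 1 - z)%C <= Cmod z * Cmod z * exp (Cmod z).
Proof.
have h1 : is_RIntC (fun _ => z) 0 1 z.
  have := @is_RInt_const C_R_NormedModule 0 1 z.
  by have -> : scal (V := C_R_NormedModule) (1 - 0) z = z by apply: C_ext; rewrite /Re /Im /= /scal /= /mult /=; ring.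
have h : is_RIntC (fun t => z * (Cexp (RtoC t * z) - 1))%C 0 1 (Cexp z - 1 - z)%C.
  by apply: is_RIntC_ext (@is_RInt_minus C_R_NormedModule _ _ _ _ _ _ (@RInt_Cexp z) h1) => t; ringC.
have := @Cmod_RIntC_le _ 0 1 (Cmod z * Cmod z * exp (Cmod z)) _ Rle_0_1 _ h.
rewrite Rminus_0_r Rmult_1_l; apply => t ht.
rewrite Cmod_mult Rmult_assoc; apply: Rmult_le_compat_l; first exact: Cmod_ge_0.
apply: Rle_trans (Cexp_minus_1_le _) _; have z0 := Cmod_ge_0 z.
have tz : Cmod (RtoC t * z)%C <= Cmod z.
  by rewrite Cmod_mult Cmod_pos; [nra|lra].
apply: Rmult_le_compat => //; [exact: Cmod_ge_0|by left; exact: exp_pos|].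
by apply: exp_le; apply: Rmax_lub => //; apply: Rle_trans (Re_le_Cmod _) tz.
Qed.

(** A function with quadratically small increments has derivative 0. In this form, constancy follows
    by subdivision, without differentiating under an integral sign. *)
Lemma quad_const (f : R -> C) (X K : R) : 0 <= X -> 0 <= K ->
  (forall x y, 0 <= y -> y <= x -> x <= X -> Cmod (f x - f y)%C <= K * ((x - y) * (x - y))) -> f X = f 0.
Proof.
move=> X0 K0 h.
have key (n : nat) : Cmod (f X - f 0)%C <= K * X * X * / INR n.+1.
  pose d := X / INR n.+1; have n0 := INR_S_pos n.
  have d0 : 0 <= d by apply: Rmult_le_pos; [|left; exact: Rinv_0_lt_compat].
  have nd : INR n.+1 * d = X by rewrite /d; field; lra.
  have st m : INR m <= INR n.+1 -> Cmod (f (INR m * d)%R - f 0)%C <= INR m * (K * (d * d)).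
    elim: m => [|m IH] hm.
      have -> : INR 0 * d = 0 by rewrite /INR; ring.
      have -> : (f 0 - f 0 = 0)%C by ring.
      by rewrite Cmod_0 /INR Rmult_0_l; lra.
    rewrite S_INR in hm *; have m0 := pos_INR m.
    have -> : (f ((INR m + 1) * d)%R - f 0 = (f ((INR m + 1) * d)%R - f (INR m * d)%R) + (f (INR m * d)%R - f 0))%C by ring.
    apply: Rle_trans (Cmod_triangle _ _) _.
    have := h ((INR m + 1) * d) (INR m * d) ltac:(nra) ltac:(nra) ltac:(nra).
    have -> : (INR m + 1) * d - INR m * d = d by ring.
    have := IH ltac:(lra); lra.
  have := st n.+1 (Rle_refl _); rewrite nd.
  by have -> : INR n.+1 * (K * (d * d)) = K * X * X * / INR n.+1 by rewrite /d; field; lra.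
have linv : is_lim_seq (fun n => K * X * X * / INR n.+1) 0.
  have l0 : is_lim_seq (fun n => / INR n.+1) 0.
    have -> : Rbar.Finite 0 = Rbar_inv p_infty by [].
    apply: is_lim_seq_inv => //; apply/(is_lim_seq_incr_1 INR); exact: is_lim_seq_INR.
  by have := is_lim_seq_scal_l _ (K * X * X) _ l0; rewrite /= Rmult_0_r.
have c0 : Cmod (f X - f 0)%C <= 0 by exact: (lim_seq_le_R (is_lim_seq_const _) linv key).
have z : (f X - f 0)%C = 0%C by apply: Cmod_eq_0; have := Cmod_ge_0 (f X - f 0)%C; lra.
have -> : f X = (f X - f 0 + f 0)%C by ring.
by rewrite z Cplus_0_l.
Qed.

Lemma RIntC_minus (f g : R -> C) (a b : R) : (forall t, contC f t) -> (forall t, contC g t) ->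
  (RIntC f a b - RIntC g a b)%C = RIntC (fun t => f t - g t)%C a b.
Proof.
move=> cf cg; symmetry; apply: RIntC_unique.
by apply: (@is_RInt_minus C_R_NormedModule); apply: RIntC_correct.
Qed.

Lemma RIntC_scal (f : R -> C) (a b : R) (c : C) : (forall t, contC f t) ->
  (c * RIntC f a b)%C = RIntC (fun t => c * f t)%C a b.
Proof. by move=> cf; symmetry; apply: RIntC_unique; apply: is_RIntC_Cmult; exact: RIntC_correct. Qed.

Lemma Cmod_RIntC (f : R -> C) (a b M : R) : (forall t, contC f t) -> a <= b ->
  (forall t, a <= t <= b -> Cmod (f t) <= M) -> Cmod (RIntC f a b) <= (b - a) * M.
Proof. by move=> cf ab h; apply: Cmod_RIntC_le ab h _; exact: RIntC_correct. Qed.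

Section Gauss.

Variable a : C.
Hypothesis a0 : 0 < Re a.

Let E (t : R) : C := Cexp (- (a * RtoC (t * t)))%C.
Let contE (t : R) : contC E t.
Proof.
apply: contC_Cexp; apply: contC_opp; apply: contC_mult; first exact: contC_const.
by apply: contC_RtoC; apply: continuous_mult; exact: continuous_id.
Qed.

Let E1 (t : R) : Cmod (E t) <= 1.
Proof. by rewrite Cmod_Cexp !ReImE /= -exp_0; apply: exp_le; nra. Qed.

Let K (x : R) : C := RIntC E 0 x.

Let hterm (x t : R) : C := (E (x * sqrt (1 + t * t)) / RtoC (1 + t * t))%C.

Let sq (t : R) : sqrt (1 + t * t) * sqrt (1 + t * t) = 1 + t * t.
Proof. by apply: sqrt_sqrt; nra. Qed.

Let htermE (x t : R) : hterm x t = (Cexp (- (a * RtoC (x * x * (1 + t * t)))) / RtoC (1 + t * t))%C.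
Proof.
rewrite /hterm /E; congr Cdiv; congr Cexp; congr Copp; congr Cmult; congr RtoC.
have -> : x * sqrt (1 + t * t) * (x * sqrt (1 + t * t)) = x * x * (sqrt (1 + t * t) * sqrt (1 + t * t)) by ring.
by rewrite sq.
Qed.

Let den (t : R) : RtoC (1 + t * t) <> 0%C.
Proof. by apply: RtoC_neq0; nra. Qed.

Let cont_poly (t : R) : continuous (fun t => 1 + t * t) t.
Proof.
apply: (continuous_plus (V := R_NormedModule)); first exact: continuous_const.
by apply: continuous_mult; exact: continuous_id.
Qed.

Let conth (x t : R) : contC (hterm x) t.
Proof.
apply: contC_mult; last by apply: contC_inv; [apply: contC_RtoC; exact: cont_poly|exact: den].
apply: contC_comp; last exact: contE.
apply: continuous_mult; first exact: continuous_const.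
apply: continuous_comp; first exact: cont_poly.
exact: continuous_sqrt.
Qed.

Let H (x : R) : C := RIntC (hterm x) 0 1.

(** First-order expansions of [K] and, in [H_inc], of [H], with explicit quadratic errors; they
    stand in for K' = E and H' = -2 a E K. *)
Let K_inc (x y X : R) : 0 <= y -> y <= x -> x <= X ->
  Cmod (K x - K y - RtoC (x - y) * E y)%C <= 2 * X * Cmod a * ((x - y) * (x - y)) /\ Cmod (K x - K y)%C <= x - y.
Proof.
move=> y0 yx xX.
have e1 : (K x - K y)%C = RIntC E y x.
  have := @RInt_Chasles C_R_CompleteNormedModule E 0 y x (ex_RIntC _ _ contE) (ex_RIntC _ _ contE).
  by rewrite /K => <-; ringC.
have e2 : (RtoC (x - y) * E y)%C = RIntC (fun _ => E y) y x.
  rewrite (@RInt_const C_R_CompleteNormedModule).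
  by apply: C_ext; rewrite /Re /Im /= /scal /= /mult /=; ring.
rewrite e1; split; last first.
  by have := Cmod_RIntC contE yx (fun t _ => E1 t); rewrite Rmult_1_r.
rewrite e2 RIntC_minus //; last by move=> t; exact: contC_const.
have -> : 2 * X * Cmod a * ((x - y) * (x - y)) = (x - y) * (2 * X * Cmod a * (x - y)) by ring.
apply: Cmod_RIntC => //; first by move=> t; apply: contC_minus; [exact: contE|exact: contC_const].
move=> t ht; apply: Rle_trans (Cexp_lipschitz (M := 0) _ _) _; try by rewrite !ReImE /=; nra.
have -> : (- (a * RtoC (t * t)) - - (a * RtoC (y * y)) = a * RtoC (y * y - t * t))%C.
  by rewrite RtoC_minus; ring.
rewrite exp_0 Rmult_1_r Cmod_mult Cmod_R Rabs_left1; last by nra.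
have -> : 2 * X * Cmod a * (x - y) = Cmod a * (2 * X * (x - y)) by ring.
by apply: Rmult_le_compat_l; [exact: Cmod_ge_0|nra].
Qed.

Let K_le (x : R) : 0 <= x -> Cmod (K x) <= x.
Proof. by move=> x0; have := Cmod_RIntC contE x0 (fun t _ => E1 t); rewrite Rminus_0_r Rmult_1_r. Qed.

Let K_scale (y : R) : (RtoC y * RIntC (fun t => E (y * t)) 0 1)%C = K y.
Proof.
rewrite RIntC_scal; last first.
  move=> t; apply: contC_comp; last exact: contE.
  by apply: continuous_mult; [exact: continuous_const|exact: continuous_id].
apply: RIntC_unique.
have h : is_RIntC E (y * 0 + 0) (y * 1 + 0) (K y).
  by rewrite Rmult_0_r Rmult_1_r !Rplus_0_r; exact: RIntC_correct.
apply: is_RIntC_ext (@is_RInt_comp_lin C_R_NormedModule E y 0 0 1 _ h) => t.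
by rewrite Rplus_0_r; apply: C_ext; rewrite /Re /Im /= /scal /= /mult /=; ring.
Qed.

Let H_inc (x y X : R) : 0 <= y -> y <= x -> x <= X ->
  Cmod (H x - H y + a * (RtoC (2 * (x - y)) * (E y * K y)))%C <=
   (16 * Cmod a * Cmod a * X * X * exp (4 * Cmod a * X * X) + Cmod a) * ((x - y) * (x - y)).
Proof.
move=> y0 yx xX; have a1 := Cmod_ge_0 a.
pose J := RIntC (fun t => E (y * t)) 0 1.
have cJ t : contC (fun t => E (y * t)) t.
  apply: contC_comp; last exact: contE.
  by apply: continuous_mult; [exact: continuous_const|exact: continuous_id].
have J1 : Cmod J <= 1.
  have := Cmod_RIntC cJ Rle_0_1 (fun t _ => E1 _).
  by rewrite Rminus_0_r Rmult_1_l.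
pose lin t := (- (a * RtoC (x * x - y * y) * E y) * E (y * t))%C.
have clin t : contC lin t by apply: contC_mult; [exact: contC_const|exact: cJ].
have e1 : (H x - H y - RIntC lin 0 1)%C = RIntC (fun t => hterm x t - hterm y t - lin t)%C 0 1.
  rewrite /H RIntC_minus // RIntC_minus //.
  by move=> t; apply: contC_minus; exact: conth.
have e2 : RIntC lin 0 1 = (- (a * (RtoC (2 * (x - y)) * (E y * K y))) - a * RtoC ((x - y) * (x - y)) * (E y * J))%C.
  rewrite /lin -RIntC_scal // -/J -(K_scale y) -/J.
  have -> : RtoC (x * x - y * y) = (RtoC (2 * (x - y)) * RtoC y + RtoC ((x - y) * (x - y)))%C.
    by rewrite -RtoC_mult -RtoC_plus; congr RtoC; ring.
  ringC.
have -> : (H x - H y + a * (RtoC (2 * (x - y)) * (E y * K y)) =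
   (H x - H y - RIntC lin 0 1) + - (a * RtoC ((x - y) * (x - y)) * (E y * J)))%C by rewrite e2; ring.
apply: Rle_trans (Cmod_triangle _ _) _; rewrite Rmult_plus_distr_r; apply: Rplus_le_compat; last first.
  have xy2 : 0 <= (x - y) * (x - y) by nra.
  rewrite Cmod_opp !Cmod_mult Cmod_pos //; rewrite -[X in _ <= X]Rmult_1_r.
  apply: Rmult_le_compat.
  - by apply: Rmult_le_pos.
  - by apply: Rmult_le_pos; exact: Cmod_ge_0.
  - exact: Rle_refl.
  by have := E1 y; have := Cmod_ge_0 (E y); have := Cmod_ge_0 J; nra.
rewrite e1.
set B := 16 * Cmod a * Cmod a * X * X * exp (4 * Cmod a * X * X).
have := @Cmod_RIntC (fun t => hterm x t - hterm y t - lin t)%C 0 1 (B * ((x - y) * (x - y))) _ Rle_0_1.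
rewrite Rminus_0_r Rmult_1_l; apply.
  by move=> t; apply: contC_minus => //; apply: contC_minus; exact: conth.
move=> t ht.
pose z := (- (a * RtoC ((x * x - y * y) * (1 + t * t))))%C.
have dt := @den t.
have -> : (hterm x t - hterm y t - lin t = Cexp (- (a * RtoC (y * y * (1 + t * t)))) / RtoC (1 + t * t) * (Cexp z - 1 - z))%C.
  have ex : Cexp (- (a * RtoC (x * x * (1 + t * t)))) = (Cexp (- (a * RtoC (y * y * (1 + t * t)))) * Cexp z)%C.
    rewrite -Cexp_plus; congr Cexp; rewrite /z.
    have -> : x * x * (1 + t * t) = y * y * (1 + t * t) + (x * x - y * y) * (1 + t * t) by ring.
    by rewrite RtoC_plus; ring.
  have ey : (E y * E (y * t))%C = Cexp (- (a * RtoC (y * y * (1 + t * t)))).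
    rewrite /E -Cexp_plus; congr Cexp.
    have -> : y * y * (1 + t * t) = y * y + y * t * (y * t) by ring.
    by rewrite RtoC_plus; ring.
  rewrite !htermE ex /lin.
  have -> : (- (a * RtoC (x * x - y * y) * E y) * E (y * t) = - (a * RtoC (x * x - y * y)) * (E y * E (y * t)))%C by ring.
  by rewrite ey /z (RtoC_mult (x * x - y * y)); field.
have t2 : 1 <= 1 + t * t <= 2 by nra.
have xy : 0 <= x * x - y * y <= 2 * X * (x - y) by nra.
have zm : Cmod z <= 4 * Cmod a * X * (x - y).
  rewrite Cmod_opp Cmod_mult Cmod_pos; last by nra.
  have : (x * x - y * y) * (1 + t * t) <= 2 * X * (x - y) * 2 by apply: Rmult_le_compat; lra.
  nra.
have zm2 : Cmod z <= 4 * Cmod a * X * X.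
  apply: Rle_trans zm _; apply: Rmult_le_compat_l; last by lra.
  by apply: Rmult_le_pos; [lra|lra].
rewrite Cmod_mult -[X in _ <= X]Rmult_1_l; apply: Rmult_le_compat; try exact: Cmod_ge_0.
  rewrite Cmod_div // Cmod_pos; last by lra.
  rewrite Cmod_Cexp !ReImE /= Rmult_0_r Rminus_0_r.
  have : exp (- (Re a * (y * y * (1 + t * t)))) <= 1.
    by rewrite -[X in _ <= X]exp_0; apply: exp_le; have := Rmult_le_pos _ _ (Rlt_le _ _ a0) (Rmult_le_pos (y * y) (1 + t * t) ltac:(nra) ltac:(lra)); lra.
  have i1 : / (1 + t * t) <= 1 by rewrite -[X in _ <= X]Rinv_1; apply: Rinv_le_contravar; lra.
  have i0 : 0 < / (1 + t * t) by apply: Rinv_0_lt_compat; lra.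
  have := exp_pos (- (Re a * (y * y * (1 + t * t)))); rewrite /Rdiv; nra.
apply: Rle_trans (Cexp_second_order z) _.
have -> : B * ((x - y) * (x - y)) = (4 * Cmod a * X * (x - y)) * (4 * Cmod a * X * (x - y)) * exp (4 * Cmod a * X * X).
  by rewrite /B; ring.
have z0 := Cmod_ge_0 z.
apply: Rmult_le_compat; [exact: Rmult_le_pos|by left; exact: exp_pos| |exact: exp_le].
by apply: Rmult_le_compat.
Qed.

Let H0 : H 0 = RtoC (PI / 4).
Proof.
apply: RIntC_unique.
apply: (is_RIntC_ext (f := fun t => RtoC (/ (1 + t * t)))).
  move=> t; rewrite htermE !Rmult_0_l Cmult_0_r.
  have -> : (- 0 = 0)%C by ring.
  by rewrite Cexp_0 RtoC_invE /Cdiv Cmult_1_l.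
apply: (is_RInt_fct_extend_pair (U := R_NormedModule) (V := R_NormedModule)) => /=.
  have := @is_RInt_derive R_CompleteNormedModule atan (fun t => / (1 + t * t)) 0 1.
  have -> : minus (atan 1) (atan 0) = PI / 4 by rewrite atan_1 atan_0 /minus /plus /opp /=; ring.
  apply=> t _.
    auto_derive => //; field; nra.
  by apply: (ex_derive_continuous (V := R_NormedModule)); auto_derive; nra.
have := @is_RInt_const R_NormedModule 0 1 0.
by rewrite /scal /= /mult /= Rmult_0_r.
Qed.

(** The classical argument: with H x the integral of e^(-a x^2 (1 + t^2)) / (1 + t^2) over [0, 1],
    the function a K^2 + H is constant, equal to H 0 = pi/4, and H X is at most e^(-Re a X^2). *)
Lemma gauss_square (X : R) : 0 <= X ->
  Cmod (a * (RIntC (fun t => Cexp (- (a * RtoC (t * t)))) 0 X * RIntC (fun t => Cexp (- (a * RtoC (t * t)))) 0 X) -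
    RtoC (PI / 4))%C <= exp (- (Re a * (X * X))).
Proof.
move=> X0; have a1 := Cmod_ge_0 a; rewrite -/E -/(K X).
pose f x := (a * (K x * K x) + H x)%C.
set B := (16 * Cmod a * Cmod a * X * X * exp (4 * Cmod a * X * X) + Cmod a).
have B0 : 0 <= B.
  have e0 := exp_pos (4 * Cmod a * X * X).
  apply: Rplus_le_le_0_compat => //; apply: Rmult_le_pos; last by lra.
  by do ![apply: Rmult_le_pos => //]; lra.
have fc : f X = f 0.
  apply: (@quad_const f X (B + Cmod a * (4 * X * X * Cmod a + 1))) => //.
    by apply: Rplus_le_le_0_compat => //; apply: Rmult_le_pos => //; nra.
  move=> x y y0 yx xX; have [k1 k2] := K_inc y0 yx xX; have h1 := H_inc y0 yx xX; rewrite -/B in h1.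
  set r := (K x - K y - RtoC (x - y) * E y)%C in k1; set d := (K x - K y)%C in k2.
  have -> : (f x - f y = (H x - H y + a * (RtoC (2 * (x - y)) * (E y * K y))) + a * (RtoC 2 * K y * r + d * d))%C.
    rewrite /f /r /d (RtoC_mult 2).
    have -> : RtoC 2 = (1 + 1)%C by rewrite -RtoC_plus; congr RtoC; ring.
    ring.
  apply: Rle_trans (Cmod_triangle _ _) _; rewrite Rmult_plus_distr_r; apply: Rplus_le_compat => //.
  rewrite Cmod_mult Rmult_assoc; apply: Rmult_le_compat_l => //.
  apply: Rle_trans (Cmod_triangle _ _) _; rewrite !Cmod_mult (Cmod_pos (x := 2)); last by lra.
  have ky := K_le y0; have ky0 := Cmod_ge_0 (K y); have r0 := Cmod_ge_0 r; have d0 := Cmod_ge_0 d.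
  have q1 : 2 * Cmod (K y) * Cmod r <= 2 * X * (2 * X * Cmod a * ((x - y) * (x - y))).
    by apply: Rmult_le_compat => //; lra.
  have q2 : Cmod d * Cmod d <= (x - y) * (x - y) by apply: Rmult_le_compat.
  lra.
have K00 : K 0 = 0%C by rewrite /K (@RInt_point C_R_CompleteNormedModule).
have -> : (a * (K X * K X) - RtoC (PI / 4) = - H X)%C.
  have : (f X = RtoC (PI / 4))%C by rewrite fc /f K00 H0; ring.
  by rewrite /f => <-; ring.
rewrite Cmod_opp.
have := @Cmod_RIntC (hterm X) 0 1 (exp (- (Re a * (X * X)))) (@conth X) Rle_0_1.
rewrite Rminus_0_r Rmult_1_l; apply => t ht; rewrite htermE Cmod_div // Cmod_pos; last by nra.
rewrite Cmod_Cexp !ReImE /= Rmult_0_r Rminus_0_r.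
have i1 : / (1 + t * t) <= 1 by rewrite -[X in _ <= X]Rinv_1; apply: Rinv_le_contravar; nra.
have i0 : 0 < / (1 + t * t) by apply: Rinv_0_lt_compat; nra.
rewrite /Rdiv -[X in _ <= X]Rmult_1_r; apply: Rmult_le_compat; [by left; exact: exp_pos|lra| |lra].
apply: exp_le; have : 0 <= Re a * (X * X * (t * t)) by apply: Rmult_le_pos; [lra|nra].
lra.
Qed.

End Gauss.

Definition gaussK (c : C) (T : R) : C := RIntC (fun t => Cexp (- (c * c * RtoC (t * t)))) 0 T.

Lemma gauss_cont (c : C) (t : R) : contC (fun t => Cexp (- (c * c * RtoC (t * t)))) t.
Proof.
apply: contC_Cexp; apply: contC_opp; apply: contC_mult; first exact: contC_const.
by apply: contC_RtoC; apply: continuous_mult; exact: continuous_id.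
Qed.

(* The sign of the square root is followed along the segment from [Re c] to [c]. *)
Lemma gauss_complex (c : C) (T : R) : 0 < Re c -> 0 < Re (c * c)%C -> 0 < T ->
  exp (- (Re (c * c)%C * (T * T))) <= / 4 ->
  Cmod (c * gaussK c T - RtoC (sqrt PI / 2))%C <= 4 * exp (- (Re (c * c)%C * (T * T))).
Proof.
move=> c0 cc0 T0 small.
set al := Re (c * c)%C in cc0 small *; set eps := exp _ in small *.
pose ct (tau : R) : C := (Re c, tau * Im c).
have alE : al = Re c * Re c - Im c * Im c by rewrite /al ReImE.
have ret tau : 0 <= tau <= 1 -> al <= Re (ct tau * ct tau)%C.
  move=> ht; rewrite Re_mult; change (Re (ct tau)) with (Re c); change (Im (ct tau)) with (tau * Im c).
  have i2 := Rle_0_sqr (Im c); rewrite /Rsqr in i2.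
  have t2 : 0 <= 1 - tau * tau by nra.
  have := Rmult_le_pos _ _ t2 i2; lra.
pose q tau := (ct tau * gaussK (ct tau) T)%C.
have qsq tau : 0 <= tau <= 1 -> Cmod (q tau * q tau - RtoC (PI / 4))%C <= eps.
  move=> ht; have h1 := ret tau ht; have h2 : 0 < Re (ct tau * ct tau)%C by lra.
  have := gauss_square h2 (Rlt_le _ _ T0).
  have -> : (q tau * q tau = ct tau * ct tau * (gaussK (ct tau) T * gaussK (ct tau) T))%C by rewrite /q; ring.
  move=> h; apply: Rle_trans h _; apply: exp_le.
  have : al * (T * T) <= Re (ct tau * ct tau)%C * (T * T) by apply: Rmult_le_compat_r; nra.
  lra.
(* Since q^2 is within 1/4 of pi/4, Re (q^2) >= (pi - 1)/4 >= 1/2, so Re q avoids an interval around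
   0. *)
have big tau : 0 <= tau <= 1 -> / 2 <= Re (q tau) * Re (q tau).
  move=> ht; have := qsq tau ht; have := Re_le_Cmod (RtoC (PI / 4) - q tau * q tau)%C.
  rewrite Cmod_minus_sym Re_minus Re_mult; change (Re (RtoC (PI / 4))) with (PI / 4).
  have := Rle_0_sqr (Im (q tau)); rewrite /Rsqr; have := PI2_3_2; lra.
pose L := Cmod c * T + (Cmod c * (2 * Cmod c * Cmod c) * (T * T * T)).
have cm := Cmod_ge_0 c.
have ctm tau : 0 <= tau <= 1 -> Cmod (ct tau) <= Cmod c.
  move=> ht; apply: Cmod_sqr_le => //; rewrite Cmod_sqr.
  change (Re (ct tau)) with (Re c); change (Im (ct tau)) with (tau * Im c).
  have i2 := Rle_0_sqr (Im c); rewrite /Rsqr in i2.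
  have t2 : 0 <= 1 - tau * tau by nra.
  have := Rmult_le_pos _ _ t2 i2; lra.
have lip s t : 0 <= s <= 1 -> 0 <= t <= 1 -> Cmod (q s - q t)%C <= L * Rabs (s - t).
  move=> hs ht.
  have hd : Cmod (ct s - ct t)%C <= Cmod c * Rabs (s - t).
    have -> : (ct s - ct t)%C = (RtoC ((s - t) * Im c) * Ci)%C by apply: C_ext; rewrite /ct /Re /Im /=; ring.
    rewrite Cmod_mult Cmod_Ci Rmult_1_r Cmod_R Rabs_mult Rmult_comm.
    by apply: Rmult_le_compat_r; [exact: Rabs_pos|exact: im_le_Cmod].
  have st0 := Rabs_pos (s - t).
  have hK tau : 0 <= tau <= 1 -> Cmod (gaussK (ct tau) T) <= T.
    move=> h; have := Cmod_RIntC (@gauss_cont (ct tau)) (Rlt_le _ _ T0) (M := 1).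
    rewrite Rminus_0_r Rmult_1_r; apply => u hu; rewrite Cmod_Cexp Re_opp.
    rewrite -[X in _ <= X]exp_0; apply: exp_le.
    have := ret tau h; rewrite Re_mult_RtoC; nra.
  have hKK : Cmod (gaussK (ct s) T - gaussK (ct t) T)%C <= 2 * Cmod c * Cmod c * (T * T * T) * Rabs (s - t).
    rewrite RIntC_minus; try by move=> u; exact: gauss_cont.
    have -> : 2 * Cmod c * Cmod c * (T * T * T) * Rabs (s - t) = (T - 0) * (2 * Cmod c * Cmod c * (T * T) * Rabs (s - t)) by ring.
    apply: Cmod_RIntC; [by move=> u; apply: contC_minus; exact: gauss_cont|lra|].
    move=> u hu; have u2 : 0 <= u * u <= T * T by nra.
    apply: Rle_trans (Cexp_lipschitz (M := 0) _ _) _.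
    - by rewrite Re_opp Re_mult_RtoC; have := ret s hs; nra.
    - by rewrite Re_opp Re_mult_RtoC; have := ret t ht; nra.
    have -> : (- (ct s * ct s * RtoC (u * u)) - - (ct t * ct t * RtoC (u * u)) =
       - (RtoC (u * u) * ((ct s - ct t) * (ct s + ct t))))%C by ring.
    rewrite exp_0 Rmult_1_r Cmod_opp !Cmod_mult Cmod_pos; last by lra.
    have h2 : Cmod (ct s + ct t)%C <= 2 * Cmod c.
      by apply: Rle_trans (Cmod_triangle _ _) _; have := ctm s hs; have := ctm t ht; lra.
    have h3 : Cmod (ct s - ct t)%C * Cmod (ct s + ct t)%C <= Cmod c * Rabs (s - t) * (2 * Cmod c).
      by apply: Rmult_le_compat => //; exact: Cmod_ge_0.
    have h4 : 0 <= Cmod (ct s - ct t)%C * Cmod (ct s + ct t)%C by apply: Rmult_le_pos; exact: Cmod_ge_0.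
    have : u * u * (Cmod (ct s - ct t)%C * Cmod (ct s + ct t)%C) <= T * T * (Cmod c * Rabs (s - t) * (2 * Cmod c)).
      by apply: Rmult_le_compat; lra.
    lra.
  have -> : (q s - q t = (ct s - ct t) * gaussK (ct s) T + ct t * (gaussK (ct s) T - gaussK (ct t) T))%C.
    by rewrite /q; ring.
  apply: Rle_trans (Cmod_triangle _ _) _; rewrite !Cmod_mult.
  have p1 : Cmod (ct s - ct t)%C * Cmod (gaussK (ct s) T) <= Cmod c * Rabs (s - t) * T.
    by apply: Rmult_le_compat; try exact: Cmod_ge_0; [|exact: hK].
  have p2 : Cmod (ct t) * Cmod (gaussK (ct s) T - gaussK (ct t) T)%C <=
     Cmod c * (2 * Cmod c * Cmod c * (T * T * T) * Rabs (s - t)).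
    by apply: Rmult_le_compat; try exact: Cmod_ge_0; [exact: ctm|].
  rewrite /L; lra.
have q0 : 0 < Re (q 0).
  have e : gaussK (ct 0) T = RtoC (RInt (fun t => exp (- (Re c * Re c * (t * t)))) 0 T).
    apply: RIntC_unique.
    apply: (is_RIntC_ext (f := fun t => RtoC (exp (- (Re c * Re c * (t * t)))))).
      move=> t; rewrite -Cexp_real; congr Cexp; apply: C_ext; rewrite /ct /Re /Im /=; ring.
    apply: (is_RInt_fct_extend_pair (U := R_NormedModule) (V := R_NormedModule)) => /=.
      apply: RInt_correct; apply: (ex_RInt_continuous (V := R_CompleteNormedModule)) => t _.
      by apply: (ex_derive_continuous (V := R_NormedModule)); auto_derive.
    have := @is_RInt_const R_NormedModule 0 T 0.
    by rewrite /scal /= /mult /= Rmult_0_r.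
  rewrite /q e ReImE /= Rmult_0_r Rminus_0_r; apply: Rmult_lt_0_compat => //.
  apply: RInt_gt_0 => // t _; first exact: exp_pos.
  by apply: (ex_derive_continuous (V := R_NormedModule)); auto_derive.
(* Discrete continuity: along steps on which q moves by less than 1, Re q cannot jump over the
   forbidden interval of length sqrt 2, so it keeps the sign that it has for a real parameter. *)
have q1 : 0 < Re (q 1).
  have [N hN] : exists N : nat, L < INR N.+1.
    have L0 : 0 <= L by rewrite /L; apply: Rplus_le_le_0_compat; do ![apply: Rmult_le_pos => //]; lra.
    by have [N] := nfloor_ex L L0; exists N; rewrite S_INR; lra.
  have n0 := INR_S_pos N.
  have st m : INR m <= INR N.+1 -> 0 < Re (q (INR m * / INR N.+1)).
    elim: m => [|m IH] hm; first by rewrite /INR Rmult_0_l.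
    rewrite S_INR in hm *; have m0 := pos_INR m; have := IH ltac:(lra) => hp.
    have i0 : 0 < / INR N.+1 by exact: Rinv_0_lt_compat.
    have iN : INR N.+1 * / INR N.+1 = 1 by rewrite Rinv_r //; lra.
    set s := (INR m + 1) * / INR N.+1; set t := INR m * / INR N.+1 in hp.
    have hs : 0 <= s <= 1.
      by rewrite /s -iN; split; [apply: Rmult_le_pos; lra|apply: Rmult_le_compat_r; lra].
    have ht : 0 <= t <= 1.
      by rewrite /t -iN; split; [apply: Rmult_le_pos; lra|apply: Rmult_le_compat_r; lra].
    have est : s - t = / INR N.+1 by rewrite /s /t; ring.
    have h1 := lip s t hs ht; rewrite est Rabs_pos_eq in h1; last by lra.
    have h2 : L * / INR N.+1 < 1.
      by rewrite -iN; apply: Rmult_lt_compat_r.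
    have := Re_le_Cmod (q t - q s)%C; rewrite Cmod_minus_sym Re_minus => h3.
    have b1 := big s hs; have b2 := big t ht; nra.
  by have := st N.+1 (Rle_refl _); rewrite Rinv_r; lra.
have ec : ct 1 = c by apply: C_ext; rewrite /= ?Rmult_1_l.
have h1 := qsq 1 ltac:(lra); rewrite /q ec -/(q 1) in h1; rewrite /q ec in q1.
set Q := (c * gaussK c T)%C in h1 q1 *.
have sp : sqrt PI * sqrt PI = PI by apply: sqrt_sqrt; have := PI_RGT_0; lra.
have s1 : 1 <= sqrt PI by rewrite -sqrt_1; apply: sqrt_le_1_alt; have := PI2_3_2; lra.
have fac : (Q * Q - RtoC (PI / 4) = (Q - RtoC (sqrt PI / 2)) * (Q + RtoC (sqrt PI / 2)))%C.
  have -> : RtoC (PI / 4) = (RtoC (sqrt PI / 2) * RtoC (sqrt PI / 2))%C.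
    by rewrite -RtoC_mult; congr RtoC; rewrite -{1}sp; field.
  ring.
rewrite fac Cmod_mult in h1.
have : / 2 <= Cmod (Q + RtoC (sqrt PI / 2))%C.
  apply: Rle_trans (Re_le_Cmod _); rewrite Re_plus.
  change (Re (RtoC (sqrt PI / 2))) with (sqrt PI / 2); lra.
have := Cmod_ge_0 (Q - RtoC (sqrt PI / 2))%C; nra.
Qed.

(** * The saddle point *)

Lemma Re_RtoC_div (r : R) (v : C) : 0 < Re v ->
  Re (RtoC r / v)%C = Re v / (Re v * Re v + Im v * Im v) * r.
Proof.
case: v => p q /= p0; rewrite /Re /Im /= /Cdiv /=; field.
by nra.
Qed.

Lemma exp_small (b e : R) : 0 < b -> 0 < e -> exists T0, 0 < T0 /\ forall T, T0 <= T -> exp (- (b * T)) <= e.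
Proof.
move=> b0 e0; exists (/ (b * e)); split; first by apply: Rinv_0_lt_compat; nra.
move=> T hT; have be : 0 < b * e by nra.
have i0 : 0 < / (b * e) by exact: Rinv_0_lt_compat.
have h : 1 <= b * T * e.
  have : b * e * / (b * e) <= b * e * T by apply: Rmult_le_compat_l; lra.
  rewrite Rinv_r; lra.
rewrite exp_Ropp; have := exp_ineq1_le (b * T) => h1; have bt : 0 < b * T by nra.
apply: (Rmult_le_reg_l (exp (b * T))); first exact: exp_pos.
rewrite Rinv_r; last by have := exp_pos (b * T); lra.
nra.
Qed.

Lemma Rabs_le_between' (x y : R) : Rabs x <= y -> - y <= x <= y.
Proof. split_Rabs; lra. Qed.

Lemma is_RIntC_sub (f : R -> C) (a b c d : R) : a <= c -> c <= d -> d <= b ->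
  ex_RInt (V := C_R_NormedModule) f a b -> ex_RInt (V := C_R_NormedModule) f c d.
Proof.
move=> ac cd db h.
have h1 : ex_RInt (V := C_R_NormedModule) f a d.
  by apply: (@ex_RInt_Chasles_1 C_R_CompleteNormedModule f a d b) => //; lra.
by apply: (@ex_RInt_Chasles_2 C_R_CompleteNormedModule f a c d) => //; lra.
Qed.

Lemma RIntC_Chasles3 (f : R -> C) (a b c d : R) : a <= c -> c <= d -> d <= b ->
  ex_RInt (V := C_R_NormedModule) f a b ->
  RIntC f a b = (RIntC f a c + RIntC f c d + RIntC f d b)%C.
Proof.
move=> ac cd db h.
have h1 : ex_RInt (V := C_R_NormedModule) f a c by apply: is_RIntC_sub h; lra.
have h2 : ex_RInt (V := C_R_NormedModule) f c d by apply: is_RIntC_sub h; lra.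
have h3 : ex_RInt (V := C_R_NormedModule) f d b by apply: is_RIntC_sub h; lra.
have h4 : ex_RInt (V := C_R_NormedModule) f a d by apply: is_RIntC_sub h; lra.
rewrite -(@RInt_Chasles C_R_CompleteNormedModule f a d b) // -(@RInt_Chasles C_R_CompleteNormedModule f a c d) //.
Qed.

Lemma RIntC_is (f : R -> C) (a b : R) : ex_RInt (V := C_R_NormedModule) f a b -> is_RIntC f a b (RIntC f a b).
Proof. exact: (@RInt_correct C_R_CompleteNormedModule). Qed.

Lemma RIntC_gauss_tail (f : R -> C) (D c0 T M : R) : 0 < c0 -> 0 < D -> 1 <= T -> T <= M ->
  ex_RInt (V := C_R_NormedModule) f T M ->
  (forall t, T <= t <= M -> Cmod (f t) <= D * exp (- (c0 * (t * t)))) ->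
  Cmod (RIntC f T M) <= D / c0 * exp (- (c0 * T)).
Proof.
move=> c00 D0 T1 TM ef hf.
have e w : norm (K := R_AbsRing) (V := C_R_NormedModule) w = Cmod w by rewrite Cmod_norm.
have hg : is_RInt (fun t => D * exp (- (c0 * t))) T M (D / c0 * exp (- (c0 * T)) - D / c0 * exp (- (c0 * M))).
  have := @is_RInt_derive R_CompleteNormedModule (fun t => - (D / c0 * exp (- (c0 * t)))) (fun t => D * exp (- (c0 * t))) T M.
  have -> : minus (- (D / c0 * exp (- (c0 * M)))) (- (D / c0 * exp (- (c0 * T)))) =
    D / c0 * exp (- (c0 * T)) - D / c0 * exp (- (c0 * M)) by rewrite /minus /plus /opp /=; ring.
  apply=> t _; first by auto_derive => //; field; lra.
  by apply: (ex_derive_continuous (V := R_NormedModule)); auto_derive.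
have h : Cmod (RIntC f T M) <= D / c0 * exp (- (c0 * T)) - D / c0 * exp (- (c0 * M)).
  rewrite -e; apply: (norm_RInt_le f (fun t => D * exp (- (c0 * t))) T M _ _ TM _ (RIntC_is ef) hg) => t ht.
  rewrite e; apply: Rle_trans (hf t ht) _; apply: Rmult_le_compat_l; first by lra.
  apply: exp_le; have : 0 <= c0 * (t * (t - 1)) by apply: Rmult_le_pos; [lra|nra].
  lra.
have : 0 < D / c0 * exp (- (c0 * M)).
  by apply: Rmult_lt_0_compat; [exact: Rdiv_lt_0_compat|exact: exp_pos].
lra.
Qed.

Lemma RIntC_opp_bounds (f : R -> C) (a b : R) : ex_RInt (V := C_R_NormedModule) f a b ->
  RIntC f a b = RIntC (fun t => f (- t)) (- b) (- a) /\ ex_RInt (V := C_R_NormedModule) (fun t => f (- t)) (- b) (- a).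
Proof.
move=> h; have h1 := RIntC_is h.
have h2 : is_RIntC f (-1 * (- a) + 0) (-1 * (- b) + 0) (RIntC f a b).
  have -> : -1 * - a + 0 = a by ring.
  have -> : -1 * - b + 0 = b by ring.
  exact: RIntC_is.
have h3 := @is_RInt_comp_lin C_R_NormedModule f (-1) 0 (- a) (- b) _ h2.
have h4 := @is_RInt_swap C_R_NormedModule _ _ _ _ h3.
have h5 := @is_RInt_opp C_R_NormedModule _ _ _ _ h4.
have h6 : is_RIntC (fun t => f (- t)) (- b) (- a) (RIntC f a b).
  have e : opp (opp (RIntC f a b)) = RIntC f a b by exact: opp_opp.
  rewrite -[X in is_RIntC _ _ _ X]e.
  apply: is_RIntC_ext h5 => t.
  have -> : -1 * t + 0 = - t by ring.
  by apply: C_ext; rewrite /Re /Im /= /scal /= /mult /= /opp /=; ring.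
by rewrite (RIntC_unique h6); split=> //; exists (RIntC f a b).
Qed.

Section Saddle.

Variables (Phi : C -> C) (al be : R) (l1 l2 kap U : R) (K c : C).
Let Lam : C := (l1, l2).
Hypotheses (al0 : al < 0) (be0 : 0 < be) (l10 : 0 < l1) (kap1 : Rabs kap <= 1).
Hypotheses (U0 : 0 < U) (UL : Rabs l2 < U * l1) (c0 : 0 < Re c) (cc : (c * c)%C = Lam).

(** The model is Phi w ~ K (Re w)^kap e^(Lam^2/w). With n = s^4 the saddle is w = Lam/s^2, on the
    line Re w = l1/s^2. [H1] makes everything outside a cone exponentially smaller, [H2] provides
    domination inside, and [H3] is needed only in the direction of [Lam]. The root [c] of [Lam]
    fixes the sign of the Gaussian integral. *)
Hypothesis H1 : exists L' x0, L' < l1 * l1 /\ 0 < x0 /\ forall x v, 0 < x < x0 -> al <= v <= be ->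
  U * x <= Rabs v -> Cmod (Phi (x, v)) <= exp (L' / x).
Hypothesis H2 : exists D x0, 0 < D /\ 0 < x0 /\ forall x v, 0 < x < x0 -> Rabs v <= U * x ->
  Cmod (Phi (x, v) * Cexp (- (Lam * Lam / (x, v))))%C <= D * Rpower x kap.
Hypothesis H3 : forall e, 0 < e -> exists d, 0 < d /\ forall x v, 0 < x < d -> Rabs (v / x - l2 / l1) < d ->
  Cmod (Phi (x, v) * Cexp (- (Lam * Lam / (x, v))) - RtoC (Rpower x kap) * K)%C <= e * Rpower x kap.

Let Lam0 : Lam <> 0%C. Proof. by apply: Re_pos_neq0. Qed.

(** The inverse of the expected size: critical value e^(2 Lam s^2), Jacobian s^(-3) of the
    substitution, and power (Re w)^kap at Re w = l1/s^2. *)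
Let scale (s : R) : C := (Cexp (- (RtoC 2 * Lam * RtoC (s * s))) *
  RtoC (s * s * s * Rpower (l1 / (s * s)) (- kap)))%C.

Let Rpower_scale_le (s : R) : 1 <= s -> Rpower (l1 / (s * s)) (- kap) <= exp (Rabs (ln l1)) * (s * s).
Proof.
move=> s1; have ls : 0 <= ln s by rewrite -ln_1; apply: Rcomplements.ln_le; lra.
have -> : s * s = exp (2 * ln s).
  have -> : 2 * ln s = ln s + ln s by ring.
  by rewrite exp_plus exp_ln; lra.
rewrite -exp_plus /Rpower; apply: exp_le.
rewrite ln_div //; last exact: exp_pos.
rewrite ln_exp; move: kap1; have := Rabs_pos (ln l1).
have k2 : Rabs kap * Rabs (ln l1) <= 1 * Rabs (ln l1) by apply: Rmult_le_compat_r => //; exact: Rabs_pos.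
have := Rle_abs (- (kap * ln l1)); rewrite Rabs_Ropp Rabs_mult => h1 h2 h3.
have : kap * (2 * ln s) <= 1 * (2 * ln s).
  by apply: Rmult_le_compat_r; [lra|have := Rle_abs kap; lra].
lra.
Qed.

Let outer (e : R) : 0 < e -> exists S, 1 <= S /\ forall s, S <= s -> forall a b : R,
  al <= a -> a <= b -> b <= be -> (forall v, a <= v <= b -> U * (l1 / (s * s)) <= Rabs v) ->
  forall J, is_RIntC (fun v => Phi ((l1 / (s * s))%R, v) *
     Cexp (RtoC (s * s * (s * s)) * (((l1 / (s * s))%R, v) : C)))%C a b J ->
  Cmod (J * scale s)%C <= e.
Proof.
move=> e0; have [L' [x0 [hL [x00 h]]]] := H1.
(* On the line x = l1/s^2 the exponent L'/x + s^4 x falls short of 2 l1 s^2 by del * s^2. *)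
pose del := l1 - L' / l1.
have d0 : 0 < del.
  rewrite /del; have : L' / l1 < l1; last by lra.
  by apply: (Rmult_lt_reg_r l1) => //; rewrite /Rdiv Rmult_assoc Rinv_l; lra.
pose C0 := (be - al) * exp (Rabs (ln l1)) * (27 / (del * del * del)).
have C00 : 0 < C0.
  apply: Rmult_lt_0_compat; first by apply: Rmult_lt_0_compat; [lra|exact: exp_pos].
  by apply: Rdiv_lt_0_compat; [lra|do 2 apply: Rmult_lt_0_compat => //].
pose S := 1 + l1 / x0 + C0 / e.
have q1 : 0 < l1 / x0 by exact: Rdiv_lt_0_compat.
have q2 : 0 < C0 / e by exact: Rdiv_lt_0_compat.
exists S; split; first by rewrite /S; lra.
move=> s hs a b ha hab hb hv J hJ.
have s1 : 1 <= s by rewrite /S in hs; lra.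
have ss : 0 < s * s by nra.
have xs : 0 < l1 / (s * s) < x0.
  split; first exact: Rdiv_lt_0_compat.
  apply: (Rmult_lt_reg_r (s * s)) => //; rewrite /Rdiv Rmult_assoc Rinv_l; last by lra.
  have : l1 / x0 < s * s by rewrite /S in hs; nra.
  have e1 : l1 / x0 * x0 = l1 by field; lra.
  nra.
set x := l1 / (s * s) in xs hv hJ *.
have hb1 : Cmod J <= (b - a) * exp (L' / x + s * s * (s * s) * x).
  apply: Cmod_RIntC_le hab _ hJ => v hvab.
  rewrite Cmod_mult Cmod_Cexp Re_scal /= exp_plus; apply: Rmult_le_compat_r; first by left; exact: exp_pos.
  by apply: h => //; [lra|exact: hv].
rewrite /scale !Cmod_mult Cmod_Cexp -/x.
have hr := Rpower_scale_le s1; rewrite -/x in hr.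
have rp : 0 < Rpower x (- kap) by exact: exp_pos.
have s3 : 0 < s * s * s by nra.
rewrite Cmod_pos; last by left; exact: Rmult_lt_0_compat.
have -> : Re (- (RtoC 2 * Lam * RtoC (s * s)))%C = - (2 * l1 * (s * s)) by rewrite !ReImE /=; ring.
have eexp : exp (L' / x + s * s * (s * s) * x) * exp (- (2 * l1 * (s * s))) = exp (- (del * (s * s))).
  by rewrite -exp_plus; congr exp; rewrite /x /del; field; lra.
(* The remaining factors grow like s^5, so e^(-y) <= (3/y)^3 with y = del * s^2 wins by one power of
   s. *)
have e3 : exp (- (del * (s * s))) <= 27 / (del * del * del) * / (s * s * s * (s * s * s)).
  have y0 : 0 < del * (s * s) by exact: Rmult_lt_0_compat.
  have -> : exp (- (del * (s * s))) = exp (- (del * (s * s) / 3)) ^ 3.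
    by rewrite exp_pow; congr exp; rewrite /INR; field.
  have h3 : exp (- (del * (s * s) / 3)) <= 3 * / (del * (s * s)).
    have -> : 3 * / (del * (s * s)) = / (del * (s * s) / 3) by field; lra.
    rewrite exp_Ropp; apply: Rinv_le_contravar; first by lra.
    by have := exp_ineq1_le (del * (s * s) / 3); lra.
  have h4 : 0 <= exp (- (del * (s * s) / 3)) by left; exact: exp_pos.
  apply: Rle_trans (pow_incr _ _ 3 (conj h4 h3)) _; right; field; lra.
have e4 : Cmod J * (exp (- (2 * l1 * (s * s))) * (s * s * s * Rpower x (- kap))) <=
   (be - al) * exp (- (del * (s * s))) * (s * s * s * (exp (Rabs (ln l1)) * (s * s))).
  have -> : Cmod J * (exp (- (2 * l1 * (s * s))) * (s * s * s * Rpower x (- kap))) =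
    Cmod J * exp (- (2 * l1 * (s * s))) * (s * s * s * Rpower x (- kap)) by ring.
  apply: Rmult_le_compat.
  - by apply: Rmult_le_pos; [exact: Cmod_ge_0|left; exact: exp_pos].
  - by left; exact: Rmult_lt_0_compat.
  - rewrite -eexp -(Rmult_assoc (be - al)); apply: Rmult_le_compat_r; first by left; exact: exp_pos.
    apply: Rle_trans hb1 _; apply: Rmult_le_compat_r; [by left; exact: exp_pos|lra].
  by apply: Rmult_le_compat_l; lra.
apply: Rle_trans e4 _.
apply: Rle_trans (_ : (be - al) * (27 / (del * del * del) * / (s * s * s * (s * s * s))) * (s * s * s * (exp (Rabs (ln l1)) * (s * s))) <= _).
  apply: Rmult_le_compat_r; last by apply: Rmult_le_compat_l; lra.
  by apply: Rmult_le_pos; [lra|apply: Rmult_le_pos; [left; exact: exp_pos|lra]].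
have -> : (be - al) * (27 / (del * del * del) * / (s * s * s * (s * s * s))) * (s * s * s * (exp (Rabs (ln l1)) * (s * s))) = C0 / s.
  by rewrite /C0; field; lra.
apply: (Rmult_le_reg_r s); first by lra.
have -> : C0 / s * s = C0 by field; lra.
have : C0 / e <= s by rewrite /S in hs; lra.
have e5 : C0 / e * e = C0 by field; lra.
nra.
Qed.

Let core (s : R) (t : R) : C :=
  (Phi ((l1 / (s * s))%R, ((l2 + t / s) / (s * s))%R) * Cexp (- (Lam * Lam / ((l1 / (s * s))%R, ((l2 + t / s) / (s * s))%R))) *
   RtoC (Rpower (l1 / (s * s)) (- kap)) * Cexp (- (RtoC (t * t) / (Lam + (0, (t / s)%R)))))%C.

(** With v = Lam + i t/s and w = v/s^2, one has s^4 w + Lam^2/w - 2 Lam s^2 = s^2 (v - Lam)^2 / v =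
    -t^2/v. The identity is exact, so no Taylor remainder has to be controlled. *)
Let exponent (s t : R) : 0 < s ->
  (RtoC (s * s * (s * s)) * ((l1 / (s * s))%R, ((l2 + t / s) / (s * s))%R) - RtoC 2 * Lam * RtoC (s * s) =
   - (Lam * Lam / ((l1 / (s * s))%R, ((l2 + t / s) / (s * s))%R)) - RtoC (t * t) / (Lam + (0, (t / s)%R)))%C.
Proof.
move=> s0; set v := (Lam + (0, (t / s)%R))%C.
have v0 : v <> 0%C by apply: Re_pos_neq0; rewrite Re_plus /=; lra.
have ss0 : RtoC (s * s) <> 0%C by apply: RtoC_neq0; nra.
have -> : (((l1 / (s * s))%R, ((l2 + t / s) / (s * s))%R) : C) = (v / RtoC (s * s))%C.
  rewrite /Cdiv -RtoC_invE /v; apply: C_ext; rewrite /Re /Im /=; field; nra.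
have hv : (v = Lam + Ci * RtoC (t / s))%C by rewrite /v; congr Cplus; apply: C_ext; rewrite /Re /Im /=; ring.
have e1 : ((v - Lam) * (v - Lam) * RtoC (s * s) = - RtoC (t * t))%C.
  have -> : (v - Lam = Ci * RtoC (t / s))%C by rewrite hv; ring.
  have i2 : (Ci * Ci = - (1))%C by apply: C_ext; rewrite /Re /Im /=; ring.
  have -> : (Ci * RtoC (t / s) * (Ci * RtoC (t / s)) * RtoC (s * s) = Ci * Ci * (RtoC (t / s) * RtoC (t / s) * RtoC (s * s)))%C by ring.
  rewrite i2 -!RtoC_mult; have -> : t / s * (t / s) * (s * s) = t * t by field; lra.
  ring.
have -> : (RtoC (t * t) / v = - ((v - Lam) * (v - Lam) * RtoC (s * s)) / v)%C by rewrite e1; field.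
rewrite (RtoC_mult (s * s)).
have -> : RtoC 2 = (1 + 1)%C by rewrite -RtoC_plus; congr RtoC; ring.
by field.
Qed.

(* The substitution [v = (l2 + t / s) / s ^ 2] centres the integral at the saddle point. *)
Let inner_subst (s a b : R) (J : C) : 0 < s ->
  is_RIntC (fun v => Phi ((l1 / (s * s))%R, v) * Cexp (RtoC (s * s * (s * s)) * (((l1 / (s * s))%R, v) : C)))%C
    ((l2 + a / s) / (s * s)) ((l2 + b / s) / (s * s)) J ->
  is_RIntC (core s) a b (J * scale s)%C.
Proof.
move=> s0 hJ.
have s3 : 0 < s * s * s by do 2 apply: Rmult_lt_0_compat => //.
have hlin t : / (s * s * s) * t + l2 / (s * s) = (l2 + t / s) / (s * s) by field; lra.
have h := @is_RInt_comp_lin C_R_NormedModule _ (/ (s * s * s)) (l2 / (s * s)) a b J.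
rewrite !hlin in h; have {}h := h _ hJ.
have h2 := @is_RIntC_Cmult _ _ _ (scale s) _ h.
rewrite Cmult_comm; apply: is_RIntC_ext h2 => t; rewrite hlin.
have hs (y : R) (w : C) : scal (V := C_R_NormedModule) y w = (RtoC y * w)%C.
  by apply: C_ext; rewrite /Re /Im /= /scal /= /mult /=; ring.
rewrite hs /core /scale.
set w : C := (_, _).
have ex := exponent t s0; rewrite -/w in ex.
have -> : Cexp (RtoC (s * s * (s * s)) * w) = (Cexp (RtoC 2 * Lam * RtoC (s * s)) * (Cexp (- (Lam * Lam / w)) * Cexp (- (RtoC (t * t) / (Lam + (0, (t / s)%R))))))%C.
  rewrite -!Cexp_plus; congr Cexp.
  have -> : (RtoC (s * s * (s * s)) * w = RtoC (s * s * (s * s)) * w - RtoC 2 * Lam * RtoC (s * s) + RtoC 2 * Lam * RtoC (s * s))%C by ring.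
  by rewrite ex; ring.
have en : (Cexp (- (RtoC 2 * Lam * RtoC (s * s))) * Cexp (RtoC 2 * Lam * RtoC (s * s)) = 1)%C.
  by rewrite -Cexp_plus -Cexp_0; congr Cexp; ring.
rewrite (RtoC_mult (s * s * s)).
have e3 : (RtoC (s * s * s) * RtoC (/ (s * s * s)) = 1)%C by rewrite -RtoC_mult Rinv_r //; lra.
set A1 := Cexp (- (RtoC 2 * _ * _)) in en *; set A2 := Cexp (RtoC 2 * _ * _) in en *.
set B1 := RtoC (s * s * s) in e3 *; set B2 := RtoC (/ _) in e3 *.
transitivity ((A1 * A2) * (B1 * B2) * (Phi w * Cexp (- (Lam * Lam / w)) *
   RtoC (Rpower (l1 / (s * s)) (- kap)) * Cexp (- (RtoC (t * t) / (Lam + (0, (t / s)%R))))))%C; first by ringC.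
by rewrite en e3; ringC.
Qed.

(** A lower bound for Re (1/v) when Re v = l1 and |Im v| <= U l1, so that the Gaussian factor decays
    uniformly over the whole cone. *)
Let cU := / (l1 * (1 + U * U)).
Let cU0 : 0 < cU.
Proof. by apply: Rinv_0_lt_compat; apply: Rmult_lt_0_compat => //; nra. Qed.

Let gauss_bound (s t : R) : 0 < s -> Rabs (l2 + t / s) <= U * l1 ->
  Cmod (Cexp (- (RtoC (t * t) / (Lam + (0, (t / s)%R)))))%C <= exp (- (cU * (t * t))).
Proof.
move=> s0 ht; rewrite Cmod_Cexp Re_opp; apply: exp_le.
have : cU * (t * t) <= Re (RtoC (t * t) / (Lam + (0, (t / s)%R)))%C; last by lra.
set y := l2 + t / s in ht.
have -> : Re (RtoC (t * t) / (Lam + (0, (t / s)%R)))%C = l1 / (l1 * l1 + y * y) * (t * t).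
  rewrite Re_RtoC_div; last by rewrite Re_plus /=; lra.
  by rewrite Re_plus Im_plus /= Rplus_0_r.
apply: Rmult_le_compat_r; first by nra.
have yb : y * y <= U * l1 * (U * l1).
  by rewrite -Rabs_sqr; apply: Rmult_le_compat => //; exact: Rabs_pos.
have -> : l1 / (l1 * l1 + y * y) = / ((l1 * l1 + y * y) / l1) by field; split; nra.
apply: Rinv_le_contravar; first by apply: Rdiv_lt_0_compat; nra.
apply: (Rmult_le_reg_r l1) => //; rewrite /Rdiv Rmult_assoc Rinv_l; nra.
Qed.

(** The error budget is e/10 for each of the two pieces outside the cone, e/10 for each Gaussian
    tail beyond T, e/5 for replacing the integrand by its limit on [-T, T], and e/5 for completing
    the limiting Gaussian. *)
Lemma saddle (e : R) : 0 < e -> exists S, 1 <= S /\ forall s J, S <= s ->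
  is_RIntC (fun v => Phi ((l1 / (s * s))%R, v) * Cexp (RtoC (s * s * (s * s)) * (((l1 / (s * s))%R, v) : C)))%C al be J ->
  Cmod (J * (Cexp (- (RtoC 2 * Lam * RtoC (s * s))) *
     RtoC (s * s * s * Rpower (l1 / (s * s)) (- kap))) - K * RtoC (sqrt PI) * c)%C <= e.
Proof.
move=> e0.
have [D [xD [D0 [xD0 hD]]]] := H2.
have cn : c <> 0%C by exact: Re_pos_neq0.
(* The limiting Gaussian is e^(-t^2/Lam) with 1/Lam = c'^2, so its full integral is sqrt PI / c' =
   sqrt PI * c. *)
pose c' := (/ c)%C.
have c'0 : 0 < Re c'.
  rewrite /c' /Cinv /=; apply: Rdiv_lt_0_compat => //.
  have := Cmod2_alt c; rewrite /= => <-; have : 0 < Cmod c by apply/Cmod_gt_0.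
  nra.
have cc' : (c' * c' = / Lam)%C by rewrite /c' -cc; field.
pose bet := Re (/ Lam)%C.
have bet0 : 0 < bet.
  rewrite /bet /Cinv /=; apply: Rdiv_lt_0_compat => //; nra.
pose K1 := Cmod K + 1; have K10 : 0 < K1 by have := Cmod_ge_0 K; rewrite /K1; lra.
pose C1 := Cmod c + 1; have C10 : 0 < C1 by have := Cmod_ge_0 c; rewrite /C1; lra.
have ep1 : 0 < Rmin (/ 4) (e / (40 * K1 * C1)).
  by apply: Rmin_glb_lt; [lra|apply: Rdiv_lt_0_compat => //; do ![apply: Rmult_lt_0_compat]; lra].
have [T1 [T10 hT1]] := exp_small bet0 ep1.
have ep2 : 0 < e * cU / (10 * D) by apply: Rdiv_lt_0_compat; [exact: Rmult_lt_0_compat|lra].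
have [T2 [T20 hT2]] := exp_small cU0 ep2.
pose T := 1 + T1 + T2.
have Tpos : 1 <= T by rewrite /T; lra.
have gT : exp (- (bet * (T * T))) <= Rmin (/ 4) (e / (40 * K1 * C1)).
  by apply: hT1; rewrite /T; nra.
have tailT : exp (- (cU * T)) <= e * cU / (10 * D) by apply: hT2; rewrite /T; lra.
have hg : Cmod (K * (RtoC 2 * gaussK c' T) - K * RtoC (sqrt PI) * c)%C <= e / 5.
  have := @gauss_complex c' T c'0; rewrite cc' -/bet => h.
  have {}h := h bet0 ltac:(lra) (Rle_trans _ _ _ gT (Rmin_l _ _)).
  have -> : (K * (RtoC 2 * gaussK c' T) - K * RtoC (sqrt PI) * c =
     K * RtoC 2 * c * (c' * gaussK c' T - RtoC (sqrt PI / 2)))%C.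
    have -> : RtoC (sqrt PI) = (RtoC 2 * RtoC (sqrt PI / 2))%C by rewrite -RtoC_mult; congr RtoC; field.
    by rewrite /c'; field.
  rewrite !Cmod_mult (Cmod_pos (x := 2)); last by lra.
  have h2 : exp (- (bet * (T * T))) <= e / (40 * K1 * C1) by apply: Rle_trans gT (Rmin_r _ _).
  have h3 : Cmod K * 2 * Cmod c <= K1 * 2 * C1.
    apply: Rmult_le_compat; try exact: Cmod_ge_0; [by have := Cmod_ge_0 K; lra| |rewrite /C1; lra].
    by rewrite /K1; lra.
  have h4 : Cmod (c' * gaussK c' T - RtoC (sqrt PI / 2))%C <= 4 * (e / (40 * K1 * C1)) by lra.
  have : Cmod K * 2 * Cmod c * Cmod (c' * gaussK c' T - RtoC (sqrt PI / 2))%C <= K1 * 2 * C1 * (4 * (e / (40 * K1 * C1))).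
    apply: Rmult_le_compat => //; try exact: Cmod_ge_0.
    by apply: Rmult_le_pos; [have := Cmod_ge_0 K; lra|exact: Cmod_ge_0].
  have -> : K1 * 2 * C1 * (4 * (e / (40 * K1 * C1))) = e / 5 by field; lra.
  by [].
have [d3 [d30 hd3]] := @H3 (e / (20 * T)) ltac:(apply: Rdiv_lt_0_compat; lra).
have [So [So1 hSo]] := @outer (e / 10) ltac:(lra).
pose B := (U * l1 - Rabs l2).
have B0 : 0 < B by rewrite /B; lra.
(* Each summand is a lower bound on s that is used once: T inside the cone, x below xD, x and the
   slope deviation within d3, the Gaussian error on [-T, T], and the cone inside [al, be]. *)
pose S := So + T / B + l1 / xD + l1 / d3 + T / (l1 * d3) + 20 * T * K1 * (T * T * T) / (l1 * l1 * e)
  + U * l1 / (- al) + U * l1 / be.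
have p1 : 0 < T / B by apply: Rdiv_lt_0_compat; lra.
have p2 : 0 < l1 / xD by exact: Rdiv_lt_0_compat.
have p3 : 0 < l1 / d3 by exact: Rdiv_lt_0_compat.
have p4 : 0 < T / (l1 * d3) by apply: Rdiv_lt_0_compat; [lra|exact: Rmult_lt_0_compat].
have p5 : 0 < 20 * T * K1 * (T * T * T) / (l1 * l1 * e).
  by apply: Rdiv_lt_0_compat; do ![apply: Rmult_lt_0_compat]; lra.
have p6 : 0 < U * l1 / (- al) by apply: Rdiv_lt_0_compat; [exact: Rmult_lt_0_compat|lra].
have p7 : 0 < U * l1 / be by apply: Rdiv_lt_0_compat => //; exact: Rmult_lt_0_compat.
exists S; split; first by rewrite /S; lra.
move=> s J hs hJ; rewrite -/(scale s).
have s1 : 1 <= s by rewrite /S in hs; lra.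
have ss : 0 < s * s by nra.
have sss : s <= s * s by nra.
set x := l1 / (s * s) in hJ.
have x0 : 0 < x by exact: Rdiv_lt_0_compat.
have lt_of (p q : R) : 0 < q -> p / q < s * s -> p / (s * s) < q.
  move=> q0 h; apply: (Rmult_lt_reg_r (s * s)) => //.
  have -> : p / (s * s) * (s * s) = p by field; lra.
  have : p / q * q < s * s * q by apply: Rmult_lt_compat_r.
  have -> : p / q * q = p by field; lra.
  lra.
have xxD : x < xD by apply: lt_of => //; rewrite /S in hs; lra.
have xd3 : x < d3 by apply: lt_of => //; rewrite /S in hs; lra.
have Ux1 : U * x < - al.
  have -> : U * x = U * l1 / (s * s) by rewrite /x /Rdiv; ring.
  by apply: lt_of; rewrite ?/S in hs *; lra.
have Ux2 : U * x < be.
  have -> : U * x = U * l1 / (s * s) by rewrite /x /Rdiv; ring.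
  by apply: lt_of; rewrite ?/S in hs *; lra.
have Ux0 : 0 < U * x by exact: Rmult_lt_0_compat.
set f := (fun v => _) in hJ.
have ef : ex_RInt (V := C_R_NormedModule) f al be by exists J.
have eJ := RIntC_unique hJ.
have ch := @RIntC_Chasles3 f al be (- (U * x)) (U * x) ltac:(lra) ltac:(lra) ltac:(lra) ef.
have e1 : ex_RInt (V := C_R_NormedModule) f al (- (U * x)) by apply: is_RIntC_sub ef; lra.
have e2 : ex_RInt (V := C_R_NormedModule) f (- (U * x)) (U * x) by apply: is_RIntC_sub ef; lra.
have e3 : ex_RInt (V := C_R_NormedModule) f (U * x) be by apply: is_RIntC_sub ef; lra.
have hSs : So <= s by rewrite /S in hs; lra.
have o1 := hSo s hSs al (- (U * x)) ltac:(lra) ltac:(lra) ltac:(lra) _ _ (RIntC_is e1).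
have o2 := hSo s hSs (U * x) be ltac:(lra) ltac:(lra) ltac:(lra) _ _ (RIntC_is e3).
have {}o1 : Cmod (RIntC f al (- (U * x)) * scale s)%C <= e / 10.
  by apply: o1 => v hv; rewrite -/x Rabs_left1; lra.
have {}o2 : Cmod (RIntC f (U * x) be * scale s)%C <= e / 10.
  by apply: o2 => v hv; rewrite -/x Rabs_pos_eq; lra.
pose a := - (s * (U * l1 + l2)); pose b := s * (U * l1 - l2).
have hl2 := Rabs_le_between' (Rlt_le _ _ UL).
have ea : (l2 + a / s) / (s * s) = - (U * x) by rewrite /a /x; field; lra.
have eb : (l2 + b / s) / (s * s) = U * x by rewrite /b /x; field; lra.
have hin : is_RIntC (core s) a b (RIntC f (- (U * x)) (U * x) * scale s)%C.
  by apply: inner_subst; [lra|rewrite ea eb; exact: RIntC_is].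
have sB : T < s * B.
  have h : T / B < s by rewrite /S in hs; lra.
  have : T / B * B < s * B by apply: Rmult_lt_compat_r.
  have -> : T / B * B = T by field; lra.
  by [].
have aT : a <= - T.
  rewrite /a; have : s * B <= s * (U * l1 + l2); last by lra.
  by apply: Rmult_le_compat_l; [lra|rewrite /B; have := Rle_abs (- l2); rewrite Rabs_Ropp; lra].
have bT : T <= b.
  rewrite /b; have : s * B <= s * (U * l1 - l2); last by lra.
  by apply: Rmult_le_compat_l; [lra|rewrite /B; have := Rle_abs l2; lra].
have ec : ex_RInt (V := C_R_NormedModule) (core s) a b by eexists; exact: hin.
have ch2 := @RIntC_Chasles3 (core s) a b (- T) T aT ltac:(lra) bT ec.
have c1 : ex_RInt (V := C_R_NormedModule) (core s) a (- T) by apply: is_RIntC_sub ec; lra.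
have c2 : ex_RInt (V := C_R_NormedModule) (core s) (- T) T by apply: is_RIntC_sub ec; lra.
have c3 : ex_RInt (V := C_R_NormedModule) (core s) T b by apply: is_RIntC_sub ec; lra.
have rpinv : Rpower x kap * Rpower x (- kap) = 1 by rewrite -Rpower_plus Rplus_opp_r Rpower_O.
have rp0 : 0 < Rpower x (- kap) by exact: exp_pos.
have yU t : a <= t <= b -> Rabs (l2 + t / s) <= U * l1.
  move=> ht; apply: Rabs_le; have is0 : 0 < / s by apply: Rinv_0_lt_compat; lra.
  have : a / s <= t / s by apply: Rmult_le_compat_r; lra.
  have : t / s <= b / s by apply: Rmult_le_compat_r; lra.
  have -> : a / s = - (U * l1 + l2) by rewrite /a; field; lra.
  have -> : b / s = U * l1 - l2 by rewrite /b; field; lra.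
  lra.
have core_le t : a <= t <= b -> Cmod (core s t) <= D * exp (- (cU * (t * t))).
  move=> ht; have hy := yU t ht.
  rewrite /core Cmod_mult; apply: Rmult_le_compat; try exact: Cmod_ge_0; last by apply: gauss_bound => //; lra.
  rewrite Cmod_mult (Cmod_pos (Rlt_le _ _ rp0)) -/x.
  have hv : Rabs ((l2 + t / s) / (s * s)) <= U * x.
    rewrite Rabs_div; last by lra.
    rewrite (Rabs_pos_eq (s * s)); last by lra.
    have -> : U * x = U * l1 / (s * s) by rewrite /x /Rdiv; ring.
    by apply: Rmult_le_compat_r => //; left; exact: Rinv_0_lt_compat.
  have := Rmult_le_compat_r _ _ _ (Rlt_le _ _ rp0) (hD x _ (conj x0 xxD) hv).
  by rewrite Rmult_assoc rpinv Rmult_1_r.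
have tail1 : D / cU * exp (- (cU * T)) <= e / 10.
  have : D / cU * exp (- (cU * T)) <= D / cU * (e * cU / (10 * D)).
    by apply: Rmult_le_compat_l => //; left; exact: Rdiv_lt_0_compat.
  have -> : D / cU * (e * cU / (10 * D)) = e / 10 by field; lra.
  by [].
have t3 : Cmod (RIntC (core s) T b) <= e / 10.
  apply: Rle_trans (RIntC_gauss_tail cU0 D0 Tpos bT c3 _) tail1 => t ht.
  by apply: core_le; lra.
have t1 : Cmod (RIntC (core s) a (- T)) <= e / 10.
  have [er exr] := RIntC_opp_bounds c1; rewrite er Ropp_involutive in exr *.
  apply: Rle_trans (RIntC_gauss_tail cU0 D0 Tpos _ exr _) tail1; first by lra.
  move=> t ht; have -> : t * t = - t * - t by ring.
  by apply: core_le; lra.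
have cg t : contC (fun t => Cexp (- (c' * c' * RtoC (t * t)))) t by exact: gauss_cont.
have t2 : Cmod (RIntC (core s) (- T) T - K * (RtoC 2 * gaussK c' T))%C <= e / 5.
  have eg : (RtoC 2 * gaussK c' T)%C = RIntC (fun t => Cexp (- (c' * c' * RtoC (t * t)))) (- T) T.
    have := @RInt_Chasles C_R_CompleteNormedModule (fun t => Cexp (- (c' * c' * RtoC (t * t)))) (- T) 0 T (ex_RIntC _ _ cg) (ex_RIntC _ _ cg).
    move=> <-.
    have [er _] := RIntC_opp_bounds (ex_RIntC (- T) 0 cg).
    rewrite er Ropp_involutive Ropp_0.
    have -> : RIntC (fun t => Cexp (- (c' * c' * RtoC (- t * - t)))) 0 T = gaussK c' T.
      by apply: (@RInt_ext C_R_CompleteNormedModule) => t _; congr (Cexp (- (_ * RtoC _))); ring.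
    rewrite -/(gaussK c' T); have -> : RtoC 2 = (1 + 1)%C by rewrite -RtoC_plus; congr RtoC; ring.
    ringC.
  rewrite eg RIntC_scal //.
  have hm := @is_RInt_minus C_R_NormedModule _ _ _ _ _ _ (RIntC_is c2)
    (RIntC_correct (a := - T) (b := T) (fun t => contC_mult (@contC_const K t) (@cg t))).
  have := @Cmod_RIntC_le _ (- T) T (e / (10 * T)) _ ltac:(lra) _ hm.
  have -> : (T - - T) * (e / (10 * T)) = e / 5 by field; lra.
  apply=> t ht; unplusC.
  have at' : a <= t <= b by lra.
  have hy := yU t at'.
  set E := Cexp (- (RtoC (t * t) / (Lam + (0, (t / s)%R)))).
  have E1 : Cmod E <= 1.
    apply: Rle_trans (gauss_bound _ hy) _; first by lra.
    rewrite -[X in _ <= X]exp_0; apply: exp_le.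
    have : 0 <= cU * (t * t) by apply: Rmult_le_pos; [lra|nra].
    lra.
  set P := (Phi (x, ((l2 + t / s) / (s * s))%R) * Cexp (- (Lam * Lam / (x, ((l2 + t / s) / (s * s))%R))))%C.
  have -> : (core s t - K * Cexp (- (c' * c' * RtoC (t * t))) =
     (P - RtoC (Rpower x kap) * K) * RtoC (Rpower x (- kap)) * E + K * (E - Cexp (- (c' * c' * RtoC (t * t)))))%C.
    have e' : (RtoC (Rpower x kap) * RtoC (Rpower x (- kap)) = 1)%C by rewrite -RtoC_mult rpinv.
    transitivity (P * RtoC (Rpower x (- kap)) * E - K * E * (RtoC (Rpower x kap) * RtoC (Rpower x (- kap))) +
       K * (E - Cexp (- (c' * c' * RtoC (t * t)))))%C; last by ring.
    by rewrite e' /core -/x -/P -/E; ring.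
  apply: Rle_trans (Cmod_triangle _ _) _.
  have tT : Rabs t <= T by apply: Rabs_le; lra.
  have is0 : 0 < / s by apply: Rinv_0_lt_compat; lra.
  have hv3 : Rabs ((l2 + t / s) / (s * s) / x - l2 / l1) < d3.
    have -> : (l2 + t / s) / (s * s) / x - l2 / l1 = t / (l1 * s) by rewrite /x; field; lra.
    rewrite Rabs_div; last by nra.
    rewrite (Rabs_pos_eq (l1 * s)); last by nra.
    apply: (Rmult_lt_reg_r (l1 * s)); first by nra.
    have -> : Rabs t / (l1 * s) * (l1 * s) = Rabs t by field; lra.
    have h4 : T / (l1 * d3) < s by rewrite /S in hs; lra.
    have : T / (l1 * d3) * (l1 * d3) < s * (l1 * d3) by apply: Rmult_lt_compat_r => //; exact: Rmult_lt_0_compat.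
    have -> : T / (l1 * d3) * (l1 * d3) = T by field; lra.
    lra.
  have q1 : Cmod ((P - RtoC (Rpower x kap) * K) * RtoC (Rpower x (- kap)) * E)%C <= e / (20 * T).
    rewrite 2!Cmod_mult (Cmod_pos (Rlt_le _ _ rp0)).
    have h := Rmult_le_compat_r _ _ _ (Rlt_le _ _ rp0) (hd3 x _ (conj x0 xd3) hv3).
    rewrite Rmult_assoc rpinv Rmult_1_r -/P in h.
    rewrite -[X in _ <= X]Rmult_1_r; apply: Rmult_le_compat => //; last exact: Cmod_ge_0.
    by apply: Rmult_le_pos; [exact: Cmod_ge_0|lra].
  have q2 : Cmod (K * (E - Cexp (- (c' * c' * RtoC (t * t)))))%C <= e / (20 * T).
    have v0 : (Lam + (0, (t / s)%R))%C <> 0%C by apply: Re_pos_neq0; rewrite Re_plus /=; lra.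
    have hl : Cmod (E - Cexp (- (c' * c' * RtoC (t * t))))%C <= T * T * T / (l1 * l1 * s).
      apply: Rle_trans (Cexp_lipschitz (M := 0) _ _) _.
      - have := gauss_bound (s := s) ltac:(lra) hy; rewrite Cmod_Cexp => h.
        have h' : exp (Re (- (RtoC (t * t) / (Lam + (0, (t / s)%R)))))%C <= exp 0.
          apply: Rle_trans h _; apply: exp_le.
          have : 0 <= cU * (t * t) by apply: Rmult_le_pos; [lra|nra].
          lra.
        by apply: Rnot_lt_le => hlt; have := exp_increasing _ _ hlt; lra.
      - rewrite Re_opp Re_mult_RtoC cc' -/bet; nra.
      rewrite cc' exp_0 Rmult_1_r.
      have -> : (- (RtoC (t * t) / (Lam + (0, (t / s)%R))) - - (/ Lam * RtoC (t * t)) =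
         RtoC (t * t) * (0, (t / s)%R) / (Lam * (Lam + (0, (t / s)%R))))%C by field.
      rewrite Cmod_div; last exact: Cmult_neq0.
      have m1 : l1 <= Cmod Lam := Re_le_Cmod Lam.
      have m2 : l1 <= Cmod (Lam + (0, (t / s)%R))%C.
        by apply: Rle_trans (Re_le_Cmod _); rewrite Re_plus /=; lra.
      have m3 : Cmod ((0, (t / s)%R) : C) = Rabs t / s.
        have -> : (((0, (t / s)%R) : C) = Ci * RtoC (t / s))%C by apply: C_ext; rewrite /Re /Im /=; ring.
        rewrite Cmod_mult Cmod_Ci Cmod_R Rmult_1_l Rabs_div; last by lra.
        by rewrite (Rabs_pos_eq s); lra.
      rewrite !Cmod_mult m3 Cmod_pos; last by nra.
      have t2' : t * t <= T * T by rewrite -Rabs_sqr; apply: Rmult_le_compat => //; exact: Rabs_pos.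
      have -> : T * T * T / (l1 * l1 * s) = T * T * (T / s) * / (l1 * l1) by field; lra.
      apply: Rmult_le_compat.
      - apply: Rmult_le_pos; first by nra.
        by apply: Rmult_le_pos; [exact: Rabs_pos|lra].
      - by left; apply: Rinv_0_lt_compat; nra.
      - apply: Rmult_le_compat => //; first by nra.
          by apply: Rmult_le_pos; [exact: Rabs_pos|lra].
        by apply: Rmult_le_compat_r; lra.
      by apply: Rinv_le_contravar; nra.
    rewrite Cmod_mult.
    have hK : Cmod K <= K1 by rewrite /K1; lra.
    have : Cmod K * Cmod (E - Cexp (- (c' * c' * RtoC (t * t))))%C <= K1 * (T * T * T / (l1 * l1 * s)).
      by apply: Rmult_le_compat => //; exact: Cmod_ge_0.
    move=> h; apply: Rle_trans h _.
    have h5 : 20 * T * K1 * (T * T * T) / (l1 * l1 * e) <= s by rewrite /S in hs; lra.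
    apply: (Rmult_le_reg_r (20 * T * s)); first by nra.
    have -> : e / (20 * T) * (20 * T * s) = e * s by field; lra.
    have -> : K1 * (T * T * T / (l1 * l1 * s)) * (20 * T * s) = e * (20 * T * K1 * (T * T * T) / (l1 * l1 * e)) by field; lra.
    by apply: Rmult_le_compat_l; lra.
  have -> : e / (10 * T) = e / (20 * T) + e / (20 * T) by field; lra.
  lra.
have final : (J * scale s - K * RtoC (sqrt PI) * c =
  RIntC f al (- (U * x)) * scale s + RIntC f (U * x) be * scale s +
  (RIntC (core s) a (- T) + RIntC (core s) T b +
  ((RIntC (core s) (- T) T - K * (RtoC 2 * gaussK c' T)) +
   (K * (RtoC 2 * gaussK c' T) - K * RtoC (sqrt PI) * c))))%C.
  have h := RIntC_unique hin; rewrite ch2 in h.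
  rewrite -eJ ch.
  transitivity (RIntC f al (- (U * x)) * scale s + RIntC f (U * x) be * scale s +
    (RIntC f (- (U * x)) (U * x) * scale s - K * RtoC (sqrt PI) * c))%C; first by ringC.
  by rewrite -h; ringC.
rewrite final.
apply: Rle_trans (Cmod_triangle _ _) _.
have h1 := Cmod_triangle (RIntC f al (- (U * x)) * scale s)%C (RIntC f (U * x) be * scale s)%C.
have h2 := Cmod_triangle (RIntC (core s) a (- T) + RIntC (core s) T b)%C
  ((RIntC (core s) (- T) T - K * (RtoC 2 * gaussK c' T)) + (K * (RtoC 2 * gaussK c' T) - K * RtoC (sqrt PI) * c))%C.
have h3 := Cmod_triangle (RIntC (core s) a (- T)) (RIntC (core s) T b).
have h4 := Cmod_triangle (RIntC (core s) (- T) T - K * (RtoC 2 * gaussK c' T))%C (K * (RtoC 2 * gaussK c' T) - K * RtoC (sqrt PI) * c)%C.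
lra.
Qed.

End Saddle.

(** * The dilogarithm on the unit circle *)

Definition unit_c (t : R) : C := (cos t, sin t).

Lemma unit_cE (t : R) : unit_c t = Cexp (RtoC t * Ci)%C.
Proof.
apply: C_ext; rewrite /= ?Rmult_0_r ?Rmult_1_r ?Rmult_0_l ?Rminus_0_r ?Rplus_0_r ?Rplus_0_l.
  by rewrite exp_0 Rmult_1_l.
by rewrite exp_0 Rmult_1_l.
Qed.

Lemma Cmod_unit_c (t : R) : Cmod (unit_c t) = 1.
Proof. by rewrite unit_cE Cmod_Cexp ReImE /= Rmult_0_r Rmult_0_l Rminus_0_r exp_0. Qed.

Lemma unit_c_pow (t : R) (n : nat) : Cpow (unit_c t) n = unit_c (INR n * t).
Proof. by rewrite !unit_cE Cexp_pow RtoC_mult; congr Cexp; ring. Qed.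

Lemma sum_n_gap (u : nat -> C) (N d : nat) : (forall j, (N < j <= N + d)%N -> u j = 0%C) ->
  sum_n (G := C_R_NormedModule) u (N + d.+1)%N = (sum_n (G := C_R_NormedModule) u N + u (N + d.+1)%N)%C.
Proof.
move=> h; rewrite addnS sum_Sn; congr Cplus.
elim: d h => [|d IH] h; first by rewrite addn0.
rewrite addnS sum_Sn IH; last by move=> j hj; apply: h; lia.
rewrite h; last by lia.
by ringC.
Qed.

Lemma is_cser_unique_sub (u v : nat -> C) (l l' : C) (phi : nat -> nat) :
  is_cser u l -> is_cser v l' -> (forall n, (n <= phi n)%N) ->
  (forall n, sum_n (G := C_R_NormedModule) u (phi n) = sum_n (G := C_R_NormedModule) v n) -> l = l'.
Proof.
move=> hu hv hphi e.
have s1 : is_lim_seq (fun n => Cmod (sum_n (G := C_R_NormedModule) u (phi n) - l)%C) 0.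
  apply: (is_lim_seq_subseq (fun n => Cmod (sum_n (G := C_R_NormedModule) u n - l)%C)) (is_cser_lim hu).
  by move=> P [N hN]; exists N => n nN; apply: hN; have := hphi n; lia.
have s2 := is_lim_seq_plus' _ _ _ _ s1 (is_cser_lim hv); rewrite Rplus_0_r in s2.
have c0 : Cmod (l' - l)%C <= 0.
  refine (lim_seq_le_R (is_lim_seq_const _) s2 _) => n; rewrite e; set S := sum_n _ _.
  have -> : (l' - l = (S - l) - (S - l'))%C by ringC.
  exact: Cmod_minus_le.
have h : (l' - l)%C = 0%C by apply: Cmod_eq_0; have := Cmod_ge_0 (l' - l)%C; lra.
have -> : (l = l' - (l' - l))%C by ring.
by rewrite h; ring.
Qed.

Lemma resonant_multiple (z xi : C) (k : nat) : Cmod z <= 1 -> (0 < k)%N ->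
  (forall j, (0 < j)%N -> Cpow xi j = 1%C <-> (k %| j)%N) ->
  CSeries (resonant z xi) = (Li2 (Cpow z k) / RtoC (INR k * INR k))%C.
Proof.
case: k => // k z1 _ hk.
have h1 := @is_cser_resonant z xi z1.
have zk1 : Cmod (Cpow z k.+1) <= 1 by exact: Cmod_pow_le1.
have h2 := @is_cser_Cmult (/ RtoC (INR k.+1 * INR k.+1)) _ _ (is_cser_Li2 zk1).
(* Index j stands for j + 1, so the multiples of k + 1 sit at the places n (k + 1) + k, and
   everything between them vanishes. *)
rewrite /Cdiv Cmult_comm; apply: (is_cser_unique_sub (phi := fun n => (n * k.+1 + k)%N)) h1 h2 _ _.
  by move=> n; nia.
have zero j : ~~ (k.+1 %| j.+1)%N -> resonant z xi j = 0%C.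
  move=> nd; rewrite /resonant; case: Ceq_dec => // e; exfalso.
  by move/negP: nd; apply; apply/(hk j.+1).
have val i : resonant z xi (i * k.+1 + k)%N =
  (/ RtoC (INR k.+1 * INR k.+1) * (Cpow (Cpow z k.+1) i.+1 / RtoC (INR i.+1 * INR i.+1)))%C.
  have e1 : (i * k.+1 + k).+1 = (k.+1 * i.+1)%N by rewrite mulnS mulnC; lia.
  rewrite /resonant e1; case: Ceq_dec => [e|ne]; last first.
    by exfalso; apply: ne; apply/hk; [lia|exact: dvdn_mulr].
  have k0 := @INR_S_neq0 k; have i0 := @INR_S_neq0 i.
  have -> : INR (k.+1 * i.+1) = INR k.+1 * INR i.+1 by rewrite -mult_INR.
  have -> : Cpow z (k.+1 * i.+1) = Cpow (Cpow z k.+1) i.+1 by exact: Cpow_mul.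
  rewrite [is_left _]/=; move: (Cpow (Cpow z k.+1) i.+1) => w.
  rewrite !RtoC_mult; field; by split.
elim=> [|n IH].
  rewrite mul0n add0n sum_O -val mul0n add0n.
  have : forall j, (j < k)%N -> resonant z xi j = 0%C.
    by move=> j jk; apply: zero; rewrite gtnNdvd.
  case: (k) => [|m] hz; first by rewrite sum_O.
  have := @sum_n_gap (resonant z xi) 0 m; rewrite !add0n => ->; last by move=> j hj; apply: hz; lia.
  by rewrite sum_O hz // Cplus_0_l.
have -> : (n.+1 * k.+1 + k = (n * k.+1 + k) + k.+1)%N by rewrite mulSn; lia.
rewrite sum_n_gap; last first.
  move=> j hj; apply: zero; apply/negP => /dvdnP [q hq].
  have h3 : (n.+1 * k.+1 < q * k.+1)%N by rewrite -hq mulSn; lia.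
  have h4 : (q * k.+1 < n.+2 * k.+1)%N by rewrite -hq !mulSn; lia.
  by rewrite !ltn_mul2r /= in h3 h4; lia.
rewrite IH sum_Sn -val; congr Cplus.
by have -> : (n * k.+1 + k + k.+1 = n.+1 * k.+1 + k)%N by rewrite mulSn; lia.
Qed.

Lemma resonant_none (z xi : C) : (forall j, Cpow xi j.+1 <> 1%C) -> CSeries (resonant z xi) = 0%C.
Proof.
move=> h; apply: CSeries_unique.
apply: (is_cser_ext (u := fun _ => RtoC 0)).
  by move=> j; rewrite /resonant; case: Ceq_dec => // e; case: (h j).
apply: is_cser_pair; apply: is_series_lim; apply: is_lim_seq_ext (is_lim_seq_const 0) => n.
  by elim: n => [|n IH]; rewrite ?sum_O // sum_Sn -IH /plus /=; ring.
by elim: n => [|n IH]; rewrite ?sum_O // sum_Sn -IH /plus /=; ring.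
Qed.

Lemma unity_order (xi : C) : (forall j, Cpow xi j.+1 <> 1%C) \/
  exists k, (0 < k)%N /\ forall j, (0 < j)%N -> Cpow xi j = 1%C <-> (k %| j)%N.
Proof.
case: (classic (exists j, Cpow xi j.+1 = 1%C)) => [h|h]; last by left => j e; apply: h; exists j.
right.
pose p (n : nat) : bool := if Ceq_dec (Cpow xi n.+1) 1 then true else false.
have pP n : p n <-> Cpow xi n.+1 = 1%C by rewrite /p; case: Ceq_dec.
have ep : exists n, p n by case: h => n hn; exists n; apply/pP.
case: (ex_minnP ep) => m /pP hm min.
have per q r : Cpow xi (q * m.+1 + r)%N = Cpow xi r.
  by rewrite Cpow_add_r mulnC Cpow_mul hm Cpow_1_l Cmult_1_l.
exists m.+1; split=> // j j0; split=> [hj|/dvdnP [q ->]]; last first.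
  by have := per q 0%N; rewrite addn0.
rewrite /dvdn; apply/negPn/negP => nz.
have : Cpow xi (j %% m.+1)%N = 1%C by rewrite -(per (j %/ m.+1)%N) -divn_eq.
move: nz; case er : (j %% m.+1)%N => [|r] // _ hr.
have := min r; have -> : p r by apply/pP.
by move=> /(_ isT); have := ltn_pmod j (ltn0Sn m); rewrite er; lia.
Qed.

Lemma growth_scal (c : C) (k : R) : 0 < k -> growth (c / RtoC k)%C = growth c / k.
Proof.
move=> k0; rewrite /growth Cmod_div; last by apply: RtoC_neq0; lra.
rewrite Cmod_pos; last by lra.
have -> : Re (c / RtoC k)%C = Re c / k by rewrite /Cdiv -RtoC_invE Re_mult_RtoC.
by field; lra.
Qed.

Lemma growth_resonant (z xi : C) (L : R) : Cmod z <= 1 -> 0 <= L ->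
  (forall k, (0 < k)%N -> (forall j, (0 < j)%N -> Cpow xi j = 1%C <-> (k %| j)%N) ->
     growth (Li2 (Cpow z k)) / (INR k * INR k) <= L) ->
  growth (CSeries (resonant z xi)) <= L.
Proof.
move=> z1 L0 h; case: (unity_order xi) => [hn|[k [k0 hk]]].
  by rewrite resonant_none // /growth Cmod_0 /=; lra.
have kp : 0 < INR k by apply: lt_0_INR; lia.
rewrite (resonant_multiple z1 k0 hk) growth_scal; last by nra.
exact: h.
Qed.

Section CircleTail.

Variable z : C.
Hypotheses (z1 : Cmod z = 1) (zn : z <> 1%C).

(** Summation by parts for coefficients that are switched off up to N. The jump at N costs 1/(N+2),
    the later differences telescope to 1/(N+2) again, and the factor 2/|1 - z| gives the 4. *)
Lemma abel_tail (N : nat) :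
  Cmod (sum_n (G := C_R_NormedModule) (fun k => Cpow z k.+1 / RtoC (INR k.+1))%C N - log1m z)%C
   <= 4 / Cmod (1 - z)%C * / INR N.+2.
Proof.
pose g k : C := if (k <= N)%N then RtoC 0 else (/ RtoC (INR k.+1))%C.
pose b k := if (k < N)%N then 0 else if k == N then / INR N.+2 else / INR k.+1 - / INR k.+2.
pose B k := if (k <= N)%N then 2 * / INR N.+2 else / INR k.+1.
have inv_dec k : / INR k.+2 < / INR k.+1.
  apply: Rinv_lt_contravar; first by apply: Rmult_lt_0_compat; exact: INR_S_pos.
  by rewrite (S_INR k.+1); lra.
have ip k : 0 < / INR k.+1 by apply: Rinv_0_lt_compat; exact: INR_S_pos.
have [exb sb] : ex_series b /\ Series b <= B 0%N.
  apply: series_telescope => k; last by rewrite /B; case: ifP => _; have := ip N.+1; have := ip k; lra.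
  rewrite /b /B; have [hk|[hk|hk]] : (k < N)%N \/ (N < k)%N \/ k = N by lia.
  - by rewrite (ltnW hk) hk; lra.
  - have -> : (k <= N)%N = false by lia.
    have -> : (k.+1 <= N)%N = false by lia.
    have -> : (k == N) = false by lia.
    have := inv_dec k; lra.
  - rewrite hk leqnn ltnn eqxx.
    have := ip N.+1; lra.
have hg k : Cmod (g k - g k.+1)%C <= b k.
  rewrite /g /b; have [hk|[hk|hk]] : (k < N)%N \/ (N < k)%N \/ k = N by lia.
  - rewrite (ltnW hk) hk; have -> : (0 - 0 = 0)%C by ring.
    by rewrite Cmod_0; lra.
  - have -> : (k <= N)%N = false by lia.
    have -> : (k.+1 <= N)%N = false by lia.
    have -> : (k == N) = false by lia.
    rewrite -!RtoC_invE -RtoC_minus Cmod_pos; have := inv_dec k; lra.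
  - rewrite hk leqnn ltnn eqxx -!RtoC_invE.
    have -> : (0 - RtoC (/ INR N.+2) = - RtoC (/ INR N.+2))%C by ring.
    rewrite Cmod_opp Cmod_pos; have := ip N.+1; lra.
have g0 : is_lim_seq (fun k => Cmod (g k)) 0.
  have linv : is_lim_seq (fun n => / INR n.+1) 0.
    have -> : Rbar.Finite 0 = Rbar_inv p_infty by [].
    apply: is_lim_seq_inv => //; apply/(is_lim_seq_incr_1 INR); exact: is_lim_seq_INR.
  apply: is_lim_seq_le_le (is_lim_seq_const 0) linv => k; split; first exact: Cmod_ge_0.
  rewrite /g; case: ifP => _; first by rewrite Cmod_0; have := ip k; lra.
  by rewrite -RtoC_invE Cmod_pos; have := ip k; lra.
have [l [hl ll]] := abel_sum z1 zn hg exb g0.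
have [hlog _] := is_cser_log1m_circle z1 zn.
set S := sum_n _ N.
have hh : is_cser (fun k => Cpow z k.+1 * g k)%C (log1m z - S)%C.
  have hd : is_cser (fun k => if (k <= N)%N then Cpow z k.+1 / RtoC (INR k.+1) else 0)%C S.
    set w := (fun k => _).
    have eS n : (N <= n)%N -> sum_n (G := C_R_NormedModule) w n = S.
      move=> Nn; have -> : sum_n (G := C_R_NormedModule) w n = sum_n (G := C_R_NormedModule) w N.
        apply: (@sum_n_trailing_zero w N n Nn) => k hk; rewrite /w.
        by have -> : (k <= N)%N = false by lia.
      by apply: sum_n_ext_loc => k hk; rewrite /w; have -> : (k <= N)%N by lia.
    move=> P hP; exists N => n nN; rewrite eS; [exact: locally_singleton hP|lia].
  apply: is_cser_ext (is_cser_minus hlog hd) => k; unplusC.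
  by rewrite /g; case: ifP => _; rewrite /Cdiv; ring.
have e : l = (log1m z - S)%C by rewrite -(CSeries_unique hl) -(CSeries_unique hh).
have -> : (S - log1m z = - (log1m z - S))%C by ringC.
rewrite Cmod_opp -e; apply: Rle_trans ll _.
have d0 : 0 < Cmod (1 - z)%C.
  apply/Cmod_gt_0 => e1; apply: zn.
  have h : (z = 1 - (1 - z))%C by ring.
  by rewrite h e1; ring.
have -> : 4 / Cmod (1 - z)%C * / INR N.+2 = 2 / Cmod (1 - z)%C * (2 * / INR N.+2) by field; split; [have := INR_S_pos N.+1; lra|lra].
apply: Rmult_le_compat_l; first by left; apply: Rdiv_lt_0_compat; lra.
by move: sb; rewrite /B.
Qed.

End CircleTail.

Lemma one_minus_unit (t : R) : 0 < t < 2 * PI -> Cmod (1 - unit_c t)%C = 2 * sin (t / 2) /\ 0 < sin (t / 2).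
Proof.
move=> ht; have s0 : 0 < sin (t / 2) by apply: sin_gt_0; lra.
split=> //; apply: Rsqr_inj; [exact: Cmod_ge_0|lra|].
rewrite /Rsqr Cmod_sqr !ReImE /=.
have e : t = 2 * (t / 2) by field.
move: (t / 2) e => u ->.
rewrite cos_2a_sin sin_2a; have := sin2_cos2 u; rewrite /Rsqr => h; nra.
Qed.

Lemma unit_c_neq1 (t : R) : 0 < t < 2 * PI -> unit_c t <> 1%C.
Proof.
move=> ht e; have [h1 h2] := one_minus_unit ht; move: h1; rewrite e.
have -> : (1 - 1 = 0)%C by ring.
by rewrite Cmod_0; lra.
Qed.

Lemma log1m_unit (t : R) : 0 < t < 2 * PI -> log1m (unit_c t) = (- ln (2 * sin (t / 2)), (PI - t) / 2).
Proof.
move=> ht; have [h1 h2] := one_minus_unit ht.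
rewrite /log1m h1; congr pair; rewrite /=.
have e : t = 2 * (t / 2) by field.
have -> : sin t / (1 - cos t) = tan ((PI - t) / 2).
  have -> : (PI - t) / 2 = PI / 2 - t / 2 by field.
  move: (t / 2) e h2 => u -> h2.
  rewrite /tan sin_shift cos_shift sin_2a cos_2a_sin; field; split; nra.
by rewrite atan_tan //; lra.
Qed.

(* On (0, 2 pi), [LX] is a quadratic polynomial and [LY] has derivative [- ln (2 sin (t / 2))]. *)
Definition LX (t : R) : R := Re (Li2 (unit_c t)).
Definition LY (t : R) : R := Im (Li2 (unit_c t)).

(** The formal derivative of Li2 (e^(it)) is i times the logarithmic series, which by [abel_tail]
    converges uniformly on [a, b]; the partial sums are integrated and the limit is taken. *)
Lemma Li2_circle_int (a b : R) : 0 < a -> a <= b -> b < 2 * PI ->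
  is_RIntC (fun t => Ci * log1m (unit_c t))%C a b (Li2 (unit_c b) - Li2 (unit_c a))%C.
Proof.
move=> a0 ab b2.
(* Uniform convergence is required on the whole line, so the integrands are made constant outside
   [a, b] by clamping t. *)
pose cl t := Rmax a (Rmin t b).
have clh t : a <= cl t <= b.
  by rewrite /cl; split; [exact: Rmax_l|apply: Rmax_lub => //; exact: Rmin_r].
have cle t : a <= t <= b -> cl t = t by move=> ht; rewrite /cl Rmin_left ?Rmax_right; lra.
pose g N t := (Ci * sum_n (G := C_R_NormedModule) (fun k => Cpow (unit_c (cl t)) k.+1 / RtoC (INR k.+1))%C N)%C.
pose gl t := (Ci * log1m (unit_c (cl t)))%C.
pose F N t := sum_n (G := C_R_NormedModule) (fun k => Cpow (unit_c t) k.+1 / RtoC (INR k.+1 * INR k.+1))%C N.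
have FE N t : F N t = (sum_n (fun k => cos (INR k.+1 * t) / (INR k.+1 * INR k.+1)) N,
                       sum_n (fun k => sin (INR k.+1 * t) / (INR k.+1 * INR k.+1)) N).
  apply: C_ext; rewrite /F ?Re_sum_n ?Im_sum_n; apply: sum_n_ext => k;
    by rewrite unit_c_pow /Cdiv -RtoC_invE /Re /Im /= /Rdiv; ring.
pose G N t := (Ci * sum_n (G := C_R_NormedModule) (fun k => Cpow (unit_c t) k.+1 / RtoC (INR k.+1))%C N)%C.
have GE N t : G N t = (- sum_n (fun k => sin (INR k.+1 * t) / INR k.+1) N,
                        sum_n (fun k => cos (INR k.+1 * t) / INR k.+1) N).
  have e : sum_n (G := C_R_NormedModule) (fun k => Cpow (unit_c t) k.+1 / RtoC (INR k.+1))%C N =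
     (sum_n (fun k => cos (INR k.+1 * t) / INR k.+1) N, sum_n (fun k => sin (INR k.+1 * t) / INR k.+1) N).
    apply: C_ext; rewrite ?Re_sum_n ?Im_sum_n; apply: sum_n_ext => k;
      by rewrite unit_c_pow /Cdiv -RtoC_invE /Re /Im /= /Rdiv; ring.
  by rewrite /G e; apply: C_ext; rewrite /Re /Im /=; ring.
have dF N t : is_derive (V := C_R_NormedModule) (F N) t (G N t).
  have k0 k : INR k.+1 <> 0 by have := INR_S_pos k; lra.
  apply: is_deriveC; rewrite GE.
    apply: (is_derive_ext (fun t => sum_n (fun k => cos (INR k.+1 * t) / (INR k.+1 * INR k.+1)) N)).
      by move=> u; rewrite FE.
    rewrite /=; elim: N => [|N IH].
      apply: (is_derive_ext (fun t => cos (INR 1 * t) / (INR 1 * INR 1))) => [u|]; first by rewrite sum_O.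
      by rewrite sum_O; auto_derive => //; field; exact: k0.
    apply: (is_derive_ext (fun t => plus (sum_n (fun k => cos (INR k.+1 * t) / (INR k.+1 * INR k.+1)) N)
       (cos (INR N.+2 * t) / (INR N.+2 * INR N.+2)))) => [u|]; first by rewrite sum_Sn.
    rewrite sum_Sn.
    have -> : - plus (sum_n (fun k => sin (INR k.+1 * t) / INR k.+1) N) (sin (INR N.+2 * t) / INR N.+2) =
      plus (- sum_n (fun k => sin (INR k.+1 * t) / INR k.+1) N) (- (sin (INR N.+2 * t) / INR N.+2)).
      by rewrite /plus /=; ring.
    apply: (@is_derive_plus _ R_NormedModule) IH _.
    by auto_derive => //; field; exact: k0.
  apply: (is_derive_ext (fun t => sum_n (fun k => sin (INR k.+1 * t) / (INR k.+1 * INR k.+1)) N)).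
    by move=> u; rewrite FE.
  rewrite /=; elim: N => [|N IH].
    apply: (is_derive_ext (fun t => sin (INR 1 * t) / (INR 1 * INR 1))) => [u|]; first by rewrite sum_O.
    by rewrite sum_O; auto_derive => //; field; exact: k0.
  apply: (is_derive_ext (fun t => plus (sum_n (fun k => sin (INR k.+1 * t) / (INR k.+1 * INR k.+1)) N)
     (sin (INR N.+2 * t) / (INR N.+2 * INR N.+2)))) => [u|]; first by rewrite sum_Sn.
  rewrite sum_Sn; apply: (@is_derive_plus _ R_NormedModule) IH _.
  by auto_derive => //; field; exact: k0.
have contU t : contC unit_c t.
  by apply: continuousC; rewrite /unit_c /Re /Im /=; [exact: continuous_cos|exact: continuous_sin].
have contG N t : contC (G N) t.
  apply: contC_mult; first exact: contC_const.
  elim: N => [|N IH].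
    apply: (continuous_ext (fun t => Cpow (unit_c t) 1 / RtoC (INR 1))%C) => [u|]; first by rewrite sum_O.
    by apply: contC_mult; [exact: contC_pow|exact: contC_const].
  apply: (continuous_ext (fun t => sum_n (G := C_R_NormedModule) (fun k => Cpow (unit_c t) k.+1 / RtoC (INR k.+1))%C N +
     Cpow (unit_c t) N.+2 / RtoC (INR N.+2))%C) => [u|]; first by rewrite sum_Sn.
  by apply: contC_plus => //; apply: contC_mult; [exact: contC_pow|exact: contC_const].
have ig N : is_RIntC (g N) a b (F N b - F N a)%C.
  apply: (@is_RInt_ext C_R_NormedModule (G N)).
    by move=> t; rewrite Rmin_left // Rmax_right // => ht; rewrite /g cle //; lra.
  by apply: (@is_RInt_derive C_R_CompleteNormedModule (F N)) => t _; [exact: dF|exact: contG].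
have hs t : 0 < sin (cl t / 2) /\ Rmin (sin (a / 2)) (sin (b / 2)) <= sin (cl t / 2).
  have hc := clh t; have [_ s0] := @one_minus_unit (cl t) ltac:(lra); split=> //.
  case: (Rle_dec (cl t / 2) (PI / 2)) => h.
    by apply: Rle_trans (Rmin_l _ _) _; apply: sin_incr_1; lra.
  by apply: Rle_trans (Rmin_r _ _) _; apply: sin_decr_1; lra.
have [_ sa] := @one_minus_unit a ltac:(lra); have [_ sb] := @one_minus_unit b ltac:(lra).
set mu := Rmin (sin (a / 2)) (sin (b / 2)) in hs.
have mu0 : 0 < mu by exact: Rmin_glb_lt.
have fg : filterlim g eventually (locally (T := fct_UniformSpace R C_R_NormedModule) gl).
  move=> P [e he].
  have linv : is_lim_seq (fun n => 2 / mu * / INR n.+2) 0.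
    have l0 : is_lim_seq (fun n => / INR n.+2) 0.
      have -> : Rbar.Finite 0 = Rbar_inv p_infty by [].
      apply: is_lim_seq_inv => //; apply/(is_lim_seq_incr_1 (fun n => INR n.+1)).
      apply/(is_lim_seq_incr_1 INR); exact: is_lim_seq_INR.
    by have := is_lim_seq_scal_l _ (2 / mu) _ l0; rewrite /= Rmult_0_r.
  have /is_lim_seq_spec/(_ e) [N0 hN0] := linv; exists N0 => N hN; apply: he => t.
  apply: C_NormedModule_mixin_compat1.
  have -> : minus (g N t) (gl t) = (Ci * (sum_n (G := C_R_NormedModule) (fun k => Cpow (unit_c (cl t)) k.+1 / RtoC (INR k.+1))%C N - log1m (unit_c (cl t))))%C.
    by rewrite /g /gl; ringC.
  rewrite Cmod_mult Cmod_Ci Rmult_1_l.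
  have hc := clh t; have hcp : 0 < cl t < 2 * PI by lra.
  apply: Rle_lt_trans (abel_tail (Cmod_unit_c _) (unit_c_neq1 hcp) N) _.
  have [-> s0] := one_minus_unit hcp; have [_ hmu] := hs t.
  have := hN0 N hN; rewrite Rminus_0_r => h3.
  apply: Rle_lt_trans (Rle_trans _ _ _ _ (Rle_abs _)) h3.
  apply: Rmult_le_compat_r; first by left; apply: Rinv_0_lt_compat; exact: INR_S_pos.
  have -> : 4 / (2 * sin (cl t / 2)) = 2 * / sin (cl t / 2) by field; lra.
  by apply: Rmult_le_compat_l; [lra|exact: Rinv_le_contravar].
have [If [i1 i2]] := @filterlim_RInt nat C_R_CompleteNormedModule g a b eventually _ gl _ ig fg.
have Flim t : is_cser (fun k => Cpow (unit_c t) k.+1 / RtoC (INR k.+1 * INR k.+1))%C (Li2 (unit_c t)).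
  by apply: is_cser_Li2; rewrite Cmod_unit_c; lra.
have eI : If = (Li2 (unit_c b) - Li2 (unit_c a))%C.
  apply: (filterlim_locally_unique (V := C_R_NormedModule) (F := eventually)) i1 _.
  have hb : filterlim (fun N => opp (F N a)) eventually (locally (opp (Li2 (unit_c a)))).
    exact: filterlim_comp (Flim a) (@filterlim_opp _ C_R_NormedModule _).
  have hp := @filterlim_plus _ C_R_NormedModule (Li2 (unit_c b)) (opp (Li2 (unit_c a))).
  have hc := filterlim_comp_2 _ _ (@plus C_R_NormedModule) (Flim b) hb hp.
  exact: (hc (@filter_filter _ _ eventually_filter)).
rewrite -eI; apply: (@is_RInt_ext C_R_NormedModule gl) i2.
by move=> t; rewrite Rmin_left // Rmax_right // => ht; rewrite /gl cle //; lra.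
Qed.

Lemma unit_c_0 : unit_c 0 = 1%C.
Proof. by rewrite /unit_c cos_0 sin_0. Qed.

Lemma Cmod_unit_c_minus1 (y : R) : Cmod (unit_c y - 1)%C <= Rabs y.
Proof.
apply: Rsqr_incr_0; [|exact: Cmod_ge_0|exact: Rabs_pos].
rewrite -Rsqr_abs /Rsqr Cmod_sqr !ReImE /=.
have := one_minus_cos_le y; have := sin2_cos2 y; rewrite /Rsqr; nra.
Qed.

Lemma is_cser_Li2_unit (t : R) :
  is_cser (fun k => Cpow (unit_c t) k.+1 / RtoC (INR k.+1 * INR k.+1))%C (Li2 (unit_c t)).
Proof. by apply: is_cser_Li2; rewrite Cmod_unit_c; lra. Qed.

Lemma Li2_unit_cont (e : R) : 0 < e ->
  exists d, 0 < d /\ forall t, 0 < t < d -> Cmod (Li2 (unit_c t) - Li2 1)%C <= e.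
Proof.
move=> e0.
pose a t (k : nat) := (Cpow (unit_c t) k.+1 / RtoC (INR k.+1 * INR k.+1) - Cpow 1 k.+1 / RtoC (INR k.+1 * INR k.+1))%C.
have hs t : is_cser (a t) (Li2 (unit_c t) - Li2 1)%C.
  by apply: is_cser_minus; [exact: is_cser_Li2_unit|apply: is_cser_Li2; rewrite Cmod_1; lra].
have hM : ex_series (fun k => isq k + isq k) by apply: (@ex_series_plus _ R_NormedModule); exact: ex_series_isq.
have fr : Filter (at_right 0) by exact: filter_filter.
have [|n e' he'|d hd] := @tannery R (at_right 0) fr a _ hM _ _ _ e0.
- exists (mkposreal 1 Rlt_0_1) => t _ _ n; apply: Rle_trans (Cmod_minus_le _ _) _.
  have h1 := @Cmod_isq_le (unit_c t) n; have h2 := @Cmod_isq_le 1 n.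
  rewrite Cmod_unit_c in h1; rewrite Cmod_1 in h2.
  have h3 := h1 (Rle_refl 1); have h4 := h2 (Rle_refl 1).
  lra.
- have n0 := INR_S_pos n.
  exists (mkposreal _ (Rdiv_lt_0_compat _ _ he' n0)) => t; rewrite /ball /= /AbsRing_ball /abs /minus /plus /opp /= => ht t0.
  rewrite Ropp_0 Rplus_0_r Rabs_pos_eq in ht; last by lra.
  rewrite /a unit_c_pow Cpow_1_l.
  have -> : (unit_c (INR n.+1 * t) / RtoC (INR n.+1 * INR n.+1) - 1 / RtoC (INR n.+1 * INR n.+1) =
    (unit_c (INR n.+1 * t) - 1) * / RtoC (INR n.+1 * INR n.+1))%C by rewrite /Cdiv; ring.
  rewrite Cmod_mult -RtoC_invE Cmod_pos; last by left; exact: isq_pos.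
  have := Cmod_unit_c_minus1 (INR n.+1 * t); rewrite Rabs_pos_eq; last by nra.
  have i1 : / (INR n.+1 * INR n.+1) <= 1.
    by rewrite -[X in _ <= X]Rinv_1; apply: Rinv_le_contravar; have := INR_S_ge1 n; nra.
  have i0 : 0 < / (INR n.+1 * INR n.+1) by exact: isq_pos.
  have : INR n.+1 * t < e'.
    have -> : e' = INR n.+1 * (e' / INR n.+1) by field; lra.
    exact: Rmult_lt_compat_l.
  have := Cmod_ge_0 (unit_c (INR n.+1 * t) - 1)%C; nra.
exists d; split; first exact: cond_pos.
move=> t ht; rewrite -(CSeries_unique (hs t)); apply: hd; last by lra.
rewrite /ball /= /AbsRing_ball /abs /minus /plus /opp /= Ropp_0 Rplus_0_r Rabs_pos_eq; lra.
Qed.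

Lemma Re_is_RIntC (f : R -> C) (a b : R) (l : C) :
  is_RIntC f a b l -> is_RInt (fun t => Re (f t)) a b (Re l) /\ is_RInt (fun t => Im (f t)) a b (Im l).
Proof.
move=> h; split.
  exact: (is_RInt_fct_extend_fst (U := R_NormedModule) (V := R_NormedModule)).
exact: (is_RInt_fct_extend_snd (U := R_NormedModule) (V := R_NormedModule)).
Qed.

Lemma LX_int (a b : R) : 0 < a -> a <= b -> b < 2 * PI ->
  is_RInt (fun t => - ((PI - t) / 2)) a b (LX b - LX a).
Proof.
move=> a0 ab b2; have [h _] := Re_is_RIntC (Li2_circle_int a0 ab b2).
apply: (is_RInt_ext _ _ _ _ _ _) h => t; rewrite Rmin_left // Rmax_right // => ht.
by rewrite log1m_unit; [rewrite !ReImE /=; ring|lra].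
Qed.

Lemma LY_int (a b : R) : 0 < a -> a <= b -> b < 2 * PI ->
  is_RInt (fun t => - ln (2 * sin (t / 2))) a b (LY b - LY a).
Proof.
move=> a0 ab b2; have [_ h] := Re_is_RIntC (Li2_circle_int a0 ab b2).
apply: (is_RInt_ext _ _ _ _ _ _) h => t; rewrite Rmin_left // Rmax_right // => ht.
by rewrite log1m_unit; [rewrite !ReImE /=; ring|lra].
Qed.

Notation basel := (Re (Li2 1)).

Lemma LX_poly (t : R) : 0 < t < 2 * PI -> LX t = basel - PI * t / 2 + t * t / 4.
Proof.
move=> ht; pose F u := - (PI * u / 2) + u * u / 4.
have dF a : 0 < a <= t -> LX t - LX a = F t - F a.
  move=> ha; have h1 := @LX_int a t ltac:(lra) ltac:(lra) ltac:(lra).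
  have h2 : is_RInt (fun u => - ((PI - u) / 2)) a t (F t - F a).
    apply: (is_RInt_derive F) => u _.
      by rewrite /F; auto_derive => //; field.
    by apply: (ex_derive_continuous (fun u => - ((PI - u) / 2))); auto_derive.
  by rewrite -(is_RInt_unique _ _ _ _ h1) -(is_RInt_unique _ _ _ _ h2).
have : forall e, 0 < e -> Rabs (LX t - (basel + F t)) <= e.
  move=> e e0; have [d [d0 hd]] := @Li2_unit_cont (e / 2) ltac:(lra).
  pose a := Rmin (Rmin (d / 2) t) (Rmin 1 (e / (PI + 2))).
  have p3 := PI2_3_2.
  have e1 : 0 < e / (PI + 2) by apply: Rdiv_lt_0_compat; lra.
  have a0 : 0 < a by rewrite /a; do! apply: Rmin_glb_lt; lra.
  have a1 : a <= d / 2 by rewrite /a; apply: Rle_trans (Rmin_l _ _) (Rmin_l _ _).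
  have a2 : a <= t by rewrite /a; apply: Rle_trans (Rmin_l _ _) (Rmin_r _ _).
  have a3 : a <= 1 by rewrite /a; apply: Rle_trans (Rmin_r _ _) (Rmin_l _ _).
  have a4 : a <= e / (PI + 2) by rewrite /a; apply: Rle_trans (Rmin_r _ _) (Rmin_r _ _).
  have ha := dF a ltac:(lra).
  have hc := hd a ltac:(lra).
  have hr : Rabs (LX a - basel) <= e / 2.
    by apply: Rle_trans hc; have := re_le_Cmod (Li2 (unit_c a) - Li2 1)%C; rewrite ReImE.
  have a5 : a * (PI + 2) <= e.
    have -> : e = e / (PI + 2) * (PI + 2) by field; lra.
    by apply: Rmult_le_compat_r; lra.
  have -> : LX t - (basel + F t) = (LX a - basel) - F a by lra.
  move: hr => /Rabs_le_between' hr; apply/Rabs_le_between; rewrite /F; nra.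
move=> h; have e : LX t - (basel + F t) = 0.
  case: (Req_dec (LX t - (basel + F t)) 0) => // n0.
  have := h (Rabs (LX t - (basel + F t)) / 2); have := Rabs_pos_lt _ n0; lra.
move: e; rewrite /F; lra.
Qed.

(** * The value of the dilogarithm at -1 and the Basel problem *)

Lemma Cpow_m1 (j : nat) : Cpow (RtoC (-1)) j = RtoC (if odd j then -1 else 1).
Proof.
elim: j => [|j IH] //=; rewrite IH -RtoC_mult; congr RtoC.
by case: (odd j) => /=; ring.
Qed.

Lemma unit_c_PI : unit_c PI = RtoC (-1).
Proof. by rewrite /unit_c cos_PI sin_PI. Qed.

Lemma m1_order (j : nat) : (0 < j)%N -> Cpow (RtoC (-1)) j = 1%C <-> (2 %| j)%N.
Proof.
move=> _; rewrite dvdn2 Cpow_m1; case: (odd j); split=> //.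
by case; lra.
Qed.

(** Twice the even-index part, which is Li2 1 / 4 by [resonant_multiple], minus the whole series at
    1. *)
Lemma Li2_m1_basel : Li2 (RtoC (-1)) = RtoC (- (basel / 2)).
Proof.
have m1 : Cmod (RtoC (-1)) <= 1 by rewrite Cmod_R Rabs_left; lra.
have m2 : Cmod 1%C <= 1 by rewrite Cmod_1; lra.
have rs := resonant_multiple m2 (isT : (0 < 2)%N) m1_order.
have h1 := @is_cser_resonant 1 (RtoC (-1)) m2; rewrite rs Cpow_1_l in h1.
have h2 := is_cser_minus (@is_cser_Cmult 2 _ _ h1) (is_cser_Li2 m2).
have e : Li2 (RtoC (-1)) = (2 * (Li2 1 / RtoC (INR 2 * INR 2)) - Li2 1)%C.
  rewrite -(CSeries_unique (is_cser_Li2 m1)) -(CSeries_unique h2); apply: CSeries_ext => k; unplusC.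
  rewrite /resonant !Cpow_1_l; case: Ceq_dec => h; rewrite [is_left _]/=; first by rewrite h; ring.
  move: h; rewrite Cpow_m1; case: (odd _) => // _.
  have -> : RtoC (-1) = Copp 1 by apply: C_ext; rewrite /=; ring.
  by rewrite /Cdiv; ring.
have i0 := Li2_1_real.
rewrite e /Cdiv -RtoC_invE; move: (Li2 1) i0 => [x y] /= ->.
have -> : INR 2 = 2 by rewrite /INR; lra.
  by apply: C_ext; rewrite /Re /Im /=; field.
Qed.

Lemma LX_PI : LX PI = - (basel / 2).
Proof. by rewrite /LX unit_c_PI Li2_m1_basel. Qed.

Lemma LY_PI : LY PI = 0.
Proof. by rewrite /LY unit_c_PI Li2_m1_basel. Qed.

(** Euler's value, from the quadratic polynomial at t = pi: -basel/2 = basel - pi^2/4. *)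
Lemma basel_PI : PI * PI = 6 * basel.
Proof.
have p3 := PI2_3_2.
by have := @LX_poly PI ltac:(lra); rewrite LX_PI; lra.
Qed.

Lemma is_series_basel : is_series isq basel.
Proof.
have h := is_cser_Re (@is_cser_Li2 1 ltac:(rewrite Cmod_1; lra)).
apply: is_series_ext h => k; rewrite Cpow_1_l /Cdiv Cmult_1_l -RtoC_invE //.
Qed.

Lemma isq_sum_tail (N : nat) : Rabs (basel - sum_n isq N) <= / (INR N.+1 + / 2) /\ / INR N.+2 <= basel - sum_n isq N.
Proof.
have [ex le] := isq_tail N.+1.
have e : basel - sum_n isq N = Series (fun n => isq (N.+1 + n)%N).
  rewrite -(is_series_unique _ _ is_series_basel).
  rewrite (Series_incr_n isq N.+1); [|lia|exact: ex_series_isq].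
  by rewrite sum_n_Reals; apply: Rplus_minus_l.
have lo : / INR N.+2 <= Series (fun n => isq (N.+1 + n)%N).
  have lim1 : is_lim_seq (sum_n (fun n => isq (N.+1 + n)%N)) (Series (fun n => isq (N.+1 + n)%N)).
    exact: (Series_correct _ ex).
  have lim2 : is_lim_seq (fun n => / INR N.+2 - / INR (N.+3 + n)) (/ INR N.+2).
    have l0 : is_lim_seq (fun n => / INR (N.+3 + n)) 0.
      have -> : Rbar.Finite 0 = Rbar_inv p_infty by [].
      apply: is_lim_seq_inv => //.
      apply: (is_lim_seq_ext (fun n => INR (n + N.+3))) => [n|]; first by rewrite addnC.
      by apply/(is_lim_seq_incr_n INR); exact: is_lim_seq_INR.
    have := is_lim_seq_minus' _ _ _ _ (is_lim_seq_const (/ INR N.+2)) l0.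
    by rewrite Rminus_0_r.
  refine (lim_seq_le_R lim2 lim1 _) => n; elim: n => [|n IH].
    rewrite sum_O addn0 addn0 /isq (S_INR N.+2) .
    have h := INR_S_pos N.+1; set x := INR N.+2 in h *.
    have -> : / x - / (x + 1) = / (x * (x + 1)) by field; lra.
    by apply: Rinv_le_contravar; nra.
  rewrite sum_Sn /plus /=; apply: Rle_trans (Rplus_le_compat_r _ _ _ IH).
  rewrite /isq; have -> : (N.+3 + n.+1 = (N.+3 + n).+1)%N by lia.
  have -> : (N.+1 + n.+1).+1 = (N.+3 + n)%N by lia.
  have h := INR_S_pos (N.+2 + n)%N; rewrite (S_INR (N.+3 + n)) -![(N.+3 + n)%N]/((N.+2 + n).+1); set x := INR _ in h *.
  have e2 : / x - / (x + 1) = / (x * (x + 1)) by field; lra.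
  have : / (x * (x + 1)) <= / (x * x) by apply: Rinv_le_contravar; nra.
  lra.
rewrite e; split; last exact: lo.
rewrite Rabs_pos_eq; first exact: le.
by apply: Rle_trans lo; left; apply: Rinv_0_lt_compat; exact: INR_S_pos.
Qed.

(** * Numerical bounds for pi^2/6, pi and the imaginary part of the dilogarithm *)

Lemma isq_IZR (k : nat) : isq k = / IZR (Z.of_nat (k.+1 * k.+1)).
Proof. by rewrite -INR_IZR_INZ mult_INR. Qed.

(** Ten terms, with the tail between 1/11 and 2/21. *)
Lemma basel_bounds : 1.6406 <= basel <= 1.6451.
Proof.
have [h1 h2] := isq_sum_tail 9; move: h1 => /Rabs_le_between [_ h1].
rewrite !sum_Sn sum_O !isq_IZR !INR_IZR_INZ /plus in h1 h2.
move: h1 h2; generalize basel => P /= h1 h2.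
have e : / (10 + / 2) = 2 / 21 by field.
lra.
Qed.

Lemma PI_bounds : 3.137 <= PI <= 3.142.
Proof. have := basel_PI; have := basel_bounds; have := PI2_3_2; nra. Qed.

Lemma LY_sum (t : R) (N : nat) :
  Rabs (LY t - sum_n (fun k => Im (Cpow (unit_c t) k.+1) * isq k) N) <= / (INR N.+1 + / 2).
Proof.
have [ex le] := isq_tail N.+1.
have hs := is_cser_Im (@is_cser_Li2_unit t).
have es k : Im (Cpow (unit_c t) k.+1 / RtoC (INR k.+1 * INR k.+1))%C = Im (Cpow (unit_c t) k.+1) * isq k.
  by rewrite /Cdiv -RtoC_invE /isq /Im /=; ring.
have bd k : Rabs (Im (Cpow (unit_c t) k.+1) * isq k) <= isq k.
  rewrite -es; apply: Rle_trans (im_le_Cmod _) _; apply: Cmod_isq_le; rewrite Cmod_unit_c; lra.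
have hs' : is_series (fun k => Im (Cpow (unit_c t) k.+1) * isq k) (LY t) by apply: is_series_ext hs.
have e : LY t - sum_n (fun k => Im (Cpow (unit_c t) k.+1) * isq k) N =
   Series (fun n => (fun k => Im (Cpow (unit_c t) k.+1) * isq k) (N.+1 + n)%N).
  rewrite -(is_series_unique _ _ hs').
  rewrite (Series_incr_n (fun k => Im (Cpow (unit_c t) k.+1) * isq k) N.+1); [|lia|by exists (LY t)].
  by rewrite sum_n_Reals; apply: Rplus_minus_l.
rewrite e; apply: Rle_trans le; apply: Rle_trans (Series_Rabs _ _) _.
  by apply: (@ex_series_le R_AbsRing R_CompleteNormedModule _ (fun n => isq (N.+1 + n)%N)) => // n; apply: Rle_trans (bd (N.+1 + n)%N); right; exact: Rabs_Rabsolu.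
by apply: Series_le => // n; split; [exact: Rabs_pos|exact: bd].
Qed.

(** This value is Catalan's constant, 0.9159...; eight terms suffice for the lower bound and twelve
    for the upper one. *)
Lemma LY_half_PI : 0.79 <= LY (PI / 2) <= 0.993.
Proof.
have u : unit_c (PI / 2) = Ci by rewrite /unit_c cos_PI2 sin_PI2.
have h1 := LY_sum (PI / 2) 7; have h2 := LY_sum (PI / 2) 11.
rewrite u in h1 h2; move: h1 h2 => /Rabs_le_between [h1 _] /Rabs_le_between [_ h2].
rewrite !sum_Sn sum_O !isq_IZR !INR_IZR_INZ /plus /Im /= in h1 h2; lra.
Qed.

(** The threshold is what [growth_zeta3] requires: for L = basel/9 and Re = -basel/3 the parabola
    condition reads Im^2 < (4 basel/9)^2. The terms are periodic mod 3 up to 1/k^2, so the partial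
    sum is a rational multiple of sqrt 3. *)
Lemma LY_two_thirds : LY (2 * PI / 3) < 4 * basel / 9.
Proof.
pose s := sqrt 3 / 2.
have sq : sqrt 3 * sqrt 3 = 3 by apply: sqrt_sqrt; lra.
have sb : 0 < sqrt 3 < 1.7321 by split; [apply: sqrt_lt_R0; lra|have := sqrt_pos 3; nra].
have u : unit_c (2 * PI / 3) = (- / 2, s).
  have -> : 2 * PI / 3 = 2 * (PI / 3) by field.
  rewrite /unit_c cos_2a sin_2a cos_PI3 sin_PI3 /s; congr pair; last by field.
  by nra.
have u2 : Cpow (- / 2, s) 2 = (- / 2, - s) by apply: C_ext; rewrite /= /s; nra.
have u3 : Cpow (- / 2, s) 3 = 1%C.
  rewrite (Cpow_add_r _ 2 1) u2 Cpow_1_r; apply: C_ext; rewrite /= /s; nra.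
have per k : Im (Cpow (- / 2, s) k.+4) = Im (Cpow (- / 2, s) k.+1).
  by rewrite -[k.+4]/(3 + k.+1)%N Cpow_add_r u3 Cmult_1_l.
have v1 : Im (Cpow (- / 2, s) 1) = s by rewrite Cpow_1_r.
have v2 : Im (Cpow (- / 2, s) 2) = - s by rewrite u2.
have v3 : Im (Cpow (- / 2, s) 3) = 0 by rewrite u3.
have := LY_sum (2 * PI / 3) 28; rewrite u => /Rabs_le_between [_ h].
rewrite !sum_Sn sum_O !isq_IZR !INR_IZR_INZ !per v1 v2 v3 /plus in h.
have [bl _] := basel_bounds.
move: h bl; generalize basel => P /= h bl.
have e : / (29 + / 2) = 2 / 59 by field.
rewrite e {e} in h.
have s0 : 0 < s < 0.86605 by rewrite /s; lra.
nra.
Qed.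

(** The level set growth z = L is the parabola |z| = 2 L - Re z with focus 0, that is Im^2 = 4 L (L
    - Re); comparing growths thus needs no square root. *)
Lemma growth_lt (z : C) (L : R) : 0 < L -> Re z < L -> Im z * Im z < 4 * L * (L - Re z) -> growth z < L.
Proof.
move=> L0 rL h; have c0 := Cmod_ge_0 z; have hc := Cmod_sqr z; rewrite /growth.
apply: Rnot_le_lt => h2; have h3 : 2 * L - Re z <= Cmod z by lra.
have : (2 * L - Re z) * (2 * L - Re z) <= Cmod z * Cmod z by apply: Rmult_le_compat; lra.
lra.
Qed.

Lemma lt_growth (z : C) (L : R) : 0 <= L -> 4 * L * (L - Re z) < Im z * Im z -> L < growth z.
Proof.
move=> L0 h; have c0 := Cmod_ge_0 z; have hc := Cmod_sqr z; rewrite /growth.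
apply: Rnot_le_lt => h2; have h3 : Cmod z <= 2 * L - Re z by lra.
have : Cmod z * Cmod z <= (2 * L - Re z) * (2 * L - Re z) by apply: Rmult_le_compat; lra.
lra.
Qed.

Lemma growth_eq (z : C) : Im z * Im z = 4 * growth z * (growth z - Re z).
Proof. have hc := Cmod_sqr z; rewrite /growth.
have -> : 4 * ((Re z + Cmod z) / 2) * ((Re z + Cmod z) / 2 - Re z) = Cmod z * Cmod z - Re z * Re z by field.
lra. Qed.

Lemma Re_le_growth (z : C) : Re z <= growth z.
Proof. have := Re_le_Cmod z; rewrite /growth; lra. Qed.

Lemma growth_le_Cmod (z : C) : growth z <= Cmod z.
Proof. have := Re_le_Cmod z; rewrite /growth; lra. Qed.

Lemma growth_conj (z : C) : growth (Cconj z) = growth z.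
Proof. by rewrite /growth Cmod_conj. Qed.

Lemma Cmod_Li2_le (z : C) : Cmod z <= 1 -> Cmod (Li2 z) <= basel.
Proof.
move=> z1; apply: Cmod_cser_le (is_cser_Li2 z1) _ is_series_basel => n; exact: Cmod_isq_le.
Qed.

Lemma growth_Li2_le (z : C) : Cmod z <= 1 -> growth (Li2 z) <= basel.
Proof. by move=> /Cmod_Li2_le; apply: Rle_trans; exact: growth_le_Cmod. Qed.

Lemma growth_Li2_m1 : growth (Li2 (RtoC (-1))) = 0.
Proof.
have [h _] := basel_bounds.
rewrite Li2_m1_basel; move: basel h => P h.
by rewrite /growth Cmod_R Rabs_left /=; lra.
Qed.

(** * Monotonicity of the growth along the upper half circle *)

Lemma LX_derive (t : R) : 0 < t < 2 * PI -> is_derive LX t (- ((PI - t) / 2)).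
Proof.
move=> ht.
apply: (is_derive_ext_loc (fun u => basel - PI * u / 2 + u * u / 4)).
  have d0 : 0 < Rmin t (2 * PI - t) by apply: Rmin_glb_lt; lra.
  exists (mkposreal _ d0) => u; rewrite /ball /= /AbsRing_ball /abs /minus /plus /opp /= => hu.
  have h1 := Rmin_l t (2 * PI - t); have h2 := Rmin_r t (2 * PI - t).
  rewrite LX_poly //; move: hu => /Rabs_lt_between; lra.
auto_derive => //; field.
Qed.

Lemma LY_derive (t : R) : 0 < t < 2 * PI -> is_derive LY t (- ln (2 * sin (t / 2))).
Proof.
move=> ht; pose a := t / 2.
apply: (@is_derive_ext R_AbsRing R_NormedModule (fun u => (LY u - LY a) + LY a)) => [u|]; first by rewrite /=; lra.
have -> : - ln (2 * sin (t / 2)) = plus (- ln (2 * sin (t / 2))) 0 by rewrite /plus /=; ring.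
apply: (@is_derive_plus _ R_NormedModule); last exact: is_derive_const.
apply: (@is_derive_RInt R_NormedModule (fun u => - ln (2 * sin (u / 2))) (fun u => LY u - LY a) a t).
  have d0 : 0 < Rmin (t - a) (2 * PI - t) by apply: Rmin_glb_lt; rewrite /a; lra.
  exists (mkposreal _ d0) => u; rewrite /ball /= /AbsRing_ball /abs /minus /plus /opp /= => hu.
  have h1 := Rmin_l (t - a) (2 * PI - t); have h2 := Rmin_r (t - a) (2 * PI - t).
  move: hu => /Rabs_lt_between hu; apply: LY_int; rewrite /a in h1 h2 hu *; lra.
have [_ s0] := one_minus_unit ht.
apply: (ex_derive_continuous (fun u => - ln (2 * sin (u / 2)))).
auto_derive; move: s0; rewrite /Rdiv; lra.
Qed.

Lemma two_sin_ge1 (t : R) : PI / 3 <= t <= PI -> 1 <= 2 * sin (t / 2).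
Proof.
have p0 := PI_RGT_0; move=> ht; have h : sin (PI / 6) <= sin (t / 2) by apply: sin_incr_1; lra.
by move: h; rewrite sin_PI6; lra.
Qed.

Lemma two_sin_le1 (t : R) : 0 <= t <= PI / 3 -> 2 * sin (t / 2) <= 1.
Proof.
have p0 := PI_RGT_0; move=> ht; have h : sin (t / 2) <= sin (PI / 6) by apply: sin_incr_1; lra.
by move: h; rewrite sin_PI6; lra.
Qed.

Lemma LY_decr (s t : R) : PI / 3 <= s -> s <= t -> t <= PI -> LY t <= LY s.
Proof.
have p0 := PI_RGT_0; move=> hs st ht; have hI := @LY_int s t ltac:(lra) st ltac:(lra).
have hc : is_RInt (fun _ : R => 0) s t 0.
  by have := @is_RInt_const R_NormedModule s t 0; rewrite scal_zero_r.
have := is_RInt_le _ _ _ _ _ _ st hI hc; have h x : s < x < t -> - ln (2 * sin (x / 2)) <= 0.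
  move=> hx; have h1 := @two_sin_ge1 x ltac:(lra).
  have : ln 1 <= ln (2 * sin (x / 2)) by apply: ln_le; lra.
  rewrite ln_1; lra.
by move=> /(_ h); lra.
Qed.

Lemma LY_ge0 (t : R) : PI / 3 <= t <= PI -> 0 <= LY t.
Proof. by move=> [h1 h2]; rewrite -LY_PI; apply: LY_decr => //; right. Qed.

Lemma ln_le_minus1 (y : R) : 0 < y -> ln y <= y - 1.
Proof.
move=> y0; rewrite -[X in _ <= X]ln_exp; apply: ln_le => //.
have := exp_ineq1_le (y - 1); lra.
Qed.

(** The bound 0.524 exceeds pi/6, half of the range t <= pi/3 where the estimate is applied. *)
Lemma sin_ge_95 (x : R) : 0 <= x <= 0.524 -> 0.95 * x <= sin x.
Proof.
move=> hx; have p3 := PI_bounds; have [h _] := SIN x ltac:(lra) ltac:(lra).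
apply: Rle_trans h.
have -> : sin_lb x = x * (1 - x * x / 6 + x * x * (x * x) / 120 - x * x * (x * x) * (x * x) / 5040).
  by rewrite /sin_lb /sin_approx /= /sin_term /= /INR; field.
rewrite Rmult_comm; apply: Rmult_le_compat_l; first lra.
have : 0 <= x * x <= 0.2746 by nra.
move: (x * x) => u hu; have : 0 <= u * u <= 0.0755 by nra.
nra.
Qed.

(** Apply ln y <= y - 1 to y = 1.013 t^(-1/4), where 1.013^4 > 1/0.95. The fourth root keeps the
    bound sharp enough near 0 and makes everything polynomial in s = t^(1/4). *)
Lemma LY_log_bound (t : R) : 0 < t <= PI / 3 ->
  - ln (2 * sin (t / 2)) <= 4 * (1.013 * Rpower t (- (1 / 4)) - 1).
Proof.
move=> ht; have pb := PI_bounds.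
set y := 1.013 * Rpower t (- (1 / 4)).
have r0 : 0 < Rpower t (- (1 / 4)) by exact: exp_pos.
have y0 : 0 < y by rewrite /y; lra.
have r4 : Rpower t (- (1 / 4)) ^ 4 = / t.
  rewrite -Rpower_pow // Rpower_mult.
  have -> : - (1 / 4) * INR 4 = - (1) by rewrite /INR; field.
  by rewrite Rpower_Ropp Rpower_1; lra.
have hs := @sin_ge_95 (t / 2) ltac:(lra).
have y4 : / y ^ 4 <= 2 * sin (t / 2).
  have -> : y ^ 4 = 1.013 ^ 4 * / t by rewrite -r4 /y; ring.
  have -> : / (1.013 ^ 4 * / t) = t * / 1.013 ^ 4 by field; split; [lra|lra].
  have : / 1.013 ^ 4 <= 0.95 by rewrite /=; lra.
  nra.
have h := ln_le _ _ (Rinv_0_lt_compat _ (pow_lt _ 4 y0)) y4.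
rewrite ln_Rinv in h; last exact: pow_lt.
rewrite ln_pow // in h.
have := ln_le_minus1 y0; have i4 : INR 4 = 4 by rewrite /INR; lra.
rewrite i4 in h; lra.
Qed.

(** The preceding bound integrated from a to t with a -> 0. The primitive is nonnegative at a <= 1,
    so its boundary term may be dropped. *)
Lemma LY_upper (t : R) : 0 < t <= PI / 3 ->
  LY t <= 4 * (1.013 * (4 / 3) * Rpower t (3 / 4) - t).
Proof.
move=> ht; have pb := PI_bounds; pose F u := 4 * (1.013 * (4 / 3) * Rpower u (3 / 4) - u).
apply: le_epsilon => e e0; have [d [d0 hd]] := Li2_unit_cont e0.
pose a := Rmin (Rmin (d / 2) t) 1.
have a0 : 0 < a by rewrite /a; do! apply: Rmin_glb_lt; lra.
have a1 : a <= d / 2 by rewrite /a; apply: Rle_trans (Rmin_l _ _) (Rmin_l _ _).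
have a2 : a <= t by rewrite /a; apply: Rle_trans (Rmin_l _ _) (Rmin_r _ _).
have a3 : a <= 1 by exact: Rmin_r.
have ya : LY a <= e.
  have := hd a ltac:(lra); have := im_le_Cmod (Li2 (unit_c a) - Li2 1)%C.
  rewrite !ReImE Li2_1_real /LY; move/Rabs_le_between'; lra.
have hF : is_RInt (fun u => 4 * (1.013 * Rpower u (- (1 / 4)) - 1)) a t (F t - F a).
  apply: (is_RInt_derive F) => u; rewrite Rmin_left // Rmax_right // => hu.
    rewrite /F /Rpower; auto_derive; first lra.
    have -> : - (1 / 4) * ln u = 3 / 4 * ln u + - ln u by lra.
    rewrite exp_plus exp_Ropp exp_ln; last lra.
    by field; lra.
  apply: (ex_derive_continuous (fun u => 4 * (1.013 * Rpower u (- (1 / 4)) - 1))).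
  by rewrite /Rpower; auto_derive; lra.
have h := is_RInt_le _ _ _ _ _ _ a2 (@LY_int a t a0 a2 ltac:(lra)) hF.
have F0 : 0 <= F a.
  have e1 : Rpower a (3 / 4) = a * Rpower a (- (1 / 4)).
    by rewrite -{2}(Rpower_1 a) // -Rpower_plus; congr Rpower; field.
  have : 1 <= Rpower a (- (1 / 4)).
    have la : ln a <= 0 by rewrite -ln_1; apply: ln_le; lra.
    by rewrite -[X in X <= _]exp_0; apply: exp_le; lra.
  rewrite /F e1; nra.
have := h _; have hx x : a < x < t -> - ln (2 * sin (x / 2)) <= 4 * (1.013 * Rpower x (- (1 / 4)) - 1).
  by move=> hx; apply: LY_log_bound; lra.
move=> /(_ hx); rewrite -/(F t); lra.
Qed.

(** One cell of a subdivision. Up to rounding, 21.892 = 16 * 1.013^2 * 4/3 and 37.819 = 16 * 1.013 *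
    7/3. The quadratic decreases up to 1.02 and is taken at the left end a; the other monotone
    factors are taken at b, with the extreme values of basel and pi. *)
Lemma growth_poly_step (a b P p s : R) : 0 <= a -> a <= s -> s <= b -> b <= 1.02 ->
  1.6406 <= P -> 3.137 <= p <= 3.142 ->
  0 <= 21.892 - 37.819 * a + 16 * (a * a) ->
  b * b * (b * b) <= 1.048 ->
  b * b * (21.892 - 37.819 * a + 16 * (a * a)) <
    (1.6406 - 1.571 * (b * b * (b * b)) + b * b * (b * b) * (b * b * (b * b)) / 4) * (3.137 - b * b * (b * b)) ->
  s * s * (21.892 - 37.819 * s + 16 * (s * s)) <
    (P - p * (s * s * (s * s)) / 2 + s * s * (s * s) * (s * s * (s * s)) / 4) * (p - s * s * (s * s)).
Proof.
move=> a0 as' sb b1 P1 p1 ha bT hb.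
have s2 : 0 <= s * s <= b * b by nra.
have s4 : 0 <= s * s * (s * s) <= b * b * (b * b) by nra.
have h1 : 21.892 - 37.819 * s + 16 * (s * s) <= 21.892 - 37.819 * a + 16 * (a * a) by nra.
have h2 : s * s * (21.892 - 37.819 * s + 16 * (s * s)) <= b * b * (21.892 - 37.819 * a + 16 * (a * a)).
  by apply: (Rle_trans _ (s * s * (21.892 - 37.819 * a + 16 * (a * a)))); [apply: Rmult_le_compat_l; lra|apply: Rmult_le_compat_r; lra].
apply: Rle_lt_trans h2 _; apply: Rlt_le_trans hb _.
move: (s * s * (s * s)) (b * b * (b * b)) s4 bT => t T s4 bT.
have h3 : 1.6406 - 1.571 * T + T * T / 4 <= P - p * t / 2 + t * t / 4.
  have : p * t / 2 <= 1.571 * t by nra.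
  nra.
have := Rle_0_sqr (T - 1.048); rewrite /Rsqr => h4.
apply: Rmult_le_compat; lra.
Qed.

Lemma growth_poly (P p s : R) : 0 < s -> s * s * (s * s) <= 1.0474 -> 1.6406 <= P -> 3.137 <= p <= 3.142 ->
  s * s * (21.892 - 37.819 * s + 16 * (s * s)) <
    (P - p * (s * s * (s * s)) / 2 + s * s * (s * s) * (s * s * (s * s)) / 4) * (p - s * s * (s * s)).
Proof.
move=> s0 sT hP hp.
have s1 : s <= 1.0117.
  apply: Rnot_lt_le => h; have h2 : 1.0235 < s * s by nra.
  have h3 : 1.0235 * 1.0235 < s * s * (s * s) by nra.
  lra.
have step a b := @growth_poly_step a b P p s.
(* The cells are short enough for the inequality between endpoint values to hold on each of them;
   1.0117 slightly exceeds the fourth root of pi/3. *)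
case: (Rle_dec s 0.3) => c1; first by apply: (step 0 0.3) => //; lra.
case: (Rle_dec s 0.44) => c2; first by apply: (step 0.3 0.44) => //; lra.
case: (Rle_dec s 0.53) => c3; first by apply: (step 0.44 0.53) => //; lra.
case: (Rle_dec s 0.61) => c4; first by apply: (step 0.53 0.61) => //; lra.
case: (Rle_dec s 0.7) => c5; first by apply: (step 0.61 0.7) => //; lra.
case: (Rle_dec s 0.841) => c6; first by apply: (step 0.7 0.841) => //; lra.
case: (Rle_dec s 0.9306) => c7; first by apply: (step 0.841 0.9306) => //; lra.
case: (Rle_dec s 0.974) => c8; first by apply: (step 0.9306 0.974) => //; lra.
by apply: (step 0.974 1.0117) => //; lra.
Qed.

(** On 0 < t <= pi/3 the imaginary part still increases, and this inequality says that its growth is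
    outweighed by the decrease of the real part. Both factors on the left are bounded in terms of s
    = t^(1/4), which leads to [growth_poly]. *)
Lemma LY_log_lt (t : R) : 0 < t <= PI / 3 -> LY t * - ln (2 * sin (t / 2)) < LX t * (PI - t).
Proof.
move=> ht; have pb := PI_bounds; have [bb _] := basel_bounds.
pose s := Rpower t (1 / 4).
have s0 : 0 < s by exact: exp_pos.
have s4 : s * s * (s * s) = t.
  by rewrite /s -!Rpower_plus -[RHS](Rpower_1 t); [congr Rpower; field|lra].
have e3 : Rpower t (3 / 4) = s * s * s by rewrite /s -!Rpower_plus; congr Rpower; field.
have e1 : Rpower t (- (1 / 4)) = / s by rewrite Rpower_Ropp.
have := LY_log_bound ht; have := LY_upper ht; rewrite e3 e1.
set l := - ln _ => hy hl.
have l0 : 0 <= l.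
  have h := @two_sin_le1 t ltac:(lra); have [_ h2] := @one_minus_unit t ltac:(lra).
  have : ln (2 * sin (t / 2)) <= ln 1 by apply: ln_le; lra.
  by rewrite ln_1 /l; lra.
have := @growth_poly basel PI s s0 ltac:(lra) bb pb; rewrite s4 LX_poly; last by lra.
have s1 : s <= 1.0117.
  apply: Rnot_lt_le => h; have h2 : 1.0235 < s * s by nra.
  have h3 : 1.0235 * 1.0235 < s * s * (s * s) by nra.
  lra.
have s5 : 0 <= s * s * s by nra.
have ym0 : 0 <= 4 * (1.013 * (4 / 3) * (s * s * s) - t) by rewrite -s4; nra.
have h1 : LY t * l <= 4 * (1.013 * (4 / 3) * (s * s * s) - t) * l by apply: Rmult_le_compat_r.
have h2 : 4 * (1.013 * (4 / 3) * (s * s * s) - t) * l <= 4 * (1.013 * (4 / 3) * (s * s * s) - t) * (4 * (1.013 * / s - 1)).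
  exact: Rmult_le_compat_l.
have e : 4 * (1.013 * (4 / 3) * (s * s * s) - t) * (4 * (1.013 * / s - 1)) =
  s * s * (16 * (1.013 * (4 / 3)) * 1.013 - 16 * (1.013 * (4 / 3)) * s - 16 * 1.013 * s + 16 * (s * s)).
  by rewrite -s4; field; lra.
rewrite e in h2.
have : s * s * (16 * (1.013 * (4 / 3)) * 1.013 - 16 * (1.013 * (4 / 3)) * s - 16 * 1.013 * s + 16 * (s * s)) <=
  s * s * (21.892 - 37.819 * s + 16 * (s * s)).
  by apply: Rmult_le_compat_l; nra.
lra.
Qed.

Lemma LX_decr (s t : R) : 0 < s -> s <= t -> t <= PI -> LX t <= LX s.
Proof. by move=> s0 st tp; rewrite !LX_poly; [nra|lra|lra]. Qed.

(** The level L = growth at s is frozen, and W u = LY^2 - 4 L (L - LX), which vanishes at s, is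
    shown to have negative derivative. Beyond pi/3 both terms of W' have the right sign; before it,
    [LY_log_lt] applies because LX c <= LX s <= L. *)
Lemma growth_Li2_decr (s t : R) : 0 < s -> s < t -> t <= PI ->
  0 < growth (Li2 (unit_c s)) -> growth (Li2 (unit_c t)) < growth (Li2 (unit_c s)).
Proof.
move=> s0 st tp; set L := growth (Li2 (unit_c s)) => L0; have pb := PI_bounds.
have Xs : LX s <= L by exact: Re_le_growth.
case: (Rle_lt_or_eq_dec _ _ tp) => [tlt|->]; last by rewrite unit_c_PI growth_Li2_m1.
have Xt : LX t < LX s by rewrite !LX_poly; [nra|lra|lra].
apply: growth_lt => //; first by rewrite -/(LX t); lra.
rewrite -/(LX t) -/(LY t).
pose W u := LY u * LY u - 4 * L * (L - LX u).
have dW u : 0 < u < 2 * PI -> is_derive W u (2 * LY u * - ln (2 * sin (u / 2)) - 2 * L * (PI - u)).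
  move=> hu; have dx := LX_derive hu; have dy := LY_derive hu.
  have ex : ex_derive LX u by eexists; exact: dx.
  have ey : ex_derive LY u by eexists; exact: dy.
  rewrite /W; auto_derive; first by intuition.
  by rewrite (is_derive_unique _ _ _ dx) (is_derive_unique _ _ _ dy); field.
have [c []] : exists c, (Rmin s t <= c <= Rmax s t) /\
    W t - W s = (2 * LY c * - ln (2 * sin (c / 2)) - 2 * L * (PI - c)) * (t - s).
  apply: (MVT_gen W s t (fun u => 2 * LY u * - ln (2 * sin (u / 2)) - 2 * L * (PI - u))) => u.
    by rewrite Rmin_left ?Rmax_right; [|lra|lra] => hu; apply: dW; lra.
  rewrite Rmin_left ?Rmax_right; [|lra|lra] => hu.
  apply/continuity_pt_filterlim; apply: (ex_derive_continuous W).
  by eexists; apply: dW; lra.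
rewrite Rmin_left ?Rmax_right; [|lra|lra] => hc hW.
have Ws : W s = 0 by rewrite /W /LX /LY growth_eq -/L; ring.
suff dc : 2 * LY c * - ln (2 * sin (c / 2)) - 2 * L * (PI - c) < 0.
  by move: hW; rewrite Ws /W; nra.
case: (Rle_dec (PI / 3) c) => h.
  have y0 := @LY_ge0 c ltac:(lra); have l0 := @two_sin_ge1 c ltac:(lra).
  have : ln 1 <= ln (2 * sin (c / 2)) by apply: ln_le; lra.
  rewrite ln_1 => l1; nra.
have h1 := @LY_log_lt c ltac:(lra).
have h2 : LX c <= LX s by apply: LX_decr; lra.
nra.
Qed.

(** * Comparison of the growths at roots of unity *)

Lemma zetaE (b : nat) : zeta b = unit_c (2 * PI / INR b).
Proof.
rewrite unit_cE /zeta; congr Cexp; rewrite /Cdiv -RtoC_invE /Rdiv !RtoC_mult; ring.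
Qed.

Lemma zeta_pow (b j : nat) : Cpow (zeta b) j = unit_c (2 * PI * INR j / INR b).
Proof. by rewrite zetaE unit_c_pow; congr unit_c; rewrite /Rdiv; ring. Qed.

Lemma Cmod_zeta (b : nat) : Cmod (zeta b) = 1.
Proof. by rewrite zetaE Cmod_unit_c. Qed.

Lemma Cconj_unit_c (t : R) : Cconj (unit_c t) = unit_c (- t).
Proof. by rewrite /Cconj /unit_c /= cos_neg sin_neg. Qed.

Lemma unit_c_2PI (t : R) : unit_c (t + 2 * PI) = unit_c t.
Proof. by rewrite /unit_c cos_plus sin_plus cos_2PI sin_2PI; congr pair; ring. Qed.

Lemma CSeries_conj (u : nat -> C) : CSeries (fun k => Cconj (u k)) = Cconj (CSeries u).
Proof. by rewrite /CSeries /Cconj /= Series_opp. Qed.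

Lemma Cpow_conj' (z : C) (n : nat) : Cpow (Cconj z) n = Cconj (Cpow z n).
Proof. elim: n => [|n IH] /=; first by apply: C_ext; rewrite /=; ring. by rewrite IH Cmult_conj. Qed.

Lemma Li2_conj (z : C) : Li2 (Cconj z) = Cconj (Li2 z).
Proof.
rewrite /Li2 -CSeries_conj; apply: CSeries_ext => k.
have -> : Cpow (RtoC (INR k.+1)) 2 = RtoC (INR k.+1 * INR k.+1) by rewrite RtoC_mult /=; ring.
rewrite Cpow_conj' /Cdiv -RtoC_invE; apply: C_ext; rewrite /=; ring.
Qed.

Lemma zeta_conj (b j : nat) : (j <= b)%N -> (0 < b)%N ->
  Cpow (zeta b) (b - j) = Cconj (Cpow (zeta b) j).
Proof.
move=> jb b0; rewrite !zeta_pow Cconj_unit_c -[RHS]unit_c_2PI; congr unit_c.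
have bp : INR b <> 0 by apply: not_0_INR; lia.
by rewrite minus_INR; [field|lia].
Qed.

Lemma zeta_pow_b (b : nat) : (0 < b)%N -> Cpow (zeta b) b = 1%C.
Proof.
move=> b0; have bp : INR b <> 0 by apply: not_0_INR; lia.
rewrite zeta_pow -unit_c_0 -[RHS]unit_c_2PI; congr unit_c; field; exact: bp.
Qed.

Lemma LX_zeta (b : nat) : (2 <= b)%N ->
  Re (Li2 (zeta b)) = basel * (1 - 6 * / INR b + 6 * (/ INR b * / INR b)).
Proof.
move=> b2; rewrite zetaE -/(LX _); have pb := PI_bounds; have bp : 2 <= INR b by apply: (le_INR 2); lia.
have ib : / INR b <= / 2 by apply: Rinv_le_contravar; lra.
have ib0 : 0 < / INR b by apply: Rinv_0_lt_compat; lra.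
rewrite LX_poly; last by rewrite /Rdiv; nra.
have e := basel_PI; field_simplify_eq; last lra.
have -> : PI ^ 2 = 6 * basel by rewrite -e /=; ring.
by ring.
Qed.

(** The number basel/4 bounds whatever a point [xi] of order at least 2 can contribute. For b >= 7
    the real part alone exceeds it; for b = 5 and 6 the imaginary part is needed, and it is at least
    [LY (PI / 2)] by monotonicity. *)
Lemma growth_zeta_gt (b : nat) : (5 <= b)%N -> basel / 4 < growth (Li2 (zeta b)).
Proof.
move=> b5; have X := @LX_zeta b ltac:(lia); have [bl bu] := basel_bounds; have pb := PI_bounds.
have [b7|hb] := leqP 7 b.
  apply: Rlt_le_trans (Re_le_growth _); rewrite X.
  have bp : 7 <= INR b by have := le_INR 7 b ltac:(lia); rewrite /INR; lra.
  have ib : / INR b <= / 7 by apply: Rinv_le_contravar; lra.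
  have ib0 : 0 < / INR b by apply: Rinv_0_lt_compat; lra.
  have : / 4 < 1 - 6 * / INR b + 6 * (/ INR b * / INR b) by nra.
  nra.
have y2 := LY_half_PI.
have aux (c : R) : 5 <= c <= 6 -> INR b = c -> 0.79 <= Im (Li2 (zeta b)).
  move=> hc ec; have [h _] := y2; apply: Rle_trans h _; rewrite zetaE ec -/(LY _).
  have ic : / 6 <= / c <= / 5 by split; apply: Rinv_le_contravar; lra.
  by apply: LY_decr; rewrite /Rdiv; nra.
have [e|e] : b = 5%N \/ b = 6%N by lia.
  have ib : INR b = 5 by rewrite e /INR; lra.
  apply: lt_growth; first lra.
  have := aux 5 ltac:(lra) ib; rewrite X ib; move: (Im _) basel bl bu => y P bl bu hy; nra.
have ib : INR b = 6 by rewrite e /INR; lra.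
apply: lt_growth; first lra.
have := aux 6 ltac:(lra) ib; rewrite X ib; move: (Im _) basel bl bu => y P bl bu hy; nra.
Qed.

(** The upper bound lets z = -1, of growth basel/4, win in part (3); the lower bound makes xi = 1
    beat all orders k >= 3 when z is a primitive fourth root of unity, as part (4) needs for b =
    4. *)
Lemma growth_zeta4 : basel / 9 < growth (Li2 (zeta 4)) < basel / 4.
Proof.
have X := @LX_zeta 4 isT; have [bl bu] := basel_bounds; have [yl yu] := LY_half_PI.
have Y : Im (Li2 (zeta 4)) = LY (PI / 2).
  rewrite zetaE -/(LY _); congr LY; have -> : INR 4 = 4 by rewrite /INR; lra.
  by field.
have i4 : INR 4 = 4 by rewrite /INR; lra.
rewrite i4 in X; split.
  apply: lt_growth; first lra.
  rewrite X Y; move: (LY _) yl yu basel bl bu => y yl yu P bl bu; nra.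
apply: growth_lt; rewrite ?X ?Y; first lra; first by move: basel bl => P bl; lra.
move: (LY _) yl yu basel bl bu => y yl yu P bl bu; nra.
Qed.

(** This is why cube roots of unity [xi], and not xi = 1, dominate for b = 3: a [xi] of order 3 sees
    Li2 1 / 9. *)
Lemma growth_zeta3 : growth (Li2 (zeta 3)) < basel / 9.
Proof.
have X := @LX_zeta 3 isT; have [bl bu] := basel_bounds; have yu := LY_two_thirds.
have i3 : INR 3 = 3 by rewrite /INR; lra.
have Y : Im (Li2 (zeta 3)) = LY (2 * PI / 3) by rewrite zetaE i3.
have y0 : 0 <= LY (2 * PI / 3) by have p0 := PI_RGT_0; apply: LY_ge0; lra.
rewrite i3 in X; apply: growth_lt; rewrite ?X ?Y {X Y}.
- by clear -bl; lra.
- clear -bl; move: basel bl => P bl.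
  have -> : P * (1 - 6 * / 3 + 6 * (/ 3 * / 3)) = - (P / 3) by field.
  lra.
move: basel (LY _) y0 yu bl bu => P y y0 yu bl bu.
have -> : 4 * (P / 9) * (P / 9 - P * (1 - 6 * / 3 + 6 * (/ 3 * / 3))) = 4 * P / 9 * (4 * P / 9) by field.
by apply: Rmult_le_0_lt_compat.
Qed.

Lemma growth_zeta_conj (b j : nat) : (j <= b)%N -> (0 < b)%N ->
  growth (Li2 (Cpow (zeta b) (b - j))) = growth (Li2 (Cpow (zeta b) j)).
Proof. by move=> jb b0; rewrite zeta_conj // Li2_conj growth_conj. Qed.

Lemma growth_zeta_pow_lt (b j : nat) : (5 <= b)%N -> (2 <= j)%N -> (j + 2 <= b)%N ->
  growth (Li2 (Cpow (zeta b) j)) < growth (Li2 (zeta b)).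
Proof.
move=> b5; wlog jb : j / (2 * j <= b)%N => [hw j2 jb|].
  have [h|h] := leqP (2 * j) b; first exact: hw.
  by rewrite -growth_zeta_conj; [apply: hw; lia|lia|lia].
move=> j2 _; rewrite zeta_pow zetaE; have pb := PI_bounds.
have bp : 5 <= INR b by have := le_INR 5 b ltac:(lia); rewrite /INR; lra.
have jp : 2 <= INR j by apply: (le_INR 2); lia.
have jb' : 2 * INR j <= INR b by rewrite -[2]/(INR 2) -mult_INR; apply: le_INR; lia.
have ib0 : 0 < / INR b by apply: Rinv_0_lt_compat; lra.
have e1 : INR j * / INR b <= / 2.
  have -> : / 2 = INR b * / INR b * / 2 by field; lra.
  nra.
have pi0 : 0 < PI * / INR b by apply: Rmult_lt_0_compat; lra.
have p2 : PI * / INR b * 2 <= PI * / INR b * INR j by apply: Rmult_le_compat_l; lra.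
have p3 : PI * (INR j * / INR b) <= PI * / 2 by apply: Rmult_le_compat_l; lra.
apply: growth_Li2_decr; rewrite /Rdiv; [lra|lra|lra|].
rewrite -/(2 * PI / INR b) -zetaE; have := growth_zeta_gt b5; have [] := basel_bounds; lra.
Qed.

Lemma growth_div_sq (z : C) (k m : nat) : Cmod z <= 1 -> (0 < m)%N -> (m <= k)%N ->
  growth (Li2 (Cpow z k)) / (INR k * INR k) <= basel / (INR m * INR m).
Proof.
move=> z1 m0 mk; have [bl _] := basel_bounds.
have mp : 0 < INR m by apply: lt_0_INR; lia.
have km : INR m <= INR k by apply: le_INR; lia.
apply: Rmult_le_compat; [exact: growth_ge0|by left; apply: Rinv_0_lt_compat; nra| |by apply: Rinv_le_contravar; nra].
by apply: growth_Li2_le; exact: Cmod_pow_le1.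
Qed.

(** The disjunction serves two purposes: it bounds the points other than 1 for the dominant z, and
    all points when z itself is not dominant. *)
Lemma growth_resonant_two (z xi : C) (L : R) : Cmod z = 1 -> basel / 4 <= L ->
  xi <> 1%C \/ growth (Li2 z) <= L -> growth (CSeries (resonant z xi)) <= L.
Proof.
move=> z1 hL h; have [bl _] := basel_bounds; apply: growth_resonant; [lra|lra|] => k k0 hk.
have [e|k2] : k = 1%N \/ (2 <= k)%N by lia.
  rewrite e Cpow_1_r; case: h => [h|h]; first by case: h; rewrite -(Cpow_1_r xi) hk // e.
  by rewrite /INR Rmult_1_r Rdiv_1_r.
have zle : Cmod z <= 1 by lra.
by apply: Rle_trans (growth_div_sq zle (isT : (0 < 2)%N) k2) _; rewrite /INR; lra.
Qed.

Lemma Cpow_zeta4_2 : Cpow (zeta 4) 2 = RtoC (-1).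
Proof.
rewrite zeta_pow -unit_c_PI; congr unit_c; rewrite /INR; field.
Qed.

Lemma growth_resonant_zeta4 (j : nat) (xi : C) (L : R) : odd j -> basel / 9 <= L ->
  xi <> 1%C \/ growth (Li2 (zeta 4)) <= L -> growth (CSeries (resonant (Cpow (zeta 4) j) xi)) <= L.
Proof.
move=> oj hL h; have [bl _] := basel_bounds.
have z1 : Cmod (Cpow (zeta 4) j) = 1 by rewrite zeta_pow Cmod_unit_c.
apply: growth_resonant; [lra|lra|] => k k0 hk.
have [e|[e|k2]] : k = 1%N \/ k = 2%N \/ (3 <= k)%N by lia.
- rewrite e Cpow_1_r; case: h => [h|h]; first by case: h; rewrite -(Cpow_1_r xi) hk // e.
  rewrite /INR Rmult_1_r Rdiv_1_r; apply: Rle_trans h; right.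
  have -> : Cpow (zeta 4) j = Cpow (zeta 4) (j %% 4).
    rewrite {1}(divn_eq j 4) Cpow_add_r mulnC Cpow_mul zeta_pow_b // Cpow_1_l Cmult_1_l //.
  have [-> | ->] : (j %% 4)%N = 1%N \/ (j %% 4 = 4 - 1)%N.
      have := modn_mod j 4; have : (j %% 4 < 4)%N by exact: ltn_pmod.
      have : odd (j %% 4) by move: oj; rewrite {1}(divn_eq j 4) oddD oddM andbF.
      by case: (j %% 4)%N => [|[|[|[|m]]]] //; auto.
    by rewrite Cpow_1_r.
  by rewrite growth_zeta_conj // Cpow_1_r.
- have -> : Cpow (Cpow (zeta 4) j) k = RtoC (-1).
    by rewrite e -Cpow_mul mulnC Cpow_mul Cpow_zeta4_2 Cpow_m1 oj.
  by rewrite growth_Li2_m1 /Rdiv Rmult_0_l; lra.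
have zle : Cmod (Cpow (zeta 4) j) <= 1 by lra.
by apply: Rle_trans (growth_div_sq zle (isT : (0 < 3)%N) k2) _; rewrite /INR; lra.
Qed.

(** Order 1 contributes growth 0, since Li2 (-1) is negative; order 2 means xi = -1, which is
    excluded; higher orders are at most basel/9. *)
Lemma growth_resonant_m1 (xi : C) : xi <> RtoC (-1) -> growth (CSeries (resonant (RtoC (-1)) xi)) <= basel / 9.
Proof.
move=> hx; have [bl _] := basel_bounds.
have z1 : Cmod (RtoC (-1)) = 1 by rewrite Cmod_R Rabs_left; lra.
apply: growth_resonant; [lra|lra|] => k k0 hk.
have [e|[e|k2]] : k = 1%N \/ k = 2%N \/ (3 <= k)%N by lia.
- by rewrite e Cpow_1_r growth_Li2_m1 /Rdiv Rmult_0_l; lra.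
- exfalso; have x2 : Cpow xi 2 = 1%C by apply/hk; rewrite // e.
  have x1 : xi <> 1%C by rewrite -{1}(Cpow_1_r xi) => /(hk 1%N isT); rewrite e.
  apply: (@Cmult_neq0 (xi - 1) (xi + 1)).
  + move=> h; apply: x1; have e1 : (xi = xi - 1 + 1)%C by ring.
    by rewrite e1 h; ring.
  + move=> h; apply: hx; have e1 : (xi = xi + 1 - 1)%C by ring.
    by rewrite e1 h; apply: C_ext; rewrite /=; ring.
  + have -> : ((xi - 1) * (xi + 1) = Cpow xi 2 - 1)%C by rewrite /=; ring.
    by rewrite x2; ring.
have zle : Cmod (RtoC (-1)) <= 1 by lra.
by apply: Rle_trans (growth_div_sq zle (isT : (0 < 3)%N) k2) _; rewrite /INR; lra.
Qed.

(** A point of order 3 would be a root of (X - 1)(X - zeta)(X - zeta^2), hence one of the two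
    excluded points. *)
Lemma growth_resonant_zeta3 (xi : C) (L : R) : xi <> zeta 3 -> xi <> Cpow (zeta 3) 2 ->
  growth (Li2 (zeta 3)) <= L -> basel / 16 <= L -> growth (CSeries (resonant (zeta 3) xi)) <= L.
Proof.
move=> h1 h2 hL hL2; have [bl _] := basel_bounds.
have z1 : Cmod (zeta 3) = 1 by exact: Cmod_zeta.
apply: growth_resonant; [lra|lra|] => k k0 hk.
have [e|[e|[e|k2]]] : k = 1%N \/ k = 2%N \/ k = 3%N \/ (4 <= k)%N by lia.
- by rewrite e Cpow_1_r /INR Rmult_1_r Rdiv_1_r.
- rewrite e (@growth_zeta_conj 3 1) // Cpow_1_r.
  have := growth_ge0 (Li2 (zeta 3)); rewrite /INR; lra.
- exfalso; have x2 : Cpow xi 3 = 1%C by apply/hk; rewrite // e.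
  have x1 : xi <> 1%C by rewrite -{1}(Cpow_1_r xi) => /(hk 1%N isT); rewrite e.
  have neq (a : C) : xi <> a -> (xi - a)%C <> 0%C.
    move=> na h; apply: na; have e1 : (xi = xi - a + a)%C by ring.
    by rewrite e1 h; ring.
  have z3 : Cpow (zeta 3) 3 = 1%C by exact: zeta_pow_b.
  have zs : (1 + zeta 3 + Cpow (zeta 3) 2 = 0)%C.
    rewrite zetaE unit_c_pow; have -> : INR 2 * (2 * PI / INR 3) = - (2 * PI / INR 3) + 2 * PI.
      by rewrite /INR; field.
    rewrite unit_c_2PI -Cconj_unit_c.
    have -> : 2 * PI / INR 3 = 2 * (PI / 3) by rewrite /INR; field.
    apply: C_ext; rewrite /= ?cos_2a ?cos_PI3 ?sin_PI3; last by ring.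
    by have := sqrt_sqrt 3 ltac:(lra); nra.
  apply: (@Cmult_neq0 ((xi - 1) * (xi - zeta 3))%C (xi - Cpow (zeta 3) 2)%C).
  + by apply: Cmult_neq0; apply: neq.
  + exact: neq.
  + have -> : ((xi - 1) * (xi - zeta 3) * (xi - Cpow (zeta 3) 2) =
      Cpow xi 3 - xi * xi * (1 + zeta 3 + Cpow (zeta 3) 2) + xi * (zeta 3 * (1 + zeta 3 + Cpow (zeta 3) 2)) - Cpow (zeta 3) 3)%C.
      by rewrite /=; ring.
    by rewrite x2 z3 zs; ring.
have zle : Cmod (zeta 3) <= 1 by lra.
by apply: Rle_trans (growth_div_sq zle (isT : (0 < 4)%N) k2) _; rewrite /INR; lra.
Qed.

(** * Asymptotics at roots of unity *)

Ltac fieldC := unplusC; lazymatch goal with |- ?a = ?b => change (@eq C a b) end; field.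

Lemma is_cser_sum_n (u : nat -> nat -> C) (l : nat -> C) (m : nat) :
  (forall r, is_cser (u r) (l r)) ->
  is_cser (fun k => sum_n (G := C_R_NormedModule) (fun r => u r k) m) (sum_n (G := C_R_NormedModule) l m).
Proof.
move=> h; elim: m => [|m IH].
  by rewrite sum_O; apply: is_cser_ext (h 0%N) => k; rewrite sum_O.
rewrite sum_Sn; apply: is_cser_ext (is_cser_plus IH (h m.+1)) => k.
by rewrite sum_Sn.
Qed.

Lemma geom_div (a : C) (m : nat) : (1 - a)%C <> 0%C -> (1 - Cpow a m.+1)%C <> 0%C ->
  (a / (1 - a))%C = sum_n (G := C_R_NormedModule) (fun r => Cpow a r.+1 / (1 - Cpow a m.+1))%C m.
Proof.
move=> a1 am.
have e n : sum_n (G := C_R_NormedModule) (fun r => Cpow a r.+1 / (1 - Cpow a m.+1))%C n =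
    (a * (1 - Cpow a n.+1) / ((1 - a) * (1 - Cpow a m.+1)))%C.
  elim: n => [|n IH]; first by rewrite sum_O !Cpow_1_r; fieldC; split.
  rewrite sum_Sn IH; change (@plus C_R_NormedModule) with Cplus.
  rewrite [Cpow a n.+2]/= -![(a * Cpow a n)%C]/(Cpow a n.+1) [Cpow a n.+1]/=.
  by move: (Cpow a n) (Cpow a m.+1) am => b d am; fieldC; split.
by rewrite e; fieldC; split.
Qed.

Lemma Csum_n_mult (c : C) (u : nat -> C) (m : nat) :
  (c * sum_n (G := C_R_NormedModule) u m)%C = sum_n (G := C_R_NormedModule) (fun r => c * u r)%C m.
Proof.
elim: m => [|m IH]; first by rewrite !sum_O.
by rewrite !sum_Sn -IH; ringC.
Qed.

(* On the coset of k-th roots of unity, [q / (1 - q)] is expanded as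
   [(q + .. + q^k) / (1 - q^k)], whose denominator only involves [exp (- k w)]. *)
Lemma elog_unity (z xi w : C) (m : nat) : Cmod z <= 1 -> Cmod xi = 1 -> Cpow xi m.+1 = 1%C -> 0 < Re w ->
  elog z (xi * Cexp (- w)) = sum_n (G := C_R_NormedModule) (fun r =>
    Li2 (z * Cpow xi r.+1) / (RtoC (INR m.+1) * w) +
    psum (z * Cpow xi r.+1) (INR r.+1 / INR m.+1) (RtoC (INR m.+1) * w))%C m.
Proof.
move=> z1 x1 xm w0; have mp := INR_S_pos m.
pose U := Rabs (Im w) / Re w.
have U0 : 0 <= U by apply: Rdiv_le_0_compat => //; exact: Rabs_pos.
have cw : cone U w by split=> //; right; rewrite /U; field; lra.
have ck : cone U (RtoC (INR m.+1) * w) by exact: cone_scal.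
have qlt : Cmod (xi * Cexp (- w)) < 1.
  by rewrite Cmod_mult x1 Rmult_1_l; rewrite Cmod_Cexp !ReImE -[X in _ < X]exp_0; apply: exp_increasing; lra.
pose f r := if (r <= m)%N then block_term (z * Cpow xi r.+1) (INR r.+1 / INR m.+1) (RtoC (INR m.+1) * w) else (fun _ => RtoC 0).
pose l r := if (r <= m)%N then (Li2 (z * Cpow xi r.+1) / (RtoC (INR m.+1) * w) +
    psum (z * Cpow xi r.+1) (INR r.+1 / INR m.+1) (RtoC (INR m.+1) * w))%C else RtoC 0.
have hf r : is_cser (f r) (l r).
  rewrite /f /l; case: ifP => rm.
    apply: is_cser_block U0 ck.
      rewrite Cmod_mult; have h := @Cmod_pow_le1 xi r.+1 ltac:(lra).
      have := Cmod_ge_0 z; have := Cmod_ge_0 (Cpow xi r.+1); nra.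
    split; first by apply: Rdiv_lt_0_compat => //; exact: INR_S_pos.
    apply/Rle_div_l => //; rewrite Rmult_1_l; apply: le_INR; lia.
  have h0 := @is_cser_Cmult 0 _ _ (@is_cser_Li2 0 ltac:(rewrite Cmod_0; lra)).
  rewrite Cmult_0_l in h0; apply: is_cser_ext h0 => k; exact: Cmult_0_l.
have hs := @is_cser_sum_n f l m hf.
transitivity (sum_n (G := C_R_NormedModule) l m); last first.
  by apply: sum_n_ext_loc => r rm; rewrite /l; have -> : (r <= m)%N by lia.
rewrite -(CSeries_unique hs); apply: CSeries_ext => j.
have -> : sum_n (G := C_R_NormedModule) (fun r => f r j) m =
  sum_n (G := C_R_NormedModule) (fun r => block_term (z * Cpow xi r.+1) (INR r.+1 / INR m.+1) (RtoC (INR m.+1) * w) j) m.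
  by apply: sum_n_ext_loc => r rm; rewrite /f; have -> : (r <= m)%N by lia.
rewrite /elog_term; set q := (xi * Cexp (- w))%C in qlt *.
have q1 : (1 - Cpow q j.+1)%C <> 0%C by exact: one_minus_pow_neq0.
have qm : (1 - Cpow (Cpow q j.+1) m.+1)%C <> 0%C.
  rewrite -Cpow_mul; have -> : (j.+1 * m.+1 = (j.+1 * m.+1).-1.+1)%N by lia.
  exact: one_minus_pow_neq0.
have eqm : Cpow (Cpow q j.+1) m.+1 = Cexp (- (RtoC (INR j.+1) * (RtoC (INR m.+1) * w)))%C.
  rewrite -Cpow_mul mulnC Cpow_mul Cpow_qE xm Cmult_1_l Cexp_pow; congr Cexp; ring.
have eqr r : Cpow (Cpow q j.+1) r.+1 =
   (Cpow (Cpow xi r.+1) j.+1 * Cexp (- (RtoC (INR r.+1 / INR m.+1) * (RtoC (INR j.+1) * (RtoC (INR m.+1) * w)))))%C.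
  rewrite -Cpow_mul mulnC Cpow_mul Cpow_qE Cpow_mult_l Cexp_pow; congr (_ * Cexp _)%C.
  have m0 := @INR_S_neq0 m; rewrite /Rdiv RtoC_mult RtoC_invE; field; exact: m0.
rewrite (geom_div q1 qm) /block_term.
rewrite Csum_n_mult; apply: sum_n_ext => r; rewrite eqr eqm Cpow_mult_l /Cdiv; ringC.
Qed.

(* [exp (f w)] is of order [(Re w)^kap] in every cone and asymptotic to [x^kap exp c] when
   [w = (x, v)] tends to 0 with slope [v / x -> m]. *)
Definition tame (m : R) (f : C -> C) (kap : R) (c : C) : Prop :=
  (forall U, 0 <= U -> exists A x0, 0 < x0 /\
     forall w, cone U w -> Re w < x0 -> Re (f w) <= A + kap * ln (Re w)) /\
  (forall e, 0 < e -> exists d, 0 < d /\ forall x v : R, 0 < x < d -> Rabs (v / x - m) < d ->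
     Cmod (f ((x, v) : C) - (RtoC (kap * ln x) + c))%C <= e).

Lemma tame_plus (m : R) (f g : C -> C) (k1 k2 : R) (c1 c2 : C) :
  tame m f k1 c1 -> tame m g k2 c2 -> tame m (fun w => f w + g w)%C (k1 + k2) (c1 + c2)%C.
Proof.
move=> [f1 f2] [g1 g2]; split=> [U U0|e e0].
  have [A [x0 [x0p hA]]] := f1 U U0; have [B [x1 [x1p hB]]] := g1 U U0.
  exists (A + B), (Rmin x0 x1); split; first exact: Rmin_glb_lt.
  move=> w cw hw; have := hA w cw (Rlt_le_trans _ _ _ hw (Rmin_l _ _)).
  have := hB w cw (Rlt_le_trans _ _ _ hw (Rmin_r _ _)); rewrite !ReImE; lra.
have [d [d0 hd]] := f2 (e / 2) ltac:(lra); have [d' [d0' hd']] := g2 (e / 2) ltac:(lra).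
exists (Rmin d d'); split; first exact: Rmin_glb_lt.
move=> x v hx hv; have h1 := Rmin_l d d'; have h2 := Rmin_r d d'.
have := hd x v ltac:(lra) ltac:(lra); have := hd' x v ltac:(lra) ltac:(lra).
set a := f _; set b := g _ => hb ha.
have -> : (a + b - (RtoC ((k1 + k2) * ln x) + (c1 + c2)) =
  (a - (RtoC (k1 * ln x) + c1)) + (b - (RtoC (k2 * ln x) + c2)))%C by rewrite Rmult_plus_distr_r RtoC_plus; ring.
apply: Rle_trans (Cmod_triangle _ _) _; lra.
Qed.

Lemma slope_cone (m x v : R) : 0 < x -> Rabs (v / x - m) < 1 -> cone (Rabs m + 1) ((x, v) : C).
Proof.
move=> x0 h; split=> //=.
have -> : v = v / x * x by field; lra.
rewrite Rabs_mult (Rabs_pos_eq x); last lra.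
apply: Rmult_le_compat_r; first lra.
have := Rabs_triang (v / x - m) m; have -> : v / x - m + m = v / x by ring.
lra.
Qed.

Lemma tame_psum (m x k : R) (y : C) : Cmod y = 1 -> y <> 1%C -> 0 < x <= 1 -> 0 < k ->
  tame m (fun w => psum y x (RtoC k * w)) 0 (RtoC (/ 2 - x) * log1m y)%C.
Proof.
move=> y1 yn hx k0.
have main U : 0 <= U -> exists A, 0 < A /\ forall w, cone U w ->
  Cmod (psum y x (RtoC k * w) - RtoC (/ 2 - x) * log1m y)%C <= A * sqrt (Re w).
  move=> U0; have [A [A0 hA]] := psum_asymp y1 yn hx U0.
  exists (A * sqrt (k * (1 + U))); split.
    by apply: Rmult_lt_0_compat => //; apply: sqrt_lt_R0; nra.
  move=> w cw; apply: Rle_trans (hA _ (cone_scal k0 cw)) _.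
  rewrite Rmult_assoc -sqrt_mult; [|nra|by case: cw; lra].
  apply: Rmult_le_compat_l; first lra.
  apply: sqrt_le_1_alt; rewrite Cmod_mult Cmod_pos; last lra.
  have := cone_Cmod cw; nra.
split=> [U U0|e e0].
  have [A [A0 hA]] := main U U0.
  exists (A + Re (RtoC (/ 2 - x) * log1m y)%C), 1; split; first lra.
  move=> w cw w1; have := hA w cw; have [w0 _] := cw.
  have s1 : sqrt (Re w) <= 1 by rewrite -sqrt_1; apply: sqrt_le_1_alt; lra.
  set q := psum _ _ _; set c := (_ * log1m y)%C => h.
  have := Re_le_Cmod (q - c)%C; rewrite !ReImE; nra.
have [A [A0 hA]] := main (Rabs m + 1) ltac:(have := Rabs_pos m; lra).
have eA : 0 < e / A by apply: Rdiv_lt_0_compat; lra.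
exists (Rmin 1 (e / A * (e / A))); split; first by apply: Rmin_glb_lt; nra.
move=> r v hr hv; have h1 := Rmin_l 1 (e / A * (e / A)); have h2 := Rmin_r 1 (e / A * (e / A)).
have h := hA _ (@slope_cone m r v ltac:(lra) ltac:(lra)).
have s1 : sqrt r <= e / A by rewrite -[X in _ <= X]sqrt_square; [apply: sqrt_le_1_alt; lra|lra].
rewrite Rmult_0_l Cplus_0_l; apply: Rle_trans h _; rewrite [Re _]/=.
have -> : e = A * (e / A) by field; lra.
by apply: Rmult_le_compat_l; lra.
Qed.

Definition psum1_const (x k : R) : R := (x - / 2) * ln k + (ln (Gamma x) - (ln (Gamma (/ 2)) + / 2 * ln 2)).

(** For y = 1 the expansion is obtained from the real axis with an error proportional to |v/x|,
    hence slope 0. That is enough: blocks with y = 1 occur only where the saddle is real. *)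
Lemma tame_psum1 (x k : R) : 0 < x < 1 -> 0 < k ->
  tame 0 (fun w => psum 1 x (RtoC k * w)) (x - / 2) (RtoC (psum1_const x k)).
Proof.
move=> hx k0.
have lim e : 0 < e -> exists d, 0 < d /\ forall r, 0 < r < d ->
    Cmod (psum 1 x (RtoC (k * r)) - RtoC ((x - / 2) * ln r + psum1_const x k))%C < e.
  move=> e0; have [d [d0 hd]] := psum1_lim hx e0.
  exists (d / k); split; first exact: Rdiv_lt_0_compat.
  move=> r hr; have kr : k * r < d by have := proj2 hr; move/(Rmult_lt_compat_l _ _ _ k0); have -> : k * (d / k) = d by field; lra.
  have := hd (k * r) ltac:(split; nra); rewrite ln_mult; [|lra|lra].
  by rewrite /psum1_const; have -> : (x - / 2) * (ln k + ln r) + (ln (Gamma x) - (ln (Gamma (/ 2)) + / 2 * ln 2)) =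
    (x - / 2) * ln r + ((x - / 2) * ln k + (ln (Gamma x) - (ln (Gamma (/ 2)) + / 2 * ln 2))) by ring.
have diff U : 0 <= U -> exists D, 0 < D /\ forall w, cone U w ->
    Cmod (psum 1 x (RtoC k * w) - psum 1 x (RtoC (k * Re w)))%C <= D * (Rabs (Im w) / Re w).
  move=> U0; have [D [D0 hD]] := @psum1_real_diff x U ltac:(lra) U0; exists D; split=> // w cw.
  have [w0 _] := cw; have := hD _ (cone_scal k0 cw).
  have -> : Re (RtoC k * w)%C = k * Re w by rewrite Cmult_comm Re_mult_RtoC; ring.
  have -> : Im (RtoC k * w)%C = k * Im w by rewrite /Im /=; ring.
  rewrite Rabs_mult (Rabs_pos_eq k); last lra.
  have -> : k * Rabs (Im w) / (k * Re w) = Rabs (Im w) / Re w by field; lra.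
  by [].
split=> [U U0|e e0].
  have [d [d0 hd]] := lim 1 Rlt_0_1; have [D [D0 hD]] := diff U U0.
  exists (psum1_const x k + 1 + D * U), d; split=> // w cw hw; have [w0 wU] := cw.
  have := hD w cw; have := hd (Re w) ltac:(lra).
  set a := psum _ _ _; set b := psum _ _ _ => h1 h2.
  have u1 : Rabs (Im w) / Re w <= U by apply/Rle_div_l.
  have := Re_le_Cmod (b - a)%C; have := Re_le_Cmod (a - RtoC ((x - / 2) * ln (Re w) + psum1_const x k))%C.
  rewrite !ReImE /=; nra.
have [d [d0 hd]] := lim (e / 2) ltac:(lra); have [D [D0 hD]] := diff 1 (Rle_0_1).
have eD : 0 < e / 2 / D by apply: Rdiv_lt_0_compat; lra.
exists (Rmin (Rmin d 1) (e / 2 / D)); split; first by do! apply: Rmin_glb_lt; lra.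
move=> r v hr hv; rewrite Rminus_0_r in hv.
have h1 := Rmin_l (Rmin d 1) (e / 2 / D); have h2 := Rmin_r (Rmin d 1) (e / 2 / D).
have h3 := Rmin_l d 1; have h4 := Rmin_r d 1.
have cw : cone 1 ((r, v) : C).
  by have := @slope_cone 0 r v ltac:(lra); rewrite Rabs_R0 Rplus_0_l Rminus_0_r; apply; lra.
have := hD _ cw; have := hd r ltac:(lra); rewrite [Re _]/= [Im _]/=.
have -> : Rabs v / r = Rabs (v / r) by rewrite Rabs_div ?(Rabs_pos_eq r); lra.
set a := psum _ _ _; set b := psum _ _ _ => h5 h6.
have -> : (b - (RtoC ((x - / 2) * ln r) + RtoC (psum1_const x k)) =
  (b - a) + (a - RtoC ((x - / 2) * ln r + psum1_const x k)))%C by rewrite RtoC_plus; ring.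
apply: Rle_trans (Cmod_triangle _ _) _.
have : D * Rabs (v / r) <= D * (e / 2 / D) by apply: Rmult_le_compat_l; lra.
have -> : D * (e / 2 / D) = e / 2 by field; lra.
lra.
Qed.

Lemma circle_saddle (z xi : C) (al be l1 l2 kap L : R) (f : C -> C) (c cc : C) :
  Cmod z <= 1 -> Cmod xi = 1 -> al < 0 -> 0 < be -> 0 < l1 -> Rabs kap <= 1 ->
  0 <= L -> L < l1 * l1 -> 0 < Re cc -> (cc * cc)%C = (l1, l2) ->
  (forall w, 0 < Re w -> elog z (xi * Cexp (- w)) = (((l1, l2) : C) * ((l1, l2) : C) / w + f w)%C) ->
  tame (l2 / l1) f kap c ->
  (forall v, al <= v <= be -> v <> 0 -> growth (CSeries (resonant z (xi * Cexp (- ((0, v) : C))))) <= L) ->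
  forall e, 0 < e -> exists S, 1 <= S /\ forall (s : R) (J : C), S <= s ->
    is_RIntC (fun v => Cexp (elog z (xi * Cexp (- (((l1 / (s * s))%R, v) : C)))) *
                       Cexp (RtoC (s * s * (s * s)) * (((l1 / (s * s))%R, v) : C)))%C al be J ->
    Cmod (J * (Cexp (- (RtoC 2 * ((l1, l2) : C) * RtoC (s * s))) *
               RtoC (s * s * s * Rpower (l1 / (s * s)) (- kap))) - Cexp c * RtoC (sqrt PI) * cc)%C <= e.
Proof.
move=> z1 x1 al0 be0 l10 kap1 L0 LL cc0 ccE hel [t1 t2] hres.
pose M := (L + l1 * l1) / 2.
have M0 : 0 < M by rewrite /M; nra.
pose q := Cmod (CSeries (resonant z xi)).
have q0 : 0 <= q by exact: Cmod_ge_0.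
(* The cone has to contain the saddle, |l2| < U l1, and be so wide that outside it the pole at the
   base point contributes at most M, which lies strictly between L and l1^2. *)
pose U := Rabs l2 / l1 + q / M + 1.
have r0 : 0 <= Rabs l2 / l1 by apply: Rdiv_le_0_compat => //; exact: Rabs_pos.
have r1 : 0 <= q / M by exact: Rdiv_le_0_compat.
have U0 : 0 < U by rewrite /U; lra.
have Ul : Rabs l2 < U * l1.
  have -> : Rabs l2 = Rabs l2 / l1 * l1 by field; lra.
  by apply: Rmult_lt_compat_r => //; rewrite /U; lra.
apply: (saddle (Phi := fun w => Cexp (elog z (xi * Cexp (- w)))%C) (U := U)) => //.
- have [| |v hv v0|x0 [x0p hx]] := @arc_bound z xi al be U M ((l1 * l1 - L) / 4) z1 x1 U0.
  + by lra.
  + apply/Rle_div_l => //; rewrite -/q.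
    have -> : q = M * (q / M) by field; lra.
    by apply: Rmult_le_compat_l; rewrite /U; lra.
  + by apply: Rle_trans (hres v hv v0) _; rewrite /M; lra.
  exists (M + (l1 * l1 - L) / 4), x0; split; first by rewrite /M; lra.
  split=> // x v hx0 hv hU; rewrite Cmod_Cexp; apply: exp_le; exact: hx.
- have [A [x0 [x0p hA]]] := t1 U ltac:(lra).
  exists (exp A), x0; split; first exact: exp_pos.
  split=> // x v hx hv; rewrite hel /=; last lra.
  set La := (((l1, l2) : C) * _ / _)%C.
  rewrite -Cexp_plus; have -> : (La + f ((x, v) : C) + - La = f ((x, v) : C))%C by ring.
  rewrite Cmod_Cexp /Rpower -exp_plus; apply: exp_le; apply: hA => /=; last lra.
  by split=> /=; lra.
move=> e e0.
have ec0 : 0 < exp (Re c) by exact: exp_pos.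
pose e1 := Rmin 1 (e / (exp (Re c) * exp 1)).
have e10 : 0 < e1.
  by apply: Rmin_glb_lt; [lra|apply: Rdiv_lt_0_compat => //; apply: Rmult_lt_0_compat => //; exact: exp_pos].
have [d [d0 hd]] := t2 e1 e10; exists d; split=> // x v hx hv.
rewrite hel /=; last lra.
set La := (((l1, l2) : C) * _ / _)%C.
rewrite -Cexp_plus; have -> : (La + f ((x, v) : C) + - La = f ((x, v) : C))%C by ring.
have h := hd x v hx hv.
set g := f _ in h *; set b := (RtoC (kap * ln x) + c)%C in h *.
have -> : (RtoC (Rpower x kap) * Cexp c = Cexp b)%C by rewrite /b Cexp_plus Cexp_real.
have hb : Re b = kap * ln x + Re c by rewrite /b !ReImE.
have := @Cexp_lipschitz g b (Re b + 1).
have hg : Re g <= Re b + 1.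
  have := Re_le_Cmod (g - b)%C; rewrite !ReImE => h2; have := Rmin_l 1 (e / (exp (Re c) * exp 1)); rewrite -/e1; lra.
move=> /(_ hg ltac:(lra)) h3; apply: Rle_trans h3 _.
have -> : exp (Re b + 1) = Rpower x kap * (exp (Re c) * exp 1) by rewrite hb !exp_plus /Rpower; ring.
have p1 := exp_pos 1.
have h4 : exp (Re c) * exp 1 * e1 <= e.
  have h5 := Rmin_r 1 (e / (exp (Re c) * exp 1)); rewrite -/e1 in h5.
  have e2 : e = exp (Re c) * exp 1 * (e / (exp (Re c) * exp 1)) by field; lra.
  by rewrite [X in _ <= X]e2; apply: Rmult_le_compat_l => //; nra.
have rp : 0 < Rpower x kap by exact: exp_pos.
have h6 : exp (Re c) * exp 1 * Cmod (g - b)%C <= exp (Re c) * exp 1 * e1 by apply: Rmult_le_compat_l => //; nra.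
nra.
Qed.

(** [arc_bound] leaves out a cone at its base point, so it is used with the two base points 1 and
    -1: a point in the cone at 1 is far from -1. The radius x = sqrt L1 / sqrt n minimises L1/x + n
    x. *)
Lemma Q_growth_bound (z : C) (L L1 : R) : Cmod z <= 1 -> 0 <= L -> L < L1 ->
  (forall xi, Cmod xi = 1 -> growth (CSeries (resonant z xi)) <= L) ->
  exists N, forall n, (N <= n)%N -> Cmod (Q n z) <= exp (2 * sqrt L1 * sqrt (INR n)).
Proof.
move=> z1 L0 LL h; pose M := (L + L1) / 2.
have M0 : 0 < M by rewrite /M; lra.
have C1 : Cmod 1%C = 1 by exact: Cmod_1.
have Cm : Cmod (RtoC (-1)) = 1 by rewrite Cmod_R Rabs_left; lra.
pose q := Cmod (CSeries (resonant z 1)) + Cmod (CSeries (resonant z (RtoC (-1)))).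
have q1 := Cmod_ge_0 (CSeries (resonant z 1)); have q2 := Cmod_ge_0 (CSeries (resonant z (RtoC (-1)))).
have qM : 0 <= q / M by apply: Rdiv_le_0_compat => //; rewrite /q; lra.
pose U := q / M + 1; have U0 : 0 < U by rewrite /U; lra.
have qU t : t <= q -> t / U <= M.
  move=> tq; apply/Rle_div_l => //; apply: Rle_trans tq _.
  have e : q = M * (q / M) by field; lra.
  by rewrite {1}e; apply: Rmult_le_compat_l; rewrite /U; lra.
have unit v : Cmod (Cexp (- ((0, v) : C))) = 1 by rewrite Cmod_Cexp /= Ropp_0 exp_0.
have hr xi (v : R) : Cmod xi = 1 -> growth (CSeries (resonant z (xi * Cexp (- ((0, v) : C))))) <= M.
  by move=> x1; apply: Rle_trans (h _ _) _; [rewrite Cmod_mult x1 unit; ring|rewrite /M; lra].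
have pb := PI_bounds.
have h0 : Cmod (CSeries (resonant z 1)) / U <= M by apply: qU; rewrite /q; lra.
have hm : Cmod (CSeries (resonant z (RtoC (-1)))) / U <= M by apply: qU; rewrite /q; lra.
have he : 0 < (L1 - L) / 2 by lra.
have [x0 [x0p b0]] := @arc_bound z 1 (- PI) PI U M ((L1 - L) / 2) z1 C1 U0 he h0 (fun v _ _ => hr 1%C v C1).
have [x2 [x2p b2]] := @arc_bound z (RtoC (-1)) (- PI - 1) (- PI + 1) U M ((L1 - L) / 2) z1 Cm U0 he hm (fun v _ _ => hr _ v Cm).
have eM : M + (L1 - L) / 2 = L1 by rewrite /M; field.
rewrite eM in b0 b2.
have all x v : 0 < x < Rmin (Rmin x0 x2) (/ U) -> - PI <= v <= PI -> Re (elog z (1 * Cexp (- ((x, v) : C)))) <= L1 / x.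
  move=> hx hv; have h1 := Rmin_l (Rmin x0 x2) (/ U); have h2 := Rmin_r (Rmin x0 x2) (/ U).
  have h3 := Rmin_l x0 x2; have h4 := Rmin_r x0 x2.
  have ux : U * x < 1 by have : U * x < U * / U by [apply: Rmult_lt_compat_l; lra]; rewrite Rinv_r; lra.
  case: (Rle_dec (U * x) (Rabs v)) => hU; first by apply: b0 => //; lra.
  have -> : (1 * Cexp (- ((x, v) : C)) = RtoC (-1) * Cexp (- ((x, (v - PI)%R) : C)))%C.
    rewrite Cmult_1_l -unit_c_PI unit_cE -Cexp_plus.
    have -> : (RtoC PI * Ci + - ((x, (v - PI)%R) : C) = - ((x, v) : C) + RtoC (2 * PI) * Ci)%C.
      by apply: C_ext; rewrite /=; ring.
    by rewrite Cexp_plus Cexp_2PI Cmult_1_r.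
  have hU' := Rnot_le_lt _ _ hU.
  have hv' : - (1) <= v <= 1 by apply/Rabs_le_between; lra.
  have av : Rabs (v - PI) = PI - v by rewrite Rabs_left; lra.
  by apply: b2; rewrite ?av; clear -hx hv hv' h1 h2 h3 h4 ux pb; lra.
have mx : 0 < Rmin (Rmin x0 x2) (/ U) by do! apply: Rmin_glb_lt => //; exact: Rinv_0_lt_compat.
set x' := Rmin _ _ in all mx.
have s0 : 0 < sqrt L1 by apply: sqrt_lt_R0; lra.
have [N [N0 hN]] : exists N, (0 < N)%N /\ sqrt L1 / x' < sqrt (INR N).
  have [N hN] := INR_unbounded (sqrt L1 / x' * (sqrt L1 / x')).
  have r0 : 0 < sqrt L1 / x' by exact: Rdiv_lt_0_compat.
  exists N; split; first by case: N hN => // hN; exfalso; move: hN; rewrite /INR; nra.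
  by rewrite -[X in X < _]sqrt_square; [apply: sqrt_lt_1_alt; nra|lra].
exists N => n Nn.
have nN : sqrt L1 / x' < sqrt (INR n).
  by apply: Rlt_le_trans hN _; apply: sqrt_le_1_alt; apply: le_INR; lia.
have sn : 0 < sqrt (INR n) by apply: Rlt_trans nN; exact: Rdiv_lt_0_compat.
pose x := sqrt L1 / sqrt (INR n).
have xp : 0 < x by exact: Rdiv_lt_0_compat.
have xx : x < x'.
  apply/Rlt_div_l => //; move: nN => /(Rmult_lt_compat_r _ _ _ mx).
  by have -> : sqrt L1 / x' * x' = sqrt L1 by [field; lra]; lra.
have hI := @coef_integral z z1 1%C x n C1 xp.
have hb v : - PI <= v <= PI -> Cmod (Cexp (elog z (1 * Cexp (- ((x, v) : C)))) * Cexp (RtoC (INR n) * ((x, v) : C)))%C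
    <= exp (2 * sqrt L1 * sqrt (INR n)).
  move=> hv; rewrite Cmod_mult !Cmod_Cexp -exp_plus; apply: exp_le.
  have := all x v ltac:(lra) hv.
  have -> : Re (RtoC (INR n) * ((x, v) : C))%C = INR n * x by rewrite /=; ring.
  have e1 : L1 / x = sqrt L1 * sqrt (INR n).
    rewrite /x -{1}(sqrt_sqrt L1); last lra.
    by field; lra.
  have e2 : INR n * x = sqrt L1 * sqrt (INR n).
    rewrite /x -{1}(sqrt_sqrt (INR n)); last exact: pos_INR.
    by field; lra.
  lra.
have pp : - PI <= PI by lra.
have := Cmod_RIntC_le pp hb hI.
rewrite Cmod_mult Cpow_1_l Cmult_1_l Cmod_pos; last lra.
move=> hh; apply: (Rmult_le_reg_l (2 * PI)); first lra.
by apply: Rle_trans hh _; right; ring.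
Qed.

(** * Sieving by roots of unity *)

Definition csum (l : seq C) : C := foldr Cplus (RtoC 0) l.

Lemma csum_cat (l1 l2 : seq C) : csum (l1 ++ l2) = (csum l1 + csum l2)%C.
Proof. by elim: l1 => [|x l IH] /=; [|rewrite IH]; ring. Qed.

Lemma csum_scal (T : Type) (c : C) (f : T -> C) (l : seq T) :
  csum (map (fun s => c * f s)%C l) = (c * csum (map f l))%C.
Proof. by elim: l => [|x l IH] /=; [|rewrite IH]; ring. Qed.

Lemma csum_plus (T : Type) (f g : T -> C) (l : seq T) :
  csum (map (fun s => f s + g s)%C l) = (csum (map f l) + csum (map g l))%C.
Proof. by elim: l => [|x l IH] /=; [|rewrite IH]; ring. Qed.

Lemma csum_conj (T : Type) (f : T -> C) (l : seq T) :
  csum (map (fun s => Cconj (f s)) l) = Cconj (csum (map f l)).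
Proof.
elim: l => [|x l IH] /=; first by apply: C_ext; rewrite /=; ring.
by rewrite IH Cplus_conj.
Qed.

Lemma sum_n_csum (T : Type) (f : nat -> T -> C) (l : seq T) (m : nat) :
  sum_n (G := C_R_NormedModule) (fun j => csum (map (f j) l)) m =
  csum (map (fun s => sum_n (G := C_R_NormedModule) (fun j => f j s) m) l).
Proof.
elim: m => [|m IH].
  by rewrite sum_O; congr csum; apply: eq_map => s; rewrite sum_O.
rewrite sum_Sn IH -[LHS]/(Cplus _ _) -csum_plus; congr csum; apply: eq_map => s.
by rewrite sum_Sn.
Qed.

Definition bounded_partition (N n : nat) (s : seq nat) : bool :=
  is_partition n s && all (fun x => (x <= N)%N) s.

Lemma bounded_partition_cons (N n : nat) (s : seq nat) : (N < n)%N ->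
  bounded_partition N.+1 (n - N.+1) s -> bounded_partition N.+1 n (N.+1 :: s).
Proof.
move=> Nn /andP[/and3P[so s0 /eqP sn] al]; apply/andP; split; last by rewrite /= leqnn.
apply/and3P; split.
- by rewrite /= path_min_sorted.
- by rewrite inE negb_or.
- by rewrite /= sn; apply/eqP; lia.
Qed.

Lemma bounded_partition_inv (N n : nat) (s : seq nat) : bounded_partition N.+1 n s ->
  bounded_partition N n s \/
  (N < n)%N /\ exists2 t, bounded_partition N.+1 (n - N.+1) t & s = N.+1 :: t.
Proof.
move=> /andP[/and3P[so s0 /eqP sn] al].
case: s so s0 sn al => [|x s] so s0 sn al.
  by left; rewrite /bounded_partition /is_partition /=; move: sn => /= <-.
have tr : transitive geq by move=> a b c h1 h2; exact: leq_trans h2 h1.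
have ax : all (geq x) s by exact: order_path_min so.
move: al => /= /andP[xN al].
have [xe|xe] := eqVneq x N.+1; last first.
  left; rewrite /bounded_partition /is_partition so s0 sn eqxx /=.
  have xN' : (x <= N)%N by lia.
  by rewrite xN' /=; apply: sub_all ax => y /= yx; lia.
right; move: sn => /= sn; split; first by lia.
exists s; last by rewrite xe.
rewrite /bounded_partition al andbT; apply/and3P; split.
- exact: path_sorted so.
- by move: s0; rewrite inE negb_or => /andP[].
- by apply/eqP; lia.
Qed.

Lemma bounded_partitionS (N n : nat) (s : seq nat) : bounded_partition N n s -> bounded_partition N.+1 n s.
Proof. by case/andP=> h al; rewrite /bounded_partition h; apply: sub_all al => x; lia. Qed.

(** Splitting off one part N + 1, when there is one, is the combinatorial form of [fps_prod_rec];
    the inner induction on n follows the repeated removal of such parts. *)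
Lemma bounded_partitions (N n : nat) : exists l : seq (seq nat),
  [/\ uniq l, forall s, (s \in l) = bounded_partition N n s &
      forall z, csum (map (fun s => Cpow z (size s)) l) = fps_prod z N n].
Proof.
elim: N n => [|N IHN] n.
  exists (if n == 0%N then [:: [::]] else [::]).
  have [->|n0] := eqVneq n 0%N.
    split=> // [s|z]; last by rewrite /= /fps_one /=; ring.
    rewrite inE; case: s => [|x s] //; rewrite /bounded_partition /is_partition /= inE.
    by case: x => [|x] //=; rewrite !andbF.
  split=> // [s|z]; last by rewrite /= /fps_one (negPf n0).
  rewrite in_nil; case: s => [|x s]; rewrite /bounded_partition /is_partition /=.
    by rewrite eq_sym (negPf n0).
  by case: x => [|x] //=; rewrite ?inE ?andbF.
elim/ltn_ind: n => n IHn; have [l [ul ml sl]] := IHN n.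
have [Nn|nN] := ltnP N n; last first.
  exists l; split=> // [s|z]; last first.
    rewrite sl fps_prod_rec; have -> : (N < n)%N = false by lia.
    by ring.
  rewrite ml; apply/idP/idP => [/bounded_partitionS //|/bounded_partition_inv [//|[]]]; lia.
have [m [um mm sm]] := IHn (n - N.+1)%N ltac:(lia).
exists (l ++ map (cons N.+1) m); split.
- rewrite cat_uniq ul map_inj_uniq ?um ?andbT; last by move=> s t [].
  apply/hasPn => s /mapP [t _ ->]; rewrite ml /bounded_partition /= .
  by rewrite ltnn /= andbF.
- move=> s; rewrite mem_cat ml; apply/idP/idP.
    case/orP=> [/bounded_partitionS //|/mapP [t ht ->]].
    by apply: bounded_partition_cons => //; rewrite -mm.
  case/bounded_partition_inv => [->//|[_ [t ht ->]]].
  by apply/orP; right; apply/mapP; exists t; rewrite ?mm.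
move=> z; rewrite map_cat csum_cat sl fps_prod_rec Nn -sm -map_comp -csum_scal; congr Cplus.
Qed.

(** One list serves all residues and all [z], so identities between the counts and the values of [Q]
    can be proved by induction on it. *)
Lemma partition_enum (n : nat) : exists l : seq (seq nat),
  (forall a b, p a b n = count (fun s => size s == a %[mod b]) l) /\
  (forall z, Q n z = csum (map (fun s => Cpow z (size s)) l)).
Proof.
have [l [ul ml sl]] := bounded_partitions n n; exists l; split=> [a b|z]; last by rewrite sl.
pose g (t : {bseq n of 'I_n.+1}) : seq nat := map val t.
have gi : injective g by move=> s t /(inj_map val_inj) /val_inj.
rewrite /p cardE -(size_map g) -size_filter; apply: perm_size; apply: uniq_perm.
- by rewrite map_inj_uniq // enum_uniq.
- exact: filter_uniq.
move=> s; rewrite mem_filter ml; apply/mapP/andP.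
  case=> t; rewrite mem_enum inE => /andP[pt st] ->; split; first by rewrite size_map.
  rewrite /bounded_partition pt; apply/allP => x /mapP [i _ ->].
  by rewrite -ltnS; exact: ltn_ord.
case=> sz /andP[ps _]; have [t ht] := is_partition_bseq ps.
exists t; last by rewrite /g ht.
by rewrite mem_enum inE ht ps -(size_map val) ht.
Qed.

Lemma Q_conj (n : nat) (z : C) : Q n (Cconj z) = Cconj (Q n z).
Proof.
have [l [_ hQ]] := partition_enum n; rewrite !hQ -csum_conj; congr csum.
by apply: eq_map => s; rewrite Cpow_conj'.
Qed.

Lemma Q_m1 (n : nat) : RtoC (INR (p 0 2 n) - INR (p 1 2 n)) = Q n (RtoC (-1)).
Proof.
have [l [hp ->]] := partition_enum n; rewrite !{}hp.
elim: l => [|s l IH] /=; first by rewrite Rminus_0_r.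
rewrite -IH Cpow_m1 !modn2 -RtoC_plus !plus_INR; congr RtoC.
by case: (odd (size s)); rewrite /INR /=; ring.
Qed.

Lemma zeta_pow_mod (b m : nat) : (0 < b)%N -> Cpow (zeta b) (m %% b) = Cpow (zeta b) m.
Proof.
move=> b0; rewrite [in RHS](divn_eq m b) Cpow_add_r mulnC Cpow_mul zeta_pow_b // Cpow_1_l.
by rewrite Cmult_1_l.
Qed.

Lemma zeta_pow_eq1 (b m : nat) : (0 < b)%N -> Cpow (zeta b) m = 1%C -> (b %| m)%N.
Proof.
move=> b0 h; rewrite /dvdn; apply/negPn/negP => r0.
have : Cpow (zeta b) (m %% b) = 1%C by rewrite zeta_pow_mod.
have rb := ltn_pmod m b0; rewrite zeta_pow; apply: unit_c_neq1.
have p0 := PI_RGT_0; have bp : 0 < INR b by apply: lt_0_INR; lia.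
have rp : 0 < INR (m %% b) by apply: lt_0_INR; lia.
have rlt : INR (m %% b) < INR b by apply: lt_INR; lia.
split; first by apply: Rdiv_lt_0_compat => //; nra.
by apply/Rlt_div_l => //; nra.
Qed.

Lemma zeta_pow_neq0 (b k : nat) : Cpow (zeta b) k <> 0%C.
Proof. by apply: Cmod_neq0; rewrite zeta_pow Cmod_unit_c; lra. Qed.

Lemma zeta_pow_eqP (b m a : nat) : (0 < b)%N ->
  Cpow (zeta b) m = Cpow (zeta b) a <-> m == a %[mod b].
Proof.
move=> b0; split=> [|/eqP h]; last by rewrite -zeta_pow_mod // h zeta_pow_mod.
wlog am : a m / (a <= m)%N => [hw|].
  by case/orP: (leq_total a m) => h e; [exact: hw|rewrite eq_sym; apply: hw].
rewrite eqn_mod_dvd // => e; apply: zeta_pow_eq1 => //.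
have u0 := @zeta_pow_neq0 b a.
have : (Cpow (zeta b) (m - a) * Cpow (zeta b) a = Cpow (zeta b) a)%C by rewrite -Cpow_add_r -e; congr Cpow; lia.
move=> h; have -> : Cpow (zeta b) (m - a) = (Cpow (zeta b) (m - a) * Cpow (zeta b) a / Cpow (zeta b) a)%C by field.
by rewrite h; field.
Qed.

Lemma zeta_filter (b a m : nat) : (0 < b)%N ->
  sum_n (G := C_R_NormedModule) (fun j => Cpow (/ Cpow (zeta b) a) j * Cpow (Cpow (zeta b) j) m)%C (b - 1) =
  RtoC (if m == a %[mod b] then INR b else 0).
Proof.
move=> b0; have ua := @zeta_pow_neq0 b a.
pose t := (Cpow (zeta b) m / Cpow (zeta b) a)%C.
have e j : (Cpow (/ Cpow (zeta b) a) j * Cpow (Cpow (zeta b) j) m)%C = Cpow t j.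
  by rewrite -Cpow_mul mulnC Cpow_mul /t /Cdiv Cpow_mult_l Cmult_comm.
transitivity (sum_n (G := C_R_NormedModule) (Cpow t) (b - 1)); first exact: sum_n_ext.
have tb : Cpow t b = 1%C.
  have pb k : Cpow (Cpow (zeta b) k) b = 1%C by rewrite -Cpow_mul mulnC Cpow_mul zeta_pow_b // Cpow_1_l.
  rewrite /t /Cdiv Cpow_mult_l pb Cpow_inv // pb; apply: C_ext; rewrite /=; field.
case: (classic (t = 1%C)) => [t1|tn].
  have -> : (m == a %[mod b]).
    apply/zeta_pow_eqP => //.
    have -> : Cpow (zeta b) m = (t * Cpow (zeta b) a)%C by rewrite /t; field.
    by rewrite t1; ring.
  transitivity (sum_n (G := C_R_NormedModule) (fun _ => RtoC 1) (b - 1)).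
    by apply: sum_n_ext => j; rewrite t1 Cpow_1_l.
  case: b b0 {ua t e tb t1} => // b _; rewrite subn1 /=.
  elim: b => [|b IH]; first by rewrite sum_O.
  by rewrite sum_Sn IH (S_INR b.+1) RtoC_plus.
have -> : (m == a %[mod b]) = false.
  by apply/negP => /zeta_pow_eqP h; apply: tn; rewrite /t h //; field.
rewrite Cgeom_sum; last first.
  by move=> h; apply: tn; have e1 : (t = 1 - (1 - t))%C by [ring]; rewrite e1 h; ring.
have -> : (b - 1).+1 = b by lia.
by rewrite tb /Cdiv; ringC.
Qed.

Lemma p_zeta (a b n : nat) : (0 < b)%N ->
  RtoC (INR b * INR (p a b n)) =
  sum_n (G := C_R_NormedModule) (fun j => Cpow (/ Cpow (zeta b) a) j * Q n (Cpow (zeta b) j))%C (b - 1).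
Proof.
move=> b0; have [l [hp hQ]] := partition_enum n; rewrite hp.
have e j : (Cpow (/ Cpow (zeta b) a) j * Q n (Cpow (zeta b) j))%C =
   csum (map (fun s => Cpow (/ Cpow (zeta b) a) j * Cpow (Cpow (zeta b) j) (size s))%C l).
  by rewrite hQ csum_scal.
transitivity (sum_n (G := C_R_NormedModule) (fun j => csum (map (fun s => Cpow (/ Cpow (zeta b) a) j * Cpow (Cpow (zeta b) j) (size s))%C l)) (b - 1)); last exact: sum_n_ext.
rewrite sum_n_csum.
have -> : [seq sum_n (G := C_R_NormedModule) (fun j => Cpow (/ Cpow (zeta b) a) j * Cpow (Cpow (zeta b) j) (size s))%C (b - 1) | s <- l]
  = [seq RtoC (if size s == a %[mod b] then INR b else 0) | s <- l].
  by apply: eq_map => s; exact: zeta_filter.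
elim: l {hp hQ e} => [|s l IH] /=; first by rewrite Rmult_0_r.
rewrite -IH -RtoC_plus plus_INR; congr RtoC.
by case: ifP => _; rewrite /INR /=; ring.
Qed.

(** * The constants *)

Lemma gauss_real (T : R) : 0 < T -> exp (- (T * T)) <= / 4 ->
  Rabs (RInt (fun v => exp (- (v * v))) 0 T - sqrt PI / 2) <= 4 * exp (- (T * T)).
Proof.
move=> T0 hT.
have e11 : Re (1 * 1)%C = 1 by rewrite /=; ring.
have := @gauss_complex 1 T; rewrite e11 Rmult_1_l => /(_ Rlt_0_1 Rlt_0_1 T0 hT).
have hr : is_RIntC (fun t => Cexp (- (1 * 1 * RtoC (t * t))))%C 0 T (RtoC (RInt (fun v => exp (- (v * v))) 0 T)).
  have hR : is_RInt (fun v => exp (- (v * v))) 0 T (RInt (fun v => exp (- (v * v))) 0 T).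
    apply: RInt_correct; apply: (ex_RInt_continuous (V := R_CompleteNormedModule)) => v _.
    by apply: (ex_derive_continuous (fun v => exp (- (v * v)))); auto_derive.
  have h0 := @is_RInt_const R_NormedModule 0 T 0; rewrite scal_zero_r in h0.
  apply: (@is_RInt_ext C_R_NormedModule (fun v => RtoC (exp (- (v * v))))) => [v _|].
    have -> : (- (1 * 1 * RtoC (v * v)) = RtoC (- (v * v)))%C by apply: C_ext; rewrite /=; ring.
    by rewrite Cexp_real.
  exact: (is_RInt_fct_extend_pair (U := R_NormedModule) (V := R_NormedModule) (fun v => RtoC (exp (- (v * v)))) 0 T (RInt _ 0 T) 0 hR h0).
rewrite /gaussK (RIntC_unique hr) Cmult_1_l -RtoC_minus Cmod_R => h; exact: h.
Qed.

(** The substitution u = v^2 on the truncated interval, with the factor 2 from du = 2 v dv. *)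
Lemma GI_half (n : nat) : GI (/ 2) n.+1 =
  2 * (RInt (fun v => exp (- (v * v))) 0 (sqrt (INR n.+2)) - RInt (fun v => exp (- (v * v))) 0 (sqrt (/ INR n.+2))).
Proof.
set N := INR n.+2; have N0 : 0 < N by exact: INR_S_pos.
have N1 : 1 <= N by rewrite /N S_INR; have := pos_INR n.+1; lra.
have i0 : 0 < / N by exact: Rinv_0_lt_compat.
have iN : / N <= N by apply: Rle_trans (N1); rewrite -[X in _ <= X]Rinv_1; apply: Rinv_le_contravar; lra.
have sa : 0 < sqrt (/ N) by exact: sqrt_lt_R0.
have sab : sqrt (/ N) <= sqrt N by exact: sqrt_le_1_alt.
have ci a b : ex_RInt (fun v => exp (- (v * v))) a b.
  apply: (ex_RInt_continuous (V := R_CompleteNormedModule)) => v _.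
  by apply: (ex_derive_continuous (fun v => exp (- (v * v)))); auto_derive.
have hc := @RInt_Chasles R_CompleteNormedModule (fun v => exp (- (v * v))) 0 (sqrt (/ N)) (sqrt N) (ci _ _) (ci _ _).
have -> : RInt (fun v => exp (- (v * v))) 0 (sqrt N) - RInt (fun v => exp (- (v * v))) 0 (sqrt (/ N)) =
   RInt (fun v => exp (- (v * v))) (sqrt (/ N)) (sqrt N) by rewrite -hc /plus /=; ring.
rewrite -[RHS](RInt_scal (V := R_CompleteNormedModule) (fun v => exp (- (v * v)))); last exact: ci.
have := @RInt_comp R_CompleteNormedModule (gamma_int (/ 2)) (fun v => v * v) (fun v => 2 * v) (sqrt (/ N)) (sqrt N).
rewrite !sqrt_sqrt; [|lra|lra]; rewrite /GI -/N => <-.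
- apply: RInt_ext => v; rewrite Rmin_left // Rmax_right // => hv.
  rewrite /scal /= /mult /= /gamma_int.
  have -> : Rpower (v * v) (/ 2 - 1) = / v.
    rewrite /Rpower ln_mult; [|lra|lra].
    have -> : (/ 2 - 1) * (ln v + ln v) = - ln v by field.
    by rewrite exp_Ropp exp_ln; lra.
  by field; lra.
- move=> v; rewrite Rmin_left // Rmax_right // => hv.
  by apply: (ex_derive_continuous (gamma_int (/ 2))); rewrite /gamma_int /Rpower; auto_derive; nra.
- move=> v _; split; first by auto_derive => //; ring.
  by apply: (ex_derive_continuous (fun v => 2 * v)); auto_derive.
Qed.

Lemma Gamma_half : Gamma (/ 2) = sqrt PI.
Proof.
have h := GI_lim (ltac:(lra) : 0 < / 2).
have h' : is_lim_seq (fun n => GI (/ 2) n.+1) (Gamma (/ 2)) by exact: (proj1 (is_lim_seq_incr_1 _ _) h).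
have linv : is_lim_seq (fun n => / INR n.+2) 0.
  have -> : Rbar.Finite 0 = Rbar_inv p_infty by [].
  apply: is_lim_seq_inv => //; apply/(is_lim_seq_incr_1 (fun n => INR n.+1)).
  by apply/(is_lim_seq_incr_1 INR); exact: is_lim_seq_INR.
have lsq : is_lim_seq (fun n => sqrt (/ INR n.+2)) 0.
  have h0 := is_lim_seq_continuous sqrt _ 0 (continuity_pt_sqrt 0 (Rle_refl 0)) linv.
  by rewrite sqrt_0 in h0.
have lim0 : is_lim_seq (fun n => GI (/ 2) n.+1 - sqrt PI) 0.
  have l2 : is_lim_seq (fun n => 8 * / INR n.+2 + 2 * sqrt (/ INR n.+2)) 0.
    have a1 := is_lim_seq_scal_l _ 8 _ linv; rewrite /= Rmult_0_r in a1.
    have a2 := is_lim_seq_scal_l _ 2 _ lsq; rewrite /= Rmult_0_r in a2.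
    by have := is_lim_seq_plus' _ _ _ _ a1 a2; rewrite Rplus_0_r.
  apply/is_lim_seq_abs_0; apply: is_lim_seq_le_le_loc (is_lim_seq_const 0) l2.
  exists 4%N => n n4; split; first exact: Rabs_pos.
  rewrite GI_half; set N := INR n.+2.
  have N4 : 5 <= N.
    have := le_INR 5 n.+2 ltac:(lia); rewrite -/N; have -> : INR 5 = 5 by rewrite /INR; lra.
    by [].
  have eN : exp (- N) <= / N.
    rewrite exp_Ropp; apply: Rinv_le_contravar; first lra.
    by have := exp_ineq1_le N; lra.
  have iN : / N <= / 4 by apply: Rinv_le_contravar; lra.
  have N0 : 0 < N by lra.
  have := @gauss_real (sqrt N) (sqrt_lt_R0 _ N0); rewrite sqrt_sqrt; last lra.
  move=> /(_ (Rle_trans _ _ _ eN iN)).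
  have s0 : 0 <= sqrt (/ N) by exact: sqrt_pos.
  have b0 : 0 <= RInt (fun v => exp (- (v * v))) 0 (sqrt (/ N)) <= sqrt (/ N).
    have ci : ex_RInt (fun v => exp (- (v * v))) 0 (sqrt (/ N)).
      apply: (ex_RInt_continuous (V := R_CompleteNormedModule)) => v _.
      by apply: (ex_derive_continuous (fun v => exp (- (v * v)))); auto_derive.
    split; first by apply: RInt_ge_0 => // v _; left; exact: exp_pos.
    have -> : sqrt (/ N) = RInt (fun _ => 1) 0 (sqrt (/ N)) by rewrite RInt_const /scal /= /mult /=; ring.
    rewrite RInt_const /scal /= /mult /= Rminus_0_r Rmult_1_r.
    apply: Rle_trans (RInt_le _ (fun _ => 1) _ _ s0 ci (@ex_RInt_const R_NormedModule _ _ _) _) _.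
      by move=> v _; rewrite -exp_0; apply: exp_le; nra.
    by rewrite RInt_const /scal /= /mult /=; lra.
  set K := RInt _ 0 (sqrt N); set k := RInt _ 0 _ in b0 *.
  move=> /Rabs_le_between hK; apply/Rabs_le_between; lra.
have := is_lim_seq_unique _ _ lim0.
have lc := is_lim_seq_minus' _ _ _ _ h' (is_lim_seq_const (sqrt PI)).
rewrite (is_lim_seq_unique _ _ lc) => -[]; lra.
Qed.

(** * Principal branches of powers and square roots *)

Lemma Carg_polar (a t : R) : - PI < t <= PI -> Carg (Cexp (a, t)) = t.
Proof.
move=> ht; have a0 := exp_pos a; rewrite /Carg Cmod_Cexp [Re (a, t)]/=.
have -> : Re (Cexp (a, t)) / exp a = cos t by rewrite /=; field; lra.
have -> : Im (Cexp (a, t)) = exp a * sin t by [].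
case: (Rle_dec 0 t) => h0.
  have s0 : 0 <= sin t by apply: sin_ge_0; lra.
  case: Rle_dec => h; first by apply: acos_cos; lra.
  by exfalso; apply: h; nra.
have h1 := Rnot_le_lt _ _ h0.
have s0 : 0 < sin (- t) by apply: sin_gt_0; lra.
rewrite sin_neg in s0; case: Rle_dec => h; first by exfalso; nra.
have e : acos (cos (- t)) = - t by apply: acos_cos; lra.
by rewrite cos_neg in e; rewrite e /=; ring.
Qed.

Lemma Cpower_polar (a t : R) (w : C) : - PI < t <= PI ->
  Cpower (Cexp (a, t)) w = Cexp (w * (a, t))%C.
Proof.
move=> ht; rewrite /Cpower; case: Ceq_dec => [e|n0]; first by case: (@Cexp_neq0 (a, t)).
by rewrite [is_left _]/= /Clog Carg_polar // Cmod_Cexp ln_exp.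
Qed.

Lemma Cexp_log1m_opp (y : C) : Re y < 1 -> Cexp (- log1m y) = (1 - y)%C.
Proof.
move=> hy; rewrite Cexp_opp Cexp_log1m //.
have n0 : (1 - y)%C <> 0%C by apply: Re_pos_neq0; rewrite !ReImE /=; lra.
by field; exact: n0.
Qed.

(** As Re y < 1, the point 1 - y lies in the right half-plane, where the principal logarithm is
    given by an arctangent, namely by - log1m y. *)
Lemma Cpower_one_minus (y w : C) : Re y < 1 -> Cpower (1 - y) w = Cexp (- (w * log1m y))%C.
Proof.
move=> hy; rewrite -Cexp_log1m_opp // /log1m /Copp /= Cpower_polar; last first.
  have := atan_bound (Im y / (1 - Re y)); have := PI_RGT_0; rewrite /Im /Re; lra.
by congr Cexp; apply: C_ext; rewrite /=; ring.
Qed.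

Lemma Csqrt_unique (w z : C) : 0 < Re w -> (w * w)%C = z -> Csqrt z = w.
Proof.
move=> w0 <-; have hy : Re (1 - w)%C < 1 by rewrite !ReImE /=; lra.
have e := Cexp_log1m_opp hy.
have e1 : (1 - (1 - w) = w)%C by ring.
rewrite e1 in e; rewrite -e -Cexp_plus /Csqrt.
have := atan_bound (Im (1 - w)%C / (1 - Re (1 - w)%C)).
rewrite /log1m; set a := ln _; set t := atan _ => ht.
have -> : (- ((- a)%R, t) + - ((- a)%R, t))%C = (2 * a, - (2 * t)) by apply: C_ext; rewrite /=; ring.
rewrite Cpower_polar; last by lra.
congr Cexp; apply: C_ext; rewrite /=; field.
Qed.

(** The real part of the principal square root of z is sqrt (growth z). This ties lambda1 in the
    theorem to the growth of Li2 (zeta b). *)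
Lemma Csqrt_growth (z : C) : 0 < growth z ->
  let w := (sqrt (growth z), Im z / (2 * sqrt (growth z))) : C in
  0 < Re w /\ (w * w)%C = z.
Proof.
move=> g0; have s0 := sqrt_lt_R0 _ g0; have ss := sqrt_sqrt (growth z) ltac:(lra).
split=> //; apply: C_ext; rewrite [LHS]/=; last by field; lra.
have e := growth_eq z.
have -> : Im z / (2 * sqrt (growth z)) * (Im z / (2 * sqrt (growth z))) = Im z * Im z / (4 * (sqrt (growth z) * sqrt (growth z))).
  by field; lra.
by rewrite ss e; field; lra.
Qed.

Lemma Im_lt_Re (w : C) : 0 < Re w -> 0 < Re (w * w)%C -> Rabs (Im w) < Re w.
Proof.
have -> : Re (w * w)%C = Re w * Re w - Im w * Im w by [].
move=> h0 h1; apply/Rabs_lt_between; nra.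
Qed.

Lemma Re_mult_pos (u v : C) : 0 < Re u -> 0 < Re (u * u)%C -> 0 < Re v -> 0 < Re (v * v)%C -> 0 < Re (u * v)%C.
Proof.
move=> u0 u2 v0 v2; have /Rabs_lt_between h1 := Im_lt_Re u0 u2; have /Rabs_lt_between h2 := Im_lt_Re v0 v2.
have -> : Re (u * v)%C = Re u * Re v - Im u * Im v by [].
nra.
Qed.

(** * Asymptotics of Q_n at roots of unity *)

(** The fourth root of n, the parameter s of the saddle point. *)
Definition sq (n : nat) : R := sqrt (sqrt (INR n)).

Lemma sq_large (S : R) : exists N, forall n, (N <= n)%N -> S <= sq n.
Proof.
pose T := Rmax S 0; have T0 : 0 <= T by exact: Rmax_r.
have [N hN] := INR_unbounded (T * T * (T * T)); exists N => n Nn.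
have h : T * T * (T * T) <= INR n by apply: Rle_trans (le_INR N n ltac:(lia)); lra.
apply: Rle_trans (Rmax_l S 0) _; rewrite -/T.
have -> : T = sqrt (sqrt (T * T * (T * T))) by rewrite !sqrt_square; nra.
by apply: sqrt_le_1_alt; exact: sqrt_le_1_alt.
Qed.

Lemma sq2 (n : nat) : sq n * sq n = sqrt (INR n).
Proof. exact: sqrt_sqrt (sqrt_pos _). Qed.

Lemma sq4 (n : nat) : sq n * sq n * (sq n * sq n) = INR n.
Proof. by rewrite sq2; exact: sqrt_sqrt (pos_INR _). Qed.

Lemma unit_c_plus (a b : R) : unit_c (a + b) = (unit_c a * unit_c b)%C.
Proof. by rewrite !unit_cE -Cexp_plus; congr Cexp; rewrite RtoC_plus; ring. Qed.

Lemma unit_c_inj (a b : R) : 0 < a - b < 2 * PI -> unit_c a <> unit_c b.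
Proof.
move=> h e; apply: (unit_c_neq1 h).
have -> : a - b = a + - b by ring.
by rewrite unit_c_plus e -unit_c_plus Rplus_opp_r unit_c_0.
Qed.

Lemma Cexp_vert (v : R) : Cexp (- ((0, v) : C)) = unit_c (- v).
Proof. by rewrite unit_cE; congr Cexp; apply: C_ext; rewrite /=; ring. Qed.

Lemma Q_asymp_full (z xi : C) (l1 l2 kap L : R) (f : C -> C) (c cc : C) :
  Cmod z <= 1 -> Cmod xi = 1 -> 0 < l1 -> Rabs kap <= 1 ->
  0 <= L -> L < l1 * l1 -> 0 < Re cc -> (cc * cc)%C = (l1, l2) ->
  (forall w, 0 < Re w -> elog z (xi * Cexp (- w)) = (((l1, l2) : C) * ((l1, l2) : C) / w + f w)%C) ->
  tame (l2 / l1) f kap c ->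
  (forall v, - PI <= v <= PI -> v <> 0 -> growth (CSeries (resonant z (xi * unit_c (- v)))) <= L) ->
  forall e, 0 < e -> exists N, forall n, (N <= n)%N ->
    Cmod (Cpow xi n * Q n z *
      (Cexp (- (RtoC 2 * ((l1, l2) : C) * RtoC (sq n * sq n))) *
       RtoC (sq n * sq n * sq n * Rpower (l1 / (sq n * sq n)) (- kap)))
      - Cexp c * cc / RtoC (2 * sqrt PI))%C <= e.
Proof.
move=> z1 x1 l10 k1 L0 LL c0 cE hel ht hres e e0; have pb := PI_bounds.
have h' v : - PI <= v <= PI -> v <> 0 -> growth (CSeries (resonant z (xi * Cexp (- ((0, v) : C))))) <= L.
  by move=> hv v0; rewrite Cexp_vert; exact: hres.
have [S [S1 hS]] := circle_saddle z1 x1 (ltac:(lra) : - PI < 0) (ltac:(lra) : 0 < PI) l10 k1 L0 LL c0 cE hel ht h' e0.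
have [N hN] := sq_large S; exists N => n Nn.
have s1 := hN n Nn; have x0 : 0 < l1 / (sq n * sq n) by apply: Rdiv_lt_0_compat => //; nra.
have hI := @coef_integral z z1 xi _ n x1 x0.
rewrite -sq4 in hI; have := hS (sq n) _ s1 hI.
set E := (Cexp _ * RtoC _)%C; set q := (Cpow xi n * Q n z)%C => h.
have sp : 0 < sqrt PI by apply: sqrt_lt_R0; lra.
have p2 := sqrt_sqrt PI ltac:(lra).
have spn := RtoC_neq0 (ltac:(lra) : sqrt PI <> 0).
have e2 : RtoC (2 * PI) = (2 * RtoC (sqrt PI) * RtoC (sqrt PI))%C by rewrite -!RtoC_mult Rmult_assoc p2.
have n2 : RtoC 2 <> 0%C by apply: RtoC_neq0; lra.
have -> : (q * E - Cexp c * cc / RtoC (2 * sqrt PI) = (RtoC (2 * PI) * q * E - Cexp c * RtoC (sqrt PI) * cc) * / RtoC (2 * PI))%C.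
  by rewrite e2 RtoC_mult; field; intuition.
rewrite Cmod_mult -RtoC_invE Cmod_pos; last by left; apply: Rinv_0_lt_compat; lra.
apply: (Rle_trans _ (e * 1)); last lra.
apply: Rmult_le_compat => //; [exact: Cmod_ge_0|by left; apply: Rinv_0_lt_compat; lra|].
by rewrite -[X in _ <= X]Rinv_1; apply: Rinv_le_contravar; lra.
Qed.

(** At xi = 1 there is a single block, with y = z and x = 1: it carries no power of Re w, and its
    constant term is (1/2 - 1) log1m z, that is the factor sqrt (1 - z). *)
Lemma Q_asymp_one (z cc : C) (l1 l2 L : R) : Cmod z = 1 -> z <> 1%C -> 0 < l1 ->
  (((l1, l2) : C) * ((l1, l2) : C))%C = Li2 z -> 0 <= L -> L < l1 * l1 ->
  0 < Re cc -> (cc * cc)%C = (l1, l2) ->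
  (forall xi, Cmod xi = 1 -> xi <> 1%C -> growth (CSeries (resonant z xi)) <= L) ->
  forall e, 0 < e -> exists N, forall n, (N <= n)%N ->
    Cmod (Q n z * (Cexp (- (RtoC 2 * ((l1, l2) : C) * RtoC (sq n * sq n))) * RtoC (sq n * sq n * sq n))
      - Cexp (- (/ 2 * log1m z)) * cc / RtoC (2 * sqrt PI))%C <= e.
Proof.
move=> z1 zn l10 lE L0 LL c0 cE hres e e0; have pb := PI_bounds.
have zle : Cmod z <= 1 by lra.
have hel w : 0 < Re w -> elog z (1 * Cexp (- w)) = (((l1, l2) : C) * ((l1, l2) : C) / w + psum z 1 (RtoC 1 * w))%C.
  move=> w0; rewrite (@elog_unity z 1 w 0 zle Cmod_1 (Cpow_1_l _) w0).
  rewrite sum_O Cpow_1_l lE Cmult_1_r.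
  have -> : INR 1 = 1 by [].
  by rewrite Rdiv_1_r Cmult_1_l.
have ht : tame (l2 / l1) (fun w => psum z 1 (RtoC 1 * w)%C) 0 (- (/ 2 * log1m z))%C.
  have -> : (- (/ 2 * log1m z))%C = (RtoC (/ 2 - 1) * log1m z)%C.
    have -> : / 2 - 1 = - / 2 by field.
    by rewrite RtoC_opp RtoC_invE; ring.
  by apply: tame_psum => //; lra.
have hr v : - PI <= v <= PI -> v <> 0 -> growth (CSeries (resonant z (1 * unit_c (- v)))) <= L.
  move=> hv v0; rewrite Cmult_1_l; apply: hres; first exact: Cmod_unit_c.
  case: (Rle_lt_dec 0 v) => h; last by apply: unit_c_neq1; lra.
  by have := @unit_c_inj 0 (- v) ltac:(lra); rewrite unit_c_0 => h1 h2; apply: h1.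
have k1 : Rabs 0 <= 1 by rewrite Rabs_R0; lra.
have [N hN] := Q_asymp_full zle Cmod_1 l10 k1 L0 LL c0 cE hel ht hr e0.
exists N.+1 => n Nn; have := hN n ltac:(lia); rewrite Cpow_1_l Cmult_1_l Ropp_0 Rpower_O; last first.
  have n0 : 0 < INR n by apply: lt_0_INR; lia.
  apply: Rdiv_lt_0_compat => //; rewrite sq2; exact: sqrt_lt_R0.
by rewrite Rmult_1_r.
Qed.

(** Part (3) compares with Q_n (-1) itself, so a lower bound with some positive constant suffices.
    At z = xi = -1 the two blocks have y = 1 and y = -1, and the polar part is (basel - basel/2)/(2
    w) = basel/(4 w). *)
Lemma Q_m1_lower : exists k0 N, 0 < k0 /\ forall n, (N <= n)%N -> 0 < sq n /\
  k0 * exp (2 * sqrt (basel / 4) * (sq n * sq n)) / (sq n * sq n * sq n) <= Cmod (Q n (RtoC (-1))).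
Proof.
have [bl bu] := basel_bounds; have pb := PI_bounds.
pose l := sqrt (basel / 4); have l0 : 0 < l by apply: sqrt_lt_R0; lra.
have l2 : l * l = basel / 4 by apply: sqrt_sqrt; lra.
pose r := sqrt l; have r0 : 0 < r by exact: sqrt_lt_R0.
have rr : r * r = l by apply: sqrt_sqrt; lra.
have m1 : Cmod (RtoC (-1)) = 1 by rewrite Cmod_R Rabs_left; lra.
have zle : Cmod (RtoC (-1)) <= 1 by lra.
have m2 : (RtoC (-1) * RtoC (-1) = 1)%C by rewrite -RtoC_mult; congr RtoC; ring.
have m1n : RtoC (-1) <> 1%C by case; lra.
have cE : (RtoC r * RtoC r)%C = (l, 0) by rewrite -RtoC_mult rr.
pose f w := (psum 1 (/ 2) (RtoC 2 * w) + psum (RtoC (-1)) 1 (RtoC 2 * w))%C.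
have hel w : 0 < Re w -> elog (RtoC (-1)) (RtoC (-1) * Cexp (- w)) = (((l, 0) : C) * ((l, 0) : C) / w + f w)%C.
  move=> w0; have wn := Re_pos_neq0 w0.
  rewrite (@elog_unity (RtoC (-1)) (RtoC (-1)) w 1 zle m1 (Cpow_m1 2) w0).
  have e1 : (RtoC (-1) * Cpow (RtoC (-1)) 1 = 1)%C by rewrite Cpow_1_r.
  have e2 : (RtoC (-1) * Cpow (RtoC (-1)) 2 = RtoC (-1))%C by rewrite Cpow_m1 Cmult_1_r.
  rewrite sum_Sn sum_O e1 e2; have -> : INR 2 = 2 by rewrite /INR; lra.
  have -> : INR 1 / 2 = / 2 by rewrite /INR; field.
  have -> : 2 / 2 = 1 by field.
  rewrite /f -[LHS]/(Cplus _ _) Li2_m1_basel.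
  have -> : (((l, 0) : C) * ((l, 0) : C))%C = RtoC (basel / 4) by rewrite -l2 RtoC_mult.
  move: (psum _ _ _) (psum _ _ _) => p1 p2.
  have n2 : RtoC 2 <> 0%C by apply: RtoC_neq0; lra.
  have e3 : RtoC (- (basel / 2)) = (- (RtoC basel / 2))%C by rewrite RtoC_opp RtoC_div //; lra.
  have e4 : RtoC (basel / 4) = (RtoC basel / (2 * 2))%C.
    have -> : (2 * 2)%C = RtoC 4 by rewrite -RtoC_mult; congr RtoC; ring.
    by rewrite RtoC_div //; lra.
  move: e3 e4 (RtoC_Re Li2_1_real); generalize basel => P e3 e4 <-.
  by rewrite e3 e4; field; intuition.
have ht : tame (0 / l) f 0 (RtoC (psum1_const (/ 2) 2) + RtoC (/ 2 - 1) * log1m (RtoC (-1)))%C.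
  have -> : 0 / l = 0 by rewrite /Rdiv Rmult_0_l.
  have h1 := @tame_psum1 (/ 2) 2 ltac:(lra) ltac:(lra); rewrite Rminus_diag in h1.
  have h2 := @tame_psum 0 1 2 (RtoC (-1)) m1 m1n ltac:(lra) ltac:(lra).
  by have := tame_plus h1 h2; rewrite Rplus_0_r.
set c := (_ + _)%C in ht.
have hr v : - PI <= v <= PI -> v <> 0 -> growth (CSeries (resonant (RtoC (-1)) (RtoC (-1) * unit_c (- v)))) <= basel / 9.
  move=> hv v0; apply: growth_resonant_m1 => e.
  have u1 : unit_c (- v) = 1%C.
    by have : (RtoC (-1) * (RtoC (-1) * unit_c (- v)) = 1)%C by [rewrite e]; rewrite Cmult_assoc m2 Cmult_1_l.
  case: (Rle_lt_dec 0 v) => h; last by apply: (@unit_c_neq1 (- v)) u1; lra.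
  by have := @unit_c_inj 0 (- v) ltac:(lra); rewrite unit_c_0 u1.
have k1 : Rabs 0 <= 1 by rewrite Rabs_R0; lra.
pose K := (Cexp c * RtoC r / RtoC (2 * sqrt PI))%C.
have sp : 0 < sqrt PI by apply: sqrt_lt_R0; lra.
have K0 : 0 < Cmod K.
  apply/Cmod_gt_0; apply: Cmult_neq0; first by apply: Cmult_neq0; [exact: Cexp_neq0|apply: RtoC_neq0; lra].
  by apply: Cinv_neq0; apply: RtoC_neq0; lra.
have LL : basel / 9 < l * l by rewrite l2; lra.
have rp : 0 < Re (RtoC r) by [].
have [N hN] := Q_asymp_full zle m1 l0 k1 (ltac:(lra) : 0 <= basel / 9) LL rp cE hel ht hr (ltac:(lra) : 0 < Cmod K / 2).
exists (Cmod K / 2), N.+1; split; first lra.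
move=> n Nn; have s0 : 0 < sq n by apply: sqrt_lt_R0; apply: sqrt_lt_R0; apply: lt_0_INR; lia.
split=> //; have := hN n ltac:(lia); rewrite Ropp_0 Rpower_O; last by apply: Rdiv_lt_0_compat => //; exact: Rmult_lt_0_compat.
rewrite Rmult_1_r -/K; set T := (_ * _)%C => h.
have eT : Cmod T = Cmod (Q n (RtoC (-1))) * (exp (- (2 * l * (sq n * sq n))) * (sq n * sq n * sq n)).
  rewrite /T !Cmod_mult Cmod_Cexp Cmod_pow m1 pow1 Rmult_1_l Cmod_pos; last by left; do! apply: Rmult_lt_0_compat.
  by congr (_ * (exp _ * _)); rewrite /=; ring.
have hK : Cmod K / 2 <= Cmod T.
  have : Cmod K <= Cmod T + Cmod (T - K)%C.
    have {1}-> : K = (T - (T - K))%C by ring.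
    exact: Cmod_minus_le.
  lra.
rewrite eT in hK.
have s3 : 0 < sq n * sq n * sq n by do! apply: Rmult_lt_0_compat.
apply/Rle_div_l => //.
have e5 : exp (2 * l * (sq n * sq n)) * exp (- (2 * l * (sq n * sq n))) = 1 by rewrite -exp_plus Rplus_opp_r exp_0.
have ep := exp_pos (2 * l * (sq n * sq n)).
move: (Rmult_le_compat_r _ _ _ (Rlt_le _ _ ep) hK); rewrite -/l.
have -> : Cmod (Q n (RtoC (-1))) * (exp (- (2 * l * (sq n * sq n))) * (sq n * sq n * sq n)) * exp (2 * l * (sq n * sq n)) =
  Cmod (Q n (RtoC (-1))) * (sq n * sq n * sq n) * (exp (2 * l * (sq n * sq n)) * exp (- (2 * l * (sq n * sq n)))) by ring.
by rewrite e5 Rmult_1_r.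
Qed.

(** * The asymptotics of Q_n at the cube root of unity *)

Section CubicRoot.

Let W : C := zeta 3.
Let l : R := sqrt basel / 3.

Lemma zeta3_facts : [/\ Cmod W = 1, Cpow W 3 = 1%C, W <> 1%C, Cpow W 2 <> 1%C & Cmod (Cpow W 2) = 1].
Proof.
have pb := PI_bounds; have i3 : INR 3 = 3 by rewrite /INR; lra.
have i2 : INR 2 = 2 by rewrite /INR; lra.
split; [exact: Cmod_zeta|exact: zeta_pow_b| | |by rewrite zeta_pow Cmod_unit_c].
  by rewrite /W zetaE i3; apply: unit_c_neq1; lra.
by rewrite /W zeta_pow i3 i2; apply: unit_c_neq1; lra.
Qed.

Lemma Li2_cubic_sum (w : C) : w <> 0%C ->
  (Li2 1 / (RtoC 3 * w) + Li2 (Cpow W 2) / (RtoC 3 * w) + Li2 W / (RtoC 3 * w))%C = (((l, 0) : C) * ((l, 0) : C) / w)%C.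
Proof.
move=> w0; have [bl _] := basel_bounds.
have -> : (((l, 0) : C) * ((l, 0) : C))%C = (RtoC basel / (3 * 3))%C.
  have -> : (3 * 3)%C = RtoC 9 by rewrite -RtoC_mult; congr RtoC; ring.
  rewrite -RtoC_div; last lra.
  rewrite -[((l, 0) : C)]/(RtoC l) -RtoC_mult; congr RtoC; rewrite /l.
  have e := sqrt_sqrt basel ltac:(lra).
  by rewrite -{3}e; field.
have X := @LX_zeta 3 isT; have i3 : INR 3 = 3 by rewrite /INR; lra.
rewrite i3 -/W in X.
have -> : Cpow W 2 = Cconj W by rewrite /W (@zeta_conj 3 1) // Cpow_1_r.
have n3 : RtoC 3 <> 0%C by apply: RtoC_neq0; lra.
have s : (Li2 (Cconj W) + Li2 W)%C = (- (2 * RtoC basel / 3))%C.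
  rewrite Li2_conj -RtoC_mult -RtoC_div; last lra.
  rewrite -RtoC_opp; move: X; generalize basel => P; case: (Li2 W) => a b; rewrite /Re /= => X.
  by apply: C_ext; rewrite /= ?X; field.
have -> : (Li2 1 / (RtoC 3 * w) + Li2 (Cconj W) / (RtoC 3 * w) + Li2 W / (RtoC 3 * w) =
  (Li2 1 + (Li2 (Cconj W) + Li2 W)) / (RtoC 3 * w))%C by rewrite /Cdiv; ring.
rewrite s; move: (RtoC_Re Li2_1_real); generalize basel => P <-.
by field; intuition.
Qed.

(** The block with y = 1 occurs with shift 1/3 and produces the power (Re w)^(1/3 - 1/2) = (Re
    w)^(-1/6). *)
Lemma elog_zeta3_main (w : C) : 0 < Re w -> elog W (Cpow W 2 * Cexp (- w)) =
  (((l, 0) : C) * ((l, 0) : C) / w +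
   (psum 1 (/ 3) (RtoC 3 * w) + psum (Cpow W 2) (2 / 3) (RtoC 3 * w) + psum W 1 (RtoC 3 * w)))%C.
Proof.
have [W1 W3 Wn W2n W21] := zeta3_facts; have i3 : INR 3 = 3 by rewrite /INR; lra.
have i2 : INR 2 = 2 by rewrite /INR; lra.
move=> w0; have wn := Re_pos_neq0 w0.
have x3 : Cpow (Cpow W 2) 3 = 1%C by rewrite -Cpow_mul (Cpow_mul W 3 2) W3 Cpow_1_l.
rewrite (@elog_unity W (Cpow W 2) w 2 (or_intror W1) W21 x3 w0) !sum_Sn sum_O i3 i2.
have e1 : (W * Cpow (Cpow W 2) 1 = 1)%C by rewrite Cpow_1_r -W3.
have e2 : (W * Cpow (Cpow W 2) 2 = Cpow W 2)%C.
  by rewrite -Cpow_mul -[(W * _)%C]/(Cpow W (3 + 2)) Cpow_add_r W3 Cmult_1_l.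
rewrite e1 e2 x3 Cmult_1_r -Li2_cubic_sum //.
have -> : INR 1 / 3 = / 3 by rewrite /INR; field.
have -> : 3 / 3 = 1 by field.
by ringC.
Qed.

(** The polar part is the same, but the block with y = 1 now has shift 2/3 and produces (Re
    w)^(1/6), smaller by the factor (Re w)^(1/3). *)
Lemma elog_zeta3_secondary (w : C) : 0 < Re w -> elog W (W * Cexp (- w)) =
  (((l, 0) : C) * ((l, 0) : C) / w +
   (psum 1 (2 / 3) (RtoC 3 * w) + psum (Cpow W 2) (/ 3) (RtoC 3 * w) + psum W 1 (RtoC 3 * w)))%C.
Proof.
have [W1 W3 Wn W2n W21] := zeta3_facts; have i3 : INR 3 = 3 by rewrite /INR; lra.
have i2 : INR 2 = 2 by rewrite /INR; lra.
move=> w0; have wn := Re_pos_neq0 w0.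
rewrite (@elog_unity W W w 2 (or_intror W1) W1 W3 w0) !sum_Sn sum_O i3 i2.
have e1 : (W * Cpow W 1 = Cpow W 2)%C by [].
have e2 : (W * Cpow W 2 = 1)%C by rewrite -W3.
rewrite e1 e2 W3 Cmult_1_r -Li2_cubic_sum //.
have -> : INR 1 / 3 = / 3 by rewrite /INR; field.
have -> : 3 / 3 = 1 by field.
by ringC.
Qed.

Lemma zeta3_unit (v : R) :
  (Cpow W 2 * unit_c (- v))%C = unit_c (4 * PI / 3 - v) /\ (W * unit_c (- v))%C = unit_c (2 * PI / 3 - v) /\
  Cpow W 2 = unit_c (4 * PI / 3) /\ W = unit_c (2 * PI / 3).
Proof.
have i3 : INR 3 = 3 by rewrite /INR; lra.
have i2 : INR 2 = 2 by rewrite /INR; lra.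
have e1 : W = unit_c (2 * PI / 3) by rewrite /W zetaE i3.
have e2 : Cpow W 2 = unit_c (4 * PI / 3) by rewrite e1 unit_c_pow i2; congr unit_c; field.
rewrite {1}e2 {1}e1 -!unit_c_plus; split=> //; split=> //.
Qed.

(** The circle based at W^2 is cut at v = pi/3. The arc [-pi, pi/3] has W^2 as its only dominant
    point; the rest, recentred at W by the shift 2 pi/3, is [-pi/3, pi/3]. *)
Lemma zeta3_arc_growth : exists L, [/\ 0 <= L, L < l * l,
  forall v, - PI <= v <= PI / 3 -> v <> 0 -> growth (CSeries (resonant W (Cpow W 2 * Cexp (- ((0, v) : C))))) <= L &
  forall v, - (PI / 3) <= v <= PI / 3 -> v <> 0 -> growth (CSeries (resonant W (W * Cexp (- ((0, v) : C))))) <= L].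
Proof.
have [bl _] := basel_bounds; have pb := PI_bounds; have g3 := growth_zeta3.
pose L := Rmax (growth (Li2 (zeta 3))) (basel / 16).
have L1 : growth (Li2 (zeta 3)) <= L by exact: Rmax_l.
have L2 : basel / 16 <= L by exact: Rmax_r.
have ll : l * l = basel / 9.
  by rewrite /l; have e := sqrt_sqrt basel ltac:(lra); rewrite -[in RHS]e; field.
exists L; split; first lra.
- by rewrite ll; apply: Rmax_lub_lt; lra.
- move=> v hv v0; rewrite Cexp_vert; have [-> [_ [e2 e1]]] := zeta3_unit v.
  apply: growth_resonant_zeta3 => //; rewrite -/W ?e2 ?e1.
    by apply: unit_c_inj; lra.
  case: (Rdichotomy _ _ v0) => h; first by apply: unit_c_inj; lra.
  by apply: not_eq_sym; apply: unit_c_inj; lra.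
move=> v hv v0; rewrite Cexp_vert; have [_ [-> [e2 e1]]] := zeta3_unit v.
apply: growth_resonant_zeta3 => //; rewrite -/W ?e2 ?e1.
  case: (Rdichotomy _ _ v0) => h; first by apply: unit_c_inj; lra.
  by apply: not_eq_sym; apply: unit_c_inj; lra.
by apply: not_eq_sym; apply: unit_c_inj; lra.
Qed.

Lemma Rpower_third_small (e : R) : 0 < e -> exists S, 1 <= S /\ forall s, S <= s ->
  Rpower (l / (s * s)) (/ 3) <= e.
Proof.
move=> e0; have [bl _] := basel_bounds.
have l0 : 0 < l by apply: Rdiv_lt_0_compat; [apply: sqrt_lt_R0; lra|lra].
have e3 : 0 < e * e * e by do! apply: Rmult_lt_0_compat.
exists (Rmax 1 (l / (e * e * e))); split; first exact: Rmax_l.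
move=> s hs; have s1 : 1 <= s by apply: Rle_trans (Rmax_l _ _) hs.
have s2 : l / (e * e * e) <= s by apply: Rle_trans (Rmax_r _ _) hs.
have -> : e = Rpower (e * e * e) (/ 3).
  rewrite /Rpower !ln_mult //; last exact: Rmult_lt_0_compat.
  have -> : / 3 * (ln e + ln e + ln e) = ln e by field.
  by rewrite exp_ln.
apply: Rle_Rpower_l; first lra.
split; first by apply: Rdiv_lt_0_compat => //; nra.
apply/Rle_div_l; first nra.
have h : l <= s * (e * e * e) by apply/(Rle_div_l l s _ e3).
have : s * (e * e * e) <= s * s * (e * e * e) by apply: Rmult_le_compat_r; nra.
lra.
Qed.

Definition zeta3_const : C :=
  (RtoC (psum1_const (/ 3) 3) + RtoC (/ 2 - 2 / 3) * log1m (Cpow W 2) + RtoC (/ 2 - 1) * log1m W)%C.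

(** Both arcs are evaluated by the saddle point on the same line Re w = l/s^2. The second one, which
    is bounded after its own normalisation, is multiplied by x^(1/3) under that of the first, and
    disappears. *)
Lemma Q_zeta3_asymp (e : R) : 0 < e -> exists N, forall n, (N <= n)%N ->
  Cmod (Cpow (Cpow W 2) n * Q n W *
    RtoC (exp (- (2 * l * (sq n * sq n))) * (sq n * sq n * sq n * Rpower (l / (sq n * sq n)) (/ 6)))
    - Cexp zeta3_const * RtoC (sqrt l) / RtoC (2 * sqrt PI))%C <= e.
Proof.
move=> e0; have [W1 W3 Wn W2n W21] := zeta3_facts; have pb := PI_bounds; have [bl _] := basel_bounds.
have l0 : 0 < l by apply: Rdiv_lt_0_compat; [apply: sqrt_lt_R0; lra|lra].
have [L [L0 LL g1 g2]] := zeta3_arc_growth.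
have cE : (RtoC (sqrt l) * RtoC (sqrt l))%C = (l, 0) by rewrite -RtoC_mult sqrt_sqrt //; lra.
have c0 : 0 < Re (RtoC (sqrt l)) by exact: sqrt_lt_R0.
have z00 : 0 / l = 0 by rewrite /Rdiv Rmult_0_l.
have t1 : tame (0 / l) (fun w => psum 1 (/ 3) (RtoC 3 * w) + psum (Cpow W 2) (2 / 3) (RtoC 3 * w) + psum W 1 (RtoC 3 * w))%C
    (- / 6) zeta3_const.
  rewrite z00; have -> : - / 6 = (/ 3 - / 2) + 0 + 0 by field.
  apply: tame_plus; last by apply: tame_psum => //; lra.
  by apply: tame_plus; [apply: tame_psum1; lra|apply: tame_psum => //; lra].
have t2 : tame (0 / l) (fun w => psum 1 (2 / 3) (RtoC 3 * w) + psum (Cpow W 2) (/ 3) (RtoC 3 * w) + psum W 1 (RtoC 3 * w))%C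
    (/ 6) (RtoC (psum1_const (2 / 3) 3) + RtoC (/ 2 - / 3) * log1m (Cpow W 2) + RtoC (/ 2 - 1) * log1m W)%C.
  rewrite z00; have -> : / 6 = (2 / 3 - / 2) + 0 + 0 by field.
  apply: tame_plus; last by apply: tame_psum => //; lra.
  by apply: tame_plus; [apply: tame_psum1; lra|apply: tame_psum => //; lra].
set c2 := (_ + RtoC (/ 2 - 1) * log1m W)%C in t2.
have k1 : Rabs (- / 6) <= 1 by rewrite Rabs_Ropp Rabs_pos_eq; lra.
have k2 : Rabs (/ 6) <= 1 by rewrite Rabs_pos_eq; lra.
have wle : Cmod W <= 1 by lra.
have [S1 [S11 hS1]] := circle_saddle wle W21 (ltac:(lra) : - PI < 0) (ltac:(lra) : 0 < PI / 3) l0 k1 L0 LL c0 cE elog_zeta3_main t1 g1 (ltac:(lra) : 0 < e / 2).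
have [S2 [S21 hS2]] := circle_saddle wle W1 (ltac:(lra) : - (PI / 3) < 0) (ltac:(lra) : 0 < PI / 3) l0 k2 L0 LL c0 cE elog_zeta3_secondary t2 g2 Rlt_0_1.
pose B := Cmod (Cexp c2 * RtoC (sqrt PI) * RtoC (sqrt l))%C + 1.
have B0 : 0 < B by rewrite /B; have := Cmod_ge_0 (Cexp c2 * RtoC (sqrt PI) * RtoC (sqrt l))%C; lra.
have [S3 [S31 hS3]] := @Rpower_third_small (e / 2 / B) ltac:(apply: Rdiv_lt_0_compat; lra).
have [N hN] := sq_large (Rmax (Rmax S1 S2) S3); exists N => n Nn.
have hs := hN n Nn.
have s1 : S1 <= sq n by apply: Rle_trans (Rmax_l _ _) (Rle_trans _ _ _ (Rmax_l _ _) hs).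
have s2 : S2 <= sq n by apply: Rle_trans (Rmax_r _ _) (Rle_trans _ _ _ (Rmax_l _ _) hs).
have s3 : S3 <= sq n by apply: Rle_trans (Rmax_r _ _) hs.
have sp : 1 <= sq n by lra.
pose x := l / (sq n * sq n).
have x0 : 0 < x by apply: Rdiv_lt_0_compat => //; nra.
have hI := @coef_integral W wle (Cpow W 2) x n W21 x0.
set F := (fun v : R => _) in hI.
have exF : ex_RInt F (- PI) PI by eexists; exact: hI.
have ex1 : ex_RInt F (- PI) (PI / 3) by apply: (is_RIntC_sub _ _ _ exF); lra.
have ex2 : ex_RInt F (PI / 3) PI by apply: (is_RIntC_sub _ _ _ exF); lra.
have hJ1 : is_RIntC F (- PI) (PI / 3) (RIntC F (- PI) (PI / 3)) by exact: (@RInt_correct C_R_CompleteNormedModule).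
have hJ2 : is_RIntC F (PI / 3) PI (RIntC F (PI / 3) PI) by exact: (@RInt_correct C_R_CompleteNormedModule).
set J1 := RIntC F (- PI) _ in hJ1; set J2 := RIntC F _ PI in hJ2.
have eJ : (RtoC (2 * PI) * (Cpow (Cpow W 2) n * Q n W))%C = (J1 + J2)%C.
  rewrite -(RIntC_unique hI).
  exact: (RIntC_unique (@is_RInt_Chasles C_R_NormedModule F _ _ _ _ _ hJ1 hJ2)).
(* The unimodular factor by which the shift of v by 2 pi/3 multiplies e^(n w). *)
pose rot := Cexp (RtoC (INR n) * ((0, (2 * PI / 3)%R) : C))%C.
have rot1 : Cmod rot = 1 by rewrite Cmod_Cexp -[RHS]exp_0; congr exp; rewrite /=; ring.
have hJ2' : is_RIntC (fun v => Cexp (elog W (W * Cexp (- ((x, v) : C)))) * Cexp (RtoC (INR n) * ((x, v) : C)))%C (- (PI / 3)) (PI / 3) (J2 / rot)%C.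
  have hl : is_RIntC F (1 * - (PI / 3) + 2 * PI / 3) (1 * (PI / 3) + 2 * PI / 3) J2.
    have -> : 1 * - (PI / 3) + 2 * PI / 3 = PI / 3 by field.
    by have -> : 1 * (PI / 3) + 2 * PI / 3 = PI by field.
  have h := @is_RInt_comp_lin C_R_NormedModule F 1 (2 * PI / 3) _ _ _ hl.
  have h2 := @is_RIntC_Cmult _ _ _ (/ rot)%C _ h.
  have -> : (J2 / rot = / rot * J2)%C by rewrite /Cdiv; ring.
  apply: (@is_RInt_ext C_R_NormedModule) h2 => v _.
  rewrite scal_one /F Rmult_1_l.
  have rn : rot <> 0%C by exact: Cexp_neq0.
  have -> : Cexp (RtoC (INR n) * ((x, (v + 2 * PI / 3)%R) : C))%C = (Cexp (RtoC (INR n) * ((x, v) : C)) * rot)%C.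
    by rewrite /rot -Cexp_plus; congr Cexp; apply: C_ext; rewrite /=; ring.
  have -> : (Cpow W 2 * Cexp (- ((x, (v + 2 * PI / 3)%R) : C)) = W * Cexp (- ((x, v) : C)))%C.
    have -> : (- ((x, (v + 2 * PI / 3)%R) : C) = - ((0, (2 * PI / 3)%R) : C) + - ((x, v) : C))%C by apply: C_ext; rewrite /=; ring.
    rewrite Cexp_plus Cexp_vert Cmult_assoc; congr Cmult.
    have [-> [_ [_ ->]]] := zeta3_unit (2 * PI / 3); congr unit_c; field.
  by fieldC; exact: rn.
rewrite /F -sq4 in hJ1; rewrite -sq4 in hJ2'.
have h1 := hS1 (sq n) _ s1 hJ1; have h2 := hS2 (sq n) _ s2 hJ2'.
have eE : Cexp (- (RtoC 2 * ((l, 0) : C) * RtoC (sq n * sq n)))%C = RtoC (exp (- (2 * l * (sq n * sq n)))).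
  by rewrite -Cexp_real; congr Cexp; apply: C_ext; rewrite /=; ring.
rewrite eE -/x Ropp_involutive in h1; rewrite eE -/x in h2.
set E := exp _ in h1 h2 *; have E0 : 0 < E by exact: exp_pos.
have q0 : 0 < sq n * sq n * sq n by nra.
set q := sq n * sq n * sq n in h1 h2 q0 *.
have r1 : 0 < Rpower x (/ 6) by exact: exp_pos.
have r2 : 0 < Rpower x (- / 6) by exact: exp_pos.
have r3 := hS3 (sq n) s3; rewrite -/x in r3.
have er : Rpower x (/ 6) = Rpower x (- / 6) * Rpower x (/ 3) by rewrite -Rpower_plus; congr Rpower; field.
have b2 : Cmod (J2 * RtoC (E * (q * Rpower x (/ 6))))%C <= e / 2.
  have b3 : Cmod (J2 / rot * (RtoC E * RtoC (q * Rpower x (- / 6))))%C <= B.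
    set T := (_ / rot * _)%C in h2 *; rewrite /B.
    set G := (Cexp c2 * _ * _)%C in h2 *.
    have -> : T = (T - G + G)%C by ring.
    by apply: Rle_trans (Cmod_triangle _ _) _; lra.
  have b4 : Cmod (J2 * RtoC (E * (q * Rpower x (/ 6))))%C = Cmod (J2 / rot * (RtoC E * RtoC (q * Rpower x (- / 6))))%C * Rpower x (/ 3).
    have rn : rot <> 0%C by exact: Cexp_neq0.
    have ri : Cmod (/ rot)%C = 1 by rewrite Cmod_inv ?rot1 ?Rinv_1.
    have p1 : 0 <= E * (q * (Rpower x (- / 6) * Rpower x (/ 3))) by left; do! apply: Rmult_lt_0_compat => //; exact: exp_pos.
    have p2 : 0 <= q * Rpower x (- / 6) by left; exact: Rmult_lt_0_compat.
    rewrite er !Cmod_mult ri !Cmod_pos //; [ring|lra].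

  rewrite b4; apply: (Rle_trans _ (B * (e / 2 / B))); last by right; field; lra.
  by apply: Rmult_le_compat => //; [exact: Cmod_ge_0|left; exact: exp_pos].
have sP : 0 < sqrt PI by apply: sqrt_lt_R0; lra.
have p2 := sqrt_sqrt PI ltac:(lra).
have spn := RtoC_neq0 (ltac:(lra) : sqrt PI <> 0).
have e2 : RtoC (2 * PI) = (2 * RtoC (sqrt PI) * RtoC (sqrt PI))%C by rewrite -!RtoC_mult Rmult_assoc p2.
have n2 : RtoC 2 <> 0%C by apply: RtoC_neq0; lra.
set A := RtoC (E * (q * Rpower x (/ 6))) in b2 *.
have eA : (RtoC E * RtoC (q * Rpower x (/ 6)))%C = A by rewrite -RtoC_mult.
rewrite eA in h1.
set qq := (Cpow (Cpow W 2) n * Q n W)%C in eJ *.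
have -> : (qq * A - Cexp zeta3_const * RtoC (sqrt l) / RtoC (2 * sqrt PI) =
  ((J1 * A - Cexp zeta3_const * RtoC (sqrt PI) * RtoC (sqrt l)) + J2 * A) * / RtoC (2 * PI))%C.
  have -> : (J1 * A - Cexp zeta3_const * RtoC (sqrt PI) * RtoC (sqrt l) + J2 * A = (J1 + J2) * A - Cexp zeta3_const * RtoC (sqrt PI) * RtoC (sqrt l))%C by ring.
  by rewrite -eJ e2 RtoC_mult; field; intuition.
rewrite Cmod_mult -RtoC_invE Cmod_pos; last by left; apply: Rinv_0_lt_compat; lra.
apply: (Rle_trans _ (e * 1)); last lra.
apply: Rmult_le_compat; [exact: Cmod_ge_0|by left; apply: Rinv_0_lt_compat; lra| |].
  by apply: Rle_trans (Cmod_triangle _ _) _; lra.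
by rewrite -[X in _ <= X]Rinv_1; apply: Rinv_le_contravar; lra.
Qed.

End CubicRoot.

(** * The four cases *)

Lemma sum_n_close (T M : nat -> nat -> C) (m : nat) :
  (forall j, (j <= m)%N -> forall e, 0 < e -> exists N, forall n, (N <= n)%N -> Cmod (T j n - M j n)%C <= e) ->
  forall e, 0 < e -> exists N, forall n, (N <= n)%N ->
    Cmod (sum_n (G := C_R_NormedModule) (fun j => T j n) m - sum_n (G := C_R_NormedModule) (fun j => M j n) m)%C <= e.
Proof.
elim: m => [|m IH] h e e0.
  by have [N hN] := h 0%N isT e e0; exists N => n Nn; rewrite !sum_O; exact: hN.
have [N1 h1] := IH (fun j jm => h j (leqW jm)) (e / 2) ltac:(lra).
have [N2 h2] := h m.+1 (leqnn _) (e / 2) ltac:(lra).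
exists (maxn N1 N2) => n; rewrite geq_max => /andP[n1 n2]; rewrite !sum_Sn.
have := h1 n n1; have := h2 n n2.
set a := sum_n _ _; set b := sum_n _ _ => h3 h4.
have -> : (plus a (T m.+1 n) - plus b (M m.+1 n) = (a - b) + (T m.+1 n - M m.+1 n))%C by ringC.
by apply: Rle_trans (Cmod_triangle _ _) _; lra.
Qed.

Lemma inv_zeta_pow (b a : nat) : (/ Cpow (zeta b) a)%C = Cconj (Cpow (zeta b) a).
Proof.
rewrite zeta_pow Cconj_unit_c; set t := _ / _.
have e : (unit_c t * unit_c (- t) = 1)%C by rewrite -unit_c_plus Rplus_opp_r unit_c_0.
have n0 : unit_c t <> 0%C by apply: Cmod_neq0; rewrite Cmod_unit_c; lra.
have -> : unit_c (- t) = (unit_c t * unit_c (- t) / unit_c t)%C by field.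
by rewrite e; field.
Qed.

(** The coefficient of Q_n (zeta_b^j) in b (p(a1,b,n) - p(a2,b,n)); it vanishes for j = 0. *)
Definition delta (b a1 a2 j : nat) : C :=
  (Cpow (/ Cpow (zeta b) a1) j - Cpow (/ Cpow (zeta b) a2) j)%C.

Lemma Cpow_inv_zeta (b a j : nat) : Cpow (/ Cpow (zeta b) a) j = Cconj (Cpow (Cpow (zeta b) j) a).
Proof. by rewrite inv_zeta_pow Cpow_conj' -!Cpow_mul mulnC. Qed.

Lemma Cmod_delta_le (b a1 a2 j : nat) : Cmod (delta b a1 a2 j) <= 2.
Proof.
rewrite /delta !Cpow_inv_zeta; apply: Rle_trans (Cmod_minus_le _ _) _.
by rewrite !Cmod_conj -!Cpow_mul !zeta_pow !Cmod_unit_c; lra.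
Qed.

Lemma delta_conj (b a1 a2 : nat) : (0 < b)%N -> delta b a1 a2 (b - 1) = Cconj (delta b a1 a2 1).
Proof.
move=> b0; rewrite /delta !Cpow_inv_zeta zeta_conj // Cminus_conj !Cpow_conj'.
by rewrite Cpow_1_r.
Qed.

Lemma p_diff (b a1 a2 n : nat) : (0 < b)%N -> RtoC (INR b * (INR (p a1 b n) - INR (p a2 b n))) =
  sum_n (G := C_R_NormedModule) (fun j => delta b a1 a2 j * Q n (Cpow (zeta b) j))%C (b - 1).
Proof.
move=> b0; rewrite Rmult_minus_distr_l RtoC_minus !p_zeta //.
elim: (b - 1)%N => [|m IH]; first by rewrite !sum_O /delta; ringC.
by rewrite !sum_Sn -IH /delta; ringC.
Qed.

Lemma delta1_neq0 (b a1 a2 : nat) : (a1 < a2)%N -> (a2 < b)%N -> delta b a1 a2 1 <> 0%C.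
Proof.
move=> h1 h2; rewrite /delta !Cpow_1_r !inv_zeta_pow -Cminus_conj => h.
have e : Cpow (zeta b) a1 = Cpow (zeta b) a2.
  have : (Cpow (zeta b) a1 - Cpow (zeta b) a2)%C = 0%C.
    by apply: Cmod_eq_0; rewrite -Cmod_conj h Cmod_0.
  move=> h0; have -> : Cpow (zeta b) a1 = (Cpow (zeta b) a1 - Cpow (zeta b) a2 + Cpow (zeta b) a2)%C by ring.
  by rewrite h0; ring.
have /eqP : a1 == a2 %[mod b] by apply/zeta_pow_eqP => //; lia.
by rewrite !modn_small //; lia.
Qed.

(** The terms j = 1 and j = b - 1, distinct as b >= 3, are complex conjugate and add up to twice a
    real part. Every other j must either have coefficient 0 or be negligible under the weight
    [w]. *)
Lemma asymp_real (b a1 a2 : nat) (w ph : nat -> R) (K : C) : (3 <= b)%N ->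
  (forall e, 0 < e -> exists N, forall n, (N <= n)%N ->
     Cmod (Q n (zeta b) * RtoC (w n) - K * unit_c (ph n))%C <= e) ->
  (forall j, (2 <= j)%N -> (j + 2 <= b)%N -> delta b a1 a2 j = 0%C \/
     forall e, 0 < e -> exists N, forall n, (N <= n)%N -> Cmod (Q n (Cpow (zeta b) j) * RtoC (w n))%C <= e) ->
  forall e, 0 < e -> exists N, forall n, (N <= n)%N ->
    Rabs (INR b * (INR (p a1 b n) - INR (p a2 b n)) * w n - 2 * Re (delta b a1 a2 1 * K * unit_c (ph n))%C) <= e.
Proof.
move=> b3 h1 h2 e e0.
pose T j n := (delta b a1 a2 j * Q n (Cpow (zeta b) j) * RtoC (w n))%C.
pose m n := (delta b a1 a2 1 * K * unit_c (ph n))%C.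
pose M1 (j n : nat) : C := if j == 1%N then m n else RtoC 0.
pose M2 (j n : nat) : C := if j == (b - 1)%N then Cconj (m n) else RtoC 0.
have T1 e' : 0 < e' -> exists N, forall n, (N <= n)%N -> Cmod (T 1%N n - m n)%C <= e'.
  move=> e'0; have [N hN] := h1 (e' / 2) ltac:(lra); exists N => n Nn.
  have -> : (T 1%N n - m n = delta b a1 a2 1 * (Q n (zeta b) * RtoC (w n) - K * unit_c (ph n)))%C.
    by rewrite /T /m Cpow_1_r; ring.
  rewrite Cmod_mult; apply: (Rle_trans _ (2 * (e' / 2))); last lra.
  apply: Rmult_le_compat; [exact: Cmod_ge_0|exact: Cmod_ge_0|exact: Cmod_delta_le|exact: hN].
have close j : (j <= b - 1)%N -> forall e', 0 < e' -> exists N, forall n, (N <= n)%N -> Cmod (T j n - (M1 j n + M2 j n))%C <= e'.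
  move=> jb e' e'0; have [->|[->|[->|[j2 j3]]]] : j = 0%N \/ j = 1%N \/ j = (b - 1)%N \/ (2 <= j)%N /\ (j + 2 <= b)%N by lia.
  - exists 0%N => n _; rewrite /M1 /M2; have -> : (0%N == (b - 1)%N) = false by lia.
    have -> : (T 0%N n - (0 + 0) = 0)%C by rewrite /T /delta /=; ring.
    by rewrite Cmod_0; lra.
  - have [N hN] := T1 e' e'0; exists N => n Nn; rewrite /M1 /M2 eqxx.
    have -> : (1%N == (b - 1)%N) = false by lia.
    by rewrite Cplus_0_r; exact: hN.
  - have [N hN] := T1 e' e'0; exists N => n Nn; rewrite /M1 /M2 eqxx.
    have -> : ((b - 1)%N == 1%N) = false by lia.
    rewrite Cplus_0_l; have -> : T (b - 1)%N n = Cconj (T 1%N n).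
      rewrite /T delta_conj; last by lia.
      rewrite zeta_conj; [|lia|lia].
      by rewrite Q_conj !Cmult_conj; congr Cmult; apply: C_ext; rewrite /=; ring.
    by rewrite -Cminus_conj Cmod_conj; exact: hN.
  have z n : (T j n - (M1 j n + M2 j n) = T j n)%C.
    rewrite /M1 /M2; have -> : (j == 1%N) = false by lia.
    have -> : (j == (b - 1)%N) = false by lia.
    by ring.
  case: (h2 j j2 j3) => [d0|hs].
    by exists 0%N => n _; rewrite z /T d0 !Cmult_0_l Cmod_0; lra.
  have [N hN] := hs (e' / 2) ltac:(lra); exists N => n Nn; rewrite z /T -Cmult_assoc Cmod_mult.
  apply: (Rle_trans _ (2 * (e' / 2))); last lra.
  by apply: Rmult_le_compat; [exact: Cmod_ge_0|exact: Cmod_ge_0|exact: Cmod_delta_le|exact: hN].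
have [N hN] := sum_n_close (M := fun j n => (M1 j n + M2 j n)%C) close e0.
exists N => n Nn; apply: Rle_trans (hN n Nn).
have -> : sum_n (G := C_R_NormedModule) (fun j => T j n) (b - 1) = RtoC (INR b * (INR (p a1 b n) - INR (p a2 b n)) * w n).
  rewrite RtoC_mult p_diff; last by lia.
  rewrite Cmult_comm Csum_n_mult; apply: sum_n_ext => j; rewrite /T; ringC.
have -> : sum_n (G := C_R_NormedModule) (fun j => (M1 j n + M2 j n)%C) (b - 1) = RtoC (2 * Re (m n)).
  transitivity (sum_n (G := C_R_NormedModule) (fun j => plus (M1 j n) (M2 j n)) (b - 1)); first by apply: sum_n_ext.
  rewrite sum_n_plus.
  have -> : sum_n (G := C_R_NormedModule) (fun j => M1 j n) (b - 1) = m n.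
    have e1 : M1 1%N n = m n by rewrite /M1 eqxx.
    rewrite -e1; apply: (@sum_n_C_single (fun j => M1 j n)); first by lia.
    by move=> k _ /negPf k1; rewrite /M1 k1.
  have -> : sum_n (G := C_R_NormedModule) (fun j => M2 j n) (b - 1) = Cconj (m n).
    have e1 : M2 (b - 1)%N n = Cconj (m n) by rewrite /M2 eqxx.
    rewrite -e1; apply: (@sum_n_C_single (fun j => M2 j n)); first exact: leqnn.
    by move=> k _ /negPf k1; rewrite /M2 k1.
  by rewrite -[LHS]/(Cplus _ _); apply: C_ext; rewrite /Re /Im /=; ring.
by rewrite -RtoC_minus Cmod_R; right.
Qed.

(** Here [X] is the normalisation of the theorem without its amplitude, and the weight [w] is its
    inverse up to the factor [kap]. The amplitude [A] is nonzero because a1 and a2 differ mod b, so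
    dividing by it is harmless. *)
Lemma asymp_lim (b a1 a2 : nat) (w X ph : nat -> R) (K : C) (A al kap : R) : (3 <= b)%N ->
  (a1 < a2)%N -> (a2 < b)%N -> K <> 0%C -> 0 < kap ->
  (exists N, forall n, (N <= n)%N -> 0 < X n /\ w n * X n = kap) ->
  (RtoC A * Cexp (Ci * RtoC al))%C = (2 * (delta b a1 a2 1 * K) / RtoC (INR b * kap))%C ->
  (forall e, 0 < e -> exists N, forall n, (N <= n)%N ->
     Cmod (Q n (zeta b) * RtoC (w n) - K * unit_c (ph n))%C <= e) ->
  (forall j, (2 <= j)%N -> (j + 2 <= b)%N -> delta b a1 a2 j = 0%C \/
     forall e, 0 < e -> exists N, forall n, (N <= n)%N -> Cmod (Q n (Cpow (zeta b) j) * RtoC (w n))%C <= e) ->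
  is_lim_seq (fun n => (INR (p a1 b n) - INR (p a2 b n)) / (A * X n) - cos (al + ph n)) 0.
Proof.
move=> b3 a12 a2b K0 k0 [N0 hX] eA h1 h2.
have d0 := delta1_neq0 a12 a2b; have bp : 0 < INR b by apply: lt_0_INR; lia.
have bk : INR b * kap <> 0 by nra.
have bkn := RtoC_neq0 bk.
have A0 : A <> 0.
  move=> A0; apply: (@Cmult_neq0 (delta b a1 a2 1) K) => //.
  have -> : (delta b a1 a2 1 * K = 2 * (delta b a1 a2 1 * K) / RtoC (INR b * kap) * (RtoC (INR b * kap) / 2))%C.
    by field; intuition; move: H; case; lra.
  by rewrite -eA A0; ring.
have A0' : 0 < Rabs A by exact: Rabs_pos_lt.
have eD : (delta b a1 a2 1 * K = RtoC (A * (INR b * kap) / 2) * unit_c al)%C.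
  have -> : unit_c al = Cexp (Ci * RtoC al) by rewrite unit_cE Cmult_comm.
  have -> : (RtoC (A * (INR b * kap) / 2) * Cexp (Ci * RtoC al) = RtoC A * Cexp (Ci * RtoC al) * (RtoC (INR b * kap) / 2))%C.
    by rewrite /Rdiv !RtoC_mult RtoC_invE /Cdiv; ring.
  by rewrite eA; field; intuition; move: H; case; lra.
apply/is_lim_seq_spec => -[e e0] /=.
have e1 : 0 < e * (Rabs A * (INR b * kap)) / 2.
  by apply: Rdiv_lt_0_compat; [do! apply: Rmult_lt_0_compat => //|lra].
have [N hN] := asymp_real b3 h1 h2 e1.
exists (maxn N0 N) => n hn.
have [X0 wX] := hX n ltac:(lia); have := hN n ltac:(lia).
have -> : Re (delta b a1 a2 1 * K * unit_c (ph n))%C = A * (INR b * kap) / 2 * cos (al + ph n).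
  by rewrite eD -Cmult_assoc -unit_c_plus Cmult_comm Re_mult_RtoC /=; ring.
set D := INR (p a1 b n) - _ => h.
have -> : D / (A * X n) - cos (al + ph n) - 0 = (INR b * D * w n - 2 * (A * (INR b * kap) / 2 * cos (al + ph n))) / (A * (INR b * kap)).
  by rewrite -wX; field; repeat split; try lra; move=> w0; rewrite w0 in wX; lra.
rewrite Rabs_div; last by apply: Rmult_integral_contrapositive.
rewrite Rabs_mult (Rabs_pos_eq (INR b * kap)); last by nra.
have q0 : 0 < Rabs A * (INR b * kap) by do! apply: Rmult_lt_0_compat.
apply/Rlt_div_l => //; nra.
Qed.

Lemma sq_exp_decay (d e : R) : 0 < d -> 0 < e ->
  exists N, forall n, (N <= n)%N -> sq n * sq n * sq n * exp (- (2 * d * (sq n * sq n))) <= e.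
Proof.
move=> d0 e0; have de : 0 < d * d * e by do! apply: Rmult_lt_0_compat.
have [N hN] := sq_large (Rmax 1 (/ (d * d * e))); exists N => n Nn.
have s1 : 1 <= sq n by apply: Rle_trans (Rmax_l _ _) (hN n Nn).
have s2 : / (d * d * e) <= sq n by apply: Rle_trans (Rmax_r _ _) (hN n Nn).
set s := sq n in s1 s2 *.
have ss : 1 <= s * s by nra.
have ds : 0 < d * (s * s) by apply: Rmult_lt_0_compat; lra.
have h : d * (s * s) * (d * (s * s)) <= exp (2 * d * (s * s)).
  have -> : 2 * d * (s * s) = d * (s * s) + d * (s * s) by ring.
  rewrite exp_plus; have h2 := exp_ineq1_le (d * (s * s)).
  by apply: Rmult_le_compat; lra.
have h3 : 1 <= s * (d * d * e).
  have -> : 1 = / (d * d * e) * (d * d * e) by field; lra.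
  by apply: Rmult_le_compat_r; lra.
rewrite exp_Ropp; apply/Rle_div_l; first exact: exp_pos.
apply: Rle_trans (Rmult_le_compat_l e _ _ (Rlt_le _ _ e0) h).
have -> : e * (d * (s * s) * (d * (s * s))) = s * s * s * (s * (d * d * e)) by ring.
have s3 : 0 < s * s * s by apply: Rmult_lt_0_compat; lra.
by rewrite -[X in X <= _]Rmult_1_r; apply: Rmult_le_compat_l; lra.
Qed.

Lemma Q_small (z : C) (L lam : R) : Cmod z <= 1 -> 0 <= L -> 0 < lam -> L < lam * lam ->
  (forall xi, Cmod xi = 1 -> growth (CSeries (resonant z xi)) <= L) ->
  forall e, 0 < e -> exists N, forall n, (N <= n)%N ->
    Cmod (Q n z * RtoC (exp (- (2 * lam * (sq n * sq n))) * (sq n * sq n * sq n)))%C <= e.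
Proof.
move=> z1 L0 lam0 LL h e e0; pose L1 := (L + lam * lam) / 2.
have L1l : sqrt L1 < lam.
  by rewrite -[X in _ < X]sqrt_square; [apply: sqrt_lt_1_alt; rewrite /L1; lra|lra].
have [N1 h1] := Q_growth_bound z1 L0 (ltac:(rewrite /L1; lra) : L < L1) h.
have [N2 h2] := sq_exp_decay (ltac:(lra) : 0 < lam - sqrt L1) e0.
exists (maxn N1 N2) => n; rewrite geq_max => /andP[n1 n2].
have := h1 n n1; have := h2 n n2; rewrite -sq2; set s := sq n => h3 h4.
have s0 : 0 <= s by exact: sqrt_pos.
have s3 : 0 <= s * s * s by nra.
have ep := exp_pos (- (2 * lam * (s * s))).
rewrite Cmod_mult Cmod_pos; last by apply: Rmult_le_pos; lra.
apply: Rle_trans h3.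
apply: (Rle_trans _ (exp (2 * sqrt L1 * (s * s)) * (exp (- (2 * lam * (s * s))) * (s * s * s)))).
  by apply: Rmult_le_compat_r => //; apply: Rmult_le_pos; lra.
have -> : - (2 * (lam - sqrt L1) * (s * s)) = 2 * sqrt L1 * (s * s) + - (2 * lam * (s * s)) by ring.
by rewrite exp_plus; right; ring.
Qed.

Lemma Re_unit_lt1 (z : C) : Cmod z = 1 -> z <> 1%C -> Re z < 1.
Proof.
move=> z1 zn; have h := Cmod_sqr z; rewrite z1 in h; have h2 := Re_le_Cmod z; rewrite z1 in h2.
case: (Rle_lt_or_eq_dec _ _ h2) => // e; exfalso; apply: zn; apply: C_ext; rewrite /= ?e //.
by rewrite e in h; have := Rle_0_sqr (Im z); rewrite /Rsqr; nra.
Qed.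

Lemma zeta_neq1 (b : nat) : (2 <= b)%N -> zeta b <> 1%C.
Proof.
move=> b2; rewrite -(Cpow_1_r (zeta b)) => /zeta_pow_eq1 h.
have b0 : (0 < b)%N by lia.
by move: (h b0); rewrite gtnNdvd.
Qed.

Lemma Csqrt_one_minus (y : C) : Re y < 1 -> Csqrt (1 - y) = Cexp (- (/ 2 * log1m y))%C.
Proof. exact: Cpower_one_minus. Qed.

Lemma exp_half_sqr (y : C) : Re y < 1 ->
  (Cexp (- (/ 2 * log1m y)) * Cexp (- (/ 2 * log1m y)))%C = (1 - y)%C.
Proof.
move=> hy; rewrite -Cexp_plus -Cexp_log1m_opp //; congr Cexp.
have n2 : RtoC 2 <> 0%C by apply: RtoC_neq0; lra.
by field.
Qed.

Lemma Re_exp_half (y : C) : 0 < Re (Cexp (- (/ 2 * log1m y)))%C.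
Proof.
have p0 := PI_RGT_0; have hb := atan_bound (Im y / (1 - Re y)).
have -> : (- (/ 2 * log1m y))%C = (ln (Cmod (1 - y)%C) / 2, - (atan (Im y / (1 - Re y)) / 2)).
  by rewrite -RtoC_invE /log1m; apply: C_ext; rewrite /=; field.
rewrite [Re _]/=; apply: Rmult_lt_0_compat; first exact: exp_pos.
by apply: cos_gt_0; lra.
Qed.

Lemma INR_ln (n : nat) : (0 < n)%N -> 0 < sq n /\ ln (INR n) = 4 * ln (sq n).
Proof.
move=> n0; have s0 : 0 < sq n by apply: sqrt_lt_R0; apply: sqrt_lt_R0; apply: lt_0_INR; lia.
split=> //; rewrite -{1}sq4 !ln_mult //; try by apply: Rmult_lt_0_compat.
by ring.
Qed.

Lemma asymp_four (b a1 a2 : nat) (lambda1 lambda2 B beta : R) :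
  (a1 < a2)%N -> (a2 < b)%N -> (5 <= b)%N \/ (b = 4%N /\ odd a1 = odd a2) ->
  (lambda1 + Ci * lambda2 = Csqrt (Li2 (zeta b)))%C ->
  (B * Cexp (Ci * beta) = (/ Cpow (zeta b) a1 - / Cpow (zeta b) a2) / INR b
          * Csqrt ((1 - zeta b) * (lambda1 + Ci * lambda2) / PI))%C ->
  is_lim_seq (fun n => (INR (p a1 b n) - INR (p a2 b n)) /
     (B * (Rpower (INR n) (- (3 / 4)) * exp (2 * lambda1 * sqrt (INR n)))) - cos (beta + 2 * lambda2 * sqrt (INR n))) 0.
Proof.
move=> a12 a2b hb hL hB; have [bl _] := basel_bounds; have pb := PI_bounds.
have b4 : (4 <= b)%N by lia.
have z1 := Cmod_zeta b; have zn := @zeta_neq1 b ltac:(lia).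
have [L [L0 LG hres]] : exists L, [/\ 0 <= L, L < growth (Li2 (zeta b)) &
    forall xi, Cmod xi = 1 -> xi <> 1%C -> growth (CSeries (resonant (zeta b) xi)) <= L].
  case: hb => [b5|[-> _]].
    exists (basel / 4); split; [lra|exact: growth_zeta_gt|] => xi x1 xn.
    by apply: growth_resonant_two => //; [lra|left].
  have [g9 _] := growth_zeta4; exists (basel / 9); split=> //; first lra.
  move=> xi x1 xn; have := @growth_resonant_zeta4 1 xi (basel / 9) isT (Rle_refl _) (or_introl xn).
  by rewrite Cpow_1_r.
set G := growth (Li2 (zeta b)) in LG.
have G0 : 0 < G by lra.
have [w0 ww] := Csqrt_growth G0; rewrite (Csqrt_unique w0 ww) in hL.
have eLam : (RtoC lambda1 + Ci * RtoC lambda2)%C = (lambda1, lambda2) by apply: C_ext; rewrite /=; ring.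
rewrite eLam in hL hB; have l1E : lambda1 = sqrt G by case: hL.
rewrite -hL in ww; have l10 : 0 < lambda1 by rewrite l1E; exact: sqrt_lt_R0.
have l11 : lambda1 * lambda1 = G by rewrite l1E; apply: sqrt_sqrt; lra.
have gl : 0 < growth ((lambda1, lambda2) : C) by apply: Rlt_le_trans (Re_le_growth _).
have [c0 cE] := Csqrt_growth gl; move: c0 cE; set cc := (_, _) => c0 cE.
pose u := Cexp (- (/ 2 * log1m (zeta b)))%C.
have Rz := Re_unit_lt1 z1 zn.
have uu : (u * u)%C = (1 - zeta b)%C by exact: exp_half_sqr.
have u0 : 0 < Re u by exact: Re_exp_half.
have sP : 0 < sqrt PI by apply: sqrt_lt_R0; lra.
have p2 := sqrt_sqrt PI ltac:(lra).
have spn := RtoC_neq0 (ltac:(lra) : sqrt PI <> 0).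
have n2 : RtoC 2 <> 0%C by apply: RtoC_neq0; lra.
have bp : 0 < INR b by apply: lt_0_INR; lia.
have bn := RtoC_neq0 (ltac:(lra) : INR b <> 0).
(* The principal square root is not multiplicative in general. Here [u] and [cc] have squares in the
   right half-plane, hence arguments below pi/4 in absolute value, so their product has positive
   real part and is the principal root. *)
have eS : Csqrt ((1 - zeta b) * ((lambda1, lambda2) : C) / RtoC PI)%C = (u * cc / RtoC (sqrt PI))%C.
  apply: Csqrt_unique.
    rewrite /Cdiv -RtoC_invE Re_mult_RtoC; apply: Rmult_lt_0_compat; last exact: Rinv_0_lt_compat.
    have r1 : Re (1 - zeta b)%C = 1 - Re (zeta b) by [].
    apply: Re_mult_pos => //; first by rewrite uu r1; lra.
    by rewrite cE; exact: l10.
  have eP : RtoC PI = (RtoC (sqrt PI) * RtoC (sqrt PI))%C by rewrite -RtoC_mult p2.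
  by rewrite -uu -cE eP; field.
rewrite eS in hB.
pose K := (u * cc / RtoC (2 * sqrt PI))%C.
have K0 : K <> 0%C.
  apply: Cmult_neq0; first by apply: Cmult_neq0; apply: Re_pos_neq0.
  by apply: Cinv_neq0; apply: RtoC_neq0; lra.
pose w n := exp (- (2 * lambda1 * (sq n * sq n))) * (sq n * sq n * sq n).
apply: (asymp_lim (w := w) (K := K) (kap := 1)) => //; [lia|lra| | | |].
- exists 1%N => n n1; have [s0 el] := INR_ln n1; split; first by apply: Rmult_lt_0_compat; exact: exp_pos.
  rewrite /w -sq2 /Rpower el; set s := sq n in s0 *.
  have -> : s * s * s = exp (3 * ln s).
    have -> : 3 * ln s = ln s + ln s + ln s by ring.
    by rewrite !exp_plus exp_ln.
  by rewrite -!exp_plus -[RHS]exp_0; congr exp; field.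
- rewrite hB Rmult_1_r /K /delta !Cpow_1_r [RtoC (2 * sqrt PI)]RtoC_mult.
  by move: (/ Cpow _ a1)%C (/ Cpow _ a2)%C => v1 v2; field; intuition.
- move=> e e0; have LG' : L < lambda1 * lambda1 by rewrite l11.
  have [N hN] := Q_asymp_one z1 zn l10 ww L0 LG' c0 cE hres e0.
  exists N => n Nn; apply: Rle_trans (hN n Nn); rewrite -/u -/K -sq2.
  set s := sq n.
  have -> : Cexp (- (RtoC 2 * ((lambda1, lambda2) : C) * RtoC (s * s)))%C =
      (RtoC (exp (- (2 * lambda1 * (s * s)))) * unit_c (- (2 * lambda2 * (s * s))))%C.
    rewrite -Cexp_real unit_cE -Cexp_plus; congr Cexp; apply: C_ext; rewrite /=; ring.
  have uv : (unit_c (2 * lambda2 * (s * s)) * unit_c (- (2 * lambda2 * (s * s))) = 1)%C.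
    by rewrite -unit_c_plus Rplus_opp_r unit_c_0.
  have -> : (Q n (zeta b) * RtoC (w n) - K * unit_c (2 * lambda2 * (s * s)) =
    unit_c (2 * lambda2 * (s * s)) * (Q n (zeta b) * (RtoC (exp (- (2 * lambda1 * (s * s)))) * unit_c (- (2 * lambda2 * (s * s))) * RtoC (s * s * s)) - K))%C.
    have -> : RtoC (w n) = (RtoC (exp (- (2 * lambda1 * (s * s)))) * RtoC (s * s * s) * 1)%C by rewrite /w RtoC_mult Cmult_1_r.
    by rewrite -uv; ring.
  by rewrite Cmod_mult Cmod_unit_c Rmult_1_l; right.
move=> j j2 jb; case: hb => [b5|[eb par]].
  right; have gj := growth_zeta_pow_lt b5 j2 jb; have g4 := growth_zeta_gt b5.
  have zj : Cmod (Cpow (zeta b) j) = 1 by rewrite zeta_pow Cmod_unit_c.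
  pose L2 := Rmax (growth (Li2 (Cpow (zeta b) j))) (basel / 4).
  apply: (Q_small (L := L2)) => //; first lra.
  - by apply: Rle_trans (Rmax_r _ _); lra.
  - by rewrite l11; apply: Rmax_lub_lt.
  by move=> xi x1; apply: growth_resonant_two => //; [exact: Rmax_r|right; exact: Rmax_l].
(* For b = 4 and equal parities the coefficient of the otherwise dominant Q_n (-1) vanishes. *)
left; have -> : j = 2%N by lia.
by rewrite /delta !Cpow_inv_zeta eb Cpow_zeta4_2 !Cpow_m1 par; ring.
Qed.

Lemma asymp_three (a1 a2 : nat) : (a1 < a2)%N -> (a2 < 4)%N -> odd a1 != odd a2 ->
  is_equiv (V := C_NormedModule) eventually
    (fun n => RtoC (INR (p a1 4 n) - INR (p a2 4 n)))
    (fun n => (RtoC (((- 1) ^ a1 - (- 1) ^ a2) / 4)%R * Q n (- 1))%C).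
Proof.
move=> a12 a24 par [e e0]; have [bl _] := basel_bounds; have [g9 g4] := growth_zeta4.
have [k0 [N0 [k00 hQ]]] := Q_m1_lower.
pose lam := sqrt (basel / 4); have lam0 : 0 < lam by apply: sqrt_lt_R0; lra.
have lam2 : lam * lam = basel / 4 by apply: sqrt_sqrt; lra.
(* With e k0 / 2 for each of j = 1 and j = 3, their sum is at most e times |Q_n (-1)|, whose
   normalised value is at least k0. *)
have small j : odd j -> exists N, forall n, (N <= n)%N ->
    Cmod (Q n (Cpow (zeta 4) j) * RtoC (exp (- (2 * lam * (sq n * sq n))) * (sq n * sq n * sq n)))%C <= e * k0 / 2.
  move=> oj; pose L := Rmax (growth (Li2 (zeta 4))) (basel / 9).
  apply: (Q_small (L := L)) => //.
  - by rewrite zeta_pow Cmod_unit_c; lra.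
  - by apply: Rle_trans (Rmax_r _ _); lra.
  - by rewrite lam2; apply: Rmax_lub_lt; lra.
  - by move=> xi x1; apply: growth_resonant_zeta4 => //; [exact: Rmax_r|right; exact: Rmax_l].
  by have := Rmult_lt_0_compat _ _ e0 k00; lra.
have [N1 h1] := small 1%N isT; have [N3 h3] := small 3%N isT.
exists (maxn N0 (maxn N1 N3)) => n hn.
have [s0 hq] := hQ n ltac:(lia); have {h1} := h1 n ltac:(lia); have {h3} := h3 n ltac:(lia).
set s := sq n in s0 hq *; have s3 : 0 < s * s * s by do! apply: Rmult_lt_0_compat.
set E := exp (- (2 * lam * (s * s))); have E0 : 0 < E by exact: exp_pos.
have eE : exp (2 * sqrt (basel / 4) * (s * s)) = / E by rewrite /E exp_Ropp Rinv_inv.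
have pos : 0 < E * (s * s * s) by exact: Rmult_lt_0_compat.
rewrite !Cmod_mult Cmod_pos; last lra.
move=> h3 h1; rewrite eE in hq.
set q1 := Cmod (Q n (Cpow _ 1)) in h1; set q3 := Cmod (Q n (Cpow _ 3)) in h3.
set q2 := Cmod (Q n (RtoC (-1))) in hq.
have hq' : k0 <= q2 * (E * (s * s * s)).
  have := Rmult_le_compat_r _ _ _ (Rlt_le _ _ pos) hq.
  by have -> : k0 * / E / (s * s * s) * (E * (s * s * s)) = k0 by field; lra.
have b1 : q1 + q3 <= e * q2.
  apply: (Rmult_le_reg_r (E * (s * s * s))) => //.
  have := Rmult_le_compat_l _ _ _ (Rlt_le _ _ e0) hq'; lra.
pose d2 := (- 1) ^ a1 - (- 1) ^ a2.
have pm a : (- 1) ^ a = (if odd a then -1 else 1) :> R.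
  elim: a => [|a IH] //=; rewrite IH; case: (odd a) => /=; ring.
have d2n : Rabs d2 = 2.
  by rewrite /d2 !pm; move: par; case: (odd a1); case: (odd a2) => // _; rewrite /Rabs; case: Rcase_abs; lra.
have hD := @p_diff 4 a1 a2 n isT.
have ed : delta 4 a1 a2 2 = RtoC d2.
  rewrite /delta !Cpow_inv_zeta Cpow_zeta4_2 !Cpow_m1 /d2 !pm; apply: C_ext; rewrite /=; ring.
rewrite subn1 /= !sum_Sn sum_O ed Cpow_zeta4_2 in hD.
have e40 : delta 4 a1 a2 0 = 0%C by rewrite /delta /=; ring.
rewrite e40 in hD.
have i4 : INR 4 = 4 by rewrite /INR; lra.
rewrite i4 in hD.
have dl j := @Cmod_delta_le 4 a1 a2 j.
set x := (delta 4 a1 a2 1 * Q n (Cpow (zeta 4) 1))%C in hD; set y := (delta 4 a1 a2 3 * Q n (Cpow (zeta 4) 3))%C in hD.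
have hx : Cmod x <= 2 * q1 by rewrite /x Cmod_mult; apply: Rmult_le_compat_r; [exact: Cmod_ge_0|exact: dl].
have hy : Cmod y <= 2 * q3 by rewrite /y Cmod_mult; apply: Rmult_le_compat_r; [exact: Cmod_ge_0|exact: dl].
change (Cmod (RtoC (d2 / 4) * Q n (RtoC (-1)) - RtoC (INR (p a1 4 n) - INR (p a2 4 n)))%C <=
  e * Cmod (RtoC (d2 / 4) * Q n (RtoC (-1)))%C).
move: hD; set D := INR _ - INR _ => hD.
have -> : (RtoC (d2 / 4) * Q n (RtoC (-1)) - RtoC D = - (x + y) * RtoC (/ 4))%C.
  have -> : RtoC D = (RtoC (4 * D) * RtoC (/ 4))%C by rewrite -RtoC_mult; congr RtoC; field.
  by rewrite hD /Rdiv RtoC_mult; ringC.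
have c4 : Cmod (RtoC (/ 4)) = / 4 by rewrite Cmod_R Rabs_pos_eq; lra.
have cd : Cmod (RtoC (d2 / 4)) = 2 * / 4.
  by rewrite Cmod_R Rabs_mult d2n (Rabs_pos_eq (/ 4)); lra.
rewrite !Cmod_mult Cmod_opp c4 cd -/q2.
have := Cmod_triangle x y; lra.
Qed.

(** All factors become exponentials of linear forms in ln 2, ln 3, ln pi and ln Gamma (1/3), using
    Gamma (1/2) = sqrt pi and basel = pi^2/6, so that only exponents remain to be compared. *)
Lemma zeta3_constant (l : R) : l = sqrt basel / 3 ->
  Gamma (/ 3) / (3 * Rpower (6 * PI) (2 / 3)) =
  2 * (exp (psum1_const (/ 3) 3) * sqrt l / (2 * sqrt PI)) / (3 * Rpower l (/ 6)).
Proof.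
move=> el; have pb := PI_bounds; have [bl _] := basel_bounds.
have g0 := Gamma_pos (ltac:(lra) : 0 < / 3).
have se a : 0 < a -> sqrt a = exp (ln a / 2).
  move=> a0; have e : a = exp (ln a / 2) * exp (ln a / 2) by rewrite -exp_plus -[LHS]exp_ln //; congr exp; field.
  by rewrite {1}e sqrt_square //; left; exact: exp_pos.
have ln6 : ln 6 = ln 2 + ln 3 by rewrite -ln_mult; [congr ln; ring|lra|lra].
have lnP : ln basel = 2 * ln PI - ln 6.
  move: basel bl basel_PI => P bP h; have : ln (PI * PI) = ln (6 * P) by rewrite h.
  rewrite (ln_mult PI PI) ?(ln_mult 6 P); lra.
have lnl : ln l = ln PI - (ln 2 + ln 3) / 2 - ln 3.
  rewrite el ln_div; [|apply: sqrt_lt_R0; lra|lra].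
  by rewrite se ?ln_exp; lra.
have l0 : 0 < l by rewrite el; apply: Rdiv_lt_0_compat; [apply: sqrt_lt_R0|]; lra.
rewrite /psum1_const Gamma_half (se PI) ?ln_exp; last lra.
rewrite (se l) // /Rpower lnl (ln_mult 6 PI) ?ln6; [|lra|lra].
have e3 : 3 = exp (ln 3) by rewrite exp_ln; lra.
have eg : Gamma (/ 3) = exp (ln (Gamma (/ 3))) by rewrite exp_ln.
move: eg; set g := ln (Gamma _) => ->.
have m1 a b : exp a / (3 * exp b) = exp (a - ln 3 - b).
  by rewrite {1}e3 -exp_plus /Rdiv -exp_Ropp -exp_plus; congr exp; ring.
have -> : forall a b c d : R, 2 * (exp a * exp b / (2 * exp c)) / (3 * exp d) = exp (a + b - c) / (3 * exp d).
  move=> a b c d; have -> : a + b - c = a + b + - c by ring.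
  by rewrite !exp_plus exp_Ropp; have := exp_pos c; have := exp_pos d => h1 h2; field; lra.
by rewrite !m1; congr exp; field.
Qed.

Lemma asymp_two (a1 a2 : nat) (A alpha : R) : (a1 < a2)%N -> (a2 < 3)%N ->
  (A * Cexp (Ci * alpha) = (/ Cpow (zeta 3) a1 - / Cpow (zeta 3) a2)
          * Cpower (1 - Cpow (zeta 3) 2) (1 / 6) * Csqrt (1 - zeta 3)
          * (Gamma (1 / 3) / (3 * Rpower (6 * PI) (2 / 3)))%R)%C ->
  is_lim_seq (fun n => (INR (p a1 3 n) - INR (p a2 3 n)) /
     (A * (Rpower (INR n) (- (2 / 3)) * exp (2 * PI / 3 * sqrt (INR n / 6)))) - cos (alpha + - (4 * PI * INR n / 3))) 0.
Proof.
move=> a12 a23; have [bl _] := basel_bounds; have pb := PI_bounds.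
have [W1 W3 Wn W2n W21] := zeta3_facts.
rewrite (Cpower_one_minus _ (Re_unit_lt1 W21 W2n)) (Csqrt_one_minus (Re_unit_lt1 W1 Wn)).
have -> : 1 / 3 = / 3 by field.
pose l := sqrt basel / 3; rewrite (zeta3_constant (erefl l)).
set u6 := Cexp (- (1 / 6 * _)); set u2 := Cexp (- (/ 2 * _)) => hA.
have l0 : 0 < l by apply: Rdiv_lt_0_compat; [apply: sqrt_lt_R0; lra|lra].
have sP : 0 < sqrt PI by apply: sqrt_lt_R0; lra.
have sl : 0 < sqrt l by exact: sqrt_lt_R0.
pose kap := Rpower l (/ 6); have kap0 : 0 < kap by exact: exp_pos.
pose K := (Cexp zeta3_const * RtoC (sqrt l) / RtoC (2 * sqrt PI))%C.
have n2 : RtoC 2 <> 0%C by apply: RtoC_neq0; lra.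
have n3 : RtoC 3 <> 0%C by apply: RtoC_neq0; lra.
have n6 : RtoC 6 <> 0%C by apply: RtoC_neq0; lra.
have nP := RtoC_neq0 (ltac:(lra) : sqrt PI <> 0).
have nk := RtoC_neq0 (ltac:(lra) : kap <> 0).
have K0 : K <> 0%C.
  apply: Cmult_neq0; first by apply: Cmult_neq0; [exact: Cexp_neq0|apply: RtoC_neq0; lra].
  by apply: Cinv_neq0; apply: RtoC_neq0; lra.
have eC : Cexp zeta3_const = (RtoC (exp (psum1_const (/ 3) 3)) * u6 * u2)%C.
  rewrite /u6 /u2 -Cexp_real -!Cexp_plus /zeta3_const; congr Cexp.
  have -> : / 2 - 2 / 3 = - (1 / 6) by field.
  have -> : / 2 - 1 = - / 2 by field.
  have e6 : RtoC (1 / 6) = (1 / 6)%C by rewrite RtoC_div //; lra.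
  rewrite !RtoC_opp RtoC_invE e6.
  by ring.
pose w n := exp (- (2 * l * (sq n * sq n))) * (sq n * sq n * sq n * Rpower (l / (sq n * sq n)) (/ 6)).
apply: (asymp_lim (w := w) (K := K) (kap := kap)) => //; [| | |by move=> j j2 j3; lia].
- exists 1%N => n n1; have [s0 eln] := INR_ln n1; split; first by apply: Rmult_lt_0_compat; exact: exp_pos.
  (* The exponent of the theorem matches because l = sqrt basel / 3 and pi = sqrt (6 basel). *)
  have e6 : 2 * PI / 3 * sqrt (INR n / 6) = 2 * l * (sq n * sq n).
    have n0 := pos_INR n; have e1 : PI * sqrt (INR n / 6) = sqrt basel * sqrt (INR n).
      rewrite -{1}(sqrt_square PI); last lra.
      rewrite -!sqrt_mult; [congr sqrt|lra|lra|nra|lra].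
      by have := basel_PI; generalize basel => P ->; field.
    have -> : 2 * PI / 3 * sqrt (INR n / 6) = 2 / 3 * (PI * sqrt (INR n / 6)) by field.
    by rewrite e1 sq2 /l; field.
  rewrite e6 /w /kap /Rpower eln ln_div //; last exact: Rmult_lt_0_compat.
  rewrite ln_mult //; set s := sq n in s0 *.
  have -> : s * s * s = exp (3 * ln s).
    have -> : 3 * ln s = ln s + ln s + ln s by ring.
    by rewrite !exp_plus exp_ln.
  by rewrite -!exp_plus; congr exp; field.
- rewrite hA /K eC /delta !Cpow_1_r; have -> : INR 3 = 3 by rewrite /INR; lra.
  rewrite -/kap /Rdiv !RtoC_mult !RtoC_invE !RtoC_mult.
  by move: (/ Cpow _ a1)%C (/ Cpow _ a2)%C => v1 v2; field; intuition.
move=> e e0; have [N hN] := Q_zeta3_asymp e0; exists N => n Nn.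
apply: Rle_trans (hN n Nn); rewrite -/l -/(w n) -/K.
have [_ [_ [-> _]]] := zeta3_unit 0; rewrite unit_c_pow.
have -> : - (4 * PI * INR n / 3) = - (INR n * (4 * PI / 3)) by field.
set t := INR n * _.
have uv : (unit_c (- t) * unit_c t = 1)%C by rewrite -unit_c_plus Rplus_opp_l unit_c_0.
have -> : (Q n (zeta 3) * RtoC (w n) - K * unit_c (- t) = unit_c (- t) * (unit_c t * Q n (zeta 3) * RtoC (w n) - K))%C.
  have -> : (Q n (zeta 3) * RtoC (w n) = 1 * (Q n (zeta 3) * RtoC (w n)))%C by ring.
  by rewrite -uv; ring.
by rewrite Cmod_mult Cmod_unit_c Rmult_1_l; right.
Qed.

Theorem theorem3p4 (b a1 a2 : nat) (hb : (2 <= b)%N)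
    (ha12 : (a1 < a2)%N) (ha2 : (a2 <= b - 1)%N) :
  (b = 2%N ->
     forall n : nat, RtoC (INR (p 0 2 n) - INR (p 1 2 n)) = Q n (- 1)%C)
  /\
  (b = 3%N ->
     forall A alpha : R, 0 <= A -> 0 <= alpha < 2 * PI ->
     (A * Cexp (Ci * alpha)
        = (/ Cpow (zeta 3) a1 - / Cpow (zeta 3) a2)
          * Cpower (1 - Cpow (zeta 3) 2) (1 / 6) * Csqrt (1 - zeta 3)
          * (Gamma (1 / 3) / (3 * Rpower (6 * PI) (2 / 3)))%R)%C ->
     is_lim_seq
       (fun n => (INR (p a1 3 n) - INR (p a2 3 n))
                 / (A * Rpower (INR n) (- (2 / 3))
                    * exp (2 * PI / 3 * sqrt (INR n / 6)))
                 - cos (alpha - 4 * PI * INR n / 3))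
       0)
  /\
  (b = 4%N -> odd a1 != odd a2 ->
     is_equiv (V := C_NormedModule) eventually
       (fun n => RtoC (INR (p a1 4 n) - INR (p a2 4 n)))
       (fun n => (RtoC (((- 1) ^ a1 - (- 1) ^ a2) / 4)%R * Q n (- 1))%C))
  /\
  ((5 <= b)%N \/ (b = 4%N /\ odd a1 = odd a2) ->
     forall lambda1 lambda2 B beta : R,
     (lambda1 + Ci * lambda2 = Csqrt (Li2 (zeta b)))%C ->
     0 <= B -> 0 <= beta < 2 * PI ->
     (B * Cexp (Ci * beta)
        = (/ Cpow (zeta b) a1 - / Cpow (zeta b) a2) / INR b
          * Csqrt ((1 - zeta b) * (lambda1 + Ci * lambda2) / PI))%C ->
     is_lim_seq
       (fun n => (INR (p a1 b n) - INR (p a2 b n))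
                 / (B * Rpower (INR n) (- (3 / 4))
                    * exp (2 * lambda1 * sqrt (INR n)))
                 - cos (beta + 2 * lambda2 * sqrt (INR n)))
       0).
Proof.
have a2b : (a2 < b)%N by lia.
split; first by move=> _ n; exact: Q_m1.
split.
  move=> b3 A alpha _ _ hA; subst b.
  by apply: is_lim_seq_ext (asymp_two ha12 a2b hA) => n; rewrite -Rmult_assoc.
split; first by move=> b4 par; subst b; exact: asymp_three.
move=> hb4 lambda1 lambda2 B beta hL _ _ hB.
by apply: is_lim_seq_ext (asymp_four ha12 a2b hb4 hL hB) => n; rewrite -Rmult_assoc.
Qed.
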